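(* Let $(A,Q)$ be a finite quadratic module of level $N$, let $d=|A/\{\pm1\}|$, and let $k\in\frac12\mathbb{Z}$ with $k\geq\frac32$ and $2k\equiv-\operatorname{sig}(A)\pmod 4$. Then \[ \left|\dim(S_{k,A})-\dim(M_{2-k,A(-1)})-\frac{d(k-1)}{12}\right|\leq R(A), \] where \[ R(A)=\frac{\sqrt{|A[2]|}}{4}+\frac{1+\sqrt{|A[3]|}}{3\sqrt3}+\frac38|A[2]|+\frac{\sqrt{|A|}}{4}\sigma(-1,A)+\frac{\sqrt{|A|}}{2\pi}\left(\frac32+\ln(N)\right)\left(\sigma(-1,A)-\frac{\sqrt{|A|}}{N}\right), \] which is independent of $k$.
   Context: A finite quadratic module $(A,Q)$ is a finite abelian group with a non-degenerate quadratic form $Q:A\to\mathbb{Q}/\mathbb{Z}$, bilinear form $(x,y)=Q(x+y)-Q(x)-Q(y)$. Level $N$: smallest positive integer with $NQ(x)=0$ for all $x$. $A[n]=\{\gamma\in A:n\gamma=0\}$; $d=|A/\{\pm1\}|$ is the number of orbits of $\gamma\mapsto-\gamma$, equal to $(|A|+|A[2]|)/2$. $\sigma(-1,A)=\sum_{a\mid N}a^{-1}\sqrt{|A[a]|}$. $A(-1)$ denotes the group $A$ with quadratic form $-Q$. Write $e(z)=e^{2\pi iz}$; $\operatorname{sig}(A)\in\mathbb{Z}/8\mathbb{Z}$ is defined by $|A|^{-1/2}\sum_{a\in A}e(Q(a))=e(\operatorname{sig}(A)/8)$. $\operatorname{Mp}_2(\mathbb{Z})$ is the metaplectic group of pairs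 $(M,\phi)$, $M=\begin{pmatrix}a&b\\c&d\end{pmatrix}\in\operatorname{SL}_2(\mathbb{Z})$, $\phi$ holomorphic on $\mathbb{H}$ with $\phi(\tau)^2=c\tau+d$, generated by $T=(\begin{pmatrix}1&1\\0&1\end{pmatrix},1)$, $S=(\begin{pmatrix}0&-1\\1&0\end{pmatrix},\sqrt\tau)$. The Weil representation $\rho_A$ on $\mathbb{C}[A]$ (basis $\mathfrak e_\gamma$) is $\rho_A(T)\mathfrak e_\gamma=e(-Q(\gamma))\mathfrak e_\gamma$, $\rho_A(S)\mathfrak e_\gamma=\frac{e(\operatorname{sig}(A)/8)}{\sqrt{|A|}}\sum_\delta e((\gamma,\delta))\mathfrak e_\delta$. For $k\in\frac12\mathbb{Z}$, $M_{k,A}$ is the space of holomorphic $f:\mathbb{H}\to\mathbb{C}[A]$, holomorphic at $\infty$, with $f(M\tau)=\phi(\tau)^{2k}\rho_A(M,\phi)f(\tau)$ for all $(M,\phi)\in\operatorname{Mp}_2(\mathbb{Z})$; $S_{k,A}$ is its subspace of cusp forms. $M_{2-k,A(-1)}$ is defined in the same way using $\rho_{A(-1)}$ (and is $\{0\}$ when $2-k<0$). *)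

(* Defs.v *)
From HB Require Import structures.
From mathcomp Require Import all_boot all_order all_algebra ring_quotient.
From mathcomp.real_closed Require Import complex.
From mathcomp Require Import boolp classical_sets functions reals topology.
From mathcomp Require Import normedtype sequences derive realfun exp trigo.
From mathcomp Require Import ring lra.

Set Implicit Arguments.
Unset Strict Implicit.
Unset Printing Implicit Defensive.

Import Order.TTheory GRing.Theory Num.Theory numFieldNormedType.Exports.

Local Open Scope ring_scope.
Local Open Scope classical_set_scope.
Local Open Scope complex_scope.

(* Q/Z; [Num.int_num_subdef] is the predicate underlying [Num.int].           *)
Definition QZ : zmodType := {ideal_quot (Num.int_num_subdef : {pred rat})}.

Section FiniteQuadraticModules.

Definition polar_form (A : zmodType) (Q : A -> QZ) (x y : A) : QZ :=
  Q (x + y) - Q x - Q y.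

Record finQuadMod := FinQuadMod {
  fqm_group :> finZmodType;
  fqm_form : fqm_group -> QZ;
  fqm_formM : forall (n : int) x, fqm_form (x *~ n) = fqm_form x *~ (n ^+ 2);
  fqm_bilin : forall x y z, polar_form fqm_form (x + y) z =
                            polar_form fqm_form x z + polar_form fqm_form y z;
  fqm_nondeg : forall x, (forall y, polar_form fqm_form x y = 0) -> x = 0
}.

Variable A : finQuadMod.

Definition fqm_bil : A -> A -> QZ := polar_form (@fqm_form A).

Fact finZmod_mulrn_card (x : A) : x *+ #|A| = 0.
Proof.
have inj : injective (+%R x) by exact: addrI.
have : \sum_(y : A) y = \sum_(y : A) (x + y).
  by rewrite (reindex_inj inj).
rewrite big_split /= sumr_const => /esym/eqP.
by rewrite -subr_eq0 addrK => /eqP.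
Qed.

Fact level_exists :
  exists n, (0 < n)%N && [forall x : A, fqm_form x *+ n == 0].
Proof.
exists (#|A| ^ 2)%N; apply/andP; split.
  by rewrite expn_gt0; apply/orP; left; apply/card_gt0P; exists 0.
apply/forallP => x; apply/eqP.
have := fqm_formM (#|A|%:Z) x; rewrite -pmulrn finZmod_mulrn_card.
have Q0 : fqm_form (0 : A) = 0 by rewrite -(mulr0z (0 : A)) fqm_formM mulr0z.
by rewrite Q0 expr2 -PoszM -pmulrn mulnn => /esym.
Qed.

Definition level : nat := ex_minn level_exists.

Definition torsion (n : nat) : {set A} := [set x : A | x *+ n == 0]%SET.

Definition num_pm_orbits : nat := #|[set [set x; - x]%SET | x : A]%SET|.

Fact fqm_opp_formM (n : int) (x : A) :
  - fqm_form (x *~ n) = (- fqm_form x) *~ (n ^+ 2).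
Proof. by rewrite fqm_formM mulNrz. Qed.

Fact polar_form_opp (x y : A) :
  polar_form (fun z => - fqm_form z) x y = - fqm_bil x y.
Proof. by rewrite /fqm_bil /polar_form !opprD !opprK. Qed.

Fact fqm_opp_bilin (x y z : A) :
  polar_form (fun t => - fqm_form t) (x + y) z =
  polar_form (fun t => - fqm_form t) x z +
  polar_form (fun t => - fqm_form t) y z.
Proof. by rewrite !polar_form_opp /fqm_bil fqm_bilin opprD. Qed.

Fact fqm_opp_nondeg (x : A) :
  (forall y, polar_form (fun t => - fqm_form t) x y = 0) -> x = 0.
Proof.
move=> h; apply: fqm_nondeg => y.
by apply/eqP; rewrite -oppr_eq0 -/(fqm_bil x y) -polar_form_opp h.
Qed.

Definition fqm_opp : finQuadMod :=
  FinQuadMod fqm_opp_formM fqm_opp_bilin fqm_opp_nondeg.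

End FiniteQuadraticModules.

Section UpperHalfPlane.
Variable R : realType.
Local Notation C := R[i].

Record uhp := Uhp { uhp_val :> C; uhp_gt0 : 0 < complex.Im uhp_val }.
HB.instance Definition _ := [isSub for uhp_val].

(* Extension by 0; only its germs at points of the upper half-plane matter. *)
Definition uhp_ext (f : uhp -> C) (z : C^o) : C^o :=
  if insub z is Some t then f t else 0.

Definition holomorphic (f : uhp -> C) : Prop :=
  forall t : uhp, derivable (uhp_ext f) (t : C^o) 1.

Lemma uhp_extE f (t : uhp) : uhp_ext f t = f t.
Proof. by rewrite /uhp_ext valK. Qed.

Lemma ler_Im_norm (z : C) : `|complex.Im z|%:C <= `|z|.
Proof.
by rewrite normc_def lecR -sqrtr_sqr ler_sqrt ?addr_ge0 ?sqr_ge0// lerDr sqr_ge0.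
Qed.

Lemma near_uhp (t : uhp) : \forall z \near (t : C^o), 0 < complex.Im (z : C).
Proof.
have t0 := uhp_gt0 t.
exists (complex.Im t)%:C => /=; first by rewrite ltcR.
move=> z /=; rewrite /ball_ /= => h.
have := le_lt_trans (ler_Im_norm _) h.
rewrite ltcR; case: t t0 {h} => -[x y] /= _ t0; case: z => u v /=.
by rewrite ltr_norml => /andP[_ h1]; lra.
Qed.

Lemma near_holomorphic (f : uhp -> C) (F : C^o -> C^o) :
    (forall t, f t = F t) -> (forall t : uhp, differentiable F (t : C^o)) ->
  holomorphic f.
Proof.
move=> fF dF t; have /derivable1_diffP := dF t.
apply: near_eq_derivable.
near=> z.
have z0 : 0 < complex.Im (z : C) by near: z; exact: near_uhp.
by rewrite -[z]/(uhp_val (Uhp z0)) uhp_extE fF.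
Unshelve. all: by end_near. Qed.

Definition cocycle (M : 'M[int]_2) (z : C) : C :=
  (M 1 0)%:~R * z + (M 1 1)%:~R.

Definition moebius (M : 'M[int]_2) (z : C) : C :=
  ((M 0 0)%:~R * z + (M 0 1)%:~R) / cocycle M z.

Lemma intr_complex (n : int) : n%:~R = (n%:~R : R)%:C :> C.
Proof. by rewrite rmorph_int. Qed.

Lemma det2 (M : 'M[int]_2) : \det M = M 0 0 * M 1 1 - M 0 1 * M 1 0.
Proof.
rewrite (expand_det_row _ 0) big_ord_recl big_ord1 /cofactor !det_mx11 !mxE /=.
have -> : lift (0 : 'I_2) 0 = 1 by exact/val_inj.
have -> : lift (1 : 'I_2) 0 = 0 by exact/val_inj.
by rewrite !expr0 !expr1 mul1r mulN1r mulrN.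
Qed.

Lemma cocycle_neq0 (M : 'M[int]_2) (t : uhp) : \det M = 1 -> cocycle M t != 0.
Proof.
rewrite det2 => dM; apply/negP => /eqP; rewrite /cocycle !intr_complex.
case: t => -[x y] /= y0 [].
rewrite !mul0r ?subr0 ?addr0 => h1 /eqP.
rewrite mulf_eq0 (gt_eqF y0) orbF intr_eq0 => /eqP c0.
move: h1 dM; rewrite c0 mul0r add0r => /eqP.
by rewrite intr_eq0 => /eqP ->; rewrite !mulr0 subrr.
Qed.

Lemma Im_moebius (M : 'M[int]_2) (t : uhp) :
  \det M = 1 -> 0 < complex.Im (moebius M t).
Proof.
move=> dM; have := cocycle_neq0 t dM; move: dM.
rewrite det2 => /(congr1 (fun n : int => n%:~R : R)).
rewrite rmorphB !rmorphM /= /moebius /cocycle !intr_complex.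
case: t => -[x y] /= y0.
set a := (M 0 0)%:~R; set b := (M 0 1)%:~R.
set c := (M 1 0)%:~R; set d := (M 1 1)%:~R => dM.
rewrite eq_complex /= !mul0r !subr0 !addr0 => nz.
have n0 : 0 < (c * x + d) ^+ 2 + (c * y) ^+ 2.
  by rewrite lt_def paddr_eq0 ?sqr_ge0// !sqrf_eq0 nz addr_ge0 ?sqr_ge0.
set n := (_ + _) in n0 *.
have -> : (a * x + b) * - (c * y / n) + (a * y) * ((c * x + d) / n) =
          y / n * (a * d - b * c) by field; exact: lt0r_neq0.
by rewrite dM mulr1 divr_gt0.
Qed.

Definition uhp_act (M : 'M[int]_2) (dM : \det M = 1) (t : uhp) : uhp :=
  Uhp (Im_moebius t dM).

Record mp2 := Mp2 {
  mp_mx : 'M[int]_2;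
  mp_phi : uhp -> C;
  mp_det : \det mp_mx = 1;
  mp_hol : holomorphic mp_phi;
  mp_sqr : forall t : uhp, mp_phi t ^+ 2 = cocycle mp_mx t
}.

Definition mp_act (g : mp2) : uhp -> uhp := uhp_act (mp_det g).

Lemma cocycleM (M P : 'M[int]_2) (t : uhp) : \det P = 1 ->
  cocycle (M *m P) t = cocycle M (moebius P t) * cocycle P t.
Proof.
move=> dP; have := cocycle_neq0 t dP.
rewrite /moebius /cocycle !mxE !big_ord_recl !big_ord0 !addr0.
have -> : lift (0 : 'I_2) 0 = 1 by exact/val_inj.
by move=> nz; rewrite !rmorphD !rmorphM /=; field.
Qed.

Lemma uhp_ext_differentiable f (t : uhp) :
  holomorphic f -> differentiable (uhp_ext f) (t : C^o).
Proof. by move=> /(_ t)/derivable1_diffP. Qed.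

Lemma differentiable_affine (a b : C) (z : C^o) :
  differentiable (fun z : C^o => a * z + b : C^o) z.
Proof.
apply: differentiableD; last exact: differentiable_cst.
exact: (@differentiableZ _ _ _ (@id C^o) a).
Qed.

Lemma moebius_differentiable (M : 'M[int]_2) (t : uhp) : \det M = 1 ->
  differentiable (moebius M : C^o -> C^o) (t : C^o).
Proof.
move=> dM; apply: differentiableM; first exact: differentiable_affine.
apply: differentiableV; first exact: differentiable_affine.
exact: cocycle_neq0.
Qed.

Section Product.
Variables g h : mp2.

Fact mp_mul_det : \det (mp_mx g *m mp_mx h) = 1.
Proof. by rewrite det_mulmx !mp_det mulr1. Qed.

Fact mp_mul_hol : holomorphic (fun t => mp_phi g (mp_act h t) * mp_phi h t).
Proof.
pose F := fun z : C^o => uhp_ext (mp_phi g) (moebius (mp_mx h) z : C^o)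
                          * uhp_ext (mp_phi h) z : C^o.
apply: (@near_holomorphic _ F) => t.
  by rewrite /F uhp_extE -[moebius _ t]/(uhp_val (mp_act h t)) uhp_extE.
apply: differentiableM; last exact/uhp_ext_differentiable/mp_hol.
apply: (@differentiable_comp _ _ _ _ (moebius (mp_mx h) : C^o -> C^o)).
  exact/moebius_differentiable/mp_det.
exact: (uhp_ext_differentiable (mp_act h t) (@mp_hol g)).
Qed.

Fact mp_mul_sqr (t : uhp) : (mp_phi g (mp_act h t) * mp_phi h t) ^+ 2 =
  cocycle (mp_mx g *m mp_mx h) t.
Proof. by rewrite exprMn !mp_sqr cocycleM ?mp_det. Qed.

Definition mp_mul : mp2 := Mp2 mp_mul_det mp_mul_hol mp_mul_sqr.

End Product.

Lemma holomorphic_cst (c : C) : holomorphic (fun=> c).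
Proof.
by apply: (@near_holomorphic _ (fun=> c)) => // t; exact: differentiable_cst.
Qed.

Fact mp1_sqr (t : uhp) : 1 ^+ 2 = cocycle 1%:M t.
Proof. by rewrite /cocycle !mxE /= expr1n mul0r add0r. Qed.

Definition mp_one : mp2 := Mp2 (det1 _ _) (@holomorphic_cst 1) mp1_sqr.

Definition mxT : 'M[int]_2 := \matrix_(i, j) ((i <= j)%N : nat)%:Z.

Definition mxS : 'M[int]_2 :=
  \matrix_(i, j) if (i == 0) && (j == 1) then -1
                 else if (i == 1) && (j == 0) then 1 else 0.

Fact mxT_det : \det mxT = 1. Proof. by rewrite det2 !mxE. Qed.
Fact mxS_det : \det mxS = 1. Proof. by rewrite det2 !mxE. Qed.

Fact mpT_sqr (t : uhp) : 1 ^+ 2 = cocycle mxT t.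
Proof. by rewrite /cocycle !mxE /= expr1n mul0r add0r. Qed.

Definition mpT : mp2 := Mp2 mxT_det (@holomorphic_cst 1) mpT_sqr.

Fact mpS_sqr (t : uhp) : sqrtC (t : C) ^+ 2 = cocycle mxS t.
Proof. by rewrite sqrtCK /cocycle !mxE /= mul1r addr0. Qed.

Lemma Re_sqrtC_gt0 (t : uhp) : 0 < complex.Re (sqrtC (t : C)).
Proof.
have := @Im_rootC_ge0 _ 2 (t : C) isT; rewrite -complexIm ler0c.
have := sqrtCK (t : C); have := uhp_gt0 t.
move: (uhp_val t) => z z0; case: (sqrtC z) => x y /= zE y0.
by move: z0; rewrite -zE expr2 /=; nra.
Qed.

Lemma sqrtC_lip (t u : uhp) :
  `|sqrtC (t : C) - sqrtC (u : C)| <=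
  `|(t : C) - (u : C)| / (complex.Re (sqrtC (t : C)))%:C.
Proof.
have t0 := Re_sqrtC_gt0 t; have u0 := Re_sqrtC_gt0 u.
rewrite ler_pdivlMr ?ltcR//.
have -> : `|(t : C) - (u : C)| =
    `|sqrtC (t : C) - sqrtC (u : C)| * `|sqrtC (t : C) + sqrtC (u : C)|.
  by rewrite -normrM -subr_sqr !sqrtCK.
apply: ler_wpM2l => //; apply: le_trans (normc_ge_Re _).
rewrite raddfD /= lecR (le_trans _ (ler_norm _))// lerDl; exact: ltW.
Qed.

Lemma sqrtC_continuous (t : uhp) :
  (sqrtC (z : C) : C^o) @[z --> (t : C^o)] --> (sqrtC (t : C) : C^o).
Proof.
have t0 := Re_sqrtC_gt0 t.
apply/(@cvgrPdist_lt _ C^o C^o _ (nbhs_filter (t : C^o))) => e e0; near=> z.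
have z0 : 0 < complex.Im (z : C) by near: z; exact: near_uhp.
apply: le_lt_trans (sqrtC_lip t (Uhp z0)) _.
rewrite ltr_pdivrMr ?ltcR//=.
near: z; exists (e * (complex.Re (sqrtC (t : C)))%:C) => /=.
  by rewrite mulr_gt0// ltcR.
by move=> z.
Unshelve. all: by end_near. Qed.

Fact mpS_hol : holomorphic (fun t : uhp => sqrtC (t : C)).
Proof.
apply: (@near_holomorphic _ (fun z : C^o => sqrtC (z : C) : C^o)) => // t.
apply/derivable1_diffP.
have t0 : sqrtC (t : C) + sqrtC (t : C) != 0.
  apply/negP => /eqP/(congr1 (@complex.Re R)); rewrite raddfD /= => h.
  by have := Re_sqrtC_gt0 t; lra.
have st : (fun h : C^o => sqrtC ((h + (t : C^o)) : C) : C^o) @ 0^'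
          --> (sqrtC (t : C) : C^o).
  apply: cvg_comp; last exact: sqrtC_continuous.
  have : (h + (t : C^o)) @[h --> (0 : C^o)] --> (0 + (t : C^o) : C^o).
    exact: (@cvgD _ C^o _ (nbhs (0 : C^o)) _ id (cst (t : C^o)) _ _
                  (@cvg_id C^o _) (@cvg_cst _ _ _ _ _)).
  by rewrite add0r; apply: cvg_trans; apply: cvg_app; exact: cvg_within.
apply/cvg_ex; exists ((sqrtC (t : C) + sqrtC (t : C))^-1 : C^o).
have F0 : Filter ((0 : C^o)^') by exact: dnbhs_filter.
have lim := @cvgV _ _ _ F0 _ _ t0 (@cvgD _ C^o _ _ F0 _ _ _ _ st
              (@cvg_cst _ (sqrtC (t : C) : C^o) _ _ F0)).
refine (cvg_trans _ lim); apply: (@near_eq_cvg _ _ _ F0); near=> h.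
have h0 : h != 0 :> C by near: h; exact: nbhs_dnbhs_neq.
have ht0 : 0 < complex.Im ((h : C) + (t : C)).
  near: h; apply: nbhs_dnbhs; exists (complex.Im t)%:C => /=.
    by rewrite ltcR uhp_gt0.
  move=> h /=; rewrite /ball_ /= sub0r normrN => /(le_lt_trans (ler_Im_norm _)).
  by rewrite ltcR raddfD /= ltr_norml => /andP[? _]; lra.
have := Re_sqrtC_gt0 (Uhp ht0); have := Re_sqrtC_gt0 t => /= p q.
have s0 : sqrtC ((h : C) + (t : C)) + sqrtC (t : C) != 0.
  apply/negP => /eqP/(congr1 (@complex.Re R)); rewrite raddfD /= => r.
  by move: p q r; lra.
rewrite /unstable.inv_fun /= !fctE /=.
rewrite -[h *: 1]/((h : C) * 1) mulr1.
have e1 : sqrtC ((h : C) + (t : C)) ^+ 2 - sqrtC (t : C) ^+ 2 = (h : C).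
  by rewrite !sqrtCK addrK.
apply: (mulfI s0); rewrite mulfV// -[_ *: _]/((h : C)^-1 * _) mulrCA.
by rewrite [X in _ * X]mulrC -subr_sqr e1 mulVf.
Unshelve. all: by end_near. Qed.

(* On the upper half-plane [sqrtC] is the principal branch: [Re_sqrtC_gt0]. *)
Definition mpS : mp2 := Mp2 mxS_det mpS_hol mpS_sqr.

End UpperHalfPlane.

Section ModularForms.
Variable R : realType.
Local Notation C := R[i].

(* e(z) = exp(2 pi i z) *)
Definition cexp2pi (z : C) : C :=
  (expR (- (2 * pi * complex.Im z)))%:C *
  (cos (2 * pi * complex.Re z) +i* sin (2 * pi * complex.Re z)).

(* e(x) for x in Q/Z; independent of the representative. *)
Definition expQZ (x : QZ) : C := cexp2pi (ratr (repr x)).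

Variable A : finQuadMod.

Definition sqrt_card (n : nat) : R := Num.sqrt n%:R.

(* sig(A) in Z/8Z is the (unique) class s with
   |A|^(-1/2) sum_a e(Q(a)) = e(s/8), which exists by Milgram's formula; the
   default value 0 is never used. *)
Definition signature : 'Z_8 :=
  odflt 0 [pick s : 'Z_8 |
    ((sqrt_card #|A|)%:C)^-1 * \sum_(a : A) expQZ (fqm_form a)
      == cexp2pi ((s : nat)%:R / 8%:R)].

Definition group_alg : vectType C := {ffun A -> C^o}.

Definition basis_elt (x : A) : group_alg := [ffun y => (y == x)%:R].

Definition is_weil_rep (rho : mp2 R -> 'End(group_alg)) : Prop :=
  [/\ rho (mp_one R) = \1%VF,
      forall g h, rho (mp_mul g h) = (rho g \o rho h)%VF,
      forall x, rho (mpT R) (basis_elt x) =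
                expQZ (- fqm_form x) *: basis_elt x
    & forall x, rho (mpS R) (basis_elt x) =
                (cexp2pi ((signature : nat)%:R / 8%:R) / (sqrt_card #|A|)%:C) *:
                \sum_(y : A) expQZ (fqm_bil x y) *: basis_elt y].

(* The Weil representation is the unique representation of Mp_2(Z) with the
   prescribed values on the generators T and S; the default is never used. *)
Definition weil_rep : mp2 R -> 'End(group_alg) :=
  xget (fun=> \1%VF) [set rho | is_weil_rep rho].

(* The Fourier expansion of f in e(tau/N) has coefficients c and no terms of
   negative exponent. *)
Definition fourier_expansion (f : uhp R -> group_alg) (c : A -> nat -> C) :=
  forall (x : A) (t : uhp R),
    series (fun n => c x n * cexp2pi (n%:R / (level A)%:R * (t : C)) : C^o)
      @ \oo --> (f t x : C^o).

(* Weights are half-integers: w stands for twice the weight. *)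
Definition modular_of_weight2 (w : int) (f : uhp R -> group_alg) : Prop :=
  (forall x : A, holomorphic (fun t => f t x)) /\
  (forall (g : mp2 R) (t : uhp R),
     f (mp_act g t) = (mp_phi g t ^ w) *: weil_rep g (f t)).

Definition modular_forms (w : int) : set (uhp R -> group_alg) :=
  [set f | modular_of_weight2 w f /\ exists c, fourier_expansion f c].

Definition cusp_forms (w : int) : set (uhp R -> group_alg) :=
  [set f | modular_of_weight2 w f /\
           exists2 c, fourier_expansion f c & forall x, c x 0%N = 0].

Definition sigma_m1 : R :=
  \sum_(a <- divisors (level A)) a%:R^-1 * sqrt_card #|torsion A a|.

Definition dim_error : R :=
  sqrt_card #|torsion A 2| / 4
  + (1 + sqrt_card #|torsion A 3|) / (3 * Num.sqrt 3)
  + 3 / 8 * #|torsion A 2|%:R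
  + sqrt_card #|A| / 4 * sigma_m1
  + sqrt_card #|A| / (2 * pi) * (3 / 2 + ln (level A)%:R)
    * (sigma_m1 - sqrt_card #|A| / (level A)%:R).

End ModularForms.

Arguments signature : clear implicits.
Arguments weil_rep : clear implicits.
Arguments modular_forms : clear implicits.
Arguments cusp_forms : clear implicits.
Arguments sigma_m1 : clear implicits.
Arguments dim_error : clear implicits.

Definition has_dim (K : fieldType) (V : lmodType K) (E : set V) (n : nat) :=
  exists b : 'I_n -> V,
    (forall c : 'I_n -> K, \sum_i c i *: b i = 0 -> forall i, c i = 0) /\
    E = [set v | exists c : 'I_n -> K, v = \sum_i c i *: b i].

(* Main.v *)
(* All functions are q-series e(lam t) * sum_n c_n q^n.  On even functions, and
   up to a power of eta making the weight an integer, the Weil representation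
   is given by a real symmetric involution S and a diagonal matrix e(L) with
   (e(L) S)^3 = 1.  The module of vector-valued forms over C[E4, E6] is free:
   Poincare series provide enough forms, and a tuple of least weight with
   nonzero determinant is a basis, its determinant being a constant times a
   power of eta.  Evaluating it at i and rho, and comparing with the dual module
   (exponents 2 - L), gives
     s - m = n (j / 6 + 5 / 12) - sum L + (terms in tr S and tr (e(L) S)).
   These traces are Gauss sums G(n), and sum (1/2 - lam) is bounded by the
   finite Fourier expansion of the sawtooth and |G(n)|^2 <= |A| |A[n]|. *)
Require Import Defs.
From HB Require Import structures.
From mathcomp Require Import all_boot all_order all_algebra ring_quotient.
From mathcomp Require Import fingroup perm generic_quotient.
From mathcomp.real_closed Require Import complex.
From mathcomp Require Import boolp classical_sets functions reals topology.
From mathcomp Require Import normedtype sequences derive realfun exp trigo.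
From mathcomp Require Import ring lra zify.

Set Implicit Arguments.
Unset Strict Implicit.
Unset Printing Implicit Defensive.

Import Order.TTheory GRing.Theory Num.Theory numFieldNormedType.Exports.

Local Open Scope ring_scope.
Local Open Scope classical_set_scope.
Local Open Scope complex_scope.

Local Notation "t °" := (uhp_val t) (at level 1, format "t °").

(** * Unordered complex sums *)

Section Modulus.
Variable R : realType.
Local Notation C := R[i].

(** No contour integral and no valence formula is used. Functions are absolutely convergent
    q-series, Cauchy's inequality comes from averages over roots of unity, and the vanishing and
    constancy theorems rest on two facts: a function with zero derivative is constant, and a form of
    negative weight is zero. The obstacle is to bring exponents, weights and signs into one setting.
    Cusp forms for A take the exponents lambda in (0,1] with e(lambda) = e(-Q), holomorphic forms
    for A(-1) the complements 1 - lambda in [0,1). Multiplying by eta^n with n = -2k mod 4,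
    respectively by eta^(24-n), gives weights 2p and 2(7-p) and exponents L = lambda + n/24 and 2 -
    L, so that the two spaces are paired through Delta^2. The congruence between 2k and -sig(A) mod
    4 makes the leftover sign of S real and all forms even. The signature and the Weil
    representation must first be shown to exist: the former by a quaternion of norm -1 modulo the
    level acting on A^4, the latter by a presentation of Mp_2(Z). *)

Definition cn (z : C) : R := Normc.normc z.
Lemma cnE (z : C) : `|z| = (cn z)%:C.
by []. Qed.
Lemma cn_ge0 z : 0 <= cn z.
by case: z => a b; rewrite /cn /= sqrtr_ge0. Qed.

Lemma cn0 : cn 0 = 0. Proof. exact: Normc.normc0. Qed.
Lemma cn1 : cn 1 = 1. Proof. exact: Normc.normc1. Qed.
Lemma cnM x y : cn (x * y) = cn x * cn y. Proof. exact: Normc.normcM. Qed.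
Lemma cnV x : cn x^-1 = (cn x)^-1. Proof. exact: Normc.normcV. Qed.
Lemma cnN x : cn (- x) = cn x. Proof. exact: normcN. Qed.
Lemma cnD x y : cn (x + y) <= cn x + cn y. Proof. exact: le_normcD. Qed.

Lemma cnB x y : cn (x - y) <= cn x + cn y.
by rewrite -(cnN y) cnD. Qed.
Lemma cnBC x y : cn (x - y) = cn (y - x).
by rewrite -cnN opprB. Qed.
Lemma cn_eq0 x : (cn x == 0) = (x == 0).
apply/eqP/eqP => [|->]; [exact: Normc.eq0_normc|exact: cn0].
Qed.
Lemma cn_gt0 x : (0 < cn x) = (x != 0).
by rewrite lt_def cn_eq0 cn_ge0 andbT. Qed.
Lemma cnX x n : cn (x ^+ n) = cn x ^+ n.
by elim: n => [|n IH]; rewrite ?expr0 ?cn1// !exprS cnM IH. Qed.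
Lemma cnXz x (m : int) : cn (x ^ m) = cn x ^ m.
by case: m => n; rewrite ?NegzE -?exprnP ?exprz_inv ?cnX// -?exprnN ?cnV ?cnX. Qed.
Lemma cn_real (a : R) : cn a%:C = `|a|.
by rewrite /cn /= expr0n addr0 sqrtr_sqr. Qed.
Lemma cn_nat n : cn n%:R = n%:R.
by rewrite -[n%:R](rmorph_nat (real_complex R)) cn_real normr_nat. Qed.
Lemma cn_ge_Re z : `|complex.Re z| <= cn z.
case: z => a b; rewrite /cn /= -[X in X <= _]sqrtr_sqr ler_wsqrtr//.
by rewrite lerDl sqr_ge0.
Qed.
Lemma cn_ge_Im z : `|complex.Im z| <= cn z.
case: z => a b; rewrite /cn /= -[X in X <= _]sqrtr_sqr ler_wsqrtr//.
by rewrite lerDr sqr_ge0.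
Qed.
Lemma cn_le_ReIm z : cn z <= `|complex.Re z| + `|complex.Im z|.
rewrite {1}[z]complexE (le_trans (cnD _ _))// cnM !cn_real lerD//.
by rewrite /cn /= expr0n expr1n add0r sqrtr1 mul1r.
Qed.
Lemma sqr_cn z : cn z ^+ 2 = complex.Re z ^+ 2 + complex.Im z ^+ 2.
by case: z => a b; rewrite /cn /= sqr_sqrtr// addr_ge0 ?sqr_ge0. Qed.
Lemma cn_sum (I : Type) (s : seq I) (F : I -> C) :
 cn (\sum_(i <- s) F i) <= \sum_(i <- s) cn (F i).
elim: s => [|i s IH]; first by rewrite !big_nil cn0.
by rewrite !big_cons (le_trans (cnD _ _))// lerD2l.
Qed.
Lemma cn_small_eq (x y : C) : (forall e : R, 0 < e -> cn (x - y) <= e) -> x = y.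
move=> h; apply/eqP; rewrite -subr_eq0 -cn_eq0 eq_le cn_ge0 andbT.
by apply/ler_addgt0Pr => e e0; rewrite add0r h.
Qed.

End Modulus.

Arguments cn : simpl never.

Section UnorderedSums.
Variable R : realType.
Local Notation C := R[i].

(** Convergence along finite subsets, listed as duplicate-free sequences. No enumeration of the
    index type is needed, so sums over N, Z, Z x Z and SL_2(Z) are treated alike. *)
Definition hsum (I : choiceType) (F : I -> C) (l : C) :=
 forall e : R, 0 < e -> exists s0 : seq I, forall s, uniq s ->
 {subset s0 <= s} -> cn (\sum_(i <- s) F i - l) < e.
(** For nonnegative terms this expresses finiteness of the sum together with a bound, without naming
    its value. *)
Definition bsum (I : choiceType) (F : I -> R) (B : R) :=
 forall s, uniq s -> \sum_(i <- s) F i <= B.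
Definition summ (I : choiceType) (F : I -> C) :=
 exists B, bsum (fun i => cn (F i)) B.
Definition usum (I : choiceType) (F : I -> C) : C := xget 0 [set l | hsum F l].

Section Basic.
Variable I : choiceType.
Implicit Types (F G : I -> C) (s t : seq I).

Lemma perm_sub_cat s0 s : uniq s0 -> uniq s -> {subset s0 <= s} ->
 perm_eq s (s0 ++ [seq i <- s | i \notin s0]).
move=> u0 u sub; apply: uniq_perm => //.
 rewrite cat_uniq u0 filter_uniq//= andbT; apply/hasPn => i.
 by rewrite mem_filter => /andP[].
move=> i; rewrite mem_cat mem_filter; case: (boolP (i \in s0)) => //= /sub ->//.
Qed.

Lemma sum_sub_le (g : I -> R) s0 s : (forall i, 0 <= g i) -> uniq s0 -> uniq s ->
 {subset s0 <= s} -> \sum_(i <- s0) g i <= \sum_(i <- s) g i.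
move=> g0 u0 u sub; rewrite (perm_big _ (perm_sub_cat u0 u sub)) big_cat /=.
by rewrite lerDl sumr_ge0.
Qed.
Lemma eq_hsum F G l : F =1 G -> hsum F l -> hsum G l.
by move=> /funext ->. Qed.

Lemma hsum_unique F l l' : hsum F l -> hsum F l' -> l = l'.
move=> h h'; apply: cn_small_eq => e e0; have e20 : 0 < e / 2 by rewrite divr_gt0.
have [s hs] := h _ e20; have [s' hs'] := h' _ e20.
have U := undup_uniq (s ++ s').
have sub : {subset s <= undup (s ++ s')}.
 by move=> i; rewrite mem_undup mem_cat => ->.
have sub' : {subset s' <= undup (s ++ s')}.
 by move=> i; rewrite mem_undup mem_cat => ->; rewrite orbT.
have := hs _ U sub; have := hs' _ U sub'; set x := \sum_(_ <- _) _ => a b.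
have -> : l - l' = (x - l') - (x - l) by ring.
by rewrite (le_trans (cnB _ _))//; lra.
Qed.

Lemma usumE F l : hsum F l -> usum F = l.
move=> h; rewrite /usum; case: xgetP => [_ -> /= h'|/(_ l)//].
exact: hsum_unique h' h.
Qed.
Lemma bsum_ge0 (g : I -> R) B : bsum g B -> 0 <= B.
by move=> /(_ [::] isT); rewrite big_nil. Qed.
Lemma hsum0 : hsum (fun _ : I => 0) 0.
by move=> e e0; exists [::] => s _ _; rewrite big1// subrr cn0. Qed.

Lemma hsumD F G l l' : hsum F l -> hsum G l' -> hsum (fun i => F i + G i) (l + l').
move=> h h' e e0; have e20 : 0 < e / 2 by rewrite divr_gt0.
have [s hs] := h _ e20; have [s' hs'] := h' _ e20.
exists (s ++ s') => t ut st; rewrite big_split /=.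
have h1 : cn (\sum_(i <- t) F i - l) < e / 2.
 by apply: hs => // i hi; apply: st; rewrite mem_cat hi.
have h2 : cn (\sum_(i <- t) G i - l') < e / 2.
 by apply: hs' => // i hi; apply: st; rewrite mem_cat hi orbT.
rewrite opprD addrACA (le_lt_trans (cnD _ _))//; lra.
Qed.

Lemma hsumZ F l (a : C) : hsum F l -> hsum (fun i => a * F i) (a * l).
have [-> _|a0 h] := eqVneq a 0.
 by rewrite mul0r; apply: eq_hsum hsum0 => i; rewrite mul0r.
move=> e e0; have [|s hs] := h (e / cn a); first by rewrite divr_gt0 ?cn_gt0.
exists s => t ut st; rewrite -mulr_sumr -mulrBr cnM.
by rewrite mulrC -ltr_pdivlMr ?cn_gt0// hs.
Qed.

Lemma hsumN F l : hsum F l -> hsum (fun i => - F i) (- l).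
by move=> /(hsumZ (-1)); rewrite mulN1r; apply: eq_hsum => i; rewrite mulN1r.
Qed.
Lemma hsumB F G l l' : hsum F l -> hsum G l' -> hsum (fun i => F i - G i) (l - l').
by move=> h h'; apply: hsumD => //; exact: hsumN. Qed.

Lemma hsum_sum (K : Type) (t : seq K) (F : K -> I -> C) (l : K -> C) :
 (forall k, hsum (F k) (l k)) ->
 hsum (fun i => \sum_(k <- t) F k i) (\sum_(k <- t) l k).
move=> h; elim: t => [|k t IH].
 by rewrite big_nil; apply: eq_hsum hsum0 => i; rewrite big_nil.
rewrite big_cons; apply: eq_hsum (hsumD (h k) IH) => i; by rewrite big_cons.
Qed.

Lemma hsum_fin F s : uniq s -> (forall i, i \notin s -> F i = 0) ->
 hsum F (\sum_(i <- s) F i).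
move=> us h e e0; exists s => t ut st.
rewrite (perm_big _ (perm_sub_cat us ut st)) big_cat /=.
rewrite [X in _ + X - _]big1_seq ?addr0 ?subrr ?cn0// => i /andP[_].
by rewrite mem_filter => /andP[/h].
Qed.

Lemma hsum_le F l B : hsum F l -> bsum (fun i => cn (F i)) B -> cn l <= B.
move=> h b; apply/ler_addgt0Pr => e e0; have [s hs] := h _ e0.
have : cn (\sum_(i <- undup s) F i - l) < e.
 by apply: hs; rewrite ?undup_uniq// => i; rewrite mem_undup.
have : cn (\sum_(i <- undup s) F i) <= B.
 by rewrite (le_trans (cn_sum _ _))//; exact/b/undup_uniq.
set x := \sum_(_ <- _) _ => xB xl.
have -> : l = x - (x - l) by ring.
rewrite (le_trans (cnB _ _))//; lra.
Qed.

(** The sum is the supremum of the finite partial sums. *)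
Lemma hsum_nneg (g : I -> R) B : (forall i, 0 <= g i) -> bsum g B ->
 exists l : R, hsum (fun i => (g i)%:C) l%:C.
move=> g0 b; pose E := [set x | exists2 s, uniq s & x = \sum_(i <- s) g i].
have hE : has_sup E.
 split; first by exists 0, [::]; rewrite ?big_nil.
 by exists B => _ [s us ->]; exact: b.
exists (sup E) => e e0; have [_ [s us ->] hs] := sup_adherent e0 hE.
exists s => t ut st.
have -> : \sum_(i <- t) (g i)%:C - (sup E)%:C = (\sum_(i <- t) g i - sup E)%:C by rewrite rmorphB rmorph_sum.
have h1 := sum_sub_le g0 us ut st.
have h2 : \sum_(i <- t) g i <= sup E by apply: sup_upper_bound => //; exists t.
by rewrite cn_real ler0_norm ?subr_le0//; lra.
Qed.

Lemma bsumW (g g' : I -> R) B : (forall i, g i <= g' i) -> bsum g' B -> bsum g B.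
by move=> h b s us; rewrite (le_trans _ (b s us))// ler_sum. Qed.
Lemma summW F (g : I -> R) B : (forall i, cn (F i) <= g i) -> bsum g B -> summ F.
by move=> h b; exists B; exact: bsumW b. Qed.
Lemma summ_le F G : (forall i, cn (F i) <= cn (G i)) -> summ G -> summ F.
by move=> h [B b]; exists B; exact: bsumW b. Qed.

Lemma hsum_real_summ (g : I -> R) B : bsum (fun i => `|g i|) B ->
 exists l : C, hsum (fun i => (g i)%:C) l.
move=> b; pose gp i := Num.max (g i) 0; pose gm i := Num.max (- g i) 0.
have [||l hl] := @hsum_nneg gp B.
- by move=> i; rewrite /gp le_max lexx orbT.
- by apply: bsumW b => i; rewrite /gp ge_max ler_norm normr_ge0.
have [||l' hl'] := @hsum_nneg gm B.
- by move=> i; rewrite /gm le_max lexx orbT.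
- by apply: bsumW b => i; rewrite /gm ge_max -normrN ler_norm normr_ge0.
exists (l%:C - l'%:C); apply: eq_hsum (hsumB hl hl') => i.
rewrite -rmorphB; congr (_ %:C); rewrite /gp /gm.
by case: (lerP (g i) 0) => h; case: (lerP (- g i) 0) => h'; lra.
Qed.

Lemma usumP F : summ F -> hsum F (usum F).
move=> [B b].
have [|x hx] := @hsum_real_summ (fun i => complex.Re (F i)) B.
 by apply: bsumW b => i; exact: cn_ge_Re.
have [|y hy] := @hsum_real_summ (fun i => complex.Im (F i)) B.
 by apply: bsumW b => i; exact: cn_ge_Im.
have h : hsum F (x + 'i * y).
 by apply: eq_hsum (hsumD hx (hsumZ 'i hy)) => i; rewrite -complexE.
by rewrite (usumE h).
Qed.

Lemma summD F G : summ F -> summ G -> summ (fun i => F i + G i).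
move=> [B b] [B' b']; exists (B + B') => s us.
by rewrite (le_trans (ler_sum _ (fun i _ => cnD _ _)))// big_split lerD ?b ?b'.
Qed.
Lemma summZ F a : summ F -> summ (fun i => a * F i).
move=> [B b]; exists (cn a * B) => s us.
under eq_bigr do rewrite cnM.
by rewrite -mulr_sumr ler_wpM2l ?cn_ge0// b.
Qed.
Lemma summN F : summ F -> summ (fun i => - F i).
by apply: summ_le => i; rewrite cnN. Qed.
Lemma summB F G : summ F -> summ G -> summ (fun i => F i - G i).
by move=> h h'; apply: summD => //; exact: summN. Qed.
Lemma usumD F G : summ F -> summ G -> usum (fun i => F i + G i) = usum F + usum G.
by move=> h h'; apply/usumE/hsumD; exact: usumP. Qed.
Lemma usumB F G : summ F -> summ G -> usum (fun i => F i - G i) = usum F - usum G.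
by move=> h h'; apply/usumE/hsumB; exact: usumP. Qed.
Lemma usumZ F a : summ F -> usum (fun i => a * F i) = a * usum F.
by move=> h; apply/usumE/hsumZ; exact: usumP. Qed.
Lemma usum_le F B : summ F -> bsum (fun i => cn (F i)) B -> cn (usum F) <= B.
by move=> /usumP; exact: hsum_le. Qed.
Lemma summ_if F (P : pred I) : summ F -> summ (fun i => if P i then F i else 0).
by apply: summ_le => i; case: ifP => _; rewrite ?cn0 ?cn_ge0. Qed.
Lemma summ_norm F : summ F -> summ (fun i => (cn (F i))%:C).
by apply: summ_le => i; rewrite cn_real ger0_norm ?cn_ge0. Qed.

Lemma usum_normE F : summ F ->
 usum (fun i => (cn (F i))%:C) = (cn (usum (fun i => (cn (F i))%:C)))%:C.
move=> /[dup] sF [B b]; have [l hl] := hsum_nneg (fun i => cn_ge0 (F i)) b.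
rewrite (usumE hl) cn_real ger0_norm//; apply/ler_addgt0Pr => e e0.
have [s hs] := hl _ e0.
have : cn (\sum_(i <- undup s) (cn (F i))%:C - l%:C) < e.
 by apply: hs; rewrite ?undup_uniq// => i; rewrite mem_undup.
rewrite -rmorph_sum -rmorphB cn_real ltr_norml => /andP[h1 h2].
have : 0 <= \sum_(i <- undup s) cn (F i) by apply: sumr_ge0 => i _; exact: cn_ge0.
by move: h1 h2; lra.
Qed.

Lemma usum_norm_bsum F : summ F ->
 bsum (fun i => cn (F i)) (cn (usum (fun i => (cn (F i))%:C))).
move=> sF s us; apply/ler_addgt0Pr => e e0.
have [t ht] := usumP (summ_norm sF) e0.
have ut := undup_uniq (s ++ t).
have : cn (\sum_(i <- undup (s ++ t)) (cn (F i))%:C -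
 usum (fun i : I => (cn (F i))%:C)) < e.
 by apply: ht => // i hi; rewrite mem_undup mem_cat hi orbT.
rewrite (usum_normE sF); move: (cn (usum _)) => l.
rewrite [cn l%:C]cn_real.
have := ler_norm l; rewrite -rmorph_sum -rmorphB cn_real ltr_norml => h0 /andP[h1 h2].
have : \sum_(i <- s) cn (F i) <= \sum_(i <- undup (s ++ t)) cn (F i).
 apply: sum_sub_le => //; first by move=> i; exact: cn_ge0.
 by move=> i hi; rewrite mem_undup mem_cat hi.
by move: h0 h1 h2; lra.
Qed.

Lemma cn_usum_le F : summ F -> cn (usum F) <= cn (usum (fun i => (cn (F i))%:C)).
by move=> sF; exact/usum_le/usum_norm_bsum. Qed.

Lemma summ_tail F : summ F -> forall e : R, 0 < e -> exists s0, forall s, uniq s ->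
 (forall i, i \in s -> i \notin s0) -> \sum_(i <- s) cn (F i) <= e.
move=> sF e e0; have e20 : 0 < e / 2 by rewrite divr_gt0.
have [s0 h] := usumP (summ_norm sF) e20.
exists s0 => s us ds.
have : cn (\sum_(i <- undup s0) (cn (F i))%:C - usum (fun i => (cn (F i))%:C)) < e / 2.
 by apply: h; rewrite ?undup_uniq// => i; rewrite mem_undup.
have uc : uniq (undup s0 ++ s).
 rewrite cat_uniq undup_uniq us andbT; apply/hasPn => i /ds.
 by rewrite mem_undup.
have : cn (\sum_(i <- undup s0 ++ s) (cn (F i))%:C - usum (fun i => (cn (F i))%:C)) < e / 2.
 by apply: h => // i hi; rewrite mem_cat mem_undup hi.
rewrite big_cat /=; set a := \sum_(i <- undup _) _; set b := \sum_(i <- s) _.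
set l := usum _ => h1 h2.
have -> : \sum_(i <- s) cn (F i) = cn b.
 rewrite /b -rmorph_sum cn_real ger0_norm//; apply: sumr_ge0 => i _; exact: cn_ge0.
have -> : b = (a + b - l) - (a - l) by ring.
by rewrite (le_trans (cnB _ _))//; lra.
Qed.

Lemma eq_usum F G : F =1 G -> usum F = usum G.
by move=> /funext ->. Qed.
Lemma eq_summ F G : F =1 G -> summ F -> summ G.
by move=> /funext ->. Qed.
Lemma usum0 : usum (fun _ : I => 0) = 0. Proof. exact/usumE/hsum0. Qed.
Lemma summ0 : summ (fun _ : I => 0).
by exists 0 => s _; rewrite big1// => i _; exact: cn0. Qed.
Lemma usum_fin F s : uniq s -> (forall i, i \notin s -> F i = 0) ->
 usum F = \sum_(i <- s) F i.
by move=> us h; exact/usumE/hsum_fin. Qed.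

Lemma summ_fin F s : uniq s -> (forall i, i \notin s -> F i = 0) -> summ F.
move=> us h; exists (\sum_(i <- s) cn (F i)) => t ut.
rewrite (bigID (mem s)) /= [X in _ + X]big1 ?addr0; last first.
 by move=> i /h ->; exact: cn0.
rewrite -big_filter; apply: sum_sub_le => //.
- by move=> i; exact: cn_ge0.
- exact: filter_uniq.
- by move=> i; rewrite mem_filter => /andP[].
Qed.

Lemma usum_sum (K : Type) (t : seq K) (F : K -> I -> C) : (forall k, summ (F k)) ->
 usum (fun i => \sum_(k <- t) F k i) = \sum_(k <- t) usum (F k).
by move=> h; apply/usumE/hsum_sum => k; exact: usumP. Qed.

Lemma summ_sum (K : Type) (t : seq K) (F : K -> I -> C) : (forall k, summ (F k)) ->
 summ (fun i => \sum_(k <- t) F k i).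
move=> h; elim: t => [|k t IH].
 by apply: eq_summ summ0 => i; rewrite big_nil.
by apply: eq_summ (summD (h k) IH) => i; rewrite big_cons.
Qed.

End Basic.

Section Grouping.
Variables (I K : choiceType) (h : I -> K).

Lemma sum_mem_if (F : I -> C) (t : seq K) i : uniq t ->
 \sum_(k <- t) (if h i == k then F i else 0) = if h i \in t then F i else 0.
move=> ut; rewrite -big_mkcond /= -big_filter.
case: ifPn => hi.
 rewrite (perm_big [:: h i]) ?big_seq1//; apply: uniq_perm => //.
 exact: filter_uniq.
 move=> k; rewrite mem_filter inE eq_sym; case: eqP => //= ->; exact: hi.
rewrite big1_seq// => k; rewrite mem_filter => /andP[_ /andP[/eqP <- kt]].
by rewrite kt in hi.
Qed.

(** Fubini along the fibres of [h]. A finite sum of fibre sums is [F] summed over the union of these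
    fibres ([sumG]); once the fibres through [s0] are included, only a tail of [F] is missing. *)
Lemma usum_group (F : I -> C) : summ F ->
 summ (fun k => usum (fun i => if h i == k then F i else 0)) /\
 usum (fun k => usum (fun i => if h i == k then F i else 0)) = usum F.
move=> sF; pose Fk k i := if h i == k then F i else 0.
have sFk k : summ (Fk k) by exact: summ_if.
have sumG t : uniq t -> \sum_(k <- t) usum (Fk k) =
 usum (fun i => if h i \in t then F i else 0).
 by move=> ut; rewrite -usum_sum//; apply: eq_usum => i; exact: sum_mem_if.
split.
 exists (cn (usum (fun i => (cn (F i))%:C))) => t ut.
 rewrite (le_trans (ler_sum _ (fun k _ => cn_usum_le (sFk k))))//.
 pose nF i := (cn (F i))%:C.
 have nE k : usum (fun i => (cn (Fk k i))%:C) =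
 usum (fun i => if h i == k then nF i else 0).
 by apply: eq_usum => i; rewrite /Fk; case: ifP => // _; rewrite cn0.
 have sn k : summ (fun i => if h i == k then nF i else 0).
 by apply: summ_if; exact: summ_norm.
 have -> : \sum_(k <- t) cn (usum (fun i => (cn (Fk k i))%:C)) =
 cn (\sum_(k <- t) usum (fun i => if h i == k then nF i else 0)).
 transitivity (cn (\sum_(k <- t) (cn (usum (fun i => (cn (Fk k i))%:C)))%:C)).
 rewrite -rmorph_sum cn_real ger0_norm//; apply: sumr_ge0 => k _; exact: cn_ge0.
 by congr cn; apply: eq_bigr => k _; rewrite -(usum_normE (sFk k)) nE.
 rewrite -usum_sum//.
 under [X in cn X]eq_usum => i do rewrite sum_mem_if//.
 apply: usum_le; first by apply: summ_if; exact: summ_norm.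
 apply: bsumW (usum_norm_bsum sF) => i.
 by case: ifP; rewrite /nF ?cn_real ?ger0_norm ?cn_ge0// cn0 cn_ge0.
apply: usumE => e e0; have e20 : 0 < e / 2 by rewrite divr_gt0.
have [s0 hs0] := summ_tail sF e20.
exists (map h s0) => t ut st; rewrite sumG//.
rewrite -usumB//; last exact: summ_if.
have -> : usum (fun i => (if h i \in t then F i else 0) - F i) =
 usum (fun i => - (if h i \in t then 0 else F i)).
 by apply: eq_usum => i; case: ifP => _; rewrite ?subrr ?sub0r// oppr0.
apply: le_lt_trans (_ : e / 2 < e); last by lra.
apply: usum_le.
 by apply: summN; apply: summ_le sF => i; case: ifP => _; rewrite ?cn0 ?cn_ge0.
move=> s us; rewrite (bigID (fun i => h i \in t)) /= big1 ?add0r; last first.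
 by move=> i ->; rewrite oppr0 cn0.
under eq_bigr => i /negbTE -> do rewrite cnN.
rewrite -big_filter; apply: hs0; first exact: filter_uniq.
move=> i; rewrite mem_filter => /andP[hi _]; apply: contra hi => i0.
by apply: st; apply: map_f.
Qed.

Lemma bsum_group (g : I -> R) (B : K -> R) Bt : (forall i, 0 <= g i) ->
 (forall k, bsum (fun i => if h i == k then g i else 0) (B k)) -> bsum B Bt ->
 bsum g Bt.
move=> g0 hB bt s us.
have -> : \sum_(i <- s) g i =
 \sum_(k <- undup (map h s)) \sum_(i <- s) (if h i == k then g i else 0).
 rewrite exchange_big /= big_seq [RHS]big_seq; apply: eq_bigr => i si.
 rewrite -big_mkcond /= -big_filter (perm_big [:: h i]) ?big_seq1//.
 apply: uniq_perm => //; first exact/filter_uniq/undup_uniq.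
 move=> k; rewrite mem_filter inE eq_sym mem_undup; case: eqP => //= ->.
 exact: map_f.
rewrite (le_trans _ (bt _ (undup_uniq (map h s))))//.
by apply: ler_sum => k _; exact: hB.
Qed.

End Grouping.

Section Reindex.
Variables (I J : choiceType) (h : J -> I).
Hypothesis hinj : injective h.

(** Preimages under [h] are chosen classically. Pulling finite sets back from [I] to [J] is all that
    reindexing an unordered sum requires. *)
Lemma preimage_seq (t : seq I) : exists2 u : seq J, uniq u &
 forall j, (j \in u) = (h j \in t).
pose g i := if pselect (exists j, h j = i) is left p then Some (projT1 (cid p))
 else None.
have gh j : g (h j) = Some j.
 by rewrite /g; case: pselect => [p|[]]; [case: cid => j' /= /hinj ->|exists j].
exists (undup (pmap g t)) => [|j]; first exact: undup_uniq.
rewrite mem_undup mem_pmap; apply/mapP/idP => [[i it]|jt]; last by exists (h j).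
by rewrite /g; case: pselect => // p [->]; case: cid => /= j' ->.
Qed.

Lemma sum_preimage (V : nmodType) (F : I -> V) t u : uniq t -> uniq u ->
 (forall j, (j \in u) = (h j \in t)) ->
 \sum_(i <- t | i \in map h u) F i = \sum_(j <- u) F (h j).
move=> ut uu hu; rewrite -big_filter (perm_big (map h u)) /= ?big_map//.
apply: uniq_perm; rewrite ?filter_uniq ?map_inj_uniq// => i.
rewrite mem_filter; case: (boolP (i \in map h u)) => //=.
by move=> /mapP[j]; rewrite hu => ? ->.
Qed.

Lemma notin_preimage (t : seq I) (u : seq J) i : (forall j, (j \in u) = (h j \in t)) ->
 i \in t -> i \notin map h u -> ~ (exists j, h j = i).
move=> hu it iu [j hj]; move/negP: iu; apply; rewrite -hj.
by apply: map_f; rewrite hu hj.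
Qed.

Lemma hsum_inj (F : I -> C) l : (forall i, ~ (exists j, h j = i) -> F i = 0) ->
 hsum (fun j => F (h j)) l -> hsum F l.
move=> F0 H e e0; have [s hs] := H _ e0; exists (map h s) => t ut st.
have [u uu hu] := preimage_seq t.
rewrite (bigID (fun i => i \in map h u)) /= sum_preimage//.
rewrite [X in _ + X - _]big1_seq ?addr0; last first.
 by move=> i /andP[iu it]; apply: F0; exact: notin_preimage hu it iu.
by apply: hs => // j js; rewrite hu; apply: st; exact: map_f.
Qed.

Lemma bsum_inj (g : I -> R) B : (forall i, ~ (exists j, h j = i) -> g i <= 0) ->
 bsum (fun j => g (h j)) B -> bsum g B.
move=> g0 b t ut; have [u uu hu] := preimage_seq t.
apply: le_trans (b _ uu).
rewrite (bigID (fun i => i \in map h u)) /= sum_preimage//.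
rewrite -[leRHS]addr0 lerD2l// big_seq_cond; apply: sumr_le0 => i /andP[it iu].
by apply: g0; exact: notin_preimage hu it iu.
Qed.

Lemma summ_comp (F : I -> C) : summ F -> summ (fun j => F (h j)).
move=> [B b]; exists B => s us; rewrite -(big_map h xpredT (fun i => cn (F i))).
by apply: b; rewrite map_inj_uniq.
Qed.
Lemma usum_inj (F : I -> C) : (forall i, ~ (exists j, h j = i) -> F i = 0) ->
 summ F -> usum F = usum (fun j => F (h j)).
by move=> F0 sF; apply/usumE/hsum_inj => //; exact/usumP/summ_comp. Qed.

End Reindex.

Lemma usum_bij (I J : choiceType) (h : J -> I) (F : I -> C) : bijective h ->
 summ F -> usum F = usum (fun j => F (h j)).
move=> hb sF; apply: usum_inj => //; first exact: bij_inj.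
by case: hb => g _ gK i []; exists (g i).
Qed.

Section Product.
Variables (I J : choiceType) (F : I -> C) (G : J -> C).

Lemma bsum_prod (f : I -> R) (g : J -> R) B B' : (forall i, 0 <= f i) ->
 (forall j, 0 <= g j) -> bsum f B -> bsum g B' ->
 bsum (fun p : I * J => f p.1 * g p.2) (B * B').
move=> f0 g0 bf bg.
apply: (@bsum_group _ _ fst _ (fun i => f i * B')); first by move=> p; exact: mulr_ge0.
 move=> i; apply: (@bsum_inj _ _ (fun j => (i, j))); first by move=> j j' [].
 by move=> [i' j'] /= n; case: eqP => //= e; exfalso; apply: n; exists j'; rewrite -e.
 move=> s us /=; under eq_bigr do rewrite eqxx.
 by rewrite -mulr_sumr ler_wpM2l// bg.
by move=> s us; rewrite -mulr_suml ler_wpM2r ?bf//; exact: bsum_ge0 bg.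
Qed.

Lemma summ_prod : summ F -> summ G -> summ (fun p : I * J => F p.1 * G p.2).
move=> [B b] [B' b']; exists (B * B').
apply: bsumW (bsum_prod (fun i => cn_ge0 (F i)) (fun j => cn_ge0 (G j)) b b').
by move=> p; rewrite cnM.
Qed.

Lemma usum_pair (H : I * J -> C) : summ H ->
 summ (fun i => usum (fun j => H (i, j))) /\
 usum (fun i => usum (fun j => H (i, j))) = usum H.
move=> sH; have [] := usum_group fst sH.
have -> // : (fun k => usum (fun i => if i.1 == k then H i else 0)) =
 (fun i => usum (fun j => H (i, j))).
apply/funext => i; rewrite (@usum_inj _ _ (fun j => (i, j))) /=; last 3 first.
- by move=> j j' [].
- by move=> [i' j'] /= n; case: eqP => //= e; exfalso; apply: n; exists j'; rewrite -e.
- exact: summ_if.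
by apply: eq_usum => j; rewrite eqxx.
Qed.

Lemma usum_prod : summ F -> summ G ->
 usum (fun p : I * J => F p.1 * G p.2) = usum F * usum G.
move=> sF sG; have [_ <-] := usum_pair (summ_prod sF sG).
rewrite mulrC -usumZ//; apply: eq_usum => i /=; by rewrite usumZ// mulrC.
Qed.

End Product.

Lemma usum_swap (I J : choiceType) (H : I * J -> C) : summ H ->
 summ (fun j => usum (fun i => H (i, j))) /\
 usum (fun j => usum (fun i => H (i, j))) = usum H.
move=> sH; pose sw (p : J * I) := (p.2, p.1).
have bs : bijective sw by exists (fun p => (p.2, p.1)); case.
rewrite (usum_bij bs)//.
have := @usum_pair _ _ (fun p => H (sw p)); apply.
by apply: summ_comp => //; exact: bij_inj.
Qed.

Definition clim (u : nat -> C) (l : C) :=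
 forall e : R, 0 < e -> exists N, forall n, (N <= n)%N -> cn (u n - l) < e.

Lemma clim_unique u l l' : clim u l -> clim u l' -> l = l'.
move=> h h'; apply: cn_small_eq => e e0; have e20 : 0 < e / 2 by rewrite divr_gt0.
have [N hN] := h _ e20; have [N' hN'] := h' _ e20.
have := hN (maxn N N') (leq_maxl _ _); have := hN' (maxn N N') (leq_maxr _ _).
set x := u _ => a b; have -> : l - l' = (x - l') - (x - l) by ring.
by rewrite (le_trans (cnB _ _))//; lra.
Qed.

Lemma eq_clim u v l : u =1 v -> clim u l -> clim v l.
by move=> /funext ->. Qed.

Lemma hsum_clim (F : nat -> C) l : hsum F l -> clim (fun n => \sum_(i < n) F i) l.
move=> h e e0; have [s hs] := h _ e0; exists (\max_(i <- s) i.+1)%N => n hn.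
rewrite -(big_mkord xpredT F); apply: hs; first exact: iota_uniq.
move=> i si; rewrite mem_index_iota /= (leq_trans _ hn)//.
by rewrite (big_rem i)//= leq_max leqnn.
Qed.

(** Dominated convergence: on the finite set [s0] the terms converge one by one, and outside it both
    sums are at most a tail of the majorant [b]. *)
Lemma clim_usum (I : choiceType) (F : nat -> I -> C) (G : I -> C) (b : I -> R) B :
 (forall n i, cn (F n i) <= b i) -> bsum b B ->
 (forall i, clim (fun n => F n i) (G i)) -> clim (fun n => usum (F n)) (usum G).
move=> Fb bB FG.
have Gb i : cn (G i) <= b i.
 apply/ler_addgt0Pr => e e0; have [N hN] := FG i _ e0.
 have -> : G i = F N i - (F N i - G i) by ring.
 by rewrite (le_trans (cnB _ _))// lerD ?Fb// ltW// hN.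
have sF n : summ (F n) by exact: summW bB.
have sG : summ G by exact: summW bB.
have b0 i : 0 <= b i by exact: le_trans (cn_ge0 _) (Gb i).
have sb : summ (fun i => (b i)%:C).
 by exists B; apply: bsumW bB => i; rewrite cn_real ger0_norm.
move=> e e0; have e40 : 0 < e / 4 by rewrite divr_gt0.
have [s0' hs0'] := summ_tail sb e40.
pose s0 := undup s0'.
have [N hN] : exists N, forall n, (N <= n)%N ->
 \sum_(i <- s0) cn (F n i - G i) <= e / 4.
 elim: (s0) (e / 4) e40 => [|i s IH] d d0.
 by exists 0%N => n _; rewrite big_nil ltW.
 have d20 : 0 < d / 2 by rewrite divr_gt0.
 have [N1 h1] := IH _ d20; have [N2 h2] := FG i _ d20.
 exists (maxn N1 N2) => n; rewrite geq_max => /andP[n1 n2]; rewrite big_cons.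
 by have := h1 n n1; have := h2 n n2; lra.
exists N => n hn; rewrite -usumB//.
apply: le_lt_trans (_ : 3 * (e / 4) < e); last by lra.
apply: usum_le; first exact: summB.
move=> s us; rewrite (bigID (mem s0)) /=.
have -> : 3 * (e / 4) = e / 4 + (e / 4 + e / 4) by ring.
apply: lerD.
 rewrite -big_filter; apply: le_trans (hN n hn); apply: sum_sub_le.
 - by move=> i; exact: cn_ge0.
 - exact: filter_uniq.
 - exact: undup_uniq.
 - by move=> i; rewrite mem_filter => /andP[].
rewrite -big_filter; pose t := [seq i <- s | i \notin s0]; rewrite -/t.
have ht : \sum_(i <- t) b i <= e / 4.
 have := hs0' t (filter_uniq _ us).
 under eq_bigr do rewrite cn_real ger0_norm//; apply.
 by move=> i; rewrite mem_filter /= mem_undup => /andP[].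
rewrite (le_trans (ler_sum _ (fun i _ => cnB _ _)))// big_split /= lerD//.
 by rewrite (le_trans _ ht)// ler_sum.
by rewrite (le_trans _ ht)// ler_sum.
Qed.

End UnorderedSums.

(** * The exponential function *)

Section Exponential.
Variable R : realType.
Local Notation C := R[i].
Local Notation e := (@cexp2pi R).

(** The Cauchy product groups the product sum over N x N along the antidiagonals. *)
Lemma usum_cauchy (F G : nat -> C) : summ F -> summ G ->
 summ (fun n => \sum_(i < n.+1) F i * G (n - i)%N) /\
 usum (fun n => \sum_(i < n.+1) F i * G (n - i)%N) = usum F * usum G.
move=> sF sG; rewrite -usum_prod//.
have := usum_group (fun p : nat * nat => (p.1 + p.2)%N) (summ_prod sF sG).
have -> // : (fun k => usum (fun i : nat * nat =>
 if (i.1 + i.2)%N == k then F i.1 * G i.2 else 0)) =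
 (fun n => \sum_(i < n.+1) F i * G (n - i)%N).
apply/funext => n; rewrite (@usum_fin _ _ _ [seq (i, n - i)%N | i <- iota 0 n.+1]).
- rewrite big_map -[n.+1]subn0 -/(index_iota 0 n.+1) big_mkord.
 by apply: eq_bigr => -[i hi] _ /=; rewrite subnKC ?eqxx.
- by rewrite map_inj_in_uniq ?iota_uniq// => i j _ _ [].
- move=> [i j] /= ni; case: eqP => // hij; exfalso; move/negP: ni; apply.
 by apply/(@mapP _ _ (fun i => (i, n - i)%N) (iota 0 n.+1)); exists i;
 [rewrite mem_iota; lia | congr pair; lia].
Qed.

Lemma bsum_nat (g : nat -> R) B : (forall i, 0 <= g i) ->
 (forall n, \sum_(0 <= i < n) g i <= B) -> bsum g B.
move=> g0 h s us; apply: le_trans (h (\max_(i <- s) i.+1)%N).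
apply: sum_sub_le => //; first exact: iota_uniq.
by move=> i si; rewrite mem_index_iota /= (big_rem i)//= leq_max leqnn.
Qed.

Lemma cvg_clim (u : nat -> R) (l : R) : u @ \oo --> l -> clim (fun n => (u n)%:C) l%:C.
move=> /cvgrPdist_lt h eps e0; have [N _ hN] := h _ e0.
by exists N => n Nn; rewrite -rmorphB cn_real distrC; exact: hN.
Qed.

Lemma clim_ReIm (u : nat -> C) (a b : R) :
 (fun n => complex.Re (u n)) @ \oo --> a ->
 (fun n => complex.Im (u n)) @ \oo --> b -> clim u (a +i* b).
move=> /cvg_clim ha /cvg_clim hb eps e0; have e20 : 0 < eps / 2 by lra.
have [N hN] := ha _ e20; have [M hM] := hb _ e20.
exists (maxn N M) => n; rewrite geq_max => /andP[/hN + /hM].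
rewrite -!rmorphB !cn_real => h1 h2.
rewrite (le_lt_trans (cn_le_ReIm _))//; move: h1 h2.
by case: (u n) => x y /=; lra.
Qed.

Lemma bsum_exp (r : R) : 0 <= r -> bsum (fun m => r ^+ m / m`!%:R) (expR r).
move=> r0; apply: bsum_nat => [i|n]; first by rewrite divr_ge0 ?exprn_ge0.
have -> : \sum_(0 <= i < n) r ^+ i / i`!%:R = series (exp_coeff r) n.
 by rewrite /series /=; apply: eq_bigr => i _; rewrite /exp_coeff.
apply: nondecreasing_cvgn_le; last exact: is_cvg_series_exp_coeff.
by apply: nondecreasing_series => i _; rewrite exp_coeff_ge0.
Qed.

(** [cexp2pi] is built from real functions. The power series supplies the addition law and the
    remainder estimate, and [eE] carries them over. *)
Definition cexp (z : C) : C := usum (fun m => z ^+ m / m`!%:R).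
Lemma cn_exp_term (z : C) m : cn (z ^+ m / m`!%:R) = cn z ^+ m / m`!%:R.
by rewrite cnM cnV cnX cn_nat. Qed.
Lemma summ_cexp (z : C) : summ (fun m => z ^+ m / m`!%:R).
exists (expR (cn z)); apply: bsumW (bsum_exp (cn_ge0 z)) => m.
by rewrite cn_exp_term.
Qed.

Lemma cexpD x y : cexp (x + y) = cexp x * cexp y.
rewrite mulrC /cexp -(usum_cauchy (summ_cexp y) (summ_cexp x)).2.
apply: eq_usum => n; rewrite exprDn mulr_suml; apply: eq_bigr => -[i hi] _ /=.
have := bin_fact (_ : i <= n)%N => /(_ hi) h.
have f0 m : m`!%:R != 0 :> C by rewrite pnatr_eq0 -lt0n fact_gt0.
have h' : n`!%:R = 'C(n, i)%:R * (i`!%:R * (n - i)`!%:R) :> C by rewrite -!natrM h.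
have b0 : 'C(n, i)%:R != 0 :> C by rewrite pnatr_eq0 -lt0n bin_gt0.
rewrite h' -mulr_natr; move: b0 (f0 i) (f0 (n - i)%N) => b0 f1 f2; field.
by rewrite f2 f1 b0.
Qed.

Lemma cexp_clim z : clim (fun n => \sum_(i < n) z ^+ i / i`!%:R) (cexp z).
by apply: (@hsum_clim R (fun i => z ^+ i / i`!%:R)); exact/usumP/summ_cexp. Qed.

Lemma cexp_real (a : R) : cexp a%:C = (expR a)%:C.
apply: clim_unique (cexp_clim _) _.
have /cvg_clim := is_cvg_series_exp_coeff a; apply: eq_clim => n.
rewrite /series /= big_mkord rmorph_sum; apply: eq_bigr => i _.
by rewrite /exp_coeff /= rmorphM rmorphXn /= fmorphV rmorph_nat.
Qed.

Lemma expr_i (b : R) n : ('i * b%:C) ^+ n =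
 (if odd n then 0 else (-1) ^+ n./2 * b ^+ n) +i*
 (if odd n then (-1) ^+ n./2 * b ^+ n else 0).
have E (m : nat) : 'i ^+ m.*2 = ((-1) ^+ m)%:C :> C by rewrite -mul2n exprM sqr_i rmorphXn rmorphN1.
rewrite exprMn -rmorphXn; move: (b ^+ n) => bn.
rewrite -{1}(odd_double_half n) exprD E.
case: (odd n) => /=; rewrite ?expr1 ?expr0; apply/eqP; rewrite eq_complex /=.
 by apply/andP; split; apply/eqP; ring.
by apply/andP; split; apply/eqP; ring.
Qed.

Lemma cexp_im (b : R) : cexp ('i * b%:C) = cos b +i* sin b.
have Ei i : ('i * b%:C) ^+ i / i`!%:R = cos_coeff b i +i* sin_coeff b i.
 have -> : i`!%:R = i`!%:R%:C :> C by rewrite rmorph_nat.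
 rewrite expr_i -fmorphV; apply/eqP; rewrite eq_complex /cos_coeff /sin_coeff /=.
 have o : odd i -> i.-1./2 = i./2 by case: i => //= i; rewrite uphalf_half => /negbTE->.
 rewrite -?exprnP; case: (boolP (odd i)) o => [_ ->//|_ _] /=; rewrite ?mulr0n ?mulr1n;
 by rewrite ?mul0r ?mul1r ?mulr0 ?subr0 ?addr0 ?add0r ?eqxx.
apply: clim_unique (cexp_clim _) _; apply: clim_ReIm.
 have -> : (fun n => complex.Re (\sum_(i < n) ('i * b%:C) ^+ i / i`!%:R)) =
 series (cos_coeff b).
 apply/funext => n; rewrite raddf_sum /series /= big_mkord.
 by apply: eq_bigr => i _; rewrite Ei.
 by rewrite unlock; exact: is_cvg_series_cos_coeff.
have -> : (fun n => complex.Im (\sum_(i < n) ('i * b%:C) ^+ i / i`!%:R)) =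
 series (sin_coeff b).
 apply/funext => n; rewrite raddf_sum /series /= big_mkord.
 by apply: eq_bigr => i _; rewrite Ei.
by rewrite unlock; exact: is_cvg_series_sin_coeff.
Qed.

Definition tpi : C := 'i * (2 * pi)%:C.
Lemma eE z : e z = cexp (tpi * z).
rewrite /cexp2pi -cexp_im -cexp_real -cexpD; congr cexp.
case: z => a b; rewrite /tpi; apply/eqP; rewrite eq_complex /=.
by apply/andP; split; apply/eqP; ring.
Qed.
Lemma eD x y : e (x + y) = e x * e y.
by rewrite !eE mulrDr cexpD. Qed.
Lemma e0 : e 0 = 1.
by rewrite /cexp2pi /= !mulr0 oppr0 expR0 cos0 sin0 mul1r. Qed.

Lemma eN x : e (- x) = (e x)^-1.
have h : e (- x) * e x = 1 by rewrite -eD addNr e0.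
have n0 : e x != 0.
 by apply/eqP => h0; move/eqP: h; rewrite h0 mulr0 eq_sym oner_eq0.
by rewrite -[LHS](mulfK n0) h mul1r.
Qed.

Lemma e_neq0 x : e x != 0.
have h : e (- x) * e x = 1 by rewrite -eD addNr e0.
by apply/eqP => h0; move/eqP: h; rewrite h0 mulr0 eq_sym oner_eq0.
Qed.
Lemma eB x y : e (x - y) = e x / e y. Proof. by rewrite eD eN. Qed.
Lemma eX x n : e x ^+ n = e (n%:R * x).
elim: n => [|n IH]; first by rewrite expr0 mul0r e0.
by rewrite exprS IH -eD; congr e; rewrite -[n.+1]add1n natrD; ring.
Qed.
Lemma eXz x (n : int) : e x ^ n = e (n%:~R * x).
case: n => n; first by rewrite -exprnP eX.
by rewrite NegzE -exprz_inv -exprnP exprVn eX -eN rmorphN /= mulNr -pmulrn.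
Qed.
Lemma e_1 : e 1 = 1.
by rewrite /cexp2pi /= !mulr0 oppr0 expR0 mulr1 mulr_natl cos2pi sin2pi mul1r.
Qed.
Lemma e_int (n : int) : e n%:~R = 1.
by rewrite -[n%:~R]mulr1 -eXz e_1 exp1rz. Qed.
Lemma cn_e z : cn (e z) = expR (- (2 * pi * complex.Im z)).
rewrite /cexp2pi cnM cn_real ger0_norm ?expR_ge0//.
by rewrite /cn /= cos2Dsin2 sqrtr1 mulr1.
Qed.
Lemma e_conj (x : R) : (e x%:C)^*%C = e (- x%:C).
rewrite /cexp2pi /= oppr0 !mulr0 oppr0 expR0 mulrN cosN sinN; apply/eqP.
by rewrite eq_complex /=; apply/andP; split; apply/eqP; ring.
Qed.

(** The real part is 1 - 2 sin^2(pi x), and the sine is positive on (0, pi). *)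
Lemma e_neq1 (x : R) : 0 < x < 1 -> e x%:C != 1.
move=> /andP[x0 x1]; apply/eqP => /(congr1 (@complex.Re R)).
rewrite /cexp2pi /= mulr0 oppr0 expR0 mul1r mul0r subr0.
have -> : 2 * pi * x = (pi * x) *+ 2 by rewrite mulr2n; ring.
rewrite cos_mulr2n cos2sin2 => h.
have : 0 < sin (pi * x).
 by apply: sin_gt0_pi; rewrite mulr_gt0 ?pi_gt0//= gtr_pMr ?pi_gt0.
by move=> s0; have : 0 < sin (pi * x) ^+ 2 by [rewrite exprn_gt0]; move: h; rewrite mulr2n; lra.
Qed.

Lemma e_eq1 (x : R) : -1 < x < 1 -> e x%:C = 1 -> x = 0.
move=> /andP[x0 x1] h; case: (ltgtP x 0) => // hx.
 have : e (- x)%:C = 1 by rewrite rmorphN eN h invr1.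
 by move/eqP; rewrite (negbTE (e_neq1 _))//; apply/andP; split; lra.
by move/eqP: h; rewrite (negbTE (e_neq1 _))// hx x1.
Qed.

(** After dropping two terms, (m+2)! >= m! bounds the tail by |x|^2 times the full exponential
    series. *)
Lemma cexp_quad x : cn (cexp x - 1 - x) <= cn x ^+ 2 * expR (cn x).
pose F m : C := x ^+ m / m`!%:R; have sF : summ F by exact: summ_cexp.
pose F2 m : C := if (m < 2)%N then 0 else F m.
have sF2 : summ F2 by apply: summ_le sF => m; rewrite /F2; case: ifP; rewrite ?cn0 ?cn_ge0.
have -> : cexp x - 1 - x = usum F2.
 rewrite -addrA -opprD.
 have -> : 1 + x = usum (fun m => if (m < 2)%N then F m else 0).
 rewrite (@usum_fin _ _ _ [:: 0; 1]%N)//.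
 by rewrite 2!big_cons big_nil /F /= expr0 expr1 !divr1 addr0.
 by move=> [|[|m]].
 have s1 : summ (fun m => if (m < 2)%N then F m else 0) by exact: summ_if.
 rewrite /cexp -(usumB sF s1); apply: eq_usum => m; rewrite /F2 /F.
 by case: ifP => _; rewrite ?subrr ?subr0.
apply: usum_le => //.
apply: (@bsum_inj _ _ _ (fun m => m.+2)) => [m n []//|[|[|m]]|].
- by move=> _; rewrite /F2 cn0.
- by move=> _; rewrite /F2 cn0.
- by move=> []; exists m.
move=> s us; rewrite /F2 /=.
apply: le_trans (ler_wpM2l _ (bsum_exp (cn_ge0 x) us)); last by rewrite exprn_ge0 ?cn_ge0.
rewrite mulr_sumr; apply: ler_sum => m _; rewrite /F cn_exp_term.
rewrite -[m.+2]add2n exprD -mulrA ler_wpM2l ?exprn_ge0 ?cn_ge0//.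
rewrite ler_wpM2l ?exprn_ge0 ?cn_ge0// lef_pV2 ?posrE ?ltr0n ?fact_gt0// ler_nat.
by rewrite add2n !factS; have := fact_gt0 m; nia.
Qed.

Lemma cn_tpi : cn tpi = 2 * pi.
by rewrite /tpi cnM cn_real /cn /= expr0n expr1n add0r sqrtr1 mul1r ger0_norm ?mulr_ge0 ?pi_ge0.
Qed.
Lemma tpi_neq0 : tpi != 0.
by rewrite -cn_gt0 cn_tpi mulr_gt0 ?pi_gt0. Qed.

End Exponential.

(** * Power series in the unit disc *)

Section PowerSeries.
Variable R : realType.
Local Notation C := R[i].
Local Notation e := (@cexp2pi R).

(** Radius of convergence at least 1; the variable will be q = e(t). *)
Definition tame (c : nat -> C) :=
 forall r : R, 0 <= r < 1 -> summ (fun n => c n * (r ^+ n)%:C).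
Definition ps (c : nat -> C) (z : C) : C := usum (fun n => c n * z ^+ n).
Definition conv (c d : nat -> C) n := \sum_(i < n.+1) c i * d (n - i)%N.
Lemma summ_ps c z : tame c -> cn z < 1 -> summ (fun n => c n * z ^+ n).
move=> tc z1; apply: summ_le (tc (cn z) _) => [n|]; last by rewrite cn_ge0.
by rewrite !cnM cnX cn_real ger0_norm ?exprn_ge0 ?cn_ge0.
Qed.
Lemma geo_sum (r : R) n : 0 <= r < 1 -> \sum_(0 <= i < n) r ^+ i <= (1 - r)^-1.
move=> /andP[r0 r1]; rewrite -div1r ler_pdivlMr ?subr_gt0// big_mkord mulrC.
have := subrX1 r n => h; rewrite -opprB mulNr -h opprB lerBlDr lerDl exprn_ge0//.
Qed.
Lemma bsum_geo (r : R) : 0 <= r < 1 -> bsum (fun n => r ^+ n) (1 - r)^-1.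
move=> h; apply: bsum_nat => [i|n]; last exact: geo_sum.
by case/andP: h => *; rewrite exprn_ge0.
Qed.
Lemma midpoint_lt1 (r : R) : 0 <= r < 1 ->
 [/\ 0 < (r + 1) / 2, (r + 1) / 2 < 1, r < (r + 1) / 2 & 0 <= r / ((r + 1) / 2) < 1].
move=> /andP[r0 r1]; have h0 : 0 < (r + 1) / 2 by lra.
by split; rewrite ?ltr_pdivrMr// ?divr_ge0//=; lra.
Qed.

(** Bounded terms at the midpoint r' of r and 1 give at r a geometric majorant of ratio r/r'. *)
Lemma tameP c : tame c <-> (forall r : R, 0 <= r < 1 ->
 exists B, forall n, cn (c n) * r ^+ n <= B).
split=> [tc r hr|h r hr].
 have [B b] := tc r hr; exists B => n; have := b [:: n] isT.
 by case/andP: hr => r0 _; rewrite big_seq1 cnM cn_real ger0_norm ?exprn_ge0.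
have [] := midpoint_lt1 hr; set r' := (r + 1) / 2 => r'0 r'1 rr' q01.
have hr'' : 0 <= r' < 1 by rewrite ltW.
have [B hB] := h _ hr''.
exists (B * (1 - r / r')^-1) => s us.
have B0 : 0 <= B by apply: le_trans (hB 0%N); rewrite mulr_ge0 ?cn_ge0// exprn_ge0; lra.
apply: le_trans (ler_wpM2l B0 (bsum_geo q01 us)); rewrite mulr_sumr.
apply: ler_sum => n _; rewrite cnM cn_real ger0_norm; last by rewrite exprn_ge0; lra.
have -> : r ^+ n = r' ^+ n * (r / r') ^+ n.
 by rewrite -exprMn mulrCA mulfV ?mulr1//; lra.
by rewrite mulrA ler_wpM2r// exprn_ge0; lra.
Qed.

Lemma tame_le c d : (forall n, cn (c n) <= cn (d n)) -> tame d -> tame c.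
by move=> h td r hr; apply: summ_le (td r hr) => n; rewrite !cnM ler_wpM2r ?cn_ge0.
Qed.
Lemma tameD c d : tame c -> tame d -> tame (fun n => c n + d n).
move=> tc td r hr; apply: eq_summ (summD (tc r hr) (td r hr)) => n.
by rewrite mulrDl.
Qed.
Lemma tameZ a c : tame c -> tame (fun n => a * c n).
by move=> tc r hr; apply: eq_summ (summZ a (tc r hr)) => n; rewrite mulrA.
Qed.
Lemma conv_mul c d z n : conv c d n * z ^+ n =
 \sum_(i < n.+1) (c i * z ^+ i) * (d (n - i)%N * z ^+ (n - i)).
rewrite mulr_suml; apply: eq_bigr => -[i hi] _ /=.
by have -> : z ^+ n = z ^+ i * z ^+ (n - i) by [rewrite -exprD subnKC]; ring.
Qed.
Lemma tame_conv c d : tame c -> tame d -> tame (conv c d).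
move=> tc td r hr.
have := (usum_cauchy (tc r hr) (td r hr)).1; apply: eq_summ => n.
rewrite rmorphXn conv_mul; apply: eq_bigr => i _; by rewrite !rmorphXn.
Qed.
Lemma ps_conv c d z : tame c -> tame d -> cn z < 1 ->
 ps (conv c d) z = ps c z * ps d z.
move=> tc td z1; rewrite -(usum_cauchy (summ_ps tc z1) (summ_ps td z1)).2.
by apply: eq_usum => n; rewrite conv_mul.
Qed.
Lemma psD c d z : tame c -> tame d -> cn z < 1 ->
 ps (fun n => c n + d n) z = ps c z + ps d z.
move=> tc td z1; rewrite -usumD; [|exact: summ_ps..].
by apply: eq_usum => n; rewrite mulrDl.
Qed.
Lemma psZ a c z : tame c -> cn z < 1 -> ps (fun n => a * c n) z = a * ps c z.
move=> tc z1; rewrite -usumZ; last exact: summ_ps.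
by apply: eq_usum => n; rewrite mulrA.
Qed.
Definition delta0 (n : nat) : C := (n == 0)%:R.
Lemma tame_delta0 : tame delta0.
move=> r _; apply: (@summ_fin _ _ _ [:: 0%N]) => // -[|n]//= _.
by rewrite /delta0 mul0r.
Qed.
Lemma ps_delta0 z : ps delta0 z = 1.
rewrite /ps (@usum_fin _ _ _ [:: 0%N])//; first by rewrite big_seq1 /delta0 mul1r.
by move=> [|n]//= _; rewrite /delta0 mul0r.
Qed.

Lemma natX_bound (x : R) n : 0 <= x < 1 -> n%:R * x ^+ n <= (1 - x)^-1.
move=> hx; apply: le_trans (geo_sum n hx); case/andP: hx => x0 x1.
rewrite big_mkord -[n in n%:R]card_ord -sumr_const mulr_suml.
under eq_bigl do rewrite inE; apply: ler_sum => -[i hi] _ /=; rewrite mul1r.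
by apply: ler_wiXn2l => //; [exact: ltW | exact: ltnW].
Qed.

Lemma tame_nat c : tame c -> tame (fun n => n%:R * c n).
move=> tc; apply/tameP => r hr.
have [] := midpoint_lt1 hr; set r' := (r + 1) / 2 => r'0 r'1 rr' q01.
have hr'' : 0 <= r' < 1 by rewrite ltW.
have [B hB] := (tameP c).1 tc _ hr''.
exists (B * (1 - r / r')^-1) => n.
have -> : r ^+ n = r' ^+ n * (r / r') ^+ n.
 by rewrite -exprMn mulrCA mulfV ?mulr1//; lra.
rewrite cnM cn_nat.
have -> : n%:R * cn (c n) * (r' ^+ n * (r / r') ^+ n) =
 (cn (c n) * r' ^+ n) * (n%:R * (r / r') ^+ n) by ring.
apply: ler_pM => //; first by rewrite mulr_ge0 ?cn_ge0// exprn_ge0; lra.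
 by rewrite mulr_ge0// exprn_ge0; lra.
exact: natX_bound.
Qed.

Lemma tame_natX k : tame (fun n => n%:R ^+ k).
elim: k => [|k IH].
 apply/tameP => r /andP[r0 r1]; exists 1 => n.
 by rewrite expr0 cn1 mul1r exprn_ile1// ltW.
apply: tame_le (tame_nat IH) => n; by rewrite exprS.
Qed.

Lemma ps_bound c (r : R) : tame c -> 0 <= r < 1 ->
 exists2 B, 0 <= B & forall z, cn z <= r -> cn (ps c z) <= B.
move=> tc hr; have [B b] := tc r hr; exists B; first exact: bsum_ge0 b.
move=> z zr; apply: usum_le; first by apply: summ_ps => //; case/andP: hr; lra.
apply: bsumW b => n; rewrite !cnM cnX cn_real ger0_norm; last first.
 by rewrite exprn_ge0; case/andP: hr.
by rewrite ler_wpM2l ?cn_ge0// lerXn2r// nnegrE ?cn_ge0//; case/andP: hr.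
Qed.

Lemma ps_shift c : tame c -> c 0%N = 0 ->
 tame (fun n => c n.+1) /\
 (forall z, cn z < 1 -> ps c z = z * ps (fun n => c n.+1) z).
move=> tc c0; have ts : tame (fun n => c n.+1).
 apply/tameP => r hr.
 have [] := midpoint_lt1 hr; set r' := (r + 1) / 2 => r'0 r'1 rr' q01.
 have hr'' : 0 <= r' < 1 by rewrite ltW.
 have [B hB] := (tameP c).1 tc _ hr''; exists (B / r') => n.
 rewrite ler_pdivlMr; last by lra.
 apply: le_trans (hB n.+1); rewrite -mulrA ler_wpM2l ?cn_ge0//.
 rewrite exprSr ler_wpM2r//; first exact: ltW.
 by rewrite lerXn2r ?nnegrE; case/andP: hr; lra.
split=> // z z1; rewrite -usumZ; last exact: summ_ps.
rewrite {1}/ps (@usum_inj _ _ _ S).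
- by apply: eq_usum => n; rewrite exprS; ring.
- by move=> m n [].
- by move=> [|n] h; [rewrite c0 mul0r | exfalso; apply: h; exists n].
- exact: summ_ps.
Qed.

Lemma sum_roots (M : nat) (k : int) : (0 < M)%N ->
 (forall x : int, k != x * M) ->
 \sum_(j < M) e (j%:R * (k%:~R / M%:R)) = 0.
move=> M0 hk; pose w := e (k%:~R / M%:R).
under eq_bigr do rewrite -eX -/w.
have M0' : M%:R != 0 :> C by rewrite pnatr_eq0 -lt0n.
have wM : w ^+ M = 1 by rewrite eX mulrCA mulfV// mulr1 e_int.
have w1 : w != 1.
 apply/eqP => w1; have M0i : (M%:Z != 0) by lia.
 pose q := (k %/ M)%Z; pose r := (k %% M)%Z.
 have kE : k = q * M + r := divz_eq k M.
 have r0 : 0 <= r by rewrite modz_ge0.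
 have rM : r < M by rewrite ltz_pmod.
 have rn0 : r != 0 by apply/eqP => r0'; move: (hk q); rewrite {1}kE r0' addr0 eqxx.
 have : w = e (r%:~R / M%:R).
 rewrite /w kE rmorphD rmorphM /= -pmulrn mulrDl mulfK// eD e_int mul1r//.
 rewrite w1 => /esym.
 have -> : r%:~R / M%:R = (r%:~R / M%:R : R)%:C by rewrite rmorphM fmorphV rmorph_nat rmorph_int.
 apply/eqP; apply: e_neq1; have M0R : 0 < M%:R :> R by rewrite ltr0n.
 rewrite divr_gt0//=; last by rewrite ltr0z; lia.
 by rewrite ltr_pdivrMr// mul1r (_ : M%:R = M%:Z%:~R)// ltr_int.
have := subrX1 w M; rewrite wM subrr => /esym/eqP.
by rewrite mulf_eq0 subr_eq0 (negbTE w1) /= => /eqP.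
Qed.

(* Averaging over the [M]-th roots of unity isolates the coefficients of index
 congruent to [m] modulo [M]; then let [M] tend to infinity. *)
Lemma ps_cauchy c (r B : R) : tame c -> 0 < r < 1 ->
 (forall x : R, cn (ps c (r%:C * e x%:C)) <= B) -> forall m, cn (c m) * r ^+ m <= B.
move=> tc /andP[r0 r1] hB m; have hr : 0 <= r < 1 by rewrite ltW.
have [Bt bt] := tc r hr.
pose d M n : C := M.+1%:R^-1 * \sum_(j < M.+1) e (j%:R * ((n%:Z - m%:Z)%:~R / M.+1%:R)).
have dE M n : (forall x : int, n%:Z - m%:Z != x * M.+1) -> d M n = 0.
 by move=> h; rewrite /d sum_roots// mulr0.
have dm M : d M m = 1.
 rewrite /d subrr; under eq_bigr do rewrite mul0r mulr0 e0.
 by rewrite sumr_const card_ord mulVf// pnatr_eq0.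
have d1 M n : cn (d M n) <= 1.
 rewrite /d cnM cnV cn_nat ler_pdivrMl ?ltr0n// mulr1.
 apply: le_trans (cn_sum _ _) _.
 rewrite -[X in _ <= X%:R]card_ord -sumr_const; apply: ler_sum => j _.
 rewrite cn_e; have -> : complex.Im (j%:R * ((n%:Z - m%:Z)%:~R / M.+1%:R) : C) = 0.
 have -> : j%:R * ((n%:Z - m%:Z)%:~R / M.+1%:R) = (j%:R * ((n%:Z - m%:Z)%:~R / M.+1%:R))%:C :> C.
 by rewrite !rmorphM /= rmorph_nat rmorph_int fmorphV rmorph_nat.
 by [].
 by rewrite mulr0 oppr0 expR0.
pose F M n : C := (c n * (r ^+ n)%:C) * d M n.
pose G n : C := if n == m then c m * (r ^+ m)%:C else 0.
have FG : clim (fun M => usum (F M)) (usum G).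
 apply: (clim_usum (b := fun n => cn (c n * (r ^+ n)%:C))) bt _ => [M n|n].
 by rewrite /F cnM ler_piMr ?cn_ge0.
 move=> eps e0; exists (n + m)%N => M hM; rewrite /F /G; case: eqP => [->|nm].
 by rewrite dm mulr1 subrr cn0.
 rewrite dE ?mulr0 ?subrr ?cn0// => x; apply/eqP => h.
 by case: (ltgtP x 0) => hx; nia.
have GE : usum G = c m * (r ^+ m)%:C.
 rewrite (@usum_fin _ _ _ [:: m])//; first by rewrite big_seq1 /G eqxx.
 by move=> n; rewrite inE /G => /negbTE ->.
have FB M : cn (usum (F M)) <= B.
 have -> : usum (F M) = M.+1%:R^-1 * \sum_(j < M.+1)
 e (- (j%:R * (m%:R / M.+1%:R))) * ps c (r%:C * e (j%:R / M.+1%:R)%:C).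
 have sj (j : 'I_M.+1) : summ (fun n => c n * (r%:C * e (j%:R / M.+1%:R)%:C) ^+ n).
 apply: summ_ps => //; rewrite cnM cn_real ger0_norm ?ltW// cn_e /=.
 by rewrite mulr0 oppr0 expR0 mulr1.
 rewrite (eq_bigr (fun j : 'I_M.+1 => usum (fun n => e (- (j%:R * (m%:R / M.+1%:R))) *
 (c n * (r%:C * e (j%:R / M.+1%:R)%:C) ^+ n)))); last by move=> j _; rewrite usumZ.
 rewrite -usum_sum; last by move=> j; exact: summZ.
 rewrite -usumZ; last by apply: summ_sum => j; exact: summZ.
 apply: eq_usum => n; rewrite /F /d mulrCA; congr (_ * _); rewrite mulr_sumr.
 apply: eq_bigr => j _; rewrite exprMn eX rmorphXn.
 have -> : e (j%:R * ((n%:Z - m%:Z)%:~R / M.+1%:R)) =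
 e (n%:R * (j%:R / M.+1%:R)%:C) * e (- (j%:R * (m%:R / M.+1%:R))).
 rewrite -eD; congr e.
 rewrite rmorphM fmorphV !rmorph_nat rmorphB /= -!pmulrn.
 by field; rewrite addrC natr1 pnatr_eq0.
 by move: (e _) (e _) => u v; ring.
 rewrite cnM cnV cn_nat ler_pdivrMl ?ltr0n//.
 apply: le_trans (cn_sum _ _) _.
 rewrite -[X in _ <= X%:R * _]card_ord -sumr_const mulr_suml; apply: ler_sum => j _.
 rewrite mul1r cnM; apply: le_trans (hB (j%:R / M.+1%:R)).
 rewrite ler_piMl ?cn_ge0// cn_e.
 have -> : complex.Im (- (j%:R * (m%:R / M.+1%:R)) : C) = 0.
 have -> : - (j%:R * (m%:R / M.+1%:R)) = (- (j%:R * (m%:R / M.+1%:R)))%:C :> C.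
 by rewrite rmorphN !rmorphM /= fmorphV !rmorph_nat.
 by [].
 by rewrite mulr0 oppr0 expR0.
have -> : cn (c m) * r ^+ m = cn (usum G) by rewrite GE cnM cn_real ger0_norm// exprn_ge0// ltW.
apply/ler_addgt0Pr => eps e0; have [N hN] := FG _ e0.
have -> : usum G = usum (F N) - (usum (F N) - usum G) by ring.
by rewrite (le_trans (cnB _ _))// lerD// ltW// hN.
Qed.

Lemma ps_continuous0 c : tame c -> forall eps : R, 0 < eps -> exists2 d : R, 0 < d &
 forall z, cn z < d -> cn (ps c z - c 0%N) <= eps.
move=> tc eps e0.
pose c' n : C := if n == 0%N then 0 else c n.
have tc' : tame c' by apply: tame_le tc => n; rewrite /c'; case: eqP; rewrite ?cn0 ?cn_ge0.
have [ts hs] := ps_shift tc' erefl.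
have h2 : 0 <= (1 / 2 : R) < 1 by lra.
have [B B0 hB] := ps_bound ts h2.
exists (Num.min (1/2) (eps / (B + 1))) => [|z].
 by rewrite lt_min divr_gt0//= ?divr_gt0//; lra.
rewrite lt_min => /andP[z1 z2].
have -> : ps c z - c 0%N = ps c' z.
 have -> : c = (fun n => c' n + c 0%N * delta0 n).
 apply/funext => -[|n]; rewrite /c' /delta0 /= ?mulr1 ?add0r//.
 by rewrite mulr0 addr0.
 rewrite psD//; [|exact/tameZ/tame_delta0|lra].
 rewrite psZ ?ps_delta0//; [|exact: tame_delta0|lra].
 by rewrite /c' /delta0 /= add0r !mulr1 addrK.
rewrite hs; last by lra.
rewrite cnM; move: z2; rewrite ltr_pdivlMr; last by lra.
move=> z2; apply: le_trans (_ : cn z * B <= _); last by have := cn_ge0 z; nra.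
by rewrite ler_wpM2l ?cn_ge0// hB// ltW.
Qed.

(* The solution of the formal differential equation [q P' = s P], [P 0 = 1]. *)
Fixpoint odeseq (s : nat -> C) n : seq C :=
 if n is m.+1 then let l := odeseq s m in
 (m.+1%:R^-1 * \sum_(i < m.+1) s i.+1 * nth 0 l i) :: l
 else [:: 1].

Definition ode s n := head 0 (odeseq s n).
Lemma ode0 s : ode s 0 = 1. Proof. by []. Qed.
Lemma nth_odeseq s n i : (i <= n)%N -> nth 0 (odeseq s n) i = ode s (n - i).
elim: n i => [|n IH] [|i]//= h; rewrite ?subn0//.
by rewrite IH// subSS.
Qed.
Lemma odeS s n : n.+1%:R * ode s n.+1 = \sum_(i < n.+1) s i.+1 * ode s (n - i).
rewrite /ode /= mulrA mulfV ?mul1r ?pnatr_eq0//; apply: eq_bigr => -[i hi] _ /=.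
by rewrite nth_odeseq.
Qed.
Lemma ode_conv s n : s 0%N = 0 -> n%:R * ode s n = conv s (ode s) n.
move=> s0; rewrite /conv big_ord_recl s0 mul0r add0r; case: n => [|n].
 by rewrite big_ord0 mul0r.
by rewrite odeS; apply: eq_bigr => i _; rewrite lift0 subSS.
Qed.

(** Let B bound the sum of |s_i| r^i. In the recurrence n P_n = sum s_i P_(n-i) the bound on |P_n|
    r^n may grow by the factor A = B + 1 up to n = N + 1 > B; beyond that B/n < 1 and it stays. *)
Lemma tame_ode s : tame s -> tame (ode s).
move=> ts; apply/tameP => r hr; have [B b] := ts r hr.
case/andP: hr => r0 r1; have B0 := bsum_ge0 b.
pose A := B + 1; have A1 : 1 <= A by rewrite /A; lra.
pose N := Num.truncn B; exists (A ^+ N.+1).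
have NB : B < N.+1%:R by rewrite truncnS_gt.
suff H n : cn (ode s n) * r ^+ n <= A ^+ minn n N.+1.
 by move=> n; apply: le_trans (H n) _; rewrite ler_weXn2l// geq_minr.
elim/ltn_ind: n => -[|n] IH; first by rewrite ode0 cn1 expr0 mulr1 min0n expr0.
have n0 : 0 < n.+1%:R :> R by rewrite ltr0n.
have key : n.+1%:R * (cn (ode s n.+1) * r ^+ n.+1) <= B * A ^+ minn n N.+1.
 rewrite mulrA -[n.+1%:R]cn_nat -cnM odeS.
 apply: le_trans (_ : \sum_(i < n.+1) (cn (s i.+1) * r ^+ i.+1) * A ^+ minn n N.+1 <= _).
 apply: le_trans (ler_wpM2r _ (cn_sum _ _)) _; first by rewrite exprn_ge0.
 rewrite mulr_suml; apply: ler_sum => -[i hi] _ /=; rewrite cnM.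
 have -> : r ^+ n.+1 = r ^+ i.+1 * r ^+ (n - i) by rewrite -exprD; congr (_ ^+ _); lia.
 rewrite mulrACA ler_wpM2l ?mulr_ge0 ?cn_ge0 ?exprn_ge0//.
 apply: le_trans (IH _ _) _; first by lia.
 by rewrite ler_weXn2l//; lia.
 rewrite -mulr_suml ler_wpM2r ?exprn_ge0//; first by lra.
 have := b [seq i.+1 | i <- iota 0 n.+1] _.
 rewrite map_inj_uniq ?iota_uniq => [/(_ isT)|i j []//].
 rewrite big_map -{1}[n.+1]subn0 -/(index_iota 0 n.+1) big_mkord.
 apply: le_trans; apply: ler_sum => i _.
 by rewrite cnM cn_real ger0_norm ?exprn_ge0.
rewrite -(ler_pM2l n0); apply: le_trans key _.
have [nN|nN] := leqP n.+1 N.+1.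
 have -> : minn n N.+1 = n by lia.
 rewrite exprS mulrCA [leRHS]mulrA ler_wpM2r ?exprn_ge0//; first by lra.
 apply: le_trans (_ : A <= _); first by rewrite /A; lra.
 by rewrite ler_peMr ?ler1n//; lra.
have -> : minn n N.+1 = N.+1 by lia.
rewrite ler_wpM2r ?exprn_ge0//; first by lra.
by apply: ltW; apply: lt_le_trans NB _; rewrite ler_nat; lia.
Qed.

End PowerSeries.

(** * Fourier expansions and complex derivatives on the upper half-plane *)

Section Fourier.
Variable R : realType.
Local Notation C := R[i].
Local Notation e := (@cexp2pi R).
Local Notation H := (uhp R).
Local Notation Im := (@complex.Im R).
Local Notation Re := (@complex.Re R).

(** The zeroth coefficient may vanish, so [lam] is only a lower bound for the exponents and can be
    lowered by integers ([QE_unshift]). *)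
Definition QEc (lam : R) (c : nat -> C) (f : H -> C) :=
 tame c /\ forall t : H, f t = e (lam%:C * t°) * ps c (e t).
Definition QE lam f := exists c, QEc lam c f.
Lemma cn_e_uhp (t : H) : cn (e t) < 1.
by rewrite cn_e expR_lt1 oppr_lt0 !mulr_gt0 ?pi_gt0 ?uhp_gt0.
Qed.
Lemma cn_e_lam (lam : R) (z : C) : cn (e (lam%:C * z)) = expR (- (2 * pi * lam * Im z)).
by rewrite cn_e; congr expR; case: z => x y /=; rewrite mul0r addr0 mulrA. Qed.

Lemma uhp_pt (r x : R) : 0 < r < 1 -> exists t : H, e t = r%:C * e x%:C /\
 Im t = - ln r / (2 * pi).
move=> hr; have p0 : 0 < 2 * pi :> R by rewrite mulr_gt0 ?pi_gt0.
have y0 : 0 < Im (x +i* (- ln r / (2 * pi))) by rewrite /= divr_gt0// oppr_gt0 ln_lt0.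
exists (Uhp y0); split=> //=; rewrite /cexp2pi /= mulr0 oppr0 expR0 mul1r.
by rewrite mulrCA mulfV ?gt_eqF// mulr1 opprK lnK ?posrE//; case/andP: hr.
Qed.

Lemma uhp_Im_pt (y : R) : 0 < y -> exists t : H, Im t = y /\ Re t = 0.
by move=> y0; exists (@Uhp R (0 +i* y) y0). Qed.
Lemma QEcZ lam c f a : QEc lam c f -> QEc lam (fun n => a * c n) (fun t => a * f t).
move=> [tc fE]; split; first exact: tameZ.
by move=> t; rewrite fE psZ ?cn_e_uhp// mulrCA.
Qed.
Lemma QEcD lam c d f g : QEc lam c f -> QEc lam d g ->
 QEc lam (fun n => c n + d n) (fun t => f t + g t).
move=> [tc fE] [td gE]; split; first exact: tameD.
by move=> t; rewrite fE gE psD ?cn_e_uhp// mulrDr.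
Qed.
Lemma QEcB lam c d f g : QEc lam c f -> QEc lam d g ->
 QEc lam (fun n => c n - d n) (fun t => f t - g t).
move=> hf /(QEcZ (-1)) hg; have := QEcD hf hg.
by congr QEc; apply/funext => n; rewrite mulN1r.
Qed.
Lemma QEcM lam mu c d f g : QEc lam c f -> QEc mu d g ->
 QEc (lam + mu) (conv c d) (fun t => f t * g t).
move=> [tc fE] [td gE]; split; first exact: tame_conv.
move=> t; rewrite fE gE ps_conv ?cn_e_uhp// rmorphD /= mulrDl eD; ring.
Qed.
Lemma QEZ lam f a : QE lam f -> QE lam (fun t => a * f t).
by move=> [c /(QEcZ a) h]; exists (fun n => a * c n). Qed.
Lemma QED lam f g : QE lam f -> QE lam g -> QE lam (fun t => f t + g t).
by move=> [c hf] [d hg]; exists (fun n => c n + d n); exact: QEcD. Qed.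
Lemma QEB lam f g : QE lam f -> QE lam g -> QE lam (fun t => f t - g t).
by move=> [c hf] [d hg]; exists (fun n => c n - d n); exact: QEcB. Qed.
Lemma QEM lam mu f g : QE lam f -> QE mu g -> QE (lam + mu) (fun t => f t * g t).
by move=> [c hf] [d hg]; exists (conv c d); exact: QEcM. Qed.
Lemma QEc1 : QEc 0 (@delta0 R) (fun=> 1).
split; first exact: tame_delta0.
by move=> t; rewrite ps_delta0 mul0r e0 mulr1.
Qed.
Lemma QEccst a : QEc 0 (fun n => a * @delta0 R n) (fun=> a).
by have := QEcZ a QEc1; congr QEc; apply/funext => t; rewrite mulr1. Qed.
Lemma QEcst a : QE 0 (fun=> a).
by eexists; exact: QEccst. Qed.
Lemma QE0 lam : QE lam (fun=> 0).
exists (fun=> 0); split; first by move=> r _; apply: eq_summ (summ0 _ _) => n; rewrite mul0r.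
move=> t; rewrite /ps (eq_usum (G := fun _ => 0)) ?usum0 ?mulr0// => n; by rewrite mul0r.
Qed.

Lemma QE_sum lam (I : Type) (s : seq I) (P : pred I) (f : I -> H -> C) :
 (forall i, P i -> QE lam (f i)) -> QE lam (fun t => \sum_(i <- s | P i) f i t).
move=> h; elim: s => [|i s IH].
 have := QE0 lam; congr QE; apply/funext => t; by rewrite big_nil.
case: (boolP (P i)) => Pi.
 have := QED (h i Pi) IH; congr QE; apply/funext => t; by rewrite big_cons Pi.
move: IH; congr QE; apply/funext => t; by rewrite big_cons (negbTE Pi).
Qed.

(** On the line Im t = y the variable q runs over a circle, to which [ps_cauchy] applies. *)
Lemma QEc_coef_bound lam c f (y B : R) : 0 < y -> QEc lam c f ->
 (forall t : H, Im t = y -> cn (f t) <= B) ->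
 forall m, cn (c m) * expR (- (2 * pi * y)) ^+ m <= B * expR (2 * pi * lam * y).
move=> y0 [tc fE] hB; have p0 : 0 < 2 * pi :> R by rewrite mulr_gt0 ?pi_gt0.
have hr : 0 < expR (- (2 * pi * y)) < 1 by rewrite expR_gt0 expR_lt1 oppr_lt0 mulr_gt0.
apply: ps_cauchy => // x; have [t [et It]] := uhp_pt x hr.
have {}It : Im t = y by rewrite It expRK opprK mulrAC mulfV ?mul1r ?gt_eqF.
have := hB t It; rewrite fE et cnM cn_e_lam It expRN.
by rewrite mulrC ler_pdivrMr ?expR_gt0.
Qed.

Lemma QEc_eq0 lam c : QEc lam c (fun=> 0) -> forall m, c m = 0.
move=> h m; have := @QEc_coef_bound _ _ _ 1 0 ltr01 h _ m.
rewrite mul0r => /(_ _) h'; apply/eqP; rewrite -cn_eq0 eq_le cn_ge0 andbT.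
have := h' ltac:(by move=> t _; rewrite cn0).
by rewrite pmulr_lle0// exprn_gt0// expR_gt0.
Qed.

Lemma QEc_inj lam c d f : QEc lam c f -> QEc lam d f -> c = d.
move=> hc hd; have h := QEcB hc hd; apply/funext => m; apply/eqP; rewrite -subr_eq0.
apply/eqP; apply: (@QEc_eq0 lam (fun n => c n - d n)); move: h; congr QEc.
by apply/funext => t; rewrite subrr.
Qed.
Lemma QEc_shift lam c f : QEc lam c f -> c 0%N = 0 -> QEc (lam + 1) (fun n => c n.+1) f.
move=> [tc fE] c0; have [ts hs] := ps_shift tc c0; split=> // t.
by rewrite fE hs ?cn_e_uhp// mulrA -eD rmorphD /= mulrDl mul1r.
Qed.
Definition unshift (c : nat -> C) n := if n is m.+1 then c m else 0.

Lemma QEc_unshift lam c f : QEc (lam + 1) c f -> QEc lam (unshift c) f.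
move=> [tc fE]; have tu : tame (unshift c).
 apply/tameP => r hr; have [B hB] := (tameP c).1 tc r hr.
 have B0 : 0 <= B by apply: le_trans (hB 0%N); case/andP: hr => *; rewrite mulr_ge0 ?cn_ge0 ?exprn_ge0.
 exists B => -[|n] /=; first by rewrite cn0 mul0r.
 apply: le_trans (hB n); rewrite ler_wpM2l ?cn_ge0//.
 by case/andP: hr => *; rewrite exprS ler_piMl ?exprn_ge0// ltW.
have [_ hs] := ps_shift tu erefl; split=> // t.
by rewrite fE hs ?cn_e_uhp// mulrA -eD rmorphD /= mulrDl mul1r.
Qed.

Lemma QE_unshift lam (k : nat) f : QE (lam + k%:R) f -> QE lam f.
elim: k => [|k IH]; first by rewrite addr0.
by rewrite -natr1 addrA => -[c /QEc_unshift h]; apply: IH; exists (unshift c).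
Qed.

Lemma ps_first_coef (c : nat -> C) : c <> (fun=> 0) ->
 exists i, c i != 0 /\ forall j, (j < i)%N -> c j = 0.
move=> cn0; have ex : exists i, c i != 0.
 apply: contrapT => h; apply: cn0; apply/funext => i; apply: contrapT => hi.
 by apply: h; exists i; apply/eqP.
exists (ex_minn ex); case: ex_minnP => i ci hi; split=> // j ji.
by apply/eqP; apply: contraTT ji => /hi; rewrite -leqNgt.
Qed.

(** The first nonzero coefficients of the factors multiply to a nonzero coefficient of the
    product. *)
Lemma QEM_eq0 lam mu f g : QE lam f -> QE mu g -> (forall t, f t * g t = 0) ->
 (forall t, f t = 0) \/ (forall t, g t = 0).
move=> [c hf] [d hg] fg0.
have ps0 t : ps (fun _ : nat => 0 : C) t = 0.
 by rewrite /ps (eq_usum (G := fun _ => 0)) ?usum0// => n; rewrite mul0r.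
case: (pselect (c = fun _ => 0)) => [c0|/ps_first_coef [i [ci hi]]].
 by left=> t; rewrite hf.2 c0 ps0 mulr0.
case: (pselect (d = fun _ => 0)) => [d0|/ps_first_coef [j [dj hj]]].
 by right=> t; rewrite hg.2 d0 ps0 mulr0.
have := QEcM hf hg; have -> : (fun t => f t * g t) = (fun=> 0) by apply/funext.
move=> /QEc_eq0 /(_ (i + j)%N); rewrite /conv.
have ij : (i < (i + j).+1)%N by lia.
rewrite (bigD1 (Ordinal ij)) //= big1 ?addr0 => [|[k hk] /= ki].
 by rewrite addKn => /eqP; rewrite mulf_eq0 (negbTE ci) (negbTE dj).
have {}ki : k != i by apply: contra ki => /eqP ki; apply/eqP; exact: val_inj.
case: (ltnP k i) => h; first by rewrite hi ?mul0r.
by rewrite hj ?mulr0//; lia.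
Qed.

Lemma QEc_bounded lam c f (y0 : R) : 0 < y0 -> 0 <= lam -> QEc lam c f ->
 exists2 B, 0 <= B & forall t : H, y0 <= Im t -> cn (f t) <= B.
move=> y00 l0 [tc fE]; have p0 : 0 < 2 * pi :> R by rewrite mulr_gt0 ?pi_gt0.
have hr : 0 <= expR (- (2 * pi * y0)) < 1 by rewrite expR_ge0 expR_lt1 oppr_lt0 mulr_gt0.
have [B B0 hB] := ps_bound tc hr; exists B => // t ht.
rewrite fE cnM cn_e_lam -[leRHS]mul1r ler_pM ?cn_ge0 ?expR_ge0//.
 by rewrite expR_le1 oppr_le0 mulr_ge0 ?mulr_ge0 ?(ltW (uhp_gt0 t)) ?pi_ge0.
by apply: hB; rewrite cn_e ler_expR lerN2 ler_wpM2l// ltW.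
Qed.

(** If mu' < lam', then high up in the half-plane the factor e((lam' - mu') t) pushes the second
    series below a quarter of its constant coefficient, while continuity at q = 0 keeps it above a
    half. *)
Lemma QEc_lead lam mu c d f : QEc lam c f -> QEc mu d f -> c 0%N != 0 -> d 0%N != 0 ->
 lam = mu.
suff H0 lam' mu' c' d' : QEc lam' c' f -> QEc mu' d' f -> d' 0%N != 0 -> ~ (mu' < lam').
 move=> hc hd c0 d0; case: (ltgtP lam mu) => // h.
 by case: (H0 _ _ _ _ hd hc c0 h).
 by case: (H0 _ _ _ _ hc hd d0 h).
move=> [tc fE] [td gE] d0 lt; have p0 : 0 < 2 * pi :> R by rewrite mulr_gt0 ?pi_gt0.
have D0 : 0 < cn (d' 0%N) / 4 by rewrite divr_gt0// cn_gt0.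
have [del del0 hdel] := ps_continuous0 td D0.
have hr : 0 <= (1 / 2 : R) < 1 by lra.
have [B B0 hB] := ps_bound tc hr.
pose q := Num.min (1/2) (Num.min (del / 2) 1).
(* The height [y1] brings q into the disc of [hdel], and [y2] makes the exponential factor small
   against the bound [B]. *)
pose y1 := (del^-1 + 2) / (2 * pi).
pose y2 := ((B + 1) * 4 / cn (d' 0%N)) / ((lam' - mu') * (2 * pi)).
have y10 : 0 < y1 by rewrite divr_gt0// addr_gt0// invr_gt0.
have l0 : 0 < lam' - mu' by lra.
have y20 : 0 < y2.
 by rewrite !divr_gt0 ?mulr_gt0// ?cn_gt0//; lra.
have [t [It _]] := uhp_Im_pt (addr_gt0 y10 y20).
have eN1 (x : R) : 0 < x -> expR (- x) < x^-1.
 move=> x0; rewrite expRN ltf_pV2 ?posrE ?expR_gt0//.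
 by apply: lt_le_trans (expR_ge1Dx x); lra.
have qt : cn (e t) < Num.min del (1/2).
 rewrite cn_e It; apply: lt_le_trans (eN1 _ _) _; first by rewrite mulr_gt0 ?addr_gt0.
 have key : del^-1 + 2 <= 2 * pi * (y1 + y2).
 rewrite mulrDr /y1 mulrCA mulfV ?gt_eqF// mulr1 lerDl mulr_ge0// ltW//.
 have di : 0 < del^-1 by rewrite invr_gt0.
 rewrite le_min; apply/andP; split.
 rewrite -[leRHS]invrK lef_pV2 ?posrE//; last lra.
 by apply: le_trans key; lra.
 rewrite -[leRHS]invrK lef_pV2 ?posrE ?invr_gt0//; [|lra|lra].
 by rewrite invf_div divr1; lra.
move: qt; rewrite lt_min => /andP[/hdel h1 h2].
have h3 : cn (ps d' (e t)) >= cn (d' 0%N) / 2.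
 have : cn (d' 0%N) <= cn (ps d' (e t)) + cn (d' 0%N) / 4.
 have {1}-> : d' 0%N = ps d' (e t) - (ps d' (e t) - d' 0%N) by ring.
 by rewrite (le_trans (cnB _ _))// lerD2l.
 by lra.
have h4 : ps d' (e t) = e ((lam' - mu')%:C * t°) * ps c' (e t).
 have := gE t; rewrite fE rmorphB /= mulrBl eB => h.
 by rewrite mulrAC h mulrAC mulfV ?e_neq0 ?mul1r.
have : cn (ps d' (e t)) <= cn (d' 0%N) / 4.
 rewrite h4 cnM cn_e_lam It.
 have h5 : expR (- (2 * pi * (lam' - mu') * (y1 + y2))) <= cn (d' 0%N) / 4 / (B + 1).
 apply: ltW; apply: lt_le_trans (eN1 _ _) _; first by rewrite mulr_gt0 ?addr_gt0// mulr_gt0.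
 have y12 : 0 < 2 * pi * (lam' - mu') * (y1 + y2) by rewrite mulr_gt0 ?addr_gt0// mulr_gt0.
 have B1 : 0 < B + 1 by lra.
 rewrite -[leRHS]invrK lef_pV2 ?posrE// ?invr_gt0 ?divr_gt0// ?cn_gt0//.
 rewrite !invf_div mulrDr -[leLHS]add0r lerD//.
 by rewrite mulr_ge0 ?(ltW y10)// mulr_ge0 ?ltW.
 rewrite /y2 mulrA [2 * pi * _]mulrC mulrCA mulfV ?mulr1 ?gt_eqF ?mulr_gt0 ?pi_gt0// mulrA.
 apply: le_trans (_ : cn (d' 0%N) / 4 / (B + 1) * B <= _).
 by rewrite ler_pM ?expR_ge0 ?cn_ge0// hB// ltW.
 rewrite mulrAC ler_pdivrMr; last by lra.
 by rewrite ler_wpM2l//; lra.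
by have : 0 < cn (d' 0%N) by [rewrite cn_gt0]; lra.
Qed.

(** Coefficients are summed over [I]. [QEc_coef_bound] on one horizontal line converts the majorant
    of the functions into one for c i n * r^n, which permits exchanging the sums over i and n. *)
Lemma QE_usum (I : choiceType) lam (f : I -> H -> C) : (forall i, QE lam (f i)) ->
 (forall y : R, 0 < y -> exists (b : I -> R) Bt, bsum b Bt /\
 forall i (t : H), y <= Im t -> cn (f i t) <= b i) ->
 QE lam (fun t => usum (fun i => f i t)).
move=> /choice [c hc] hb; have p0 : 0 < 2 * pi :> R by rewrite mulr_gt0 ?pi_gt0.
have cb (r : R) : 0 < r < 1 -> exists (b : I -> R) Bt, [/\ forall i, 0 <= b i,
 bsum b Bt & forall i n, cn (c i n) * r ^+ n <= b i].
 move=> hr; pose y := - ln r / (2 * pi).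
 have y0 : 0 < y by rewrite divr_gt0// oppr_gt0 ln_lt0.
 have [b [Bt [hB h]]] := hb y y0; pose K := expR (2 * pi * lam * y).
 have cbd i n : cn (c i n) * r ^+ n <= b i * K.
 have hi (t : H) : Im t = y -> cn (f i t) <= b i by move=> ht; apply: h; rewrite ht.
 have := QEc_coef_bound y0 (hc i) hi n.
 have -> : expR (- (2 * pi * y)) = r.
 by rewrite /y mulrCA mulfV ?gt_eqF// mulr1 opprK lnK ?posrE//; case/andP: hr.
 by [].
 exists (fun i => b i * K), (Bt * K); split=> //.
 move=> i; apply: le_trans (cbd i 0%N); rewrite mulr_ge0 ?cn_ge0 ?exprn_ge0//.
 by case/andP: hr => /ltW.
 by move=> s us; rewrite -mulr_suml ler_wpM2r ?expR_ge0// hB.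
have sc n : summ (fun i => c i n).
 have h2 : 0 < (1 / 2 : R) < 1 by lra.
 have [b [Bt [b0 hB h]]] := cb _ h2; exists (Bt * 2 ^+ n) => s us.
 apply: le_trans (_ : \sum_(i <- s) b i * 2 ^+ n <= _); last first.
 by rewrite -mulr_suml ler_wpM2r ?exprn_ge0// hB.
 apply: ler_sum => i _; have := h i n; rewrite expr_div_n expr1n div1r.
 by rewrite ler_pdivrMr ?exprn_gt0.
exists (fun n => usum (fun i => c i n)); split.
 apply/tameP => r /andP[r0 r1].
 have [] := midpoint_lt1 (_ : 0 <= r < 1); first by rewrite r0.
 set r' := (r + 1) / 2 => r'0 r'1 rr' _.
 have [|b [Bt [b0 hB h]]] := cb r'; first by rewrite r'0.
 exists Bt => n; apply: le_trans (_ : cn (usum (fun i => c i n)) * r' ^+ n <= _).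
 by rewrite ler_wpM2l ?cn_ge0// lerXn2r ?nnegrE// ltW.
 have -> : cn (usum (fun i => c i n)) * r' ^+ n = cn (usum (fun i => (r' ^+ n)%:C * c i n)).
 by rewrite usumZ// cnM cn_real ger0_norm ?exprn_ge0 1?mulrC// ltW.
 apply: usum_le; first exact: summZ.
 have rn : 0 <= r' ^+ n by rewrite exprn_ge0// ltW.
 apply: bsumW hB => i; rewrite cnM cn_real ger0_norm// [_ * cn _]mulrC; exact: h.
move=> t.
have [] := midpoint_lt1 (_ : 0 <= cn (e t) < 1); first by rewrite cn_ge0 cn_e_uhp.
set r' := (_ + 1) / 2 => r'0 r'1 rr' q01.
have [|b [Bt [b0 hB h]]] := cb r'; first by rewrite r'0.
pose G (p : I * nat) : C := c p.1 p.2 * e t ^+ p.2.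
have sG : summ G.
 exists (Bt * (1 - cn (e t) / r')^-1).
 apply: bsumW (bsum_prod b0 _ hB (bsum_geo q01)) => [[i n]|n].
 rewrite /G /= cnM cnX.
 have -> : cn (e t) ^+ n = r' ^+ n * (cn (e t) / r') ^+ n by rewrite -exprMn mulrCA mulfV ?mulr1 ?gt_eqF.
 by rewrite mulrA ler_wpM2r// exprn_ge0//; case/andP: q01.
 by rewrite exprn_ge0//; case/andP: q01.
transitivity (e (lam%:C * t°) * usum (fun i => usum (fun n => G (i, n)))).
 rewrite -usumZ; last exact: (usum_pair sG).1.
 by apply: eq_usum => i; rewrite (hc i).2.
congr (_ * _); rewrite (usum_pair sG).2 -(usum_swap sG).2.
apply: eq_usum => n; rewrite /G /= [RHS]mulrC -usumZ//.
by apply: eq_usum => i; rewrite mulrC.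
Qed.

Definition uhpT (t : H) : H := uhp_act (mxT_det) t.
Definition uhpS (t : H) : H := uhp_act (mxS_det) t.
Lemma uhpTE (t : H) : uhpT t = t° + 1 :> C.
by rewrite /uhpT /= /moebius /cocycle !mxE /= mul0r add0r divr1 mul1r. Qed.
Lemma uhpSE (t : H) : uhpS t = - t°^-1 :> C.
by rewrite /uhpS /= /moebius /cocycle !mxE /= mul0r add0r mul1r addr0 mulN1r. Qed.
Lemma uhp_neq0 (t : H) : t° != 0.
by apply/eqP => h; have := uhp_gt0 t; rewrite h ltxx. Qed.
Lemma uhpSS t : uhpS (uhpS t) = t.
by apply: val_inj; rewrite [LHS]uhpSE uhpSE invrN invrK opprK. Qed.
Lemma QE_uhpT lam f t : QE lam f -> f (uhpT t) = e lam%:C * f t.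
move=> [c [tc fE]]; rewrite !fE uhpTE mulrDr mulr1 !eD e_1 mulr1; ring.
Qed.

End Fourier.

Section Derivative.
Variable R : realType.
Local Notation C := R[i].
Local Notation e := (@cexp2pi R).
Local Notation H := (uhp R).
Local Notation Im := (@complex.Im R).
Local Notation Re := (@complex.Re R).
Local Notation tpi := (@tpi R).

(* All functions below are analytic, so the error term may be taken quadratic. *)
Definition cder (f : H -> C) (t : H) (l : C) := exists K d : R,
 [/\ 0 <= K, 0 < d & forall u : H, cn (u° - t°) < d ->
 cn (f u - f t - l * (u° - t°)) <= K * cn (u° - t°) ^+ 2].

Lemma uhp_near (t : H) (d : R) : 0 < d ->
 exists u : H, u° != t /\ cn (u° - t°) < d.
move=> d0; have y0 : 0 < Im (t° + 'i * (d / 2)%:C).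
 rewrite raddfD /= !mul0r add0r mul1r addr_gt0 ?uhp_gt0//; lra.
have E : cn ((Uhp y0 : C) - t°) = d / 2.
 rewrite /= addrAC subrr add0r cnM cn_real ger0_norm; last lra.
 by rewrite /cn /= expr0n expr1n add0r sqrtr1 mul1r.
exists (Uhp y0); split; last by rewrite E; lra.
by rewrite -subr_eq0 -cn_eq0 E; apply/eqP; lra.
Qed.

Lemma cder_unique f t l l' : cder f t l -> cder f t l' -> l = l'.
move=> [K [d [K0 d0 h]]] [K' [d' [K'0 d'0 h']]]; apply: cn_small_eq => eps e0.
pose m := Num.min (Num.min d d') (eps / (K + K' + 1)).
have m0 : 0 < m by rewrite !lt_min d0 d'0 divr_gt0//; lra.
have [u [ut]] := uhp_near t m0; rewrite !lt_min -andbA => /and3P[/h {}h /h' {}h' he].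
have n0 : 0 < cn (u° - t°) by rewrite cn_gt0 subr_eq0.
move: he; rewrite ltr_pdivlMr; last lra.
set x := u° - t° in h h' n0 * => he; rewrite -(ler_pM2r n0) -cnM.
have -> : (l - l') * x = (f u - f t - l' * x) - (f u - f t - l * x) by ring.
apply: le_trans (cnB _ _) _; apply: le_trans (lerD h' h) _.
by rewrite -mulrDl expr2 mulrA ler_wpM2r ?ltW//; nra.
Qed.

Lemma cder_lip f t l : cder f t l -> exists K d : R,
 [/\ 0 <= K, 0 < d & forall u : H, cn (u° - t°) < d ->
 cn (f u - f t) <= K * cn (u° - t°)].
move=> [K [d [K0 d0 h]]]; exists (K + cn l), (Num.min d 1); split.
- by rewrite addr_ge0 ?cn_ge0.
- by rewrite lt_min d0 ltr01.
move=> u; rewrite lt_min => /andP[/h {}h u1]; have n0 := cn_ge0 (u° - t°).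
set x := u° - t° in h u1 n0 *.
have -> : f u - f t = (f u - f t - l * x) + l * x by ring.
apply: le_trans (cnD _ _) _; rewrite mulrDl -cnM lerD2r.
by apply: le_trans h _; rewrite ler_wpM2l// expr2 ler_piMr// ltW.
Qed.

Lemma cder_cst a t : cder (fun=> a) t 0.
exists 0, 1; split => // u _; by rewrite subrr mul0r subr0 cn0 mul0r.
Qed.

Lemma cderD f g t l m : cder f t l -> cder g t m -> cder (fun u => f u + g u) t (l + m).
move=> [K [d [K0 d0 h]]] [K' [d' [K'0 d'0 h']]]; exists (K + K'), (Num.min d d'); split.
- exact: addr_ge0.
- by rewrite lt_min d0.
move=> u; rewrite lt_min => /andP[/h {}h /h' {}h'].
set x := u° - t° in h h' *.
have -> : f u + g u - (f t + g t) - (l + m) * x =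
 (f u - f t - l * x) + (g u - g t - m * x) by ring.
by apply: le_trans (cnD _ _) _; rewrite mulrDl lerD.
Qed.

Lemma cderM f g t l m : cder f t l -> cder g t m ->
 cder (fun u => f u * g u) t (l * g t + f t * m).
move=> df dg; have [L [d1 [L0 d10 h1]]] := cder_lip dg.
case: df => K [d [K0 d0 h]]; case: dg => K' [d' [K'0 d'0 h']].
exists (K * (cn (g t) + L) + cn l * L + cn (f t) * K'),
 (Num.min (Num.min d d') (Num.min d1 1)); split.
- by rewrite !addr_ge0// mulr_ge0 ?addr_ge0 ?cn_ge0.
- by rewrite !lt_min d0 d'0 d10 ltr01.
move=> u; rewrite !lt_min -!andbA => /and4P[/h {}h /h' {}h' /h1 {}h1 u1].
have n0 := cn_ge0 (u° - t°); set x := u° - t° in h h' h1 u1 n0 *.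
have -> : f u * g u - f t * g t - (l * g t + f t * m) * x =
 (f u - f t - l * x) * g u + (l * x * (g u - g t) + f t * (g u - g t - m * x)) by ring.
have gu : cn (g u) <= cn (g t) + L.
 have -> : g u = g t + (g u - g t) by ring.
 apply: le_trans (cnD _ _) _; rewrite lerD2l; apply: le_trans h1 _.
 by rewrite ler_piMr// ltW.
have -> : (K * (cn (g t) + L) + cn l * L + cn (f t) * K') * cn x ^+ 2 =
 K * (cn (g t) + L) * cn x ^+ 2 + (cn l * L + cn (f t) * K') * cn x ^+ 2 by ring.
apply: le_trans (cnD _ _) _; apply: lerD.
 rewrite cnM [leRHS]mulrAC; apply: ler_pM; rewrite ?cn_ge0//.
apply: le_trans (cnD _ _) _; rewrite mulrDl; apply: lerD.
 rewrite !cnM expr2 [leRHS]mulrACA; apply: ler_pM; rewrite ?mulr_ge0 ?cn_ge0//.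
by rewrite cnM -[leRHS]mulrA ler_wpM2l ?cn_ge0.
Qed.

Lemma cderZ a f t l : cder f t l -> cder (fun u => a * f u) t (a * l).
by move=> h; have := cderM (cder_cst a t) h; rewrite mul0r add0r. Qed.

Lemma cder_sum (I : Type) (s : seq I) (f : I -> H -> C) (l : I -> C) t :
 (forall i, cder (f i) t (l i)) ->
 cder (fun u => \sum_(i <- s) f i u) t (\sum_(i <- s) l i).
move=> h; elim: s => [|i s IH].
 rewrite big_nil; have := cder_cst 0 t; congr cder; apply/funext => u.
 by rewrite big_nil.
rewrite big_cons; have := cderD (h i) IH; congr cder; apply/funext => u.
by rewrite big_cons.
Qed.

Lemma cder_prod (I : eqType) (s : seq I) (f : I -> H -> C) (l : I -> C) t : uniq s ->
 (forall i, cder (f i) t (l i)) ->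
 cder (fun u => \prod_(i <- s) f i u) t
 (\sum_(i <- s) \prod_(j <- s) (if j == i then l j else f j t)).
move=> us h; elim: s us => [|i s IH] /=.
 rewrite big_nil => _; have := cder_cst 1 t; congr cder; apply/funext => u.
 by rewrite big_nil.
move=> /andP[ins us]; have := cderM (h i) (IH us); congr cder.
 by apply/funext => u; rewrite big_cons.
rewrite big_cons; congr (_ + _).
 rewrite big_cons eqxx; congr (_ * _); rewrite big_seq [RHS]big_seq.
 apply: eq_bigr => j js; case: eqP => // ji; by rewrite -ji js in ins.
rewrite mulr_sumr; apply: eq_big_seq => j js.
rewrite big_cons; case: eqP => // ij; by rewrite ij js in ins.
Qed.

Lemma cder_comp f (g : H -> H) t l m : cder (fun u => (g u : C)) t m -> cder f (g t) l ->
 cder (fun u => f (g u)) t (l * m).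
move=> dg [K [d [K0 d0 h]]]; have [L [d1 [L0 d10 h1]]] := cder_lip dg.
case: dg => K' [d' [K'0 d'0 h']].
exists (K * L ^+ 2 + cn l * K'), (Num.min d' (Num.min d1 (d / (L + 1)))); split.
- by rewrite addr_ge0 ?mulr_ge0 ?exprn_ge0 ?cn_ge0.
- by rewrite !lt_min d'0 d10 divr_gt0//; lra.
move=> u; rewrite !lt_min => /and3P[/h' {}h' /h1 {}h1]; rewrite ltr_pdivlMr; last lra.
have n0 := cn_ge0 (u° - t°); set x := u° - t° in h' h1 n0 * => hd.
have {}h : cn (f (g u) - f (g t) - l * ((g u : C) - (g t : C))) <= K * cn ((g u : C) - (g t : C)) ^+ 2.
 by apply: h; apply: le_lt_trans h1 _; nra.
have -> : f (g u) - f (g t) - l * m * x = (f (g u) - f (g t) - l * ((g u : C) - (g t : C))) +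
 l * ((g u : C) - (g t : C) - m * x) by ring.
apply: le_trans (cnD _ _) _; rewrite mulrDl; apply: lerD.
 apply: le_trans h _; rewrite -mulrA ler_wpM2l// -exprMn.
 by rewrite lerXn2r ?nnegrE ?mulr_ge0 ?cn_ge0.
by rewrite cnM -[leRHS]mulrA ler_wpM2l ?cn_ge0.
Qed.

Lemma cder_id t : cder (fun u => u : C) t 1.
by exists 0, 1; split=> // u _; rewrite mul1r subrr cn0 mul0r. Qed.

Lemma cder_inv t : cder (fun u => (u : C)^-1) t (- t° ^- 2).
have t0 := uhp_neq0 t; have ct : 0 < cn t° by rewrite cn_gt0.
exists (2 / cn t° ^+ 3), (cn t° / 2); split.
- by rewrite divr_ge0// exprn_ge0// ltW.
- by lra.
move=> u hu; have u0 := uhp_neq0 u.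
have hcu : cn t° / 2 <= cn u°.
 have : cn t° <= cn u° + cn (u° - t°).
 have {1}-> : t° = u° - (u° - t°) by ring.
 exact: cnB.
 by lra.
have -> : u°^-1 - t°^-1 - - t° ^- 2 * (u° - t°) =
 (u° - t°) ^+ 2 * (t° ^- 2 * u°^-1).
 by field; rewrite u0 t0.
rewrite cnM cnX mulrC ler_wpM2r ?exprn_ge0 ?cn_ge0// cnM !cnV cnX.
have cu : 0 < cn u° by rewrite cn_gt0.
have a2 : 0 < cn t° ^+ 2 by rewrite exprn_gt0.
rewrite -invfM ler_pdivlMr ?exprn_gt0// mulrC ler_pdivrMr ?mulr_gt0// exprS; nra.
Qed.

Lemma cder_uhpS t : cder (fun u => (uhpS u)°) t (t° ^- 2).
have := cderZ (-1) (cder_inv t); rewrite mulN1r opprK; congr cder.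
by apply/funext => u; rewrite uhpSE mulN1r.
Qed.

Lemma cder_e (a : C) t : cder (fun u => e (a * u°)) t (tpi * a * e (a * t°)).
exists (cn (e (a * t°)) * (cn (tpi * a) ^+ 2 * expR (cn (tpi * a)))), 1; split=> //.
 by rewrite !mulr_ge0 ?exprn_ge0 ?cn_ge0 ?expR_ge0.
move=> u u1; set x := u° - t° in u1 *.
have -> : e (a * u°) = e (a * t°) * cexp (tpi * a * x).
 by rewrite -mulrA -eE -eD /x; congr e; ring.
set E := e _; have -> : E * cexp (tpi * a * x) - E - tpi * a * E * x =
 E * (cexp (tpi * a * x) - 1 - tpi * a * x) by ring.
rewrite cnM -[leRHS]mulrA ler_wpM2l ?cn_ge0//; apply: le_trans (cexp_quad _) _.
rewrite [cn (_ * x)]cnM exprMn mulrAC ler_wpM2r ?exprn_ge0 ?cn_ge0//.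
rewrite ler_wpM2l ?exprn_ge0 ?cn_ge0// ler_expR ler_piMr ?cn_ge0//; exact: ltW.
Qed.

(** The factor r^2 on the left avoids the exponent n - 2. One factor w - z comes from w^n - z^n, the
    second from the differences w^i - z^i that remain. *)
Lemma power_quad (w z : C) (r : R) n : 0 <= r -> cn w <= r -> cn z <= r ->
 r ^+ 2 * cn (w ^+ n - z ^+ n - n%:R * z ^+ n.-1 * (w - z)) <=
 (n%:R ^+ 2 * r ^+ n) * cn (w - z) ^+ 2.
move=> r0 wr zr; have rX m : 0 <= r ^+ m by exact: exprn_ge0.
have lip m : r * cn (w ^+ m - z ^+ m) <= m%:R * r ^+ m * cn (w - z).
 rewrite subrXX cnM mulrCA [leRHS]mulrC ler_wpM2l ?cn_ge0//.
 apply: le_trans (ler_wpM2l r0 (cn_sum _ _)) _; rewrite mulr_sumr.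
 rewrite -[m in m%:R]card_ord -sumr_const mulr_suml.
 under [leRHS]eq_bigl do rewrite inE; apply: ler_sum => -[i hi] _ /=.
 rewrite mul1r cnM !cnX.
 apply: le_trans (_ : r * (r ^+ (m.-1 - i) * r ^+ i) <= _).
 by rewrite ler_wpM2l// ler_pM ?exprn_ge0 ?cn_ge0// lerXn2r ?nnegrE ?cn_ge0.
 by rewrite -exprD -exprS; have -> : (m.-1 - i + i).+1 = m by lia.
case: n => [|n]; first by rewrite !expr0 subrr !mul0r subr0 cn0 mulr0 expr0n /= !mul0r.
have -> : w ^+ n.+1 - z ^+ n.+1 - n.+1%:R * z ^+ n * (w - z) =
 (w - z) * \sum_(i < n.+1) z ^+ (n - i) * (w ^+ i - z ^+ i).
 rewrite (subrXX w z n.+1).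
 have -> : n.+1%:R * z ^+ n * (w - z) = (w - z) * \sum_(i < n.+1) z ^+ n by rewrite sumr_const card_ord mulrC mulr_natl.
 rewrite -mulrBr -sumrB; congr (_ * _).
 rewrite (reindex_inj rev_ord_inj) /=; apply: eq_bigr => -[i hi] _ /=.
 rewrite mulrBr -exprD subSS; congr (_ - _); first rewrite mulrC.
 by have -> : (n.+1.-1 - (n - i) = i)%N by lia.
 by rewrite subnK.
rewrite cnM mulrCA expr2 [in leRHS]expr2 [leRHS]mulrCA ler_wpM2l ?cn_ge0//.
apply: le_trans (ler_wpM2l _ (cn_sum _ _)) _; first exact: mulr_ge0.
rewrite mulr_sumr.
have -> : n.+1%:R * n.+1%:R * r ^+ n.+1 * cn (w - z) =
 \sum_(i < n.+1) n.+1%:R * r ^+ n.+1 * cn (w - z).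
 by rewrite sumr_const card_ord -[RHS]mulr_natl; ring.
apply: ler_sum => -[i hi] _ /=; rewrite cnM cnX.
apply: le_trans (_ : (r * r ^+ (n - i)) * (r * cn (w ^+ i - z ^+ i)) <= _).
 rewrite [leRHS]mulrACA; apply: ler_wpM2l; first exact: mulr_ge0.
 rewrite ler_wpM2r ?cn_ge0// lerXn2r ?nnegrE ?cn_ge0//.
apply: le_trans (ler_wpM2l _ (lip i)) _; first exact: mulr_ge0.
rewrite -exprS.
have -> : r ^+ (n - i).+1 * (i%:R * r ^+ i * cn (w - z)) =
 i%:R * r ^+ n.+1 * cn (w - z).
 have -> : r ^+ n.+1 = r ^+ (n - i).+1 * r ^+ i by rewrite -exprD; congr (_ ^+ _); lia.
 ring.
by rewrite ler_wpM2r ?cn_ge0// ler_wpM2r// ler_nat ltnW.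
Qed.

Lemma ps_quad (c : nat -> C) (z : C) (r : R) : tame c -> 0 < r < 1 -> z != 0 -> cn z <= r ->
 exists2 K : R, 0 <= K & forall w, cn w <= r ->
 cn (ps c w - ps c z - z^-1 * ps (fun n => n%:R * c n) z * (w - z)) <= K * cn (w - z) ^+ 2.
move=> tc /andP[r0 r1] z0 zr; have t2 := tame_nat (tame_nat tc).
have hr : 0 <= r < 1 by rewrite ltW.
have [B b] := t2 r hr; exists (B / r ^+ 2); first by rewrite divr_ge0 ?(bsum_ge0 b) ?exprn_ge0 ?ltW.
move=> w wr; have r20 : 0 < r ^+ 2 by rewrite exprn_gt0.
have z1 : cn z < 1 by lra.
have w1 : cn w < 1 by lra.
have s1 := summ_ps tc w1; have s2 := summ_ps tc z1.
have s3 := summ_ps (tame_nat tc) z1.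
have sZ : summ (fun n => (z^-1 * (w - z)) * (n%:R * c n * z ^+ n)) by exact: summZ.
have -> : ps c w - ps c z - z^-1 * ps (fun n => n%:R * c n) z * (w - z) =
 usum (fun n => c n * (w ^+ n - z ^+ n - n%:R * z ^+ n.-1 * (w - z))).
 rewrite mulrAC -(usumZ _ s3) -(usumB s1 s2) -usumB//; last exact: summB.
 apply: eq_usum => -[|n] /=; first by rewrite !expr0; ring.
 by rewrite (exprS z); field.
have Eb n : cn (c n * (w ^+ n - z ^+ n - n%:R * z ^+ n.-1 * (w - z))) <=
 (cn (w - z) ^+ 2 / r ^+ 2) * cn (n%:R * (n%:R * c n) * (r ^+ n)%:C).
 rewrite [leRHS]mulrAC ler_pdivlMr// cnM -[leLHS]mulrA [X in _ * X <= _]mulrC.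
 apply: le_trans (ler_wpM2l (cn_ge0 _) (power_quad n (ltW r0) wr zr)) _.
 rewrite !cnM cn_nat cn_real ger0_norm; last by rewrite exprn_ge0// ltW.
 by rewrite le_eqVlt; apply/orP; left; apply/eqP; ring.
have b' : bsum (fun n => (cn (w - z) ^+ 2 / r ^+ 2) * cn (n%:R * (n%:R * c n) * (r ^+ n)%:C))
 (B / r ^+ 2 * cn (w - z) ^+ 2).
 move=> s us; rewrite -mulr_sumr.
 have -> : B / r ^+ 2 * cn (w - z) ^+ 2 = (cn (w - z) ^+ 2 / r ^+ 2) * B by ring.
 by rewrite ler_wpM2l ?b// divr_ge0 ?exprn_ge0 ?cn_ge0// ltW.
by apply: usum_le; [exact: summW b' | exact: bsumW b'].
Qed.

Lemma cder_ps c t : tame c ->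
 cder (fun u => ps c (e u)) t (tpi * ps (fun n => n%:R * c n) (e t)).
move=> tc; have := cder_e 1 t; rewrite mulr1 mul1r.
have -> : (fun u : H => e (1 * u°)) = (fun u : H => e u).
 by apply/funext => u; rewrite mul1r.
move=> de; have [L [d1 [L0 d10 h1]]] := cder_lip de.
case: de => K' [d' [K'0 d'0 h']].
have [] := midpoint_lt1 (_ : 0 <= cn (e t) < 1); first by rewrite cn_ge0 cn_e_uhp.
set r := (_ + 1) / 2 => r0 r1 tr _.
have hr : 0 < r < 1 by rewrite r0.
have [K K0 hK] := ps_quad tc hr (e_neq0 t) (ltW tr).
set D := _ * ps (fun n => n%:R * c n) (e t) in hK.
exists (K * L ^+ 2 + cn D * K'), (Num.min d' (Num.min d1 ((r - cn (e t)) / (L + 1)))); split.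
- by rewrite addr_ge0 ?mulr_ge0 ?exprn_ge0 ?cn_ge0.
- by rewrite !lt_min d'0 d10 divr_gt0//; lra.
move=> u; rewrite !lt_min => /and3P[/h' {}h' /h1 {}h1]; rewrite ltr_pdivlMr; last lra.
have n0 := cn_ge0 (u° - t°); set x := u° - t° in h' h1 n0 * => hd.
have ur : cn (e u) <= r.
 have -> : e u = e t + (e u - e t) by ring.
 apply: le_trans (cnD _ _) _; rewrite -lerBrDl; apply: le_trans h1 _; nra.
have -> : ps c (e u) - ps c (e t) - tpi * ps (fun n => n%:R * c n) (e t) * x =
 (ps c (e u) - ps c (e t) - D * (e u - e t)) + D * (e u - e t - tpi * e t * x).
 rewrite /D; have := e_neq0 t; move: (e t) => z z0; by field.
apply: le_trans (cnD _ _) _; rewrite mulrDl; apply: lerD.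
 apply: le_trans (hK _ ur) _; rewrite -mulrA ler_wpM2l// -exprMn.
 by rewrite lerXn2r ?nnegrE ?mulr_ge0 ?cn_ge0.
by rewrite cnM -[leRHS]mulrA ler_wpM2l ?cn_ge0.
Qed.

Lemma QEc_cder lam c f : QEc lam c f -> exists f',
 QEc lam (fun n => (lam%:C + n%:R) * c n) f' /\ forall t, cder f t (tpi * f' t).
move=> [tc fE]; exists (fun t : H => e (lam%:C * t°) *
 (lam%:C * ps c (e t) + ps (fun n => n%:R * c n) (e t))); split.
 have -> : (fun n => (lam%:C + n%:R) * c n) = (fun n => lam%:C * c n + n%:R * c n).
 by apply/funext => n; rewrite mulrDl.
 split; first by apply: tameD; [exact: tameZ | exact: tame_nat].
 move=> t; rewrite psD ?cn_e_uhp ?psZ ?cn_e_uhp//; [exact: tameZ | exact: tame_nat].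
move=> t; have := cderM (cder_e lam%:C t) (cder_ps t tc).
have -> : (fun u : H => e (lam%:C * u°) * ps c (e u)) = f.
 by apply/funext => u; rewrite fE.
by congr cder; ring.
Qed.

(** Real induction along the segment from t to u. The parameters s with |f(P s) - f(t)| <= eps s
    have a supremum c; near P c the quadratic remainder is below eps |s - c|, so c belongs to the
    set and cannot be less than 1. *)
Lemma cder0_cst f : (forall t, cder f t 0) -> forall t u, f t = f u.
move=> df t u; apply/esym; apply: cn_small_eq => eps e0.
pose x := u° - t°; pose L := cn x + 1; have L0 : 0 < L by rewrite /L; have := cn_ge0 x; lra.
have pos (s : R) : 0 <= s <= 1 -> 0 < Im (t° + s%:C * x).
 move=> /andP[s0 s1]; have := uhp_gt0 t; have := uhp_gt0 u; rewrite /x.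
 case: u° t° => ux uy [tx ty] /= u0 t0; nra.
(* Outside [0,1] the line may leave the half-plane, hence the default [t]. *)
pose P s := if pselect (0 <= s <= 1) is left h then Uhp (pos s h) else t.
have PE s : 0 <= s <= 1 -> P s = t° + s%:C * x :> C.
 by rewrite /P; case: pselect.
have P0 : P 0 = t by apply: val_inj; rewrite [LHS]PE ?mul0r ?addr0// lexx ler01.
have P1 : P 1 = u.
 by apply: val_inj; rewrite [LHS]PE ?mul1r ?ler01 ?lexx// /x addrC subrK.
pose E := [set s : R | 0 <= s <= 1 /\ cn (f (P s) - f t) <= eps * s].
have E0 : E 0 by split; rewrite ?lexx ?ler01// P0 subrr cn0 mulr0.
have supE : has_sup E by split; [exists 0 | exists 1 => s [/andP[]]].
pose c := sup E.
have c01 : 0 <= c <= 1.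
 apply/andP; split; first by apply: sup_upper_bound.
 by apply: sup_le_ub => [|s [/andP[]]]; first by exists 0.
have [K [d [K0 d0 h]]] := df (P c).
have KL : 0 < K * L ^+ 2 + 1 by rewrite ltr_wpDl// mulr_ge0// exprn_ge0// ltW.
have [del del0 hdel] : exists2 del : R, 0 < del & forall s, 0 <= s <= 1 -> `|s - c| < del ->
 cn (f (P s) - f (P c)) <= eps * `|s - c|.
 exists (Num.min (d / L) (eps / (K * L ^+ 2 + 1))).
 by rewrite lt_min !divr_gt0.
 move=> s hs; rewrite lt_min => /andP[]; rewrite ltr_pdivlMr// => h1.
 rewrite ltr_pdivlMr// => h2.
 have dE : (P s : C) - (P c : C) = (s - c)%:C * x.
 by rewrite !PE// rmorphB /=; ring.
 have n1 : cn ((P s : C) - (P c : C)) <= `|s - c| * L.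
 by rewrite dE cnM cn_real ler_wpM2l// /L; lra.
 have := h (P s) (le_lt_trans n1 h1); rewrite mul0r subr0 => /le_trans; apply.
 apply: le_trans (_ : K * (`|s - c| * L) ^+ 2 <= _).
 by rewrite ler_wpM2l// lerXn2r ?nnegrE ?cn_ge0// mulr_ge0// ltW.
 rewrite exprMn expr2 -mulrA mulrCA mulrC ler_wpM2r//.
 have : 0 <= `|s - c| by []. by move: h2; nra.
have Ec : E c.
 have [s Es hs] := sup_adherent del0 supE; have sc : s <= c by exact: sup_upper_bound.
 case: Es => s01 hfs; split=> //.
 have -> : f (P c) - f t = (f (P s) - f t) - (f (P s) - f (P c)) by ring.
 apply: le_trans (cnB _ _) _.
 have := hdel s s01 _; rewrite ler0_norm ?subr_le0// => /(_ _)/le_trans hh.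
 have -> : eps * c = eps * s + eps * - (s - c) by ring.
 apply: lerD => //; apply: hh => //; rewrite /c; lra.
have {}c1 : c = 1.
 case/andP: (c01) => c0; rewrite le_eqVlt => /orP[/eqP//|c1].
 pose s := Num.min 1 (c + del / 2).
 have cs : c < s by rewrite lt_min c1; lra.
 have s01 : 0 <= s <= 1 by rewrite ge_min lexx/= andbT; lra.
 have : E s.
 split=> //; have -> : f (P s) - f t = (f (P s) - f (P c)) + (f (P c) - f t) by ring.
 apply: le_trans (cnD _ _) _.
 have -> : eps * s = eps * (s - c) + eps * c by ring.
 apply: lerD; last exact: Ec.2.
 rewrite -[X in eps * X]ger0_norm; last by lra.
 apply: hdel => //; rewrite ger0_norm; last by lra.
 have : s <= c + del / 2 by rewrite ge_min lexx orbT.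
 by lra.
 by move=> /(sup_upper_bound supE); rewrite -/c; lra.
by case: Ec; rewrite c1 P1 mulr1.
Qed.

Lemma cder_derivable f : (forall t, exists l, cder f t l) -> holomorphic f.
move=> df t; have [l [K [d [K0 d0 h]]]] := df t.
apply/cvg_ex; exists (l : C^o).
apply/(@cvgrPdist_le _ C^o C^o _ (@dnbhs_filter C^o (0 : C^o))).
move=> eps e0; have eE : eps = (Re eps)%:C by rewrite RRe_real// gtr0_real.
have re0 : 0 < Re eps by rewrite -ltcR -eE.
pose m := Num.min (Num.min d (Im t)) (Re eps / (K + 1)).
have m0 : 0 < m by rewrite !lt_min d0 uhp_gt0 divr_gt0//; lra.
exists m%:C; first by rewrite /= ltcR.
move=> x /=; rewrite /ball_ /= sub0r normrN cnE ltcR !lt_min -andbA => /and3P[xd xt xe] x0.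
have ht0 : 0 < Im ((x : C) + t°).
 rewrite raddfD /=; have := cn_ge_Im x; rewrite ler_norml => /andP[h1 _].
 by have := uhp_gt0 t; lra.
have -> : uhp_ext f (t : C^o) = f t by exact: uhp_extE.
have -> : uhp_ext f (x *: 1 + (t : C^o)) = f (Uhp ht0).
 have -> : x *: 1 + (t : C^o) = Uhp ht0 :> C by rewrite -[x *: 1]/((x : C) * 1) mulr1.
 exact: uhp_extE.
rewrite cnE {1}eE lecR.
have x0' : 0 < cn x by rewrite cn_gt0.
have := h (Uhp ht0); rewrite /= addrK => /(_ xd) {}h.
have -> : l - x^-1 *: (f (Uhp ht0) - f t) = - ((x : C)^-1 * (f (Uhp ht0) - f t - l * x)).
 rewrite -[_ *: _]/((x : C)^-1 * (f (Uhp ht0) - f t)); by field.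
rewrite cnN cnM cnV ler_pdivrMl// [leRHS]mulrC; apply: le_trans h _.
rewrite expr2 mulrA ler_wpM2r// ?ltW//.
by move: xe; rewrite ltr_pdivlMr; [nra|lra].
Qed.

End Derivative.

(** * The Lipschitz summation formula *)

Section Limits.
Variable R : realType.
Local Notation C := R[i].
Implicit Types u v : nat -> C.

Lemma clim_cst (a : C) : clim (fun=> a) a.
by move=> eps e0; exists 0%N => n _; rewrite subrr cn0. Qed.

Lemma climD u v a b : clim u a -> clim v b -> clim (fun n => u n + v n) (a + b).
move=> h h' eps e0; have e20 : 0 < eps / 2 by lra.
have [N hN] := h _ e20; have [M hM] := h' _ e20.
exists (maxn N M) => n; rewrite geq_max => /andP[/hN h1 /hM h2].
by rewrite opprD addrACA; apply: le_lt_trans (cnD _ _) _; lra.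
Qed.

Lemma clim_bounded u a : clim u a -> exists2 N, (0 < cn a + 1) &
 forall n, (N <= n)%N -> cn (u n) <= cn a + 1.
move=> h; have [N hN] := h 1 ltr01; exists N; first by have := cn_ge0 a; lra.
move=> n /hN hn; have -> : u n = a + (u n - a) by ring.
by apply: le_trans (cnD _ _) _; rewrite lerD2l ltW.
Qed.

Lemma climM u v a b : clim u a -> clim v b -> clim (fun n => u n * v n) (a * b).
move=> h h' eps e0; have [N0 p hN0] := clim_bounded h.
have a0 : 0 < eps / 2 / (cn a + 1) by rewrite !divr_gt0.
have b0 : 0 < eps / 2 / (cn b + 1) by rewrite !divr_gt0//; have := cn_ge0 b; lra.
have [N hN] := h _ b0; have [M hM] := h' _ a0.
exists (maxn N0 (maxn N M)) => n; rewrite !geq_max => /and3P[/hN0 h0 /hN h1 /hM h2].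
have -> : u n * v n - a * b = u n * (v n - b) + b * (u n - a) by ring.
apply: le_lt_trans (cnD _ _) _; rewrite !cnM.
have {}h2 : cn (u n) * cn (v n - b) <= eps / 2.
 apply: le_trans (ler_pM (cn_ge0 _) (cn_ge0 _) h0 (ltW h2)) _.
 by rewrite mulrCA mulfV ?mulr1// gt_eqF.
have : cn b * cn (u n - a) < eps / 2; last by lra.
have [b00|bn0] := eqVneq (cn b) 0; first by rewrite b00 mul0r; lra.
have b1 : 0 < cn b by rewrite lt_def bn0 cn_ge0.
apply: le_lt_trans (_ : (cn b) * (eps / 2 / (cn b + 1)) < _).
 by rewrite ler_wpM2l ?ltW.
by rewrite mulrA ltr_pdivrMr; [nra|lra].
Qed.

Lemma climZ u a c : clim u a -> clim (fun n => c * u n) (c * a).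
exact/climM/clim_cst. Qed.
Lemma climX u a k : clim u a -> clim (fun n => u n ^+ k) (a ^+ k).
move=> h; elim: k => [|k IH].
 by apply: eq_clim (clim_cst 1) => n; rewrite expr0.
by rewrite exprS; apply: eq_clim (climM h IH) => n; rewrite exprS.
Qed.

Lemma climV u a : a != 0 -> clim u a -> clim (fun n => (u n)^-1) a^-1.
move=> a0 h eps e0; have ca : 0 < cn a by rewrite cn_gt0.
have h1 : 0 < Num.min (cn a / 2) (eps * (cn a / 2 * cn a)).
 by rewrite lt_min; apply/andP; split; [lra | rewrite !mulr_gt0//; lra].
have [N hN] := h _ h1; exists N => n /hN; rewrite lt_min => /andP[h2 h3].
have cu : cn a / 2 <= cn (u n).
 have : cn a <= cn (u n) + cn (u n - a); last by lra.
 by have {1}-> : a = u n - (u n - a) by [ring]; exact: cnB.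
have cu0 : 0 < cn (u n) by lra.
have u0 : u n != 0 by rewrite -cn_gt0.
have -> : (u n)^-1 - a^-1 = - (u n - a) / (u n * a) by field; rewrite ?u0 ?a0.
rewrite cnM cnN cnV cnM ltr_pdivrMr ?mulr_gt0//; apply: lt_le_trans h3 _.
by rewrite ler_wpM2l ?(ltW e0)// ler_wpM2r// ltW.
Qed.

Lemma clim_prod (I : Type) (s : seq I) (u : I -> nat -> C) (a : I -> C) :
 (forall i, clim (u i) (a i)) ->
 clim (fun n => \prod_(i <- s) u i n) (\prod_(i <- s) a i).
move=> h; elim: s => [|i s IH].
 by rewrite big_nil; apply: eq_clim (clim_cst 1) => n; rewrite big_nil.
by rewrite big_cons; apply: eq_clim (climM (h i) IH) => n; rewrite big_cons.
Qed.

Lemma clim_subseq u a (g : nat -> nat) : (forall n, (n <= g n)%N) -> clim u a ->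
 clim (fun n => u (g n)) a.
move=> hg h eps e0; have [N hN] := h _ e0; exists N => n Nn.
by apply: hN; apply: leq_trans Nn (hg n).
Qed.
Lemma clim_invn : clim (fun n => n.+1%:R^-1 : C) 0.
move=> eps e0; exists (Num.truncn eps^-1) => n hn.
rewrite subr0 cnV cn_nat -[eps]invrK ltf_pV2 ?posrE ?ltr0n ?invr_gt0//.
apply: lt_le_trans (truncnS_gt _) _; by rewrite ler_nat ltnS.
Qed.

End Limits.

(** * Elementary bounds: majorants, sines and binomial series *)

Section BasicSums.
Variable R : realType.
Local Notation C := R[i].

(** The exponent -3/2 is matched to [lattice_lower]: for a nonzero lattice point, |m t + n|^-3 is at
    most a constant times [alpha |m| * alpha |n|]. *)
Definition alpha (n : nat) : R := Num.sqrt n.+1%:R ^- 3.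
Lemma alpha_gt0 n : 0 < alpha n.
by rewrite invr_gt0 exprn_gt0// sqrtr_gt0 ltr0n. Qed.

Lemma alpha_telescope n : alpha n.+1 <= 2 * ((Num.sqrt n.+1%:R)^-1 - (Num.sqrt n.+2%:R)^-1).
rewrite /alpha; set a := Num.sqrt n.+1%:R; set b := Num.sqrt n.+2%:R.
have a0 : 0 < a by rewrite sqrtr_gt0 ltr0n.
have b0 : 0 < b by rewrite sqrtr_gt0 ltr0n.
have ab : a <= b by rewrite ler_wsqrtr// ler_nat.
have E : b ^+ 2 - a ^+ 2 = 1 by rewrite !sqr_sqrtr// -natrB// subSnn.
have -> : a^-1 - b^-1 = (b ^+ 2 - a ^+ 2) / (a * b * (a + b)).
 by field; rewrite ?gt_eqF ?addr_gt0.
rewrite E mul1r ler_pdivlMr ?mulr_gt0 ?addr_gt0// mulrC ler_pdivrMr ?exprn_gt0//.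
by rewrite !exprS expr0 mulr1; nra.
Qed.

Lemma bsum_alpha : bsum alpha 3.
apply: bsum_nat => [i|n]; first by rewrite ltW ?alpha_gt0.
case: n => [|n]; first by rewrite big_geq.
rewrite big_nat_recl//= /alpha sqrtr1 expr1n invr1.
apply: le_trans (_ : 1 + \sum_(0 <= i < n) 2 * ((Num.sqrt i.+1%:R)^-1 - (Num.sqrt i.+2%:R)^-1) <= _).
 by rewrite lerD2l; apply: ler_sum => i _; exact: alpha_telescope.
rewrite -mulr_sumr.
have -> : \sum_(0 <= i < n) ((Num.sqrt i.+1%:R)^-1 - (Num.sqrt i.+2%:R)^-1) =
 1 - (Num.sqrt n.+1%:R)^-1 :> R.
 elim: n => [|n IH]; first by rewrite big_geq// sqrtr1 invr1 subrr.
 by rewrite big_nat_recr//= IH; ring.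
have : 0 <= (Num.sqrt n.+1%:R)^-1 :> R by rewrite invr_ge0 sqrtr_ge0.
lra.
Qed.

Lemma bsum_int (g : nat -> R) B : (forall n, 0 <= g n) -> bsum g B ->
 bsum (fun j : int => g `|j|%N) (2 * B).
move=> g0 b; apply: (@bsum_group R _ _ (fun j : int => `|j|%N) _ (fun n => 2 * g n)) => //.
 move=> n s us; rewrite -big_mkcond /= -big_filter.
 apply: le_trans (_ : \sum_(i <- [:: n%:Z; - n%:Z]) g `|i|%N <= _); last first.
 by rewrite !big_cons big_nil abszN absz_nat; lra.
 case: n => [|n].
 apply: le_trans (_ : \sum_(i <- [:: 0%Z]) g `|i|%N <= _); last first.
 by rewrite !big_cons !big_nil /= lerD2l addr0 g0.
 apply: sum_sub_le => //; first exact: filter_uniq.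
 by move=> i; rewrite mem_filter !inE => /andP[+ _]; lia.
 apply: sum_sub_le => //; first exact: filter_uniq.
 by move=> i; rewrite mem_filter !inE => /andP[+ _]; lia.
by move=> s us; rewrite -mulr_sumr ler_wpM2l// b.
Qed.

Lemma sqr_alpha n : (n.+1%:R : R) ^- 2 <= alpha n.
rewrite /alpha; set s := Num.sqrt _; have s1 : 1 <= s by rewrite -sqrtr1 ler_wsqrtr// ler1n.
have -> : n.+1%:R = s ^+ 2 :> R by rewrite sqr_sqrtr.
rewrite -exprM lef_pV2 ?posrE ?exprn_gt0//; try lra.
by rewrite ler_weXn2l.
Qed.

Lemma bsum_intsq : bsum (fun j : int => (`|j|.+1%:R : R) ^- 2) 6.
have -> : 6 = 2 * 3 :> R by ring.
apply: (@bsum_int (fun n => n.+1%:R ^- 2)) => [n|]; first by rewrite invr_ge0 exprn_ge0.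
exact: bsumW sqr_alpha bsum_alpha.
Qed.

(** For small |j| the imaginary part suffices, for large |j| the real part does. The constant
    depends on y and X only, which makes the bound uniform on half-strips. *)
Lemma shift_lower (y X : R) : 0 < y -> 1 <= X -> exists2 d : R, 0 < d &
 forall (t : uhp R), y <= complex.Im t -> `|complex.Re t| <= X ->
 forall j : int, d * `|j|.+1%:R <= cn (t° + j%:~R).
move=> y0 X1; have X2 : 0 < 2 * X + 2 by lra.
exists (Num.min (y / (2 * X + 2)) (1 / 2)).
 by rewrite lt_min divr_gt0//=; lra.
move=> t ty tx j; set d := Num.min _ _.
have d1 : d * (2 * X + 2) <= y by rewrite -ler_pdivlMr// ge_min lexx.
have d2 : d <= 1 / 2 by rewrite ge_min lexx orbT.
have d0 : 0 < d by rewrite lt_min divr_gt0//=; lra.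
have jE : j%:~R = (j%:~R : R)%:C by rewrite rmorph_int.
have j1 : `|j|.+1%:R = `|j%:~R| + 1 :> R by rewrite -natr1 -intr_norm -abszE.
have := cn_ge_Im (t° + j%:~R); have := cn_ge_Re (t° + j%:~R).
rewrite jE !raddfD /= addr0 => h1; rewrite ger0_norm ?(ltW (uhp_gt0 t))// => h2; rewrite j1.
have [hj|hj] := lerP `|j%:~R : R| (2 * X + 1).
 apply: le_trans (_ : y <= _); last exact: le_trans ty h2.
 by apply: le_trans d1; rewrite ler_wpM2l ?(ltW d0)//; lra.
apply: le_trans h1; have : `|j%:~R : R| - `|complex.Re t| <= `|complex.Re t + j%:~R|.
 have := ler_normD (complex.Re t + j%:~R) (- complex.Re t).
 by rewrite normrN addrAC subrr add0r; lra.
by move=> h; nra.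
Qed.

Lemma sin_ge_xcos (x : R) : 0 < x < pi -> x * cos x <= sin x.
move=> /andP[x0 xp].
have dsin (z : R) : is_derive z 1 (sin : R -> R) (cos z) by exact: is_derive_sin.
have [c] := MVT x0 (fun z _ => dsin z) (continuous_subspaceT (@continuous_sin R)).
rewrite sin0 !subr0 in_itv /= => /andP[c0 cx] ->; rewrite mulrC ler_wpM2r ?(ltW x0)//.
by rewrite ltW// ltr_cos ?in_itv /= ?(ltW c0) ?(ltW x0) ?(ltW xp) ?(ltW (lt_trans cx xp)).
Qed.

(** On (0, pi/2], x cos x <= sin x and cos x + sin x >= 1 give 1 <= sin x (1 + 1/x); the other half
    follows by reflection. It serves both [sin_lower] and the sawtooth coefficients. *)
Lemma inv_sin_le (x : R) : 0 < x < pi -> (sin x)^-1 <= 1 + x^-1 + (pi - x)^-1.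
have key (y : R) : 0 < y <= pi / 2 -> y < pi -> (sin y)^-1 <= 1 + y^-1.
 move=> /andP[y0 y2] yp; have s0 : 0 < sin y by apply: sin_gt0_pi; rewrite y0.
 have h := sin_ge_xcos (introT andP (conj y0 yp)).
 have c0 : 0 <= cos y by apply: cos_ge0_pihalf; rewrite y2 andbT; lra.
 have q1 := cos2Dsin2 y; have s1 := sin_le1 y; have c1 := cos_le1 y.
 have a1 : 1 <= cos y + sin y by nra.
 have yy : cos y <= sin y / y by rewrite ler_pdivlMr// mulrC.
 rewrite -[leLHS]mul1r ler_pdivrMr// mulrDl mul1r [y^-1 * _]mulrC; lra.
move=> /andP[x0 xp]; have [x2|x2] := leP x (pi / 2).
 apply: le_trans (key x (introT andP (conj x0 x2)) xp) _.
 by rewrite lerDl invr_ge0 subr_ge0 ltW.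
have y0 : 0 < pi - x by rewrite subr_gt0.
have sE : sin x = sin (pi - x) by rewrite sinB sinpi cospi mul0r sub0r mulN1r opprK.
rewrite sE; apply: le_trans (key (pi - x) _ _) _; [by rewrite y0 /=; lra | by lra |].
by rewrite lerD2r lerDl invr_ge0 ltW.
Qed.

Lemma sin_lower : exists2 c : R, 0 < c &
 forall u : R, `|u| <= 3 / 4 -> c * `|u| <= `|sin (pi * u)|.
have pi2 := pi_ge2 R; have pos (v : R) : 0 < v -> v <= 3 / 4 -> 3^-1 * v <= sin (pi * v).
 move=> v0 v1; have x0 : 0 < (pi * v : R) < pi by apply/andP; split; nra.
 have s0 := sin_gt0_pi x0; have i1 : (pi * v)^-1 <= (2 * v)^-1.
 by rewrite lef_pV2 ?posrE ?mulr_gt0// ?ler_wpM2r ?(ltW v0)//; lra.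
 have i2 : (pi - pi * v)^-1 <= 2.
 by rewrite -[leRHS]invrK lef_pV2 ?posrE ?invr_gt0//; nra.
 have h : (sin (pi * v))^-1 <= 3 + (2 * v)^-1 by have := inv_sin_le x0; lra.
 have : (sin (pi * v))^-1 * (sin (pi * v) * v) <= (3 + (2 * v)^-1) * (sin (pi * v) * v) by rewrite ler_wpM2r// mulr_ge0 ?ltW.
 have -> : (3 + (2 * v)^-1) * (sin (pi * v) * v) = sin (pi * v) * (3 * v + 1 / 2) by field; rewrite gt_eqF.
 by rewrite mulrA mulVf ?mul1r ?gt_eqF//; nra.
exists 3^-1 => [|u hu]; first by rewrite invr_gt0.
have [u0|u0|->] := ltrgtP u 0; last by rewrite normr0 mulr0.
 rewrite -[X in sin X]opprK -mulrN sinN normrN; apply: le_trans (ler_norm _).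
 by move: hu; rewrite ltr0_norm// => hu; apply: pos; rewrite ?oppr_gt0.
by apply: le_trans (ler_norm _); move: hu; rewrite gtr0_norm// => hu; exact: pos.
Qed.

Local Notation e := (@cexp2pi R).

Lemma sqr_cn_one_sub_e (u v : R) : cn (1 - e (u +i* v)) ^+ 2 =
 (1 - expR (- (2 * pi * v))) ^+ 2 + 4 * expR (- (2 * pi * v)) * sin (pi * u) ^+ 2.
rewrite sqr_cn /cexp2pi /=; move: (expR _) => rho.
have -> : 2 * pi * u = (pi * u) *+ 2 by ring.
rewrite !mul0r subr0 addr0 sub0r sqrrN cos_mulr2n sin_mulr2n.
have := cos2Dsin2 (pi * u); move: (cos _) (sin _) => c s h.
have -> : c ^+ 2 = 1 - s ^+ 2 by rewrite -h addrK.
have -> : (rho * ((c * s) *+ 2)) ^+ 2 = 4 * rho ^+ 2 * s ^+ 2 * c ^+ 2 by ring.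
by rewrite -[c ^+ 2](addrK (s ^+ 2)) h; ring.
Qed.

Lemma one_sub_e_lower : exists2 c : R, 0 < c &
 forall w : C, `|complex.Re w| <= 3 / 4 -> 0 <= complex.Im w <= 1 ->
 c * cn w <= cn (1 - e w).
have pi2 := pi_ge2 R; have pi4 : pi < 4 :> R by have := pihalf_lt2 R; lra.
have [c c0 hc] := sin_lower; pose r0 := expR (- 8 : R); have r00 : 0 < r0 by exact: expR_gt0.
(* The squared modulus is (1 - rho)^2 + 4 rho sin^2(pi u) with rho = exp(-2 pi v). Here rho >=
   exp(-8) since pi < 4, and for x = 2 pi v in [0,8] one has 1 - rho >= x/(1 + x) >= x/9 and x >= 4
   v; so 16/81 is (4/9)^2. *)
pose k := Num.min (16 / 81 : R) (4 * r0 * c ^+ 2); have k0 : 0 < k.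
 by rewrite lt_min; apply/andP; split; [lra | rewrite !mulr_gt0 ?exprn_gt0].
exists (Num.sqrt k) => [|[u v] /= hu /andP[v0 v1]]; first by rewrite sqrtr_gt0.
rewrite -(@ler_pXn2r _ 2) ?nnegrE ?mulr_ge0 ?sqrtr_ge0 ?cn_ge0//.
rewrite exprMn sqr_sqrtr ?(ltW k0)// sqr_cn sqr_cn_one_sub_e /=; set rho := expR _.
have hr : r0 <= rho by rewrite ler_expR; nra.
have h1 : 4/9 * v <= 1 - rho.
 have a0 : 0 <= 2 * pi * v by rewrite !mulr_ge0//; lra.
 have := expR_ge1Dx (2 * pi * v); have := expRxMexpNx_1 (2 * pi * v).
 rewrite -/rho => E1 E2; have rp : 0 < rho := expR_gt0 _.
 have : (1 + 2 * pi * v) * rho <= 1 by rewrite -[leRHS]E1 ler_wpM2r// (ltW rp).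
 have : 2 * pi * v <= 8 by nra.
 have : 4 * v <= 2 * pi * v by nra.
 nra.
have kk1 : k <= 16/81 by rewrite ge_min lexx.
have kk2 : k <= 4 * r0 * c ^+ 2 by rewrite ge_min lexx orbT.
have h2 : (c * u) ^+ 2 <= sin (pi * u) ^+ 2.
 have : (c * `|u|) ^+ 2 <= `|sin (pi * u)| ^+ 2 by rewrite lerXn2r ?nnegrE ?mulr_ge0 ?(ltW c0)// hc.
 by rewrite !exprMn !real_normK ?num_real.
rewrite mulrDr addrC; apply: lerD.
 have : 0 <= v ^+ 2 by rewrite sqr_ge0.
 have : (4/9 * v) ^+ 2 <= (1 - rho) ^+ 2 by rewrite lerXn2r ?nnegrE; lra.
 by rewrite exprMn; nra.
apply: le_trans (_ : 4 * r0 * (c * u) ^+ 2 <= _).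
 by rewrite exprMn [leRHS]mulrA ler_wpM2r ?sqr_ge0.
apply: ler_pM; [rewrite mulr_ge0 ?(ltW r00)// | exact: sqr_ge0 | by rewrite ler_wpM2l | exact: h2].
Qed.

Lemma ps_geo (z : C) : cn z < 1 -> ps (fun=> 1) z = (1 - z)^-1.
move=> z1; have t1 : tame (fun=> 1 : C) by have := @tame_natX R 0; congr tame.
have z0 : 1 - z != 0 by apply/eqP => /eqP; rewrite subr_eq0 => /eqP h; rewrite -h cn1 ltxx in z1.
apply: (mulfI z0); rewrite mulfV//.
pose c n : C := if n == 0%N then 0 else 1.
have tc : tame c by apply: tame_le t1 => n; rewrite /c; case: eqP; rewrite ?cn0 ?cn1.
have [_ hs] := ps_shift tc erefl.
have := hs z z1; rewrite /c /= => hz.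
have E : ps (fun=> 1) z = 1 + ps c z.
 have -> : (fun=> 1) = (fun n => @delta0 R n + c n).
 by apply/funext => -[|n]; rewrite /delta0 /c /= ?addr0 ?add0r.
 by rewrite psD ?ps_delta0//; exact: tame_delta0.
by rewrite mulrBl mul1r -hz -/c E; ring.
Qed.

(** Induction on s: one more geometric factor is a convolution with 1, and the coefficients add up
    by the hockey-stick identity. *)
Lemma ps_negbin (s : nat) :
 tame (fun m => 'C(m + s, s)%:R : C) /\
 forall z : C, cn z < 1 -> ps (fun m => 'C(m + s, s)%:R) z = (1 - z) ^- s.+1.
have t1 : tame (fun=> 1 : C) by have := @tame_natX R 0; congr tame.
elim: s => [|s [tI IH]].
 have -> : (fun m => 'C(m + 0, 0)%:R : C) = (fun=> 1).
 by apply/funext => m; rewrite bin0.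
 by split=> // z; rewrite expr1; exact: ps_geo.
have E : (fun m => 'C(m + s.+1, s.+1)%:R : C) = conv (fun=> 1) (fun m => 'C(m + s, s)%:R).
 apply/funext => m; rewrite /conv; under eq_bigr do rewrite mul1r.
 rewrite -natr_sum; congr (_%:R); rewrite (reindex_inj rev_ord_inj) /=.
 elim: m => [|m IHm]; first by rewrite big_ord1 subnn !add0n !binn.
 rewrite big_ord_recr /= subnn subn0 addSn binS.
 congr addn; last by rewrite addSnnS.
 by rewrite IHm; apply: eq_bigr => -[i hi] _ /=; congr 'C(_, _); lia.
rewrite E; split; first exact: tame_conv.
move=> z z1; rewrite ps_conv// IH// ps_geo//.
by rewrite [in RHS]exprS invfM.
Qed.

End BasicSums.

#[global] Opaque cexp2pi.

Section Lipschitz.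
Variable R : realType.
Local Notation C := R[i].
Local Notation e := (@cexp2pi R).
Local Notation H := (uhp R).
Local Notation Im := (@complex.Im R).
Local Notation Re := (@complex.Re R).
Local Notation tpi := (@tpi R).

Lemma real_mul_int (a : R) (j : int) : a%:C * j%:~R = (a * j%:~R)%:C.
by rewrite rmorphM rmorph_int. Qed.
Lemma div_expNM (F : fieldType) (x y z : F) n : x / (- (y * z)) ^+ n = (- y) ^- n * (x / z ^+ n).
by rewrite -mulNr exprMn invfM mulrCA. Qed.
Lemma cn_e_real (x : R) : cn (e x%:C) = 1.
by rewrite cn_e /= mulr0 oppr0 expR0. Qed.
Lemma cn_prod (I : Type) (l : seq I) (F : I -> C) :
 cn (\prod_(i <- l) F i) = \prod_(i <- l) cn (F i).
elim: l => [|i l IH]; first by rewrite !big_nil cn1.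
by rewrite !big_cons cnM IH.
Qed.

(** This limit turns the finite sums with 1 - e(w/m) into sums of inverse powers of w. *)
Lemma clim_one_sub_e (w : C) (m : nat -> nat) : (forall n, (n < m n)%N) ->
 clim (fun n => (m n)%:R * (1 - e (w / (m n)%:R))) (- (tpi * w)).
move=> hm eps e0; pose x := cn (tpi * w); pose A := x ^+ 2 * expR x.
have x0 : 0 <= x := cn_ge0 _.
have A0 : 0 <= A by rewrite mulr_ge0 ?exprn_ge0 ?expR_ge0.
exists (Num.truncn (A / eps)) => n hn; set M := m n.
have M0 : 0 < M%:R :> R by rewrite ltr0n (leq_ltn_trans _ (hm n)).
have M0' : M%:R != 0 :> C by rewrite pnatr_eq0 -lt0n -(ltr0n R).
rewrite eE; set z := tpi * (w / M%:R).
have -> : M%:R * (1 - cexp z) - - (tpi * w) = - M%:R * (cexp z - 1 - z).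
 by rewrite /z; field.
have zx : cn z = x / M%:R by rewrite /z mulrA cnM cnV cn_nat.
have zle : cn z <= x by rewrite zx ler_pdivrMr// ler_peMr// ler1n -(ltr0n R).
rewrite cnM cnN cn_nat; apply: le_lt_trans (_ : A / M%:R < eps).
 apply: le_trans (ler_wpM2l (ltW M0) (cexp_quad z)) _.
 rewrite {1}zx expr_div_n.
 have -> : A / M%:R = M%:R * (x ^+ 2 / M%:R ^+ 2 * expR x) by rewrite /A; field; rewrite gt_eqF.
 by rewrite ler_wpM2l ?(ltW M0)// ler_wpM2l ?divr_ge0 ?exprn_ge0 ?(ltW M0)// ler_expR.
rewrite ltr_pdivrMr// -ltr_pdivrMl// mulrC.
apply: lt_le_trans (truncnS_gt _) _; rewrite ler_nat.
by rewrite (leq_ltn_trans hn)//; exact: hm.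
Qed.

Definition int_range (M : nat) : seq int := [seq (i%:Z - M%:Z) | i <- iota 0 M.*2].
Lemma uniq_int_range M : uniq (int_range M).
by rewrite map_inj_uniq ?iota_uniq// => i j; lia. Qed.
Lemma mem_int_range M j : (j \in int_range M) = ((- M%:Z <= j) && (j < M%:Z)).
apply/mapP/idP => [[] i|h]; first by rewrite mem_iota => ? ->; lia.
case: j h => j h; [exists (j + M)%N | exists (M - j.+1)%N]; rewrite ?mem_iota; move: h; lia.
Qed.
Lemma sum_int_range (V : nmodType) (F : int -> V) M :
 \sum_(j <- int_range M) F j = \sum_(i < M.*2) F (i%:Z - M%:Z).
by rewrite big_map -[M.*2]subn0 -/(index_iota 0 M.*2) subn0 big_mkord.
Qed.

(** The condition 2|j| <= M keeps the real part of (t + j)/M within 1/4 + 1/2, the range of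
    [one_sub_e_lower]. The bound does not depend on M and so gives a dominating series. *)
Lemma lip_lower (t : H) : exists2 d : R, 0 < d & exists n0 : nat,
 forall (M : nat) (j : int), (n0 <= M)%N -> (2 * `|j| <= M)%N ->
 d * `|j|.+1%:R <= cn (M%:R * (1 - e ((t° + j%:~R) / M%:R))).
have y0 := uhp_gt0 t; have r0 : 0 <= `|Re t| by [].
have ty := lexx (Im t); have X1 : 1 <= `|Re t| + Im t + 1 by lra.
set X := _ + 1 in X1; have [d d0 hd] := shift_lower y0 X1; have [c c0 hc] := one_sub_e_lower R.
exists (c * d); first exact: mulr_gt0.
exists (Num.truncn (4 * X)).+1 => M j nM jM.
have XM : 4 * X <= M%:R by apply: ltW; apply: lt_le_trans (truncnS_gt _) _; rewrite ler_nat.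
have tX : `|Re t| <= X by rewrite /X; lra.
have tX' : Im t <= X by rewrite /X; lra.
have M0 : 0 < M%:R :> R by lra.
rewrite cnM cn_nat; set w := _ / _; have wE : w = (M%:R^-1 : R)%:C * (t° + j%:~R) by rewrite /w mulrC fmorphV rmorph_nat.
have jE : j%:~R = (j%:~R : R)%:C by rewrite rmorph_int.
have wIm : Im w = Im t / M%:R.
 by rewrite wE jE; case: t° => a b /=; ring.
have wRe : Re w = (Re t + j%:~R) / M%:R.
 by rewrite wE jE; case: t° => a b /=; ring.
have ch : cn (t° + j%:~R) = M%:R * cn w by rewrite /w cnM cnV cn_nat mulrCA mulfV ?mulr1 ?gt_eqF.
have h1 : c * cn w <= cn (1 - e w).
 apply: hc.
 rewrite wRe normrM normfV [`|M%:R|]gtr0_norm// ler_pdivrMr//.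
 apply: le_trans (ler_normD _ _) _.
 have : 2 * `|j%:~R : R| <= M%:R by rewrite -intr_norm -abszE -natrM ler_nat.
 by lra.
 rewrite wIm divr_ge0 ?(ltW (uhp_gt0 t)) ?(ltW M0)//= ler_pdivrMr// mul1r.
 by lra.
rewrite -mulrA; apply: le_trans (_ : c * cn (t° + j%:~R) <= _).
 by rewrite ler_wpM2l ?(ltW c0)// hd.
by rewrite ch mulrCA ler_wpM2l ?(ltW M0).
Qed.

Lemma natr_asc (n s : nat) : s`!%:R * 'C(n + s, s)%:R = \prod_(i < s) (n + i.+1)%:R :> C.
elim: s => [|s IH]; first by rewrite big_ord0 fact0 bin0 mulr1.
rewrite big_ord_recr /= -IH -!natrM; congr (_%:R).
have := mul_bin_diag (n + s).+1 s.
rewrite addnS /= => h; rewrite factS mulnAC -h; lia.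
Qed.

Lemma summ_lip (lam : R) (s : nat) (t : H) : (0 < s)%N ->
 summ (fun j : int => e (- (lam%:C * j%:~R)) / (t° + j%:~R) ^+ s.+1).
move=> s0; have X1 : 1 <= `|Re t| + 1 by have : 0 <= `|Re t| by []; lra.
have [d d0 hd] := shift_lower (uhp_gt0 t) X1.
have h1 : `|Re t| <= `|Re t| + 1 by lra.
have := bsum_intsq R => b.
have b' : bsum (fun j : int => d ^- s.+1 * `|j|.+1%:R ^- 2) (d ^- s.+1 * 6).
 by move=> l ul; rewrite -mulr_sumr ler_wpM2l ?b// invr_ge0 exprn_ge0// ltW.
apply: summW b' => j; rewrite cnM cnV cnX.
have -> : cn (e (- (lam%:C * j%:~R))) = 1 by rewrite real_mul_int -rmorphN cn_e_real.
have jp : 0 < `|j|.+1%:R :> R by rewrite ltr0n.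
rewrite mul1r -invfM lef_pV2 ?posrE; last 2 first.
- by rewrite exprn_gt0//; apply: lt_le_trans (hd t (lexx _) h1 j); rewrite mulr_gt0.
- by rewrite mulr_gt0 ?exprn_gt0.
apply: le_trans (_ : (d * `|j|.+1%:R) ^+ s.+1 <= _); last first.
 by rewrite lerXn2r ?nnegrE ?cn_ge0 ?mulr_ge0 ?(ltW d0)// hd.
by rewrite exprMn ler_wpM2l ?exprn_ge0 ?(ltW d0)// ler_weXn2l ?ler1n.
Qed.

Section Twisted.
Variables (lam : R) (s N k : nat).
Hypotheses (N0 : (0 < N)%N) (kN : (k < N)%N) (lamN : lam = k%:R / N%:R).

Definition lip (t : H) : C :=
 usum (fun j : int => e (- (lam%:C * j%:~R)) / (t° + j%:~R) ^+ s.+1).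

(* Modulus [2 M] with [M] a multiple of [N]: the finite analogue of the sum
 over [j], a power series in [e t] by orthogonality of roots of unity. *)
Variables M D k' : nat -> nat.
Hypotheses (ME : forall n, M n = (N * (n + 4))%N) (DE : forall n, D n = (M n).*2)
 (kE : forall n, k' n = (k * (n + 4)).*2).

Let N0C : N%:R != 0 :> C. Proof. by rewrite pnatr_eq0 -lt0n. Qed.
Let n4 n : (n + 4)%:R != 0 :> C. Proof. by rewrite pnatr_eq0 addn4. Qed.
Let lamE : lam%:C = k%:R / N%:R :> C. Proof. by rewrite lamN rmorphM fmorphV !rmorph_nat. Qed.
Let D0 n : (0 < D n)%N. Proof. by rewrite DE double_gt0 ME; lia. Qed.
Let D0C n : (D n)%:R != 0 :> C. Proof. by rewrite pnatr_eq0 -lt0n. Qed.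
Let lamD n : lam%:C * (D n)%:R = (k' n)%:R.
rewrite lamE DE kE ME -!muln2 !natrM; move: (n4 n); move: ((n + 4)%:R) => p p0.
by field.
Qed.

(** The range is 0, ..., D - 1 shifted by -M, which costs the factor e(-q/2). When D divides q, this
    is 1 because D = 2M. *)
Lemma lip_inner (m n : nat) :
 \sum_(j <- int_range (M n)) e (- (lam%:C * j%:~R)) * e (j%:~R * (m%:R / (D n)%:R)) =
 if `[< exists l : int, m%:Z - (k' n)%:Z = l * (D n)%:Z >] then (D n)%:R else 0.
pose q : int := m%:Z - (k' n)%:Z.
have E (j : int) : e (- (lam%:C * j%:~R)) * e (j%:~R * (m%:R / (D n)%:R)) =
 e (j%:~R * (q%:~R / (D n)%:R)).
 rewrite -eD; congr e; rewrite /q rmorphB /= -!pmulrn -lamD.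
 by field.
under eq_bigr do rewrite E; rewrite sum_int_range -DE.
have E2 (i : 'I_(D n)) : e ((i%:Z - (M n)%:Z)%:~R * (q%:~R / (D n)%:R)) =
 e (- (q%:~R / 2)) * e (i%:R * (q%:~R / (D n)%:R)).
 rewrite -eD; congr e; rewrite rmorphB /= -!pmulrn mulrBl addrC; congr (_ + _).
 rewrite DE -muln2 natrM.
 have : (M n)%:R != 0 :> C by have := D0 n; rewrite DE double_gt0 pnatr_eq0 -lt0n.
 by move=> M1; field.
under eq_bigr do rewrite E2; rewrite -mulr_sumr.
case: asboolP => h; last first.
 by rewrite sum_roots// ?mulr0// => x; apply/eqP => hx; apply: h; exists x.
have [x hx] := h.
have -> : \sum_(i < D n) e (i%:R * (q%:~R / (D n)%:R)) = (D n)%:R.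
 rewrite (eq_bigr (fun=> 1)) => [|i _]; first by rewrite sumr_const card_ord.
 rewrite /q hx rmorphM /= -pmulrn mulfK//.
 have -> : i%:R * x%:~R = (i%:Z * x)%:~R :> C by rewrite rmorphM.
 exact: e_int.
have -> : e (- (q%:~R / 2)) = 1; last by rewrite mul1r.
have -> : - (q%:~R / 2) = (- (x * (M n)%:Z))%:~R :> C.
 rewrite /q hx rmorphN !rmorphM /= -!pmulrn DE -muln2 natrM.
 by field.
exact: e_int.
Qed.

(** Expand each power by [ps_negbin] and sum over j first. Orthogonality keeps the indices m = k' +
    D l, and k' < D rules out negative l. *)
Lemma lip_finite (t : H) n :
 \sum_(j <- int_range (M n)) e (- (lam%:C * j%:~R)) *
 ((D n)%:R * (1 - e ((t° + j%:~R) / (D n)%:R))) ^- s.+1 =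
 usum (fun l => (D n)%:R ^- s * 'C(k' n + D n * l + s, s)%:R * e ((lam%:C + l%:R) * t°)).
have [tb hb] := ps_negbin R s.
have zE (j : int) : e ((t° + j%:~R) / (D n)%:R) =
 e (t° / (D n)%:R) * e (j%:~R / (D n)%:R) by rewrite -eD mulrDl.
have z1 (j : int) : cn (e ((t° + j%:~R) / (D n)%:R)) < 1.
 rewrite cn_e expR_lt1 oppr_lt0 !mulr_gt0 ?pi_gt0//.
 have -> : (t° + j%:~R) / (D n)%:R = ((D n)%:R^-1 : R)%:C * (t° + (j%:~R : R)%:C).
 by rewrite mulrC fmorphV rmorph_nat rmorph_int.
 have : 0 < (D n)%:R^-1 :> R by rewrite invr_gt0 ltr0n.
 have := uhp_gt0 t; case: t° => a b /= b0 p0.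
 by rewrite addr0 mul0r addr0 mulr_gt0.
have S j := summ_ps tb (z1 j).
pose u := e (t° / (D n)%:R).
have zX (j : int) m : e ((t° + j%:~R) / (D n)%:R) ^+ m =
 u ^+ m * e (j%:~R * (m%:R / (D n)%:R)).
 by rewrite zE exprMn [X in _ * X = _]eX; congr (_ * e _); ring.
transitivity (usum (fun m => (D n)%:R ^- s.+1 * ('C(m + s, s)%:R * u ^+ m *
 \sum_(j <- int_range (M n)) e (- (lam%:C * j%:~R)) * e (j%:~R * (m%:R / (D n)%:R))))).
 pose Fj (j : int) m := ((D n)%:R ^- s.+1 * e (- (lam%:C * j%:~R))) *
 ('C(m + s, s)%:R * e ((t° + j%:~R) / (D n)%:R) ^+ m).
 transitivity (\sum_(j <- int_range (M n)) usum (Fj j)).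
 apply: eq_bigr => j _; rewrite usumZ// -/(ps _ _) hb// exprMn invfM.
 by rewrite mulrCA mulrA.
 rewrite -usum_sum => [|j]; last exact: summZ.
 apply: eq_usum => m; rewrite mulr_sumr mulr_sumr; apply: eq_bigr => j _.
 by rewrite /Fj zX; ring.
pose G m := (D n)%:R ^- s * ('C(m + s, s)%:R * u ^+ m) *
 (if `[< exists l : int, m%:Z - (k' n)%:Z = l * (D n)%:Z >] then 1 else 0 : C).
have u1 : cn u < 1 by have := z1 0; rewrite addr0.
have sG : summ G.
 apply: summ_le (summZ ((D n)%:R ^- s) (summ_ps tb u1)) => m.
 by rewrite /G [X in X <= _]cnM; case: ifP => _; rewrite ?cn0 ?cn1 ?mulr1// mulr0 cn_ge0.
rewrite (eq_usum (G := G)); last first.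
 move=> m; rewrite lip_inner /G; case: ifP => _; last by rewrite !mulr0.
 by rewrite exprS invfM; have := D0C n; move: ((D n)%:R) => d d0; field; rewrite expf_neq0.
have k'D : (k' n < D n)%N by rewrite kE DE ME ltn_double ltn_mul2r addn4.
rewrite (@usum_inj _ _ _ (fun l => (k' n + D n * l)%N)) //.
- apply: eq_usum => l; rewrite /G.
 have -> : `[< exists l0 : int, (k' n + D n * l)%:Z - (k' n)%:Z = l0 * (D n)%:Z >].
 by apply/asboolP; exists l%:Z; lia.
 rewrite mulr1 -mulrA /u eX; congr (_ * (_ * e _)).
 by rewrite natrD natrM -lamD; have := D0C n; move: ((D n)%:R) => d d0; field.
- move=> l l' /eqP; rewrite eqn_add2l eqn_pmul2l// => /eqP//.
- move=> m h; rewrite /G; case: asboolP => [[l hl]|_]; last by rewrite mulr0.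
 exfalso; apply: h; have l0 : 0 <= l.
 case: (ltP l 0) => // l0; have : l * (D n)%:Z <= - (D n)%:Z by nia.
 by rewrite -hl; lia.
 by case: l l0 hl => // l _ hl; exists l; lia.
Qed.

Definition lip_coef l : C := (- tpi) ^+ s.+1 / s`!%:R * (lam%:C + l%:R) ^+ s.

(** Both sides of [lip_finite] converge by domination. On the left D (1 - e(w/D)) tends to -2 pi i
    w; on the right D^-s times the binomial is a product of the factors lam + l + i/D over s!, which
    tends to (lam + l)^s / s!. *)
Lemma lip_QE_aux : (0 < s)%N -> QEc lam lip_coef lip.
move=> s0.
have ts1 : tame (fun n => n.+1%:R ^+ s : C).
 by have [] := ps_shift (@tame_natX R s) _; first by rewrite expr0n gtn_eqF.
have lam01 : 0 <= lam < 1 by rewrite lamN divr_ge0//= ltr_pdivrMr ?ltr0n// mul1r ltr_nat.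
split.
 apply: tame_le (tameZ ((- tpi) ^+ s.+1 / s`!%:R) ts1) => l.
 rewrite !cnM ler_wpM2l ?mulr_ge0 ?cn_ge0// !cnX lerXn2r ?nnegrE ?cn_ge0//.
 apply: le_trans (cnD _ _) _; rewrite !cn_nat cn_real ger0_norm; last by case/andP: lam01.
 by rewrite -natr1 addrC lerD2l; case/andP: lam01 => _ /ltW.
move=> t; have [d d0 [n0 hd]] := lip_lower t; pose g n := (n + n0)%N.
have unit_e (j : int) : cn (e (- (lam%:C * j%:~R))) = 1 by rewrite real_mul_int -rmorphN cn_e_real.
pose F n (j : int) := if j \in int_range (M (g n)) then e (- (lam%:C * j%:~R)) *
 ((D (g n))%:R * (1 - e ((t° + j%:~R) / (D (g n))%:R))) ^- s.+1 else 0.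
pose b (j : int) : R := d ^- s.+1 * `|j|.+1%:R ^- 2.
have bB : bsum b (d ^- s.+1 * 6).
 by move=> l ul; rewrite -mulr_sumr ler_wpM2l ?bsum_intsq// invr_ge0 exprn_ge0// ltW.
have Fb n j : cn (F n j) <= b j.
 have jp : 0 < `|j|.+1%:R :> R by rewrite ltr0n.
 have b0 : 0 <= b j by rewrite mulr_ge0 ?invr_ge0 ?exprn_ge0// ltW.
 rewrite /F; case: ifPn => jr; last by rewrite cn0.
 have h := hd (D (g n)) j ltac:(rewrite DE ME /g; nia) ltac:(by move: jr; rewrite mem_int_range DE; lia).
 rewrite cnM unit_e mul1r cnV cnX /b -invfM lef_pV2 ?posrE; last 2 first.
 - by rewrite exprn_gt0//; apply: lt_le_trans h; rewrite mulr_gt0.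
 - by rewrite mulr_gt0 ?exprn_gt0.
 apply: le_trans (_ : (d * `|j|.+1%:R) ^+ s.+1 <= _); last first.
 by rewrite lerXn2r ?nnegrE ?mulr_ge0 ?cn_ge0 ?(ltW d0).
 by rewrite exprMn ler_wpM2l ?exprn_ge0 ?(ltW d0)// ler_weXn2l ?ler1n.
have t0 (j : int) : - (tpi * (t° + j%:~R)) != 0.
 rewrite oppr_eq0 mulf_neq0 ?tpi_neq0//; apply/eqP => /(congr1 Im).
 rewrite raddfD /= -(rmorph_int (real_complex R)) /= addr0 => h.
 by have := uhp_gt0 t; rewrite h ltxx.
have FG j : clim (fun n => F n j)
 (e (- (lam%:C * j%:~R)) * (- (tpi * (t° + j%:~R))) ^- s.+1).
 have gDn n : (n < D (g n))%N by rewrite DE ME /g; nia.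
 have := climZ (e (- (lam%:C * j%:~R)))
 (climV (expf_neq0 s.+1 (t0 j)) (climX s.+1 (clim_one_sub_e (t° + j%:~R) gDn))).
 move=> h eps e0; have [n1 h1] := h _ e0; exists (n1 + `|j|.+1)%N => n hn.
 rewrite /F; have -> : j \in int_range (M (g n)) by rewrite mem_int_range ME /g; nia.
 by apply: h1; lia.
have lim1 := clim_usum Fb bB FG.
have usF n : usum (F n) = usum (fun l => (D (g n))%:R ^- s *
 'C(k' (g n) + D (g n) * l + s, s)%:R * e ((lam%:C + l%:R) * t°)).
 rewrite -lip_finite (@usum_fin _ _ _ (int_range (M (g n)))).
 - by rewrite big_seq [RHS]big_seq; apply: eq_bigr => j jr; rewrite /F jr.
 - exact: uniq_int_range.
 - by move=> j jr; rewrite /F (negbTE jr).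
pose a n l : C := (D (g n))%:R ^- s * 'C(k' (g n) + D (g n) * l + s, s)%:R.
have aE n l : a n l = s`!%:R^-1 * \prod_(i < s) (lam%:C + l%:R + i.+1%:R / (D (g n))%:R).
 have f0 : s`!%:R != 0 :> C by rewrite pnatr_eq0 -lt0n fact_gt0.
 apply: (mulfI f0); rewrite mulVKf// /a mulrCA natr_asc.
 rewrite -[s in _ ^- s]card_ord -prodr_const -prodfV -big_split /=.
 apply: eq_bigr => i _; rewrite !natrD natrM -lamD; have := D0C (g n).
 by move: ((D (g n))%:R) => x x0; field.
have ab n l : cn (a n l) <= cn (s.+1%:R ^+ s * l.+1%:R ^+ s).
 rewrite aE [leLHS]cnM cnV cn_nat cn_prod -exprMn -natrM cnX cn_nat.
 apply: le_trans (_ : 1 * \prod_(i < s) (s.+1 * l.+1)%:R <= _); last first.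
 by rewrite prodr_const card_ord mul1r.
 apply: ler_pM; rewrite ?invr_ge0//; first by apply: prodr_ge0 => i _; exact: cn_ge0.
 by rewrite invf_le1 ?ltr0n ?fact_gt0// ler1n fact_gt0.
 apply: ler_prod => i _; rewrite cn_ge0 /=.
 apply: le_trans (cnD _ _) _; apply: le_trans (lerD (cnD _ _) (lexx _)) _.
 rewrite cnM cnV !cn_nat cn_real ger0_norm; last by case/andP: lam01.
 have h1 : i.+1%:R / (D (g n))%:R <= s%:R :> R.
 rewrite ler_pdivrMr ?ltr0n// -natrM ler_nat; apply: leq_trans (ltn_ord i) _.
 by rewrite leq_pmulr.
 have : lam <= 1 by case/andP: lam01 => _ /ltW.
 have : (0 : R) <= s%:R * l%:R by rewrite -natrM.
 by rewrite natrM -!natr1; lra.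
have Dinv : clim (fun n => (D (g n))%:R^-1 : C) 0.
 have h : forall n, (n <= (D (g n)).-1)%N by move=> n; rewrite DE ME /g; nia.
 by move: (clim_subseq h (@clim_invn R)); apply: eq_clim => n; rewrite prednK.
have lim2 : clim (fun n => usum (fun l => a n l * e ((lam%:C + l%:R) * t°)))
 (usum (fun l => (s`!%:R^-1 * (lam%:C + l%:R) ^+ s) * e ((lam%:C + l%:R) * t°))).
 have [B hB] := summZ (s.+1%:R ^+ s * e (lam%:C * t°)) (summ_ps ts1 (cn_e_uhp t)).
 apply: (clim_usum _ hB) => [n l|l].
 rewrite mulrDl eD -eX.
 have -> : s.+1%:R ^+ s * e (lam%:C * t°) * (l.+1%:R ^+ s * e t ^+ l) =
 (s.+1%:R ^+ s * l.+1%:R ^+ s) * (e (lam%:C * t°) * e t ^+ l) by ring.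
 by rewrite [leLHS]cnM [leRHS]cnM ler_wpM2r ?cn_ge0.
 apply: climM; last exact: clim_cst.
 have h : clim (fun n => s`!%:R^-1 * \prod_(i < s) (lam%:C + l%:R + i.+1%:R * (D (g n))%:R^-1))
 (s`!%:R^-1 * \prod_(i < s) (lam%:C + l%:R + i.+1%:R * 0)).
 apply: climZ; apply: clim_prod => i; apply: climD; first exact: clim_cst.
 exact: climZ.
 move: h; under eq_bigr do rewrite mulr0 addr0.
 rewrite prodr_const card_ord; apply: eq_clim => n; by rewrite aE.
have /clim_unique/(_ lim1) := eq_clim (fun n => esym (usF n)) lim2.
have E j : e (- (lam%:C * j%:~R)) * (- (tpi * (t° + j%:~R))) ^- s.+1 =
 (- tpi) ^- s.+1 * (e (- (lam%:C * j%:~R)) / (t° + j%:~R) ^+ s.+1).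
 exact: div_expNM.
rewrite (eq_usum E) usumZ; last exact: summ_lip.
rewrite -/(lip t) => /esym h.
have p0 : (- tpi) ^+ s.+1 != 0 :> C by rewrite expf_neq0// oppr_eq0 tpi_neq0.
have -> : lip t = (- tpi) ^+ s.+1 * usum (fun l => (s`!%:R^-1 * (lam%:C + l%:R) ^+ s) *
 e ((lam%:C + l%:R) * t°)).
 by rewrite -h mulVKf.
have tcf : tame (fun l => s`!%:R^-1 * (lam%:C + l%:R) ^+ s).
 apply: tame_le (tameZ (s`!%:R^-1) ts1) => l.
 rewrite !cnM ler_wpM2l ?cn_ge0// !cnX lerXn2r ?nnegrE ?cn_ge0//.
 apply: le_trans (cnD _ _) _; rewrite !cn_nat cn_real ger0_norm; last by case/andP: lam01.
 by rewrite -natr1 addrC lerD2l; case/andP: lam01 => _ /ltW.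
have S := summ_ps tcf (cn_e_uhp t).
rewrite (eq_usum (G := fun l => e (lam%:C * t°) *
 ((s`!%:R^-1 * (lam%:C + l%:R) ^+ s) * e t ^+ l))); last first.
 by move=> l; rewrite mulrDl eD -eX; ring.
rewrite usumZ// mulrCA -usumZ//; congr (_ * _); apply: eq_usum => l.
by rewrite /lip_coef; ring.
Qed.

End Twisted.

Lemma lip_QE (lam : R) (s N k : nat) : (0 < s)%N -> (k < N)%N -> lam = k%:R / N%:R ->
 QEc lam (lip_coef lam s) (lip lam s).
move=> s0 kN lamN; apply: (@lip_QE_aux lam s N k _ kN lamN
 (fun n => N * (n + 4))%N (fun n => (N * (n + 4)).*2) (fun n => (k * (n + 4)).*2)) => //.
exact: leq_ltn_trans kN.
Qed.

End Lipschitz.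

(** * Partial fractions of the cotangent *)

Section Cotangent.
Variable R : realType.
Local Notation C := R[i].
Local Notation e := (@cexp2pi R).
Local Notation H := (uhp R).
Local Notation Im := (@complex.Im R).
Local Notation tpi := (@tpi R).

Lemma sum_int_rangeS (V : zmodType) (F : int -> V) M : \sum_(j <- int_range M.+1) F j =
 F (- M.+1%:Z) + \sum_(j <- int_range M) F j + F M%:Z.
rewrite !sum_int_range doubleS big_ord_recr big_ord_recl /=; congr (F _ + _ + F _); try lia.
by apply: eq_bigr => i _; congr F; rewrite /bump /=; lia.
Qed.

Lemma sum_int_range_sym (V : comNzRingType) (F : int -> V) M : (0 < M)%N ->
 \sum_(j <- int_range M) F j =
 F (- M%:Z) + (F 0 + \sum_(1 <= i < M) (F i%:Z + F (- i%:Z))).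
elim: M => // -[|M] IH _.
 by rewrite sum_int_rangeS big_geq// big_nil !addr0.
rewrite [in RHS]big_nat_recr//= sum_int_rangeS IH//; ring.
Qed.

Lemma pred_dblR (m : nat) : (0 < m)%N -> m.-1%:R = m.*2%:R / 2 - 1 :> C.
by case: m => // m _; rewrite -muln2 natrM mulfK ?pnatr_eq0//= -natr1 addrK. Qed.
Lemma inv_pair (p a b : C) : p != 0 -> a != 0 -> b != 0 ->
 a^-1 + b^-1 = - p * (- (p * a)^-1 - (p * b)^-1).
by move=> p0 a0 b0; field; rewrite p0 a0 b0. Qed.
Lemma one_sub_e_neq0 (t : H) : 1 - e t != 0.
apply/eqP => /eqP; rewrite subr_eq0 => /eqP h; have := cn_e_uhp t.
by rewrite -h cn1 ltxx.
Qed.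
Lemma uhp_addint_neq0 (t : H) (j : int) : t° + j%:~R != 0.
apply/eqP => /(congr1 Im); rewrite raddfD /= -(rmorph_int (real_complex R)) /= addr0 => h.
by have := uhp_gt0 t; rewrite h ltxx.
Qed.

Lemma one_sub_e_upper (w : C) (M : nat) : (0 < M)%N ->
 cn (M%:R * (1 - e (w / M%:R))) <= cn (tpi * w) * (1 + cn (tpi * w) * expR (cn (tpi * w))).
move=> M0; set x := cn (tpi * w); have x0 : 0 <= x := cn_ge0 _.
have M0R : 0 < M%:R :> R by rewrite ltr0n.
rewrite eE; set z := tpi * (w / M%:R); have zx : cn z = x / M%:R by rewrite /z mulrA cnM cnV cn_nat.
have zle : cn z <= x by rewrite zx ler_pdivrMr// ler_peMr// ler1n.
have -> : M%:R * (1 - cexp z) = - (M%:R * (z + (cexp z - 1 - z))) by ring.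
rewrite cnN cnM cn_nat.
apply: le_trans (_ : M%:R * (cn z + cn z ^+ 2 * expR (cn z)) <= _).
 rewrite ler_wpM2l ?(ltW M0R)//; apply: le_trans (cnD _ _) _; rewrite lerD2l; exact: cexp_quad.
have -> : M%:R * (cn z + cn z ^+ 2 * expR (cn z)) = (M%:R * cn z) * (1 + cn z * expR (cn z)) by ring.
have -> : M%:R * cn z = x by rewrite zx mulrCA mulfV ?mulr1 ?gt_eqF.
by rewrite ler_wpM2l// lerD2l ler_pM ?cn_ge0 ?expR_ge0// ler_expR.
Qed.

(** This is pi cot(pi t). The terms j and -j are paired because the sum of 1/(t + j) alone is not
    absolutely convergent. *)
Definition csum (t : H) : C :=
 usum (fun i : nat => if i is 0%N then t°^-1
 else (t° + i%:R)^-1 + (t° - i%:R)^-1).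

Lemma lip0_finite (t : H) (M : nat) : (4 <= M)%N ->
 \sum_(j <- int_range M) ((M.*2)%:R * (1 - e ((t° + j%:~R) / (M.*2)%:R)))^-1 =
 (1 - e t)^-1.
move=> M4.
have := @lip_finite R 0 0 1 0 (ltn0Sn 0) _ _ (fun n => 1 * (n + 4))%N
 (fun n => (1 * (n + 4)).*2) (fun n => (0 * (n + 4)).*2).
move=> /(_ (ltn0Sn 0) _ (fun=> erefl) (fun=> erefl) (fun=> erefl) t (M - 4)%N).
rewrite mul1n subnK// => h.
have -> : (1 - e t)^-1 = ps (fun=> 1) (e t) by rewrite ps_geo// cn_e_uhp.
transitivity (\sum_(j <- int_range M) e (- ((0 : R)%:C * j%:~R)) /
 (M.*2%:R * (1 - e ((t° + j%:~R) / M.*2%:R))) ^+ 1).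
 by apply: eq_bigr => j _; rewrite mul0r oppr0 e0 mul1r expr1.
rewrite h ?mul0r//; apply: eq_usum => l.
by rewrite expr0 invr1 bin0 !mul1r add0r -eX.
Qed.

Lemma csum_summ_E (t : H) :
 summ (fun i : nat => if i is 0%N then t°^-1
 else (t° + i%:R)^-1 + (t° - i%:R)^-1) /\
 csum t = - (tpi / 2) * ((1 + e t) / (1 - e t)).
have [d d0 [nd hd]] := lip_lower t.
pose n0 := (nd + 4)%N; pose M n := (n + n0)%N; pose D n := (M n).*2.
have D0 n : (0 < D n)%N by rewrite /D /M /n0; lia.
have D0C n : (D n)%:R != 0 :> C by rewrite pnatr_eq0 -lt0n.
have D0R n : 0 < (D n)%:R :> R by rewrite ltr0n.
pose A n (j : int) := ((D n)%:R * (1 - e ((t° + j%:~R) / (D n)%:R)))^-1.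
have lowA n (j : int) : (`|j| <= M n)%N ->
 d * `|j|.+1%:R <= cn ((D n)%:R * (1 - e ((t° + j%:~R) / (D n)%:R))).
 by rewrite /M /n0 => jM; apply: hd; rewrite /D /M /n0; lia.
have Ab n (j : int) : (`|j| <= M n)%N -> cn (A n j) <= d^-1 * `|j|.+1%:R^-1.
 move=> /lowA h; rewrite /A cnV -invfM lef_pV2 ?posrE ?mulr_gt0//.
 by apply: lt_le_trans h; rewrite mulr_gt0.
pose B := cn (tpi * (2 * t°)) * (1 + cn (tpi * (2 * t°)) * expR (cn (tpi * (2 * t°)))).
have B0 : 0 <= B by rewrite mulr_ge0 ?addr_ge0 ?mulr_ge0 ?cn_ge0 ?expR_ge0.
(* At finite level the pairs are dominated only after subtracting 1/D: 1/(Du) + 1/(Dv) - 1/D = D (u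
   + v - uv) / (Du Dv), where u + v - uv = 1 - e(2t/D), so the numerator stays bounded. The
   subtracted terms add up to nearly 1/2. *)
pose F n i : C := if (i < M n)%N then
 if i is 0%N then A n 0 - (2 * (D n)%:R)^-1 else A n i%:Z + A n (- i%:Z) - (D n)%:R^-1
 else 0.
pose G i : C := if i is 0%N then - (tpi * t°)^-1
 else - (tpi * (t° + i%:R))^-1 - (tpi * (t° - i%:R))^-1.
pose K := B / d ^+ 2 + d^-1 + 1.
have di : 0 < d^-1 by rewrite invr_gt0.
have FbB : bsum (fun i : nat => K * (i.+1%:R ^- 2)) (K * 3).
 move=> s us; rewrite -mulr_sumr ler_wpM2l//.
 by rewrite !addr_ge0 ?divr_ge0 ?exprn_ge0 ?(ltW d0) ?(ltW di).
 exact: (bsumW (@sqr_alpha R) (bsum_alpha R)).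
have Fb n i : cn (F n i) <= K * (i.+1%:R ^- 2).
 have K0 : 0 <= K by rewrite !addr_ge0 ?divr_ge0 ?exprn_ge0 ?(ltW d0) ?(ltW di).
 rewrite /F; case: ltnP => iM; last by rewrite cn0 mulr_ge0 ?invr_ge0 ?exprn_ge0.
 case: i iM => [|i] iM.
 apply: le_trans (cnB _ _) _; rewrite expr1n invr1 mulr1.
 have := Ab n 0 isT; rewrite invr1 mulr1 => h.
 have : cn ((2 * (D n)%:R)^-1 : C) <= 1.
 rewrite cnV cnM !cn_nat -natrM invf_le1 ?ltr0n ?muln_gt0 ?D0//.
 by rewrite ler1n; have := D0 n; lia.
 have : 0 <= B / d ^+ 2 by rewrite divr_ge0 ?exprn_ge0 ?(ltW d0).
 by rewrite /K; lra.
 set u := 1 - e ((t° + i.+1%:Z%:~R) / (D n)%:R).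
 set v := 1 - e ((t° + (- i.+1%:Z)%:~R) / (D n)%:R).
 have lu := lowA n i.+1 (ltnW iM); rewrite -/u absz_nat in lu.
 have lv := lowA n (- i.+1%:Z) _; rewrite abszN absz_nat -/v in lv; have {}lv := lv (ltnW iM).
 have dp : 0 < d * i.+2%:R by rewrite mulr_gt0.
 have u0 : u != 0.
 by apply/eqP => hu; move: (lt_le_trans dp lu); rewrite hu mulr0 cn0 ltxx.
 have v0 : v != 0.
 by apply/eqP => hv; move: (lt_le_trans dp lv); rewrite hv mulr0 cn0 ltxx.
 have uv : u + v - u * v = 1 - e (2 * t° / (D n)%:R).
 have -> : e (2 * t° / (D n)%:R) = (1 - u) * (1 - v); last by ring.
 rewrite /u /v !subKr -eD; congr e; rewrite rmorphN /=; ring.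
 have -> : A n i.+1 + A n (- i.+1%:Z) - (D n)%:R^-1 =
 ((D n)%:R * (1 - e (2 * t° / (D n)%:R))) / (((D n)%:R * u) * ((D n)%:R * v)).
 rewrite /A -/u -/v -uv; have := D0C n; move: ((D n)%:R) => x x0.
 by field; rewrite ?x0 ?u0 ?v0.
 rewrite cnM cnV.
 apply: le_trans (_ : B * ((d * i.+2%:R) * (d * i.+2%:R))^-1 <= _).
 apply: ler_pM; rewrite ?cn_ge0 ?invr_ge0 ?cn_ge0//.
 exact: one_sub_e_upper.
 rewrite lef_pV2 ?posrE ?mulr_gt0//; last first.
 by rewrite cnM mulr_gt0// cn_gt0 mulf_neq0.
 by rewrite [leRHS]cnM; apply: ler_pM => //; exact: ltW.
 have -> : (d * i.+2%:R * (d * i.+2%:R))^-1 = d ^- 2 * i.+2%:R ^- 2 by rewrite -expr2 exprMn invfM.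
 by rewrite mulrA ler_wpM2r ?invr_ge0 ?exprn_ge0// /K -addrA lerDl; lra.
have hDn n : (n < D n)%N by rewrite /D /M /n0; lia.
have limA j : clim (fun n => A n j) (- (tpi * (t° + j%:~R))^-1).
 rewrite -invrN; apply: climV; last exact: clim_one_sub_e.
 by rewrite oppr_eq0 mulf_neq0 ?tpi_neq0 ?uhp_addint_neq0.
have Dinv : clim (fun n => (D n)%:R^-1 : C) 0.
 have h : forall n, (n <= (D n).-1)%N by move=> n; have := hDn n; lia.
 by move: (clim_subseq h (@clim_invn R)); apply: eq_clim => n; rewrite prednK.
have FG i : clim (fun n => F n i) (G i).
 have ev (u : nat -> C) l : clim u l -> (forall n, (i < M n)%N -> F n i = u n) -> clim (fun n => F n i) l.
 move=> h hF eps e0; have [n1 h1] := h _ e0; exists (n1 + i.+1)%N => n hn.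
 by rewrite hF; [apply: h1; lia | rewrite /M; lia].
 case: i ev => [|i] ev.
 apply: (ev (fun n => A n 0 + (- 2^-1) * (D n)%:R^-1)) => [|n iM].
 rewrite /G -[X in clim _ X]addr0 -[X in _ + X](mulr0 (- 2^-1)); apply: climD; last exact: climZ.
 by have := limA 0; rewrite addr0.
 by rewrite /F iM invfM mulNr.
 apply: (ev (fun n => A n i.+1 + A n (- i.+1%:Z) + (- 1) * (D n)%:R^-1)) => [|n iM].
 rewrite /G -[X in clim _ X]addr0 -[X in _ + X](mulr0 (-1)); apply: climD; last exact: climZ.
 apply: climD; first exact: limA.
 by have := limA (- i.+1%:Z); rewrite rmorphN.
 by rewrite /F iM mulN1r.
have lim1 := clim_usum Fb FbB FG.
(* [int_range] is half-open, so -M has no partner; its term is split off and tends to 0. *)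
have usF n : usum (F n) = (1 - e t)^-1 - 2^-1 - (A n (- (M n)%:Z) - (2 * (D n)%:R)^-1).
 have M0 : (0 < M n)%N by rewrite /M /n0; lia.
 rewrite -(lip0_finite t (_ : (4 <= M n)%N)); last by rewrite /M /n0; lia.
 rewrite -/(D n) -/(A n _) (@usum_fin _ _ _ (iota 0 (M n))) ?iota_uniq//; last first.
 by move=> i; rewrite mem_iota /F add0n; case: ltnP.
 have -> : iota 0 (M n) = index_iota 0 (M n) by rewrite /index_iota subn0.
 have S1 : \sum_(j <- int_range (M n)) A n j = A n (- (M n)%:Z) +
 (A n 0 + \sum_(1 <= i < M n) (A n i%:Z + A n (- i%:Z))).
 exact: sum_int_range_sym.
 rewrite S1 big_ltn// /F M0.
 have -> : \sum_(1 <= i < M n) (if (i < M n)%N then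
 match i with 0%N => A n 0 - (2 * (D n)%:R)^-1
 | _ => A n i%:Z + A n (- i%:Z) - (D n)%:R^-1 end else 0) =
 \sum_(1 <= i < M n) (A n i%:Z + A n (- i%:Z)) - (M n).-1%:R * (D n)%:R^-1.
 have -> : (M n).-1%:R / (D n)%:R = \sum_(1 <= i < M n) (D n)%:R^-1 :> C by rewrite sumr_const_nat subn1 mulr_natl.
 rewrite -sumrB big_nat [RHS]big_nat.
 by apply: eq_bigr => -[|i] /andP[// _ ->].
 have -> : (M n).-1%:R = (D n)%:R / 2 - 1 :> C.
 exact: pred_dblR.
 have := D0C n; move: ((D n)%:R) => x x0; field.
 exact: x0.
have lim2 : clim (fun n => usum (F n)) ((1 - e t)^-1 - 2^-1).
 have h0 : clim (fun n => A n (- (M n)%:Z) - (2 * (D n)%:R)^-1) 0.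
 rewrite -[X in clim _ X](addr0 0); apply: climD; last first.
 have := climZ (- 2^-1) Dinv; rewrite mulr0; apply: eq_clim => n.
 by rewrite invfM mulNr.
 move=> eps e0; have [n1 h1] := climZ (d^-1)%:C (@clim_invn R) e0.
 exists n1 => n hn; rewrite subr0; apply: le_lt_trans (h1 n hn).
 rewrite mulr0 subr0 cnM cn_real cnV cn_nat (gtr0_norm di).
 apply: le_trans (Ab n _ _) _; first by rewrite abszN absz_nat.
 rewrite ler_wpM2l ?(ltW di)// abszN absz_nat lef_pV2 ?posrE ?ltr0n// ler_nat /M; lia.
 have := climD (clim_cst ((1 - e t)^-1 - 2^-1)) (climZ (-1) h0).
 by rewrite mulr0 addr0; apply: eq_clim => n; rewrite usF mulN1r.
have GE : usum G = (1 - e t)^-1 - 2^-1 by exact: clim_unique lim1 lim2.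
have sG : summ G.
 apply: summW FbB => i; apply/ler_addgt0Pr => eps e0.
 have [n1 h1] := FG i _ e0; have -> : G i = F n1 i - (F n1 i - G i) by ring.
 by apply: le_trans (cnB _ _) _; rewrite lerD// ltW// h1.
have GF : forall i, (- tpi) * G i = (if i is 0%N then t°^-1
 else (t° + i%:R)^-1 + (t° - i%:R)^-1).
 apply: fsym => -[|i]; have p0 := tpi_neq0 R; rewrite /G.
 by have := uhp_neq0 t => t0; field; rewrite t0.
 have h1 : t° + i.+1%:R != 0 := uhp_addint_neq0 t i.+1.
 have h2 : t° - i.+1%:R != 0.
 by have := uhp_addint_neq0 t (- i.+1%:Z); rewrite rmorphN.
 exact: inv_pair.
split; first exact: eq_summ GF (summZ _ sG).
rewrite /csum -(eq_usum GF) usumZ// GE; have := one_sub_e_neq0 t; move: (e t) => q q1; field.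
exact: q1.
Qed.

Lemma csumE (t : H) : csum t = - (tpi / 2) * ((1 + e t) / (1 - e t)).
by have [] := csum_summ_E t. Qed.

End Cotangent.

(** * Lattice sums arranged by rows *)

Section Lattice.
Variable R : realType.
Local Notation C := R[i].
Local Notation e := (@cexp2pi R).
Local Notation H := (uhp R).
Local Notation Im := (@complex.Im R).
Local Notation Re := (@complex.Re R).

Lemma hsum_int_clim (F : int -> C) l : hsum F l -> clim (fun M => \sum_(j <- int_range M) F j) l.
move=> hF eps e0; have [s0 h0] := hF _ e0.
exists (\max_(j <- s0) `|j|.+1)%N => n hn; apply: h0; first exact: uniq_int_range.
move=> j js; rewrite mem_int_range.
have : (`|j|.+1 <= n)%N by apply: leq_trans hn; exact: (@leq_bigmax_seq _ _ _ (fun j : int => `|j|.+1)).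
lia.
Qed.

Lemma telescope_int (f : int -> C) M :
 \sum_(j <- int_range M) (f j - f (j + 1)) = f (- M%:Z) - f M%:Z.
elim: M => [|M IH]; first by rewrite big_nil oppr0 subrr.
rewrite sum_int_rangeS IH; have -> : - M.+1%:Z + 1 = - M%:Z by lia.
have -> : M%:Z + 1 = M.+1%:Z by lia.
ring.
Qed.

Lemma usum_telescope (f : int -> C) l : summ (fun j => f j - f (j + 1)) ->
 clim (fun M : nat => f (- M%:Z) - f M%:Z) l -> usum (fun j => f j - f (j + 1)) = l.
move=> sf fl; apply: clim_unique fl; apply: eq_clim (hsum_int_clim (usumP sf)) => M.
exact: telescope_int.
Qed.
Lemma summ_D1 (I : choiceType) (F : I -> C) (a : I) : summ F -> summ (fun i => if i == a then 0 else F i).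
by apply: summ_le => i; case: eqP => _; rewrite ?cn0 ?cn_ge0. Qed.

Lemma usum_D1 (I : choiceType) (F : I -> C) (a : I) : summ F ->
 usum (fun i => if i == a then 0 else F i) = usum F - F a.
move=> sF; have h i : i \notin [:: a] -> (if i == a then F a else 0) = 0 by rewrite inE => /negbTE ->.
have <- : usum (fun i => if i == a then F a else 0) = F a.
 by rewrite (usum_fin (s := [:: a]))// big_seq1 eqxx.
rewrite -usumB//; last exact: summ_fin h.
by apply: eq_usum => i; case: eqP => [->|_]; rewrite ?subrr ?subr0.
Qed.

Lemma usum_natS (F : nat -> C) : summ F -> usum F = F 0%N + usum (fun n => F n.+1).
move=> sF; have := usum_D1 0%N sF; rewrite (@usum_inj _ _ _ succn) => [h| | |].
- by rewrite -[usum F](subrK (F 0%N)) -h addrC.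
- by move=> i j [].
- by move=> [|i] h //=; case: h; exists i.
- exact: summ_D1.
Qed.

Lemma usum_int_pair (f : int -> C) : summ (fun c : int => if c == 0 then 0 else f c) ->
 usum (fun c : int => if c == 0 then 0 else f c) = usum (fun i : nat => f i.+1%:Z + f (- i.+1%:Z)).
move=> sf; have [s1 <-] := usum_group absz sf.
have E k : usum (fun i : int => if `|i|%N == k then if i == 0 then 0 else f i else 0) =
 if k is i.+1 then f i.+1%:Z + f (- i.+1%:Z) else 0.
 case: k => [|k].
 rewrite (eq_usum (G := fun _ => 0)) ?usum0// => i; case: eqP => [/eqP|_] //.
 by rewrite absz_eq0 => ->.
 rewrite (usum_fin (s := [:: k.+1%:Z; - k.+1%:Z])).
 - by rewrite big_cons big_seq1 abszN absz_nat eqxx oppr_eq0.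
 - by rewrite cons_uniq mem_seq1 andbT; apply/eqP; lia.
 - move=> i; rewrite !inE negb_or => /andP[h1 h2]; case: eqP => // h3; lia.
by rewrite usum_natS// E add0r; apply: eq_usum => i; rewrite E.
Qed.

Lemma natabsE (m : int) : `|m|.+1%:R = `|m%:~R| + 1 :> R.
by rewrite -natr1 -intr_norm -abszE. Qed.
Lemma intr_ge1 (m : int) : m != 0 -> 1 <= `|m%:~R : R|.
by move=> m0; rewrite -intr_norm -abszE ler1n absz_gt0. Qed.

(** With x = |m t + n| and y = Im t one has |m| <= x/y and |n| <= x + |m||t|, so (|m|+1)(|n|+1) is
    at most a multiple of x^2. The product form lets double sums be majorized by products of single
    ones. *)
Lemma lattice_lower (t : H) : exists2 d : R, 0 < d & forall m n : int, (m, n) != (0, 0) ->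
 d * (Num.sqrt `|m|.+1%:R * Num.sqrt `|n|.+1%:R) <= cn (m%:~R * t° + n%:~R).
have y0 := uhp_gt0 t; set y := Im t in y0; pose a := cn t°.
have a0 : 0 <= a := cn_ge0 _.
pose K := (2 / y) * (1 + (a + 1) / y) + 2.
have K1 : 0 <= (2 / y) * (1 + (a + 1) / y) by rewrite mulr_ge0 ?divr_ge0 ?addr_ge0 ?divr_ge0 ?addr_ge0 ?(ltW y0).
have K0 : 0 < K by rewrite /K; lra.
exists (Num.sqrt K)^-1; first by rewrite invr_gt0 sqrtr_gt0.
move=> m n mn; set x := cn _; have x0 : 0 <= x := cn_ge0 _.
rewrite mulrC ler_pdivrMr ?sqrtr_gt0// -sqrtrM//.
have -> : x * Num.sqrt K = Num.sqrt (x ^+ 2 * K) by rewrite sqrtrM ?sqr_ge0// sqrtr_sqr ger0_norm.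
rewrite ler_sqrt ?mulr_ge0 ?sqr_ge0 ?(ltW K0)// !natabsE.
set M : R := `|m%:~R|; set N : R := `|n%:~R|; have M0 : 0 <= M := normr_ge0 _; have N0 : 0 <= N := normr_ge0 _.
have mE : m%:~R = (m%:~R : R)%:C by rewrite rmorph_int.
have nE : n%:~R = (n%:~R : R)%:C by rewrite rmorph_int.
have h1 : M * y <= x.
 apply: le_trans (cn_ge_Im _); rewrite mE nE /y; case: t° => p q /=.
 rewrite mul0r !addr0 normrM -/M ler_wpM2l//; exact: ler_norm.
have h2 : N <= x + M * a.
 have -> : N = cn (m%:~R * t° + n%:~R - m%:~R * t°) by rewrite addrC addKr nE cn_real.
 by apply: le_trans (cnB _ _) _; rewrite lerD2l cnM mE cn_real.
have [m0|m0] := eqVneq m 0.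
 have n0 : n != 0 by move: mn; rewrite m0 xpair_eqE eqxx.
 have N1 : 1 <= N := intr_ge1 n0.
 have M00 : M = 0 by rewrite /M m0 normr0.
 rewrite M00 in h2 *; rewrite /K [x ^+ 2 * _]mulrDr; have : 0 <= x ^+ 2 * (2 / y * (1 + (a + 1) / y)).
 by rewrite mulr_ge0 ?sqr_ge0.
 have : N + 1 <= x ^+ 2 * 2 by nra.
 by lra.
have M1 : 1 <= M := intr_ge1 m0.
have Mx : M <= x / y by rewrite ler_pdivlMr.
have -> : x ^+ 2 * K = (2 * (x / y)) * (x + (x / y) * (a + 1)) + x ^+ 2 * 2.
 by rewrite /K; field; rewrite gt_eqF.
apply: le_trans (_ : (2 * (x / y)) * (x + (x / y) * (a + 1)) <= _); last first.
 by rewrite lerDl mulr_ge0 ?sqr_ge0.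
apply: ler_pM; [lra|lra|lra|].
have : M * (a + 1) <= x / y * (a + 1) by rewrite ler_wpM2r// addr_ge0.
by lra.
Qed.

(** Eisenstein's device: 1/(x^2 (x+1)) = 1/x^2 - (1/x - 1/(x+1)) is absolutely summable over the
    lattice, 1/x^2 is not. The telescoping part sums to 0 along each row but not over the columns,
    and the discrepancy is the anomaly of E2. *)
Definition Efun (t : H) (p : int * int) : C :=
 let x := p.1%:~R * t° + p.2%:~R in
 if p.1 == 0 then 0 else (x ^+ 2 * (x + 1))^-1.
Lemma lat_neq0 (t : H) (m n : int) : m != 0 -> m%:~R * t° + n%:~R != 0.
move=> m0; have [d d0 hd] := lattice_lower t; rewrite -cn_gt0.
apply: lt_le_trans (hd _ _ _); last by rewrite xpair_eqE (negbTE m0).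
by rewrite !mulr_gt0 ?sqrtr_gt0.
Qed.

Lemma summ_Efun (t : H) : summ (Efun t).
have [d d0 hd] := lattice_lower t.
have ba := bsum_int (fun n => ltW (@alpha_gt0 R n)) (bsum_alpha R).
have b2 := bsum_prod (fun i : int => ltW (@alpha_gt0 R `|i|)) (fun i : int => ltW (@alpha_gt0 R `|i|)) ba ba.
have K0 : 0 <= 2 / d ^+ 3 by rewrite divr_ge0 ?exprn_ge0 ?(ltW d0).
have b3 : bsum (fun p : int * int => 2 / d ^+ 3 * (@alpha R `|p.1| * @alpha R `|p.2|)) (2 / d ^+ 3 * ((2 * 3) * (2 * 3))).
 by move=> s us; rewrite -mulr_sumr ler_wpM2l ?b2.
apply: summW b3 => -[m n] /=; rewrite /Efun /=; case: eqP => [_|/eqP m0].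
 by rewrite cn0; apply: mulr_ge0 => //; apply: mulr_ge0; exact: ltW (@alpha_gt0 R _).
have mn (k : int) : (m : int, k) != (0 : int, 0 : int) by rewrite xpair_eqE (negbTE m0).
have h1 := hd m n (mn n); have h2 := hd m (n + 1) (mn _).
rewrite rmorphD /= addrA in h2; set x := _ + _ in h1 h2 *.
set A := Num.sqrt `|m|.+1%:R in h1 h2 *; set B := Num.sqrt `|n|.+1%:R in h1 *.
have A0 : 0 < A by rewrite sqrtr_gt0. have B0 : 0 < B by rewrite sqrtr_gt0.
have h3 : B / 2 <= Num.sqrt `|n + 1|.+1%:R.
 rewrite ler_pdivrMr//; have -> : (2 : R) = Num.sqrt (2 ^+ 2) by rewrite sqrtr_sqr ger0_norm.
 rewrite -sqrtrM// ler_sqrt ?mulr_ge0// -natrX -natrM ler_nat; lia.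
have h4 : d * (A * (B / 2)) <= cn (x + 1).
 by apply: le_trans h2; rewrite ler_wpM2l ?(ltW d0)// ler_wpM2l ?(ltW A0).
rewrite cnV /alpha -/A -/B.
have -> : 2 / d ^+ 3 * (A ^- 3 * B ^- 3) = ((d * (A * B)) ^+ 2 * (d * (A * (B / 2))))^-1.
 by field; rewrite !gt_eqF.
have p1 : 0 < d * (A * B) by rewrite !mulr_gt0.
have p2 : 0 < d * (A * (B / 2)) by rewrite !mulr_gt0 ?invr_gt0.
rewrite cnM cnX lef_pV2 ?posrE ?mulr_gt0 ?exprn_gt0//.
by apply: ler_pM; rewrite ?exprn_ge0 ?(ltW p1) ?(ltW p2)// lerXn2r ?nnegrE ?cn_ge0 ?(ltW p1).
all: first [exact: lt_le_trans p1 h1 | exact: lt_le_trans p2 h4 | by rewrite invr_gt0].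
Qed.

Lemma uhp_scale_gt0 (n : nat) (t : H) : 0 < Im (n.+1%:R * t°).
have -> : n.+1%:R = (n.+1%:R : R)%:C by rewrite rmorph_nat.
have := uhp_gt0 t; case: t° => a b /= b0.
by rewrite mul0r addr0 mulr_gt0.
Qed.
Definition uhp_scale n t : H := Uhp (uhp_scale_gt0 n t).
Lemma uhp_scaleE n t : uhp_scale n t = n.+1%:R * t° :> C.
by []. Qed.

Lemma row_lower (t : H) (c : int) : c != 0 ->
 exists2 d : R, 0 < d & forall j : int, d * `|j|.+1%:R <= cn (c%:~R * t° + j%:~R).
move=> c0; set z := uhp_scale `|c|.-1 t.
have X1 : 1 <= `|Re (z : C)| + 1 by have : 0 <= `|Re (z : C)| by []; lra.
have [d d0 hd] := shift_lower (uhp_gt0 z) X1.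
have h1 : `|Re (z : C)| <= `|Re (z : C)| + 1 by lra.
exists d => // j; case: (ltrP 0 c) => cs.
 have -> : c%:~R * t° = z by rewrite /= prednK ?absz_gt0// pmulrn gez0_abs// ltW.
 exact: hd.
have -> : c%:~R * t° = - (z : C) by rewrite /= prednK ?absz_gt0// pmulrn lez0_abs// rmorphN mulNr opprK.
have -> : - (z : C) + j%:~R = - ((z : C) + (- j)%:~R) by rewrite rmorphN; ring.
by rewrite cnN -abszN; exact: hd.
Qed.

Definition L2 (z : H) : C := lip 0 1 z.
Lemma L2_term (z : H) (j : int) : e (- ((0 : R)%:C * j%:~R)) / ((z : C) + j%:~R) ^+ 2 = ((z : C) + j%:~R) ^- 2.
by rewrite mul0r oppr0 e0 mul1r. Qed.
Lemma L2E z : L2 z = usum (fun j : int => ((z : C) + j%:~R) ^- 2).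
by apply: eq_usum => j; exact: L2_term. Qed.
Lemma summ_L2 (z : H) : summ (fun j : int => ((z : C) + j%:~R) ^- 2).
by apply: eq_summ (summ_lip 0 z (ltn0Sn 0)) => j; exact: L2_term. Qed.
Lemma sqrV_opp (x y : C) : (- x + y) ^- 2 = (x - y) ^- 2.
by rewrite -(sqrrN (x - y)) opprD opprK. Qed.
Lemma oppz_bij : bijective (@GRing.opp int).
by exists (@GRing.opp int); exact: opprK. Qed.

Lemma L2_opp (z : H) : hsum (fun j : int => (- (z : C) + j%:~R) ^- 2) (L2 z).
have E : (fun j : int => (- (z : C) + j%:~R) ^- 2) = (fun j : int => ((z : C) + (- j)%:~R) ^- 2).
 by apply/funext => j; rewrite rmorphN sqrV_opp.
rewrite E; have s1 : summ (fun j : int => ((z : C) + (- j)%:~R) ^- 2).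
 exact: (summ_comp (@oppr_inj int) (summ_L2 z)).
rewrite L2E (usum_bij oppz_bij (summ_L2 z)); exact: usumP.
Qed.

Lemma L2_int (t : H) (c : int) : c != 0 ->
 hsum (fun j : int => (c%:~R * t° + j%:~R) ^- 2) (L2 (uhp_scale `|c|.-1 t)).
move=> c0; set z := uhp_scale _ t; case: (ltrP 0 c) => cs.
 have -> : c%:~R * t° = z by rewrite /= prednK ?absz_gt0// pmulrn gez0_abs// ltW.
 rewrite L2E; exact/usumP/summ_L2.
have -> : c%:~R * t° = - (z : C) by rewrite /= prednK ?absz_gt0// pmulrn lez0_abs// rmorphN mulNr opprK.
exact: L2_opp.
Qed.

Lemma Efun_split (t : H) (c j : int) : c != 0 -> Efun t (c, j) =
 (c%:~R * t° + j%:~R) ^- 2 -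
 ((c%:~R * t° + j%:~R)^-1 - (c%:~R * t° + (j + 1)%:~R)^-1).
move=> c0; rewrite /Efun /= (negbTE c0).
have := lat_neq0 t j c0; have := lat_neq0 t (j + 1) c0; rewrite rmorphD /= addrA.
by move: (_ + j%:~R) => x x1 x0; field; rewrite x0 x1.
Qed.

Lemma clim_shiftS (u : nat -> C) l : clim (fun n => u n.+1) l -> clim u l.
by move=> h eps e0; have [N hN] := h _ e0; exists N.+1 => -[|n] // hn; exact: hN. Qed.

Lemma clim_dominated (u : nat -> C) (K : R) : (forall n, cn (u n) <= K * n.+1%:R^-1) -> clim u 0.
move=> h eps e0; have [N hN] := climZ (K%:C) (@clim_invn R) e0.
exists N => n hn; rewrite subr0; apply: le_lt_trans (hN n hn).
rewrite mulr0 subr0 cnM cn_real cnV cn_nat; apply: le_trans (h n) _.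
by rewrite ler_wpM2r ?invr_ge0// ler_norm.
Qed.

Lemma Efun_row (t : H) (c : int) : usum (fun j => Efun t (c, j)) =
 if c == 0 then 0 else L2 (uhp_scale `|c|.-1 t).
case: eqP => [->|/eqP c0]; first by rewrite (eq_usum (G := fun _ => 0)) ?usum0.
have hs := L2_int t c0.
have sL : summ (fun j : int => (c%:~R * t° + j%:~R) ^- 2).
 case: (ltrP 0 c) => cs.
 have -> : c%:~R * t° = uhp_scale `|c|.-1 t by rewrite /= prednK ?absz_gt0// pmulrn gez0_abs// ltW.
 exact: summ_L2.
 have -> : c%:~R * t° = - (uhp_scale `|c|.-1 t : C) by rewrite /= prednK ?absz_gt0// pmulrn lez0_abs// rmorphN mulNr opprK.
 apply: eq_summ (summ_comp (@oppr_inj int) (summ_L2 (uhp_scale `|c|.-1 t))) => j.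
 by rewrite rmorphN sqrV_opp.
have sE : summ (fun j => Efun t (c, j)).
 by apply: (summ_comp _ (summ_Efun t)) => i j [].
pose f (j : int) := (c%:~R * t° + j%:~R)^-1.
have sf : summ (fun j => f j - f (j + 1)).
 by apply: eq_summ (summB sL sE) => j; rewrite Efun_split// subKr.
rewrite (eq_usum (fun j => Efun_split t j c0)) usumB// (usumE hs).
rewrite (@usum_telescope f 0) ?subr0//.
have [d d0 hd] := row_lower t c0.
have fb (j : int) : cn (f j) <= d^-1 * `|j|.+1%:R^-1.
 rewrite /f cnV -invfM lef_pV2 ?posrE ?mulr_gt0//.
 by apply: lt_le_trans (hd j); rewrite mulr_gt0.
apply: (@clim_dominated _ (2 * d^-1)) => n; apply: le_trans (cnB _ _) _.
have -> : 2 * d^-1 * n.+1%:R^-1 = d^-1 / n.+1%:R + d^-1 / n.+1%:R by ring.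
by apply: lerD; [have := fb (- n%:Z); rewrite abszN absz_nat | exact: fb].
Qed.

(** The rows c <> 0 of the Eisenstein sum of weight 2; the rows c and -c agree, hence the absolute
    value. *)
Definition Gsum (t : H) : C := usum (fun c : int => if c == 0 then 0 else L2 (uhp_scale `|c|.-1 t)).
Lemma summ_Gsum t : summ (fun c : int => if c == 0 then 0 else L2 (uhp_scale `|c|.-1 t)).
by have [s _] := usum_pair (summ_Efun t); apply: eq_summ s => c; rewrite Efun_row. Qed.
Lemma Gsum_rows t : usum (Efun t) = Gsum t.
by have [_ <-] := usum_pair (summ_Efun t); apply: eq_usum => c; rewrite Efun_row. Qed.

End Lattice.

(** * Transformation law of the Eisenstein series of weight 2 *)

Section EisensteinTwo.
Variable R : realType.
Local Notation C := R[i].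
Local Notation e := (@cexp2pi R).
Local Notation H := (uhp R).
Local Notation tpi := (@tpi R).

(** This is 2 zeta(2). Its value emerges later, when [a_eq1] fixes the normalization of E2. *)
Definition zkappa : C := usum (fun c : int => if c == 0 then 0 else (c%:~R : C) ^- 2).

Lemma summ_zkappa : summ (fun c : int => if c == 0 then 0 else (c%:~R : C) ^- 2).
have b : bsum (fun j : int => 4 * (`|j|.+1%:R : R) ^- 2) (4 * 6).
 by move=> l ul; rewrite -mulr_sumr ler_wpM2l// bsum_intsq.
apply: summW b => j; case: eqP => [->|/eqP j0]; first by rewrite cn0 mulr_ge0 ?invr_ge0 ?exprn_ge0.
have -> : j%:~R = (j%:~R : R)%:C by rewrite rmorph_int.
have := intr_ge1 R j0; rewrite cnV cnX cn_real natabsE; move: `|_| => x x1.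
have x0 : 0 < x by lra.
have x2 : 0 < x + 1 by lra.
rewrite -[X in X <= _]mul1r ler_pdivrMr ?exprn_gt0// mulrAC ler_pdivlMr ?exprn_gt0//; nra.
Qed.

Section Columns.
Variable t : H.

Definition colA (d : int) : C :=
 usum (fun c : int => if c == 0 then 0 else (c%:~R * t° + d%:~R) ^- 2).

Let z (d : int) : H := uhp_scale `|d|.-1 (uhpS t).

(** Since c t + d = t (c - d (-1/t)), a column at t is t^-2 times a row at -1/t. *)
Lemma colA_term (d : int) : d != 0 -> hsum (fun c : int => (c%:~R * t° + d%:~R) ^- 2)
 (t° ^- 2 * L2 (z d)).
move=> d0; have t0 := uhp_neq0 t.
have [cs|cs] := ltrP 0 d.
 have E (c : int) : t° ^- 2 * (- (z d : C) + c%:~R) ^- 2 = (c%:~R * t° + d%:~R) ^- 2.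
 rewrite -invfM -exprMn; congr (_ ^- 2).
 by rewrite /z uhp_scaleE uhpSE prednK ?absz_gt0// pmulrn gez0_abs ?(ltW cs)//; field.
 by apply: eq_hsum E _; apply: hsumZ; exact: L2_opp.
have E (c : int) : t° ^- 2 * ((z d : C) + c%:~R) ^- 2 = (c%:~R * t° + d%:~R) ^- 2.
 rewrite -invfM -exprMn; congr (_ ^- 2).
 by rewrite /z uhp_scaleE uhpSE prednK ?absz_gt0// pmulrn lez0_abs// rmorphN; field.
by apply: eq_hsum E _; apply: hsumZ; rewrite L2E; exact/usumP/summ_L2.
Qed.

Lemma colA_summ (d : int) : d != 0 -> summ (fun c : int => (c%:~R * t° + d%:~R) ^- 2).
move=> d0.
have t0 := uhp_neq0 t; have [cs|cs] := ltrP 0 d.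
 apply: eq_summ (summZ (t° ^- 2) (summ_comp (@oppr_inj int) (summ_L2 (z d)))) => c.
 rewrite rmorphN -sqrV_opp -invfM -exprMn; congr (_ ^- 2).
 by rewrite /z uhp_scaleE uhpSE prednK ?absz_gt0// pmulrn gez0_abs ?(ltW cs)//; field.
apply: eq_summ (summZ (t° ^- 2) (summ_L2 (z d))) => c.
rewrite -invfM -exprMn; congr (_ ^- 2).
by rewrite /z uhp_scaleE uhpSE prednK ?absz_gt0// pmulrn lez0_abs// rmorphN; field.
Qed.

Lemma colA_E (d : int) : d != 0 -> colA d = t° ^- 2 * L2 (z d) - (d%:~R : C) ^- 2.
move=> d0; have hA := colA_term d0; rewrite /colA usum_D1; last first.
 exact: colA_summ.
by rewrite (usumE hA) mul0r add0r.
Qed.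
Lemma colA_0 : colA 0 = t° ^- 2 * zkappa.
rewrite -usumZ; last exact: summ_zkappa.
by apply: eq_usum => c; case: eqP => _; rewrite ?mulr0// addr0 exprMn invfM mulrC.
Qed.

Lemma colA_sum : summ colA /\ usum colA = t° ^- 2 * (zkappa + Gsum (uhpS t)) - zkappa.
pose F (d : int) := t° ^- 2 * (if d == 0 then 0 else L2 (z d)) +
 ((if d == 0 then t° ^- 2 * zkappa else 0) - (if d == 0 then 0 else (d%:~R : C) ^- 2)).
have E d : F d = colA d.
 rewrite /F; case: eqP => [->|/eqP d0]; last by rewrite colA_E// add0r.
 by rewrite mulr0 add0r subr0 colA_0.
have s1 := summZ (t° ^- 2) (summ_Gsum (uhpS t)).
have h0 (d : int) : d \notin [:: 0] -> (if d == 0 then t° ^- 2 * zkappa else 0) = 0 by rewrite inE => /negbTE ->.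
have s2 := summ_fin (isT : uniq [:: 0 : int]) h0.
have s3 := summB s2 summ_zkappa.
split; first exact: eq_summ E (summD s1 s3).
rewrite -(eq_usum E) usumD// usumZ ?usumB//; last exact: summ_Gsum.
rewrite (usum_fin (isT : uniq [:: 0 : int]) h0) big_seq1 eqxx -/zkappa -/(Gsum _).
 by ring.
exact: summ_zkappa.
Qed.

(** The sum of 1/(c t + d) over c <> 0, with c and -c paired. *)
Definition Hfun (d : int) : C :=
 usum (fun i : nat => (i.+1%:R * t° + d%:~R)^-1 + (- (i.+1%:R * t°) + d%:~R)^-1).

Lemma Hfun_summ d : summ (fun i : nat => (i.+1%:R * t° + d%:~R)^-1 + (- (i.+1%:R * t°) + d%:~R)^-1).
have t0 := uhp_neq0 t; have [->|d0] := eqVneq d 0.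
 apply: eq_summ (@summ0 R nat) => i; rewrite addr0 addr0.
 by rewrite invrN subrr.
have [a a0 ha] := row_lower (uhpS t) d0.
have ctp : 0 < cn t° by rewrite cn_gt0.
pose K := cn (2 * (d%:~R : C)) / (cn t° * a) ^+ 2.
have K0 : 0 <= K by rewrite divr_ge0 ?cn_ge0 ?sqr_ge0.
have low (c : int) : cn t° * a * `|c|.+1%:R <= cn (c%:~R * t° + d%:~R).
 have -> : c%:~R * t° + d%:~R = - t° * (d%:~R * (uhpS t)° + (- c)%:~R).
 by rewrite uhpSE rmorphN; field.
 by rewrite cnM cnN -mulrA ler_wpM2l ?cn_ge0// -abszN; exact: ha.
have bK : bsum (fun i : nat => K * (@alpha R i)) (K * 3).
 by move=> l ul; rewrite -mulr_sumr ler_wpM2l// bsum_alpha.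
apply: summW bK => i.
have l1 := low i.+1%:Z; have l2 := low (- i.+1%:Z).
rewrite abszN absz_nat rmorphN mulNr /= -!pmulrn in l1 l2.
have p : 0 < cn t° * a * i.+1%:R by rewrite !mulr_gt0.
have p' : cn t° * a * i.+1%:R <= cn t° * a * i.+2%:R by rewrite ler_wpM2l ?mulr_ge0 ?(ltW ctp) ?(ltW a0)// ler_nat.
have {}l1 := le_trans p' l1; have {}l2 := le_trans p' l2.
set x := _ + d%:~R in l1 *; set y := _ + d%:~R in l2 *.
have x0 : x != 0 by rewrite -cn_gt0; exact: lt_le_trans l1.
have y0 : y != 0 by rewrite -cn_gt0; exact: lt_le_trans l2.
have -> : x^-1 + y^-1 = (2 * d%:~R) / (x * y).
 have -> : 2 * d%:~R = x + y by rewrite /x /y; ring.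
 by field; rewrite x0 y0.
rewrite cnM cnV (cnM x y) /K -[leRHS]mulrA ler_wpM2l ?cn_ge0//.
apply: le_trans (_ : (cn t° * a) ^- 2 * i.+1%:R ^- 2 <= _); last first.
 by rewrite ler_wpM2l ?invr_ge0 ?sqr_ge0// sqr_alpha.
rewrite -invfM -exprMn lef_pV2 ?posrE ?exprn_gt0 ?mulr_gt0 ?cn_gt0//.
by rewrite expr2; apply: ler_pM => //; exact: ltW.
Qed.

Lemma inv_pair_opp (x y : C) : (x - y)^-1 + (- x - y)^-1 = -1 * ((x + y)^-1 + (- x + y)^-1).
rewrite (_ : x - y = - (- x + y)); last by ring.
rewrite (_ : - x - y = - (x + y)); last by ring.
by rewrite !invrN; ring.
Qed.
Lemma Hfun_opp d : Hfun (- d) = - Hfun d.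
rewrite -[RHS]mulN1r /Hfun -usumZ; last exact: Hfun_summ.
by apply: eq_usum => i; rewrite rmorphN; exact: inv_pair_opp.
Qed.

Lemma Hfun_neg (m : nat) : Hfun (- m.+1%:Z) =
 t°^-1 * (csum (uhp_scale m (uhpS t)) - (uhp_scale m (uhpS t) : C)^-1).
have t0 := uhp_neq0 t; set u := uhp_scale m (uhpS t).
have uE : t° * u = - m.+1%:R.
 by rewrite /u uhp_scaleE uhpSE; field.
have [S _] := csum_summ_E u.
rewrite /csum usum_natS// [X in X - _]addrC addrK -usumZ; last first.
 exact: (@summ_comp R nat nat succn succn_inj _ S).
apply: eq_usum => i; rewrite mulrNz -pmulrn -uE.
have -> : i.+1%:R * t° + t° * u° = t° * (u° + i.+1%:R) by ring.
have -> : - (i.+1%:R * t°) + t° * u° = t° * (u° - i.+1%:R) by ring.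
by rewrite !invfM -mulrDr.
Qed.

(** By [Hfun_neg] these are cotangent sums at multiples of -1/t, where q^m tends to 0 and (1 +
    q^m)/(1 - q^m) to 1. What survives is the boundary value of a telescoping sum. *)
Lemma colB_sum : clim (fun M : nat => Hfun (- M%:Z) - Hfun M%:Z) (- (tpi / t°)).
have t0 := uhp_neq0 t.
apply: clim_shiftS; have E m : (2 / t°) * (- (tpi / 2) * ((1 + e (uhpS t) ^+ m.+1) / (1 - e (uhpS t) ^+ m.+1))
 + t° * m.+1%:R^-1) = Hfun (- m.+1%:Z) - Hfun m.+1%:Z.
 have -> : Hfun m.+1 = - Hfun (- m.+1%:Z) by rewrite Hfun_opp opprK.
 rewrite opprK Hfun_neg csumE eX.
 have -> : (uhp_scale m (uhpS t) : C)^-1 = - (t° * m.+1%:R^-1) by rewrite uhp_scaleE uhpSE invfM invrN invrK mulrN mulrC.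
 rewrite -[uhp_val (uhp_scale _ _)]/(m.+1%:R * (uhpS t)°).
 by rewrite opprK -mulrDl -mulr2n mulr_natl; ring.
apply: eq_clim E _.
have q1 := cn_e_uhp (uhpS t); have q0 := cn_ge0 (e (uhpS t)).
have lq : clim (fun m => e (uhpS t) ^+ m.+1) 0.
 apply: (@clim_dominated _ _ (1 - cn (e (uhpS t)))^-1) => n.
 rewrite cnX ler_pdivlMr ?ltr0n// mulrC; apply: natX_bound; exact/andP.
have l1 : clim (fun m => (1 + e (uhpS t) ^+ m.+1) / (1 - e (uhpS t) ^+ m.+1)) 1.
 have lV : clim (fun m => (1 - e (uhpS t) ^+ m.+1)^-1) (1 + -1 * 0)^-1.
 apply: climV; first by rewrite mulr0 addr0 oner_neq0.
 by apply: eq_clim (climD (clim_cst 1) (climZ (-1) lq)) => n; rewrite mulN1r.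
 by have := climM (climD (clim_cst 1) lq) lV; rewrite addr0 mulr0 addr0 invr1 mulr1.
have -> : - (tpi / t°) = 2 / t° * (- (tpi / 2) * 1 + t° * 0) by field.
by apply: climZ; apply: climD; apply: climZ => //; exact: clim_invn.
Qed.

Lemma Efun_col (d : int) : usum (fun c => Efun t (c, d)) = colA d - (Hfun d - Hfun (d + 1)).
have sA : summ (fun c : int => if c == 0 then 0 else (c%:~R * t° + d%:~R) ^- 2).
 have [->|d0] := eqVneq d 0; last by apply: summ_D1; exact: colA_summ.
 apply: eq_summ (summZ (t° ^- 2) summ_zkappa) => c.
 case: (c == 0); first by rewrite mulr0.
 by rewrite mulr0z addr0 exprMn [in RHS]invfM [RHS]mulrC.
have sE : summ (fun c => Efun t (c, d)).
 by apply: (summ_comp _ (summ_Efun t)) => i j [].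
pose g (c : int) := (c%:~R * t° + d%:~R)^-1 - (c%:~R * t° + (d + 1)%:~R)^-1.
have E (c : int) : (if c == 0 then 0 else (c%:~R * t° + d%:~R) ^- 2) -
 Efun t (c, d) = if c == 0 then 0 else g c.
 case: eqP => [->|/eqP c0]; first by rewrite /Efun eqxx subrr.
 by rewrite Efun_split// subKr.
have sg : summ (fun c => if c == 0 then 0 else g c) by exact: eq_summ E (summB sA sE).
have -> : Hfun d - Hfun (d + 1) = usum (fun c => if c == 0 then 0 else g c).
 rewrite usum_int_pair// /Hfun -usumB; [|exact: Hfun_summ|exact: Hfun_summ].
 by apply: eq_usum => i; rewrite /g rmorphN !mulNr /= -!pmulrn; ring.
by rewrite -(eq_usum E) usumB// subKr.
Qed.

(** The sum of [Efun] by rows is Gsum at t. By columns it is the [colA] part, which involves Gsum at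
    -1/t, minus the boundary term of [colB_sum]. *)
Lemma Gsum_S : zkappa + Gsum (uhpS t) = t° ^+ 2 * (zkappa + Gsum t) - tpi * t°.
have t0 := uhp_neq0 t.
have [s1 s2] := usum_swap (summ_Efun t).
have [sA hA] := colA_sum.
have sB : summ (fun d => Hfun d - Hfun (d + 1)).
 by apply: eq_summ (summB sA s1) => d; rewrite Efun_col subKr.
have hB := usum_telescope sB colB_sum.
have : Gsum t = usum colA - usum (fun d => Hfun d - Hfun (d + 1)).
 by rewrite -Gsum_rows -s2 -usumB//; apply: eq_usum => d; rewrite Efun_col.
rewrite hA hB => ->; field.
exact: t0.
Qed.

End Columns.
End EisensteinTwo.

(** * Divisor sums and numerical bounds for zeta(2) and pi *)

Section EtaFunction.
Variable R : realType.
Local Notation C := R[i].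
Local Notation e := (@cexp2pi R).
Local Notation H := (uhp R).
Local Notation tpi := (@tpi R).

(** The sum of the divisors of m, written over factorizations (n+1) l = m so as to match the
    grouping of the double series in [hsum_pair_L2]. *)
Definition sigma1 (m : nat) : nat := \sum_(n < m.+1) \sum_(l < m.+1) (if n.+1 * l == m then l : nat else 0).

Lemma sigma1_le m : (sigma1 m <= m.+1 ^ 3)%N.
apply: leq_trans (_ : \sum_(n < m.+1) m.+1 * m.+1 <= _)%N; last first.
 by rewrite sum_nat_const card_ord !expnS expn0 muln1.
apply: leq_sum => n _; apply: leq_trans (_ : \sum_(l < m.+1) m.+1 <= _)%N; last first.
 by rewrite sum_nat_const card_ord.
by apply: leq_sum => l _; case: eqP => // _; exact: ltnW.
Qed.

Lemma tame_sigma1 : tame (fun m => (sigma1 m)%:R : C).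
have := @tame_natX R 3; move=> t3.
have t4 : tame (fun n => 8 * (n%:R ^+ 3) + 8 * (@delta0 R n) : C).
 by apply: tameD; apply: tameZ => //; exact: tame_delta0.
apply: tame_le t4 => -[|n].
 by rewrite /delta0 /sigma1 !big_ord1 /= cn0 cn_ge0.
rewrite /delta0 /= mulr0 addr0 cnM cnX !cn_nat -natrX -natrM ler_nat.
apply: leq_trans (sigma1_le _) _; rewrite -[8%N]/(2 ^ 3)%N -expnMn leq_exp2r//; lia.
Qed.

Lemma hsum_pair_L2 (t : H) : summ (fun p : nat * nat => p.2%:R * e t ^+ (p.1.+1 * p.2)) /\
 usum (fun p : nat * nat => p.2%:R * e t ^+ (p.1.+1 * p.2)) =
 usum (fun m : nat => (sigma1 m)%:R * e t ^+ m).
have q1 := cn_e_uhp t.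
have S : summ (fun p : nat * nat => p.2%:R * e t ^+ (p.1.+1 * p.2)).
 have tn : tame (fun n => n%:R : C).
 by have := @tame_natX R 1.
 have s1 : summ (fun n : nat => e t ^+ n).
 exists (1 - cn (e t))^-1 => s us.
 have := @bsum_geo R (cn (e t)); rewrite cn_ge0 q1 => /(_ isT s us).
 by under eq_bigr do rewrite -cnX.
 apply: summ_le (summ_prod s1 (summ_ps tn q1)) => -[n l] /=.
 case: l => [|l]; first by rewrite !mul0r mulr0.
 rewrite !cnM mulrCA ler_wpM2l ?cn_ge0// !cnX -exprD.
 by apply: ler_wiXn2l; rewrite ?cn_ge0 ?(ltW q1)//; nia.
split=> //; have [_ <-] := usum_group (fun p : nat * nat => (p.1.+1 * p.2)%N) S.
apply: eq_usum => m.
pose s := [seq (i, j) | i <- iota 0 m.+1, j <- iota 0 m.+1].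
have us : uniq s by apply: allpairs_uniq; rewrite ?iota_uniq// => -[a b] [c d] _ _ [-> ->].
have [m0|m0] := posnP m.
 rewrite m0 (eq_usum (G := fun _ => 0)) ?usum0.
 by rewrite /sigma1 !big_ord1 /= mul0r.
 by move=> [n [|l]] /=; rewrite ?muln0 ?mul0r//; case: eqP.
rewrite (usum_fin us); last first.
 move=> [n l]; case: eqP => // /= h; rewrite /s => /negP[].
 apply/allpairsP; exists (n, l); rewrite !mem_iota /=.
 case: l h => [|l] h; first by rewrite muln0 in h; rewrite -h in m0.
 have h1 : (n <= n.+1 * l.+1)%N := leq_trans (leqnSn n) (leq_pmulr _ (ltn0Sn l)).
 have h2 : (l.+1 <= n.+1 * l.+1)%N := leq_pmull _ (ltn0Sn n).
 by rewrite -h.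
rewrite big_allpairs /sigma1 natr_sum mulr_suml.
rewrite -[iota 0 m.+1]/(index_iota 0 m.+1) big_mkord; apply: eq_bigr => n _.
rewrite natr_sum mulr_suml big_mkord; apply: eq_bigr => l _ /=.
by case: eqP => [->|_]; rewrite ?mul0r.
Qed.

Lemma Gsum_ps (t : H) : Gsum t = 2 * tpi ^+ 2 * ps (fun m => (sigma1 m)%:R) (e t).
have [S E] := hsum_pair_L2 t.
rewrite /Gsum (usum_int_pair (f := fun c => L2 (uhp_scale `|c|.-1 t))); last exact: summ_Gsum.
have [s1 <-] : summ (fun i => usum (fun l : nat => l%:R * e t ^+ (i.+1 * l))) /\ 
 usum (fun i => usum (fun l : nat => l%:R * e t ^+ (i.+1 * l))) = ps (fun m => (sigma1 m)%:R) (e t).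
 by have [s h] := usum_pair S; split; [exact: s|rewrite /ps -E -h].
rewrite -usumZ//; apply: eq_usum => i.
rewrite -mulrA [LHS](_ : _ = 2 * L2 (uhp_scale i t)); last by rewrite abszN absz_nat /=; ring.
congr (2 * _).
rewrite /L2; have [tl ->] := lip_QE (s := 1) (ltn0Sn 0) (ltn0Sn 0) (esym (mul0r (1%:R^-1 : R))).
rewrite mul0r e0 mul1r -usumZ; last first.
 exact: (@summ_comp R _ _ (fun l : nat => (i : nat, l)) (fun a b h => congr1 snd h) _ S).
apply: eq_usum => l; rewrite /lip_coef -[1`!]/1%N expr1 divr1 add0r sqrrN -mulrA; congr (_ * (_ * _)).
by rewrite uhp_scaleE -eX -exprM.
Qed.

Lemma sin_le_self (x : R) : 0 <= x -> sin x <= x.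
move=> x0; have [->|x1] := eqVneq x 0; first by rewrite sin0.
have xp : 0 < x by rewrite lt_def x1.
have dsin (z : R) : is_derive z 1 (sin : R -> R) (cos z) by exact: is_derive_sin.
have [c _] := MVT xp (fun z _ => dsin z) (continuous_subspaceT (@continuous_sin R)).
rewrite sin0 !subr0 => ->; rewrite -[leRHS]mul1r ler_wpM2r// cos_le1.
by [].
Qed.

(** Otherwise cos(13/10) <= 0, whereas cos(13/10) = 1 - 2 sin^2(13/20) >= 1 - 2 (13/20)^2 > 0. *)
Lemma pi_gt_26 : 13 / 5 < pi :> R.
rewrite ltNge; apply/negP => h.
have h1 : cos (13 / 10 : R) <= 0.
 rewrite -(@cos_pihalf R); have [->//|ne] := eqVneq (13 / 10 : R) (pi / 2).
 apply: ltW; rewrite ltr_cos ?in_itv /=; have := @pi_ge2 R; lra.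
have s1 : sin (13 / 20 : R) <= 13 / 20 by apply: sin_le_self; lra.
have s0 : 0 <= sin (13 / 20 : R) by apply: sin_ge0_pi; have := @pi_ge2 R; lra.
have : cos (13 / 10 : R) = 1 - 2 * sin (13 / 20) ^+ 2.
 have -> : (13 / 10 : R) = (13 / 20) *+ 2 by rewrite mulr2n; lra.
 by rewrite cos_mulr2n cos2sin2 -mulr_natl; ring.
have : sin (13 / 20 : R) ^+ 2 <= (13 / 20) ^+ 2 by rewrite lerXn2r ?nnegrE//; lra.
lra.
Qed.

(** Here zeta(2) = 1 + x, and telescoping bounds the partial sums of x by 3/4 - 1/(m+2). *)
Lemma zkappa_real : exists2 x : R, -(3 / 4) <= x <= 3 / 4 & zkappa R = (2 * (1 + x))%:C.
pose F (i : nat) : R := i.+2%:R ^- 2.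
have part m : \sum_(0 <= i < m.+1) F i <= 3 / 4 - (m.+2%:R)^-1.
 elim: m => [|m IH]; first by rewrite big_nat1 /F; lra.
 rewrite big_nat_recr//=; apply: le_trans (lerD IH (lexx _)) _; rewrite /F.
 have h2 : m.+3%:R = m.+2%:R + 1 :> R by rewrite natr1.
 rewrite h2; have : 0 < m.+2%:R :> R by rewrite ltr0n.
 move: (m.+2%:R) => x x0; have x1 : 0 < x + 1 by lra.
 have -> : x^-1 = (x + 1)^-1 + (x * (x + 1))^-1 by field; rewrite !gt_eqF.
 have : (x + 1) ^- 2 <= (x * (x + 1))^-1.
 by rewrite expr2 lef_pV2 ?posrE ?mulr_gt0// ler_wpM2r ?(ltW x1)//; lra.
 by lra.
have b : bsum F (3 / 4).
 apply: bsum_nat => [i|[|m]]; first by rewrite invr_ge0 exprn_ge0.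
 by rewrite big_geq//; lra.
 by apply: le_trans (part m) _; rewrite lerBlDr lerDl invr_ge0.
have F0 i : 0 <= F i by rewrite invr_ge0 exprn_ge0.
have [x hx] := hsum_nneg F0 b.
have sF : summ (fun i => (F i)%:C).
 by apply: summW b => i; rewrite cn_real ger0_norm// invr_ge0 exprn_ge0.
exists x.
 rewrite -ler_norml -cn_real; apply: hsum_le hx _ => s us.
 apply: le_trans (b s us); apply: ler_sum => i _.
 by rewrite cn_real ger0_norm// invr_ge0 exprn_ge0.
rewrite /zkappa usum_int_pair; last exact: summ_zkappa.
have E (i : nat) : (i.+1%:Z%:~R : C) ^- 2 + ((- i.+1%:Z)%:~R : C) ^- 2 = 2 * (i.+1%:R ^- 2).
 by rewrite mulrNz sqrrN -pmulrn; ring.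
have E2 (i : nat) : (F i)%:C = (i.+2%:R : C) ^- 2 by rewrite /F fmorphV rmorphXn rmorph_nat.
have sF' : summ (fun i : nat => (i.+1%:R : C) ^- 2).
 by apply: summW (bsumW (@sqr_alpha R) (bsum_alpha R)) => i; rewrite cnV cnX cn_nat.
rewrite (eq_usum E) usumZ// usum_natS// -(eq_usum E2) (usumE hx).
have -> : (2 * (1 + x))%:C = 2%:R%:C * (1%:C + x%:C) :> C by rewrite rmorphM [X in _ * X]rmorphD.
by rewrite expr1n invr1 rmorph_nat.
Qed.

End EtaFunction.

Lemma ps_eq0 (R : realType) (c : nat -> R[i]) z : (forall m, c m = 0) -> ps c z = 0.
by move=> h; rewrite /ps (eq_usum (G := fun _ => 0)) ?usum0// => m; rewrite h mul0r. Qed.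

#[global] Opaque pi usum ps.

Lemma tpi_sqr (R : realType) : tpi R ^+ 2 = - (4 * pi ^+ 2)%:C.
rewrite /tpi exprMn sqrCi -rmorphXn mulN1r exprMn; congr (- _%:C); congr (_ * _).
by rewrite -natrX.
Qed.

(** * The powers of the eta function *)

Section EtaTransformation.
Variable R : realType.
Local Notation C := R[i].
Local Notation e := (@cexp2pi R).
Local Notation H := (uhp R).
Local Notation Re := (@complex.Re R).
Local Notation tpi := (@tpi R).

Definition e2coef (m : nat) : C := - 24 * (sigma1 m)%:R.
Lemma tame_e2coef : tame e2coef.
by apply: tameZ; exact: tame_sigma1. Qed.
Lemma sigma1_0 : sigma1 0 = 0%N.
by rewrite /sigma1 !big_ord1. Qed.
Lemma sigma1_1 : sigma1 1 = 1%N.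
by rewrite /sigma1 !big_ord_recl !big_ord0. Qed.
Lemma e2coef0 : e2coef 0 = 0. Proof. by rewrite /e2coef sigma1_0 mulr0. Qed.

(** The constant term is a = 6 zeta(2) / pi^2. At this stage only the window (0,2) is available,
    from 6 (7/4) / (13/5)^2 < 2; it contains a single integer, which is what [a_eq1] exploits. *)
Lemma E2_exists : exists2 a : R, 0 < a < 2 & forall t : H,
 a%:C + ps e2coef (e (uhpS t)) = t° ^+ 2 * (a%:C + ps e2coef (e t)) + 12 * t° / tpi.
have [x hx hk] := zkappa_real R; have p26 := @pi_gt_26 R.
pose a := 6 * (1 + x) / pi ^+ 2.
have pp : 0 < pi ^+ 2 :> R by rewrite exprn_gt0// pi_gt0.
have p0 := tpi_neq0 R.
exists a.
 rewrite /a divr_gt0//=; last by lra.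
 rewrite ltr_pdivrMr//; have : (13 / 5) ^+ 2 < pi ^+ 2 :> R by rewrite ltrXn2r ?nnegrE//; lra.
 by lra.
have ba : a%:C = - 12 / tpi ^+ 2 * zkappa R.
 have pc : (pi ^+ 2)%:C != 0 :> C by rewrite -cn_gt0 cn_real normr_gt0 gt_eqF.
 have aE : a%:C = 6%:R * (1 + x)%:C / (pi ^+ 2)%:C :> C by rewrite /a rmorphM fmorphV rmorphM rmorph_nat.
 have -> : zkappa R = 2%:R * (1 + x)%:C by rewrite hk rmorphM rmorph_nat.
 have -> : tpi ^+ 2 = - (4%:R * (pi ^+ 2)%:C) by rewrite tpi_sqr rmorphM rmorph_nat.
 rewrite aE; move: pc; move: ((pi ^+ 2)%:C) ((1 + x)%:C) => P X P0; field.
 exact: P0.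
have G (t : H) : ps e2coef (e t) = - 12 / tpi ^+ 2 * Gsum t.
 rewrite Gsum_ps psZ ?cn_e_uhp//; last exact: tame_sigma1.
 by move: p0 (ps _ _); move: tpi => p p0 z; field.
move=> t; rewrite !G ba; move: (Gsum_S t).
move: p0 (zkappa R) (Gsum (uhpS t)) (Gsum t) t°; move: tpi => p p0 z g' g y key.
have -> : g' = y ^+ 2 * (z + g) - p * y - z by rewrite -key addrC addKr.
field.
exact: p0.
Qed.

Definition uhp_i : H := @Uhp R (0 +i* 1) ltr01.
Lemma uhpS_i : uhpS uhp_i = uhp_i.
apply/val_inj; rewrite /= -[LHS]/(uhpS uhp_i)° uhpSE /=.
by rewrite -[0 +i* 1]/('i : C)%C; apply/eqP; rewrite eq_complex /=; apply/andP; split; apply/eqP; field.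
Qed.
Fact rho_gt0 : 0 < Num.sqrt 3 / 2 :> R.
by rewrite divr_gt0// sqrtr_gt0. Qed.
Definition uhp_rho : H := @Uhp R (1 / 2 +i* (Num.sqrt 3 / 2)) rho_gt0.

Lemma uhp_rho_sqr : uhp_rho° ^+ 2 = uhp_rho° - 1.
have s3 : Num.sqrt 3 ^+ 2 = 3 :> R by rewrite sqr_sqrtr.
apply/eqP; rewrite expr2 eq_complex /=; apply/andP; split; apply/eqP; [|by field].
have -> : 1 / 2 * (1 / 2) - Num.sqrt 3 / 2 * (Num.sqrt 3 / 2) = 1 / 4 - Num.sqrt 3 ^+ 2 / 4 :> R by field.
by rewrite s3; lra.
Qed.

Lemma uhpTS_rho : uhpT (uhpS uhp_rho) = uhp_rho.
have h := uhp_rho_sqr; have r0 := uhp_neq0 uhp_rho.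
apply/val_inj; rewrite -[LHS]/(uhpT _)° uhpTE uhpSE -[RHS]/uhp_rho°.
apply: (mulIf r0); rewrite -expr2 h; field.
exact: r0.
Qed.

Lemma cder_sqrtC (t : H) : cder (fun u : H => sqrtC u°) t (2 * sqrtC t°)^-1.
have r0 := Re_sqrtC_gt0 t; set r := Re _ in r0.
have st0 : sqrtC t° != 0 by rewrite sqrtC_eq0 uhp_neq0.
have sp : 0 < cn (2 * sqrtC t°) by rewrite cn_gt0 mulf_neq0 ?pnatr_eq0.
exists ((cn (2 * sqrtC t°))^-1 * r ^- 2), 1; split=> //.
 by rewrite mulr_ge0 ?invr_ge0 ?exprn_ge0 ?cn_ge0// ltW.
move=> u _; set a := sqrtC u°; set b := sqrtC t° in st0 sp *.
have -> : a - b - (2 * b)^-1 * (u° - t°) = - ((2 * b)^-1 * (a - b) ^+ 2).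
 by rewrite -[u°]sqrtCK -[t°]sqrtCK -/a -/b; field.
rewrite cnN cnM cnV cnX -mulrA ler_wpM2l ?invr_ge0 ?cn_ge0//.
have := sqrtC_lip t u; rewrite -/b -/a -/r !cnE -fmorphV -rmorphM lecR cnBC [X in _ <= X * _]cnBC => h.
by rewrite mulrC -expr_div_n lerXn2r ?nnegrE ?cn_ge0 ?divr_ge0 ?cn_ge0 ?(ltW r0).
Qed.

Lemma cder_expn f (t : H) l n : cder f t l -> cder (fun u => f u ^+ n) t (n%:R * f t ^+ n.-1 * l).
move=> h; elim: n => [|n IH].
 by rewrite mul0r mul0r; apply: (@cder_cst R 1).
have := cderM h IH.
have -> : (fun u : H => f u * f u ^+ n) = (fun u => f u ^+ n.+1) by apply/funext => u; rewrite exprS.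
case: n {IH} => [|n] /=; first by rewrite !expr0 !mulr1 !mul0r mulr0 addr0 mul1r.
by congr cder; rewrite -[in RHS]natr1 !exprS; ring.
Qed.

Lemma cder_eq f g (t : H) l m : f =1 g -> l = m -> cder f t l -> cder g t m.
by move=> /funext -> ->. Qed.

Lemma cder_V f (t : H) l : (forall u, f u != 0) -> cder f t l -> cder (fun u => (f u)^-1) t (- l / f t ^+ 2).
move=> f0 [K [d [K0 d0 h]]].
have [K1 [d1 [K10 d10 h1]]] : exists K d : R, [/\ 0 <= K, 0 < d & forall u : H,
 cn (u° - t°) < d -> cn (f u - f t) <= K * cn (u° - t°)].
 by apply: (@cder_lip R f t l); exists K, d.
set a := cn (f t); have a0 : 0 < a by rewrite cn_gt0.
pose dd := Num.min d (Num.min d1 (a / (2 * (K1 + 1)))).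
have K1p : 0 < K1 + 1 by lra.
exists (2 / a ^+ 2 * K + 2 * cn l / a ^+ 3 * K1), dd; split.
- by rewrite addr_ge0// mulr_ge0 ?divr_ge0 ?mulr_ge0 ?cn_ge0 ?exprn_ge0 ?(ltW a0).
- by rewrite !lt_min d0 d10 divr_gt0 ?mulr_gt0.
move=> u; rewrite !lt_min => /and3P[u1 u2 u3].
set x := cn (u° - t°) in u1 u2 u3 *; have x0 : 0 <= x := cn_ge0 _.
have low : a / 2 <= cn (f u).
 have : cn (f u - f t) <= a / 2.
 apply: le_trans (h1 u u2) _; rewrite -/x.
 move: u3; rewrite ltr_pdivlMr ?mulr_gt0// => /ltW; nra.
 have := cnD (f u) (- (f u - f t)); rewrite cnN (_ : f u + - (f u - f t) = f t); last by ring.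
 by rewrite -/a; lra.
have fu := f0 u; have ft := f0 t.
have -> : (f u)^-1 - (f t)^-1 - - l / f t ^+ 2 * (u° - t°) =
 - (f u * f t)^-1 * (f u - f t - l * (u° - t°)) +
 (f u * f t ^+ 2)^-1 * (l * (u° - t°) * (f u - f t)).
 by field; rewrite fu ft.
apply: le_trans (cnD _ _) _; rewrite mulrDl; apply: lerD.
 rewrite cnM cnN cnV cnM -[leRHS]mulrA; apply: ler_pM; rewrite ?cn_ge0 ?invr_ge0 ?mulr_ge0 ?cn_ge0//.
 have -> : 2 / a ^+ 2 = (a / 2 * a)^-1 by field; rewrite gt_eqF.
 rewrite -/a lef_pV2 ?posrE; first (by apply: ler_wpM2r => //; exact: ltW).
 by rewrite !mulr_gt0 ?invr_gt0 ?cn_gt0.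
 by rewrite !mulr_gt0 ?invr_gt0 ?cn_gt0.
 exact: h.
rewrite !cnM cnV cnM cnX -/a -/x.
have -> : 2 * cn l / a ^+ 3 * K1 * x ^+ 2 = (2 / a ^+ 3) * (cn l * x * (K1 * x)) by ring.
apply: ler_pM; rewrite ?invr_ge0 ?mulr_ge0 ?cn_ge0 ?exprn_ge0 ?(ltW a0)//; last first.
 by rewrite ler_wpM2l ?mulr_ge0 ?cn_ge0//; exact: h1.
have -> : 2 / a ^+ 3 = (a / 2 * a ^+ 2)^-1 by field; rewrite gt_eqF.
rewrite lef_pV2 ?posrE; first (by apply: ler_wpM2r => //; rewrite exprn_ge0 ?(ltW a0)).
 by rewrite !mulr_gt0 ?invr_gt0 ?exprn_gt0 ?cn_gt0.
by rewrite !mulr_gt0 ?invr_gt0 ?exprn_gt0 ?cn_gt0.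
Qed.

(** eta^w is obtained by integrating its logarithmic derivative (w/24) E2 formally, for all integers
    w at once, instead of expanding an infinite product. *)
Definition etac (w : int) : nat -> C := ode (fun n => w%:~R / 24 * e2coef n).
Definition eta_pre (a : R) (w : int) (t : H) : C :=
 e ((w%:~R / 24 * a : R)%:C * t°) * ps (etac w) (e t).

Section WithA.
Variable a : R.
Local Notation etaw := (eta_pre a).
Let E2 t := a%:C + ps e2coef (e t).
Hypothesis E2S : forall t : H, E2 (uhpS t) = t° ^+ 2 * E2 t + 12 * t° / tpi.




Lemma tame_etac w : tame (etac w).
by apply: tame_ode; apply: tameZ; exact: tame_e2coef. Qed.

Lemma etaw_QEc w : QEc (w%:~R / 24 * a) (etac w) (etaw w).
by split=> //; exact: tame_etac. Qed.

Lemma etaw_der w t : cder (etaw w) t (tpi * (w%:~R / 24) * E2 t * etaw w t).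
have [f' [[tf hf] h]] := QEc_cder (etaw_QEc w).
suff E : f' t = w%:~R / 24 * E2 t * etaw w t.
 by apply: cder_eq (h t) => //; rewrite E; ring.
rewrite hf.
have te := tame_e2coef; have tc := tame_etac w.
rewrite /eta_pre /E2; set lam := _%:C; set q := e t.
have -> : (fun n => (lam + n%:R) * etac w n) = (fun n => lam * etac w n + (w%:~R / 24) * conv e2coef (etac w) n).
 apply/funext => n; rewrite mulrDl /etac ode_conv ?e2coef0 ?mulr0//; congr (_ + _).
 by rewrite /conv mulr_sumr; apply: eq_bigr => i _; rewrite !mulrA.
have cq : cn q < 1 := cn_e_uhp t.
have tz := tameZ lam tc; have tv := tame_conv te tc; have tz2 := tameZ (w%:~R / 24) tv.
rewrite (psD tz tz2 cq) (psZ _ tc cq) (psZ _ tv cq) (ps_conv te tc cq).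
have lamE : lam = w%:~R / 24 * a%:C by rewrite /lam !rmorphM fmorphV rmorph_int rmorph_nat.
by move: (e (lam * _)) => E0; rewrite lamE; ring.
Qed.

Lemma QEc0_const (g : H -> C) c : (forall t, cder g t 0) -> QEc 0 c g -> forall t, g t = c 0%N.
move=> dg hc t.
have h : QEc 0 c (fun=> g t) by case: hc => tc hc; split=> // u; rewrite -hc; exact: cder0_cst.
by have := congr1 (fun f => f 0%N) (QEc_inj h (QEccst (g t))); rewrite /delta0 /= mulr1.
Qed.
Lemma etac0 w : etac w 0 = 1. Proof. by []. Qed.

(** The logarithmic derivatives cancel, so the product equals its constant coefficient. Nonvanishing
    of eta follows. *)
Lemma etaw_mulN w t : etaw w t * etaw (- w) t = 1.
have h := QEcM (etaw_QEc w) (etaw_QEc (- w)).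
have l0 : (w%:~R / 24 * a + (- w)%:~R / 24 * a : R) = 0 by rewrite rmorphN; ring.
rewrite l0 in h; rewrite (QEc0_const _ h) /conv ?big_ord1 ?etac0 ?mulr1// => u.
apply: cder_eq (cderM (etaw_der w u) (etaw_der (- w) u)) => //.
by rewrite rmorphN; ring.
Qed.

Lemma etaw_neq0 w t : etaw w t != 0.
by apply/eqP => h; have := etaw_mulN w t; rewrite h mul0r => /esym/eqP; rewrite oner_eq0. Qed.

Lemma eta_log_der (p s z E f g : C) n : s ^+ 2 = z -> p != 0 -> s != 0 ->
 p * (n%:R / 24) * (z ^+ 2 * E + 12 * z / p) * g * z ^- 2 * ((s ^+ n)^-1 * f) +
 g * (- (n%:R * s ^+ n.-1 * (2 * s)^-1) / (s ^+ n) ^+ 2 * f + (s ^+ n)^-1 * (p * (- n%:R / 24) * E * f)) = 0.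
move=> <- p0 s0; case: n => [|m] /=; first by rewrite !mul0r !expr0; field; rewrite p0 s0.
have := expf_neq0 m s0; rewrite (exprS s m); move: (s ^+ m) => sm sm0.
by move: (m.+1%:R) => c; field; rewrite p0 s0 sm0.
Qed.

(** By [E2S] the quotient of eta^n at -1/t by sqrt(t)^n eta^n has derivative 0; the constant is read
    off at the fixed point i. *)
Lemma etaw_S_nat (n : nat) t : etaw n (uhpS t) = (sqrtC uhp_i°) ^- n * sqrtC t° ^+ n * etaw n t.
pose F u := etaw n (uhpS u) * ((sqrtC u° ^+ n)^-1 * etaw (- n%:Z) u).
have s0 (u : H) : sqrtC u° != 0 by rewrite sqrtC_eq0 uhp_neq0.
have sn (u : H) : sqrtC u° ^+ n != 0 by rewrite expf_neq0.
have dF u : cder F u 0.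
 have d1 := cder_comp (cder_uhpS u) (etaw_der n (uhpS u)).
 have d2 := cder_V sn (cder_expn n (cder_sqrtC u)).
 apply: cder_eq (cderM d1 (cderM d2 (etaw_der (- n%:Z) u))) => //.
 rewrite E2S mulrNz -pmulrn.
 by apply: eta_log_der; [exact: sqrtCK | exact: tpi_neq0 | exact: s0].
have h : F t = sqrtC uhp_i° ^- n.
 rewrite (cder0_cst dF t uhp_i) /F uhpS_i; have := etaw_mulN n uhp_i.
 move: (etaw n uhp_i) (etaw _ uhp_i) => x y xy.
 by rewrite -[RHS]mulr1 -xy; ring.
have := etaw_mulN n t; have := etaw_neq0 n t; have := sn t => s1 f0 fN.
have -> : etaw n (uhpS t) = F t * (sqrtC t° ^+ n * etaw n t).
 rewrite /F; have : etaw (- n%:Z) t = (etaw n t)^-1.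
 by apply: (mulfI f0); rewrite fN mulfV.
 by move=> ->; move: s1 f0; move: (_ ^+ n) (etaw n t) (etaw n _) => x y z x0 y0; field; rewrite x0 y0.
by rewrite h mulrA.
Qed.

Lemma sqrtC_i_sqr : sqrtC uhp_i° ^+ 2 = 'i%C.
by rewrite sqrtCK. Qed.

(** The point rho is fixed by TS. For eta^24, S acts trivially there because rho^12 = i^12 = 1, and
    T multiplies by e(a); the value is nonzero, so e(a) = 1. This amounts to zeta(2) = pi^2 / 6. *)
Lemma a_eq1 : 0 < a < 2 -> a = 1.
move=> a02.
have [a0 a2] := andP a02.
have rS := etaw_S_nat 24 uhp_rho.
have i24 : sqrtC uhp_i° ^+ 24 = 1.
 rewrite (exprM _ 2 12) sqrtC_i_sqr (exprM _ 2 6) sqr_i -signr_odd.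
 by [].
have r24 : sqrtC uhp_rho° ^+ 24 = 1.
 have h := uhp_rho_sqr; rewrite (exprM _ 2 12) sqrtCK (exprM _ 3 4).
 have -> : uhp_rho° ^+ 3 = -1.
 rewrite exprS h mulrBr -expr2 h mulr1; ring.
 by rewrite -signr_odd.
rewrite i24 r24 invr1 !mul1r in rS.
have QE24 : QE ((Posz 24)%:~R / 24 * a) (etaw (Posz 24)) by exists (etac 24); exact: etaw_QEc.
have := QE_uhpT (uhpS uhp_rho) QE24; rewrite uhpTS_rho rS.
have -> : ((Posz 24)%:~R / 24 * a : R) = a by rewrite -pmulrn; field.
move=> h; have ea : e a%:C = 1.
 apply: (mulIf (etaw_neq0 (Posz 24) uhp_rho)); exact: etrans (esym h) (esym (mul1r _)).
have : e (a - 1)%:C = 1 by rewrite rmorphB eB ea e_1 divr1.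
move=> /e_eq1 h1; suff : a - 1 = 0 by lra.
by apply: h1; apply/andP; split; lra.
Qed.

End WithA.

Lemma E2_S (t : H) : 1 + ps e2coef (e (uhpS t)) = t° ^+ 2 * (1 + ps e2coef (e t)) + 12 * t° / tpi.
by have [a a0 h] := E2_exists; have := h t; rewrite (a_eq1 h a0) rmorph1. Qed.
Definition E2 (t : H) : C := 1 + ps e2coef (e t).
Lemma E2_uhpS (t : H) : E2 (uhpS t) = t° ^+ 2 * E2 t + 12 * t° / tpi.
exact: E2_S. Qed.
Lemma E2E (t : H) : E2 t = 1 + ps e2coef (e t).
by []. Qed.
Definition eta (w : int) (t : H) : C := e ((w%:~R / 24 : R)%:C * t°) * ps (etac w) (e t).

Let E2S' (t : H) : (1 : R)%:C + ps e2coef (e (uhpS t)) =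
 t° ^+ 2 * ((1 : R)%:C + ps e2coef (e t)) + 12 * t° / tpi.
by rewrite rmorph1; exact: E2_S. Qed.

Lemma eta_QEc w : QEc (w%:~R / 24) (etac w) (eta w).
by split=> //; exact: tame_etac. Qed.
Lemma etaE w t : eta w t = eta_pre 1 w t.
by rewrite /eta /eta_pre mulr1. Qed.
Lemma eta_QE w : QE (w%:~R / 24) (eta w).
by exists (etac w); exact: eta_QEc. Qed.
Lemma eta_der w t : cder (eta w) t (tpi * (w%:~R / 24) * E2 t * eta w t).
have := etaw_der (1 : R) w t; rewrite rmorph1; apply: cder_eq => [u|]; first by rewrite etaE.
by rewrite etaE. Qed.
Lemma eta_mulN w t : eta w t * eta (- w) t = 1.
by have := etaw_mulN (1 : R) w t; rewrite -!etaE. Qed.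
Lemma eta_neq0 w t : eta w t != 0.
by have := etaw_neq0 (1 : R) w t; rewrite -!etaE. Qed.
Lemma eta_S_nat (n : nat) t : eta n (uhpS t) = (sqrtC uhp_i°) ^- n * sqrtC t° ^+ n * eta n t.
by have := etaw_S_nat E2S' n t; rewrite -!etaE. Qed.

End EtaTransformation.

#[global] Opaque E2 eta.

(** * Scalar forms of level one *)

Section Forms.
Variable R : realType.
Local Notation C := R[i].
Local Notation e := (@cexp2pi R).
Local Notation H := (uhp R).
Local Notation Im := (@complex.Im R).
Local Notation Re := (@complex.Re R).
Local Notation tpi := (@tpi R).

Lemma Im_add_int (t : H) (n : int) : Im (t° + n%:~R) = Im t.
by rewrite raddfD /= -(rmorph_int (real_complex R)) /= addr0. Qed.
Fact uhp_add_gt0 (t : H) (n : int) : 0 < Im (t° + n%:~R).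
by rewrite Im_add_int; exact: uhp_gt0. Qed.
Definition uhp_add (t : H) n : H := Uhp (uhp_add_gt0 t n).
Lemma Im_uhpS (t : H) : Im (uhpS t) = Im t / cn t° ^+ 2.
have := uhp_gt0 t; rewrite uhpSE sqr_cn; case: t° => x y /= y0.
by rewrite opprK.
Qed.

(** Reduction theory as an induction principle. Below height 1/2, translate to |Re t| <= 1/2; then
    |t|^2 <= 1/2 and S at least doubles the height. The exponent m bounds the number of doublings
    still needed. *)
Lemma uhp_reduce (P : H -> Prop) : (forall t : H, 1 / 2 <= Im t -> P t) ->
 (forall (t : H) n, P (uhp_add t n) -> P t) -> (forall t : H, P (uhpS t) -> P t) -> forall t, P t.
move=> h0 hT hS t; have y0 := uhp_gt0 t.
have [m] : exists m, 1 <= Im t * 2 ^+ m.+1.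
 exists (Num.truncn (Im t)^-1); have h := truncnS_gt (Im t)^-1.
 rewrite -ler_pdivrMl// mulr1; apply: le_trans (ltW h) _.
 by rewrite -natrX ler_nat ltnW// ltn_expl.
elim: m t {y0} => [|m IH] t hm; first by apply: h0; rewrite expr1 in hm; lra.
have [y2|y2] := lerP (1 / 2) (Im t); first exact: h0.
have y0 := uhp_gt0 t.
pose n : int := - Num.floor (Re t + 1 / 2); apply: (hT t n); apply: hS; apply: IH.
set u := uhp_add t n; rewrite Im_uhpS; have uI : Im u = Im t by exact: Im_add_int.
have uR : `|Re u| <= 1 / 2.
 have -> : Re u = Re t - (Num.floor (Re t + 1 / 2))%:~R by rewrite /u /= raddfD /= -(rmorph_int (real_complex R)) /= /n rmorphN.
 have := floor_le (Re t + 1 / 2); have := floorD1_gt (Re t + 1 / 2).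
 by rewrite rmorphD /= => h1 h2; rewrite ler_norml; lra.
have u1 : cn u° ^+ 2 <= 1 / 2.
 rewrite sqr_cn uI; have : Re u ^+ 2 <= (1 / 2) ^+ 2.
 by rewrite -[Re u ^+ 2]real_normK ?num_real// lerXn2r ?nnegrE//; lra.
 have : Im t ^+ 2 <= (1 / 2) ^+ 2 by rewrite lerXn2r ?nnegrE ?(ltW y0)//; lra.
 lra.
have u0 : 0 < cn u° ^+ 2 by rewrite exprn_gt0// cn_gt0 uhp_neq0.
rewrite uI; apply: le_trans hm _; rewrite exprS mulrA ler_wpM2r ?exprn_ge0//.
by rewrite ler_pdivlMr//; nra.
Qed.

Definition isometric n (S : 'M[C]_n) := forall x : 'cV[C]_n,
 \sum_i cn ((S *m x) i 0) ^+ 2 = \sum_i cn (x i 0) ^+ 2.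
Lemma QE_cn_add lam (f : H -> C) (t : H) n : QE lam f -> cn (f (uhp_add t n)) = cn (f t).
move=> [c [tc fE]]; rewrite (fE (uhp_add t n)) (fE t) [LHS]cnM [RHS]cnM.
have -> : e (uhp_add t n) = e t by rewrite /= eD e_int mulr1.
by rewrite !cn_e_lam /= Im_add_int.
Qed.

Lemma small_le0 (a K : R) : (forall y, 0 < y <= 1 -> a <= K * y) -> a <= 0.
move=> h; rewrite leNgt; apply/negP => a0.
have K0 : 0 < K by have := h 1; rewrite ltr01 lexx mulr1 => /(_ isT); lra.
have := h (a / (2 * K)).
rewrite divr_gt0 ?mulr_gt0//= ler_pdivrMr ?mulr_gt0// mul1r.
have -> : K * (a / (2 * K)) = a / 2 by field; rewrite gt_eqF.
have : a <= K * 1 by apply: h; rewrite ltr01 lexx.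
by move=> h1 h2; have := h2 _; lra.
Qed.

Section Negative.
Variables (n : nat) (S : 'M[C]_n) (L : 'I_n -> R) (f : H -> 'cV[C]_n) (j : nat).
Hypotheses (isoS : isometric S) (L0 : forall i, 0 <= L i) (j0 : (0 < j)%N).
Hypotheses (fQ : forall i, QE (L i) (fun t => f t i 0)).
Hypotheses (fS : forall t : H, t° ^+ j.*2 *: f (uhpS t) = S *m f t).

(** The quotient of the two sides is invariant under S by the isometry and under T by the
    expansions, and it is bounded for Im t >= 1/2 because the exponents are nonnegative. *)
Lemma neg_bound : exists2 K : R, 0 <= K & forall t, \sum_i cn (f t i 0) ^+ 2 <= K * Im t ^+ j.*2.
have [B B0 hB] : exists2 B, 0 <= B & forall (t : H), 1 / 2 <= Im t -> forall i, cn (f t i 0) <= B.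
 have h i : exists B, 0 <= B /\ forall t : H, 1 / 2 <= Im t -> cn (f t i 0) <= B.
 have [c hc] := fQ i; have h2 : 0 < 1 / 2 :> R by lra.
 by have [B B0 hB] := QEc_bounded h2 (L0 i) hc; exists B.
 have [B hB] := choice h; exists (\sum_i B i); first by apply: sumr_ge0 => i _; case: (hB i).
 move=> t ht i; apply: le_trans (_ : B i <= _); first by case: (hB i) => _; exact.
 by rewrite (bigD1 i)//= lerDl sumr_ge0// => k _; case: (hB k).
exists (n%:R * B ^+ 2 * 2 ^+ j.*2); first by rewrite !mulr_ge0 ?exprn_ge0.
apply: uhp_reduce => [t ht|t m|t].
- apply: le_trans (_ : n%:R * B ^+ 2 <= _).
 apply: le_trans (_ : \sum_(i < n) B ^+ 2 <= _).
 by apply: ler_sum => i _; rewrite lerXn2r ?nnegrE ?cn_ge0// hB.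
 by rewrite sumr_const card_ord mulr_natl.
 rewrite -[leRHS]mulrA -exprMn ler_peMr ?mulr_ge0 ?exprn_ge0// exprn_ege1//; lra.
- rewrite /= Im_add_int; congr (_ <= _); apply: eq_bigr => i _; congr (_ ^+ 2).
 exact: QE_cn_add (fQ i).
rewrite Im_uhpS; set x := cn t°; have x0 : 0 < x by rewrite cn_gt0 uhp_neq0.
have -> : \sum_i cn (f t i 0) ^+ 2 = (x ^+ j.*2) ^+ 2 * \sum_i cn (f (uhpS t) i 0) ^+ 2.
 rewrite -isoS -fS mulr_sumr; apply: eq_bigr => i _.
 by rewrite !mxE cnM cnX exprMn.
move=> h; apply: le_trans (ler_wpM2l _ h) _; first by rewrite !exprn_ge0// ltW.
rewrite expr_div_n -(exprM x 2) mulnC (exprM x); move: (_ * _ * _) => K.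
have z0 : x ^+ j.*2 != 0 by rewrite expf_neq0// gt_eqF.
move: (x ^+ _) z0 => z z0; rewrite le_eqVlt; apply/orP; left; apply/eqP; field.
exact: z0.
Qed.

(** On the line Im t = y the form is O(y^j) with j > 0. The coefficient bound makes every
    coefficient O(y) as y tends to 0. *)
Lemma neg_weight_eq0 t : f t = 0.
have [K K0 hK] := neg_bound; apply/colP => i; rewrite [RHS]mxE.
have [c hc] := fQ i; have [tc fE] := hc.
have c0 m : c m = 0.
 apply/eqP; rewrite -cn_eq0 eq_le cn_ge0 andbT.
 apply: (@small_le0 _ ((K + 1) * expR (2 * pi * L i) * expR (2 * pi * m%:R))) => y /andP[y0 y1].
 have := QEc_coef_bound y0 hc (B := (K + 1) * y) _ m => h.
 have {}h := h _; have b : forall t0 : H, Im t0 = y -> cn (f t0 i 0) <= (K + 1) * y.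
 move=> u uy; rewrite -(@ler_pXn2r _ 2) ?nnegrE ?cn_ge0 ?mulr_ge0 ?(ltW y0)//; last by lra.
 apply: le_trans (_ : K * y ^+ j.*2 <= _).
 have := hK u; rewrite uy; apply: le_trans; rewrite (bigD1 i)//= lerDl sumr_ge0// => k _.
 exact: exprn_ge0 (cn_ge0 _).
 rewrite exprMn; apply: ler_pM => //; first exact: exprn_ge0 (ltW y0).
 by nra.
 by apply: ler_wiXn2l; rewrite ?(ltW y0)//; move: j0; lia.
 have {h} := h b; rewrite -expRM_natl => h.
 have p0 : 0 < 2 * pi :> R by rewrite mulr_gt0 ?pi_gt0.
 have E0 : 0 < expR (m%:R * (2 * pi * y)) by exact: expR_gt0.
 apply: le_trans (_ : (K + 1) * y * expR (2 * pi * L i * y) * expR (m%:R * (2 * pi * y)) <= _).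
 rewrite -ler_pdivrMr// -expRN; apply: le_trans h; rewrite mulrN; exact: lexx.
 have -> : (K + 1) * expR (2 * pi * L i) * expR (2 * pi * m%:R) * y =
 (K + 1) * y * expR (2 * pi * L i) * expR (2 * pi * m%:R) by ring.
 have Ky : 0 <= (K + 1) * y by rewrite mulr_ge0 ?(ltW y0)//; lra.
 apply: ler_pM; rewrite ?expR_ge0//.
 by rewrite mulr_ge0 ?expR_ge0.
 rewrite ler_wpM2l// ler_expR ler_piMr// mulr_ge0 ?L0// ltW//.
 by rewrite ler_expR mulrCA mulrA ler_piMr// mulr_ge0 ?(ltW p0).
by rewrite fE ps_eq0 ?mulr0.
Qed.

End Negative.

Lemma isometric1 n : isometric (1%:M : 'M[C]_n).
by move=> x; rewrite mul1mx. Qed.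

Lemma neg_weight_scalar (g : H -> C) (j : nat) : (0 < j)%N -> QE 0 g ->
 (forall t : H, t° ^+ j.*2 * g (uhpS t) = g t) -> forall t, g t = 0.
move=> j0 gQ gS t.
have := @neg_weight_eq0 1 1%:M (fun=> 0) (fun t => (g t)%:M) j (@isometric1 1) (fun=> lexx _) j0.
move=> /(_ _ _ t) h; have : (g t)%:M = 0 :> 'cV[C]_1.
 apply: h => [i|u].
 by have := gQ; congr QE; apply/funext => u; rewrite mxE ord1 eqxx mulr1n.
 apply/matrixP => a b; rewrite mul1mx !mxE !ord1 eqxx !mulr1n; exact: gS.
by move=> /matrixP/(_ 0 0); rewrite !mxE eqxx mulr1n.
Qed.

Definition Dpow (c : nat -> C) (n : nat) : C := n%:R * c n.

Definition c2 n : C := @delta0 R n + e2coef R n.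
Lemma tame_c2 : tame c2.
by apply: tameD; [exact: tame_delta0 | exact: tame_e2coef]. Qed.
Lemma E2_ps t : E2 t = ps c2 (e t).
by rewrite E2E psD ?ps_delta0//; [exact: tame_delta0|exact: tame_e2coef|exact: cn_e_uhp]. Qed.
Lemma tame_Dpow c : tame c -> tame (Dpow c). Proof. exact: tame_nat. Qed.

(** Ramanujan's identities for the derivatives of E2 and E4 are taken as definitions of E4 and E6.
    Modularity then comes from differentiating the law of E2, without divisor sums of higher
    powers. *)
Definition c4 n : C := conv c2 c2 n + (-12) * Dpow c2 n.
Definition E4 (t : H) : C := ps c4 (e t).
Lemma tame_c4 : tame c4.
by apply: tameD; [apply: tame_conv|apply: tameZ; apply: tame_Dpow]; exact: tame_c2. Qed.
Definition c6 n : C := conv c2 c4 n + (-3) * Dpow c4 n.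
Definition E6 (t : H) : C := ps c6 (e t).
Lemma tame_c6 : tame c6.
apply: tameD; first by apply: tame_conv; [exact: tame_c2|exact: tame_c4].
by apply: tameZ; apply: tame_Dpow; exact: tame_c4.
Qed.

Lemma E4E t : E4 t = E2 t ^+ 2 - 12 * ps (Dpow c2) (e t).
have t2 := tame_c2; have q := cn_e_uhp t.
rewrite /E4 psD ?psZ ?ps_conv -?E2_ps//; first by ring.
- exact: tame_Dpow.
- exact: tame_conv.
- by apply: tameZ; exact: tame_Dpow.
Qed.

Lemma E6E t : E6 t = E2 t * E4 t - 3 * ps (Dpow c4) (e t).
have t2 := tame_c2; have t4 := tame_c4; have q := cn_e_uhp t.
rewrite /E6 psD ?psZ ?ps_conv -?E2_ps//; first by rewrite /E4; ring.
- exact: tame_Dpow.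
- exact: tame_conv.
- by apply: tameZ; exact: tame_Dpow.
Qed.

Lemma QEc_ps0 c : tame c -> QEc 0 c (fun t => ps c (e t)).
by move=> tc; split=> // t; rewrite mul0r e0 mul1r. Qed.
Lemma E2_der t : cder (@E2 R) t (tpi * ps (Dpow c2) (e t)).
by apply: cder_eq (cder_ps t tame_c2) => // u; rewrite E2_ps. Qed.
Lemma E4_der t : cder E4 t (tpi * ps (Dpow c4) (e t)).
exact: cder_ps t tame_c4. Qed.

(** The anomaly of E2 cancels the derivative of t^k. Two functions [f] and [g] are allowed so that
    the lemma applies to a component of a vector-valued form, [g] being that component of S f. *)
Lemma serre_S (k : nat) (f f' g g' : H -> C) : (forall t : H, f (uhpS t) = t° ^+ k * g t) ->
 (forall t, cder f t (tpi * f' t)) -> (forall t, cder g t (tpi * g' t)) ->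
 forall t : H, f' (uhpS t) - k%:R / 12 * E2 (uhpS t) * f (uhpS t) =
 t° ^+ k.+2 * (g' t - k%:R / 12 * E2 t * g t).
move=> fS fd gd t; have t0 := uhp_neq0 t; have p0 := tpi_neq0 R.
have d1 := cder_comp (cder_uhpS t) (fd (uhpS t)).
have d2 := cderM (cder_expn k (cder_id t)) (gd t).
have {}d2 := cder_eq (fun u => esym (fS u)) erefl d2.
have h := cder_unique d1 d2.
have -> : f' (uhpS t) = t° ^+ 2 * (k%:R * t° ^+ k.-1 * g t / tpi + t° ^+ k * g' t).
 move: h t0 p0; move: t° (f' _) (g t) (g' t) (_ ^+ k.-1) (_ ^+ k) (tpi).
 move=> z a b b' x y p h z0 p0; apply: (mulIf (_ : p / z ^+ 2 != 0)).
 by rewrite mulf_neq0 ?invr_eq0 ?expf_neq0.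
 rewrite mulrA [a * p]mulrC h; field; rewrite p0 z0.
 by [].
rewrite E2_uhpS fS; case: k {fS d2 h} => [|k] /=.
 by rewrite !mul0r !expr0; ring.
rewrite !exprS; move: p0; move: (k.+1%:R) t° (_ ^+ k) (tpi) (g t) (g' t) (E2 t).
by move=> a z x p b b' c p0; field.
Qed.

Lemma E4_S (t : H) : E4 (uhpS t) = t° ^+ 4 * E4 t.
have t0 := uhp_neq0 t; have p0 := tpi_neq0 R.
have d1 := cder_comp (cder_uhpS t) (E2_der (uhpS t)).
have d2 := cderD (cderM (cder_expn 2 (cder_id t)) (E2_der t)) (cderZ (12 / tpi) (cder_id t)).
have {}d2 : cder (fun u => E2 (uhpS u)) t _ := cder_eq _ erefl d2.
have h := cder_unique d1 (d2 _).
rewrite !E4E E2_uhpS.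
have -> : ps (Dpow c2) (e (uhpS t)) = t° ^+ 2 / tpi * (tpi * ps (Dpow c2) (e (uhpS t)) * t° ^- 2).
 by move: (ps _ _) t0 p0; move: t° tpi => z p y z0 p0; field; rewrite z0 p0.
rewrite h; last first.
 by move=> u; rewrite E2_uhpS; ring.
rewrite /= expr1; move: t0 p0; move: t° tpi (E2 t) (ps _ _) => z p a b z0 p0; field.
exact: p0.
Qed.

Lemma E6_S (t : H) : E6 (uhpS t) = t° ^+ 6 * E6 t.
have := serre_S E4_S E4_der E4_der t; rewrite !E6E.
move: (E2 (uhpS t)) (E4 (uhpS t)) (ps _ (e (uhpS t))) (E2 t) (E4 t) (ps _ (e t)) (_ ^+ 6).
move=> a b c a' b' c' z h; have -> : a * b - 3 * c = -3 * (c - 4 / 12 * a * b) by field.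
by rewrite h; field.
Qed.

(** The weight is 2j; [QE 0] contains both invariance under T and holomorphy at infinity. *)
Definition MS (j : int) (g : H -> C) := QE 0 g /\ forall t : H, g (uhpS t) = t° ^ (j * 2) * g t.
Lemma E4_MS : MS 2 E4. Proof. by split; [exists c4; exact: QEc_ps0 tame_c4 | exact: E4_S]. Qed.
Lemma E6_MS : MS 3 E6. Proof. by split; [exists c6; exact: QEc_ps0 tame_c6 | exact: E6_S]. Qed.
Lemma uhp_exprD (t : H) (j k : int) : t° ^ ((j + k) * 2) = t° ^ (j * 2) * t° ^ (k * 2).
by rewrite mulrDl expfzDr ?uhp_neq0. Qed.
Lemma uhp_expr12 (t : H) : t° ^ (6 * 2) = t° ^+ 12.
by have -> : (6 * 2 : int) = Posz 12 by []; rewrite -exprnP. Qed.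
Lemma MS_M j k f g : MS j f -> MS k g -> MS (j + k) (fun t => f t * g t).
move=> [fQ fS] [gQ gS]; split; first by have := QEM fQ gQ; rewrite addr0.
by move=> t; rewrite fS gS uhp_exprD; ring.
Qed.
Lemma MS_Z a j f : MS j f -> MS j (fun t => a * f t).
by move=> [fQ fS]; split=> [|t]; [exact: QEZ | rewrite fS mulrCA]. Qed.
Lemma MS_D j f g : MS j f -> MS j g -> MS j (fun t => f t + g t).
by move=> [fQ fS] [gQ gS]; split=> [|t]; [exact: QED | rewrite fS gS [RHS]mulrDr]. Qed.
Lemma MS_B j f g : MS j f -> MS j g -> MS j (fun t => f t - g t).
by move=> [fQ fS] [gQ gS]; split=> [|t]; [exact: QEB | rewrite fS gS [RHS]mulrBr]. Qed.
Lemma MS_0 j : MS j (fun=> 0).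
by split=> [|t]; [exact: QE0 | rewrite mulr0]. Qed.
Lemma MS_cst a : MS 0 (fun=> a).
by split=> [|t]; [exact: QEcst | rewrite mul0r expr0z mul1r]. Qed.
Lemma MS_ext j k f g : j = k -> f =1 g -> MS j f -> MS k g.
by move=> <- /funext <-. Qed.
Lemma MS_X j f (m : nat) : MS j f -> MS (m%:Z * j) (fun t => f t ^+ m).
move=> h; elim: m => [|m IH]; first by apply: MS_ext (MS_cst 1); rewrite ?mul0r.
by apply: MS_ext (MS_M h IH) => [|t]; [lia | rewrite exprS].
Qed.
Lemma MS_neg j g : j < 0 -> MS j g -> forall t, g t = 0.
case: j => [//|m] _ [gQ gS]; apply: (@neg_weight_scalar g m.+1) => // t.
rewrite gS; have -> : t° ^ (Negz m * 2) = t° ^- m.+1.*2 by rewrite NegzE mulNr exprnN -PoszM muln2.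
by rewrite mulVKf// expf_neq0// uhp_neq0.
Qed.
Definition Delta : H -> C := eta 24%N.
Lemma Delta_neq0 t : Delta t != 0. Proof. exact: eta_neq0. Qed.
Lemma sqrtC_i24 : sqrtC (uhp_i R)° ^+ 24 = 1.
by rewrite (exprM _ 2 12) sqrtC_i_sqr (exprM _ 2 6) sqr_i -signr_odd. Qed.
Lemma Delta_S (t : H) : Delta (uhpS t) = t° ^+ 12 * Delta t.
by rewrite /Delta eta_S_nat sqrtC_i24 invr1 mul1r (exprM _ 2 12) sqrtCK. Qed.
Lemma Delta_QEc : QEc 1 (etac R 24%N) Delta.
have -> : (1 : R) = (Posz 24)%:~R / 24 by rewrite -pmulrn divff// pnatr_eq0.
exact: eta_QEc.
Qed.
Lemma Delta_MS : MS 6 Delta.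
split; last exact: Delta_S.
by apply: (@QE_unshift R 0 1); rewrite add0r; exists (etac R 24%N); exact: Delta_QEc.
Qed.
Lemma DeltaV_QEc : QEc (-1) (etac R (- 24%:Z)) (fun t => (Delta t)^-1).
have := @eta_QEc R (- 24%:Z); rewrite mulrNz -pmulrn mulNr divff ?pnatr_eq0//.
congr QEc; apply/funext => t; have := @eta_mulN R 24%N t => h.
by apply: (mulfI (Delta_neq0 t)); rewrite h mulfV ?Delta_neq0.
Qed.

Lemma MS_div_Delta j g c : QEc 0 c g -> c 0%N = 0 -> (forall t : H, g (uhpS t) = t° ^ (j * 2) * g t) ->
 MS (j - 6) (fun t => g t / Delta t).
move=> hc c0 gS; split.
 have h1 : QE 1 g by have := QEc_shift hc c0; rewrite add0r => h; exists (fun n => c n.+1).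
 have h2 : QE (-1) (fun t => (Delta t)^-1) by exists (etac R (- 24%:Z)); exact: DeltaV_QEc.
 by have := QEM h1 h2; rewrite subrr.
move=> t; rewrite gS Delta_S; have t0 := uhp_neq0 t; have d0 := Delta_neq0 t.
have -> : t° ^ (j * 2) = t° ^+ 12 * t° ^ ((j - 6) * 2).
 by rewrite -uhp_expr12 -uhp_exprD; congr (_ ^ (_ * _)); lia.
have := expf_neq0 12 t0; move: (_ ^+ 12) (_ ^ _) => x y x0; field.
by rewrite x0 d0.
Qed.

Lemma MS_0_const g : MS 0 g -> exists a, forall t, g t = a.
move=> [[c hc] gS]; exists (c 0%N) => t.
have h := QEcB hc (QEccst (c 0%N)).
have hS : forall t : H, g (uhpS t) - c 0%N = t° ^ (0 * 2) * (g t - c 0%N).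
 by move=> u; rewrite gS mul0r expr0z !mul1r.
have := MS_div_Delta h _ hS; rewrite /delta0 /= mulr1 subrr => /(_ erefl) h1.
have n6 : 0 - 6 < 0 :> int by [].
have /eqP := MS_neg n6 h1 t.
by rewrite mulf_eq0 invr_eq0 (negbTE (Delta_neq0 t)) orbF subr_eq0 => /eqP.
Qed.

Lemma c2_0 : c2 0 = 1. Proof. by rewrite /c2 /delta0 e2coef0 addr0. Qed.
Lemma c2_1 : c2 1 = - 24. Proof. by rewrite /c2 /delta0 /e2coef sigma1_1 add0r mulr1. Qed.
Lemma conv0 (c d : nat -> C) : conv c d 0 = c 0%N * d 0%N. Proof. by rewrite /conv big_ord1. Qed.
Lemma conv1 (c d : nat -> C) : conv c d 1 = c 0%N * d 1%N + c 1%N * d 0%N.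
by rewrite /conv !big_ord_recl big_ord0 addr0. Qed.
Lemma c4_0 : c4 0 = 1. Proof. by rewrite /c4 conv0 c2_0 /Dpow mul0r mulr0 addr0 mulr1. Qed.
Lemma c4_1 : c4 1 = 240. Proof. by rewrite /c4 conv1 c2_0 /Dpow c2_1; ring. Qed.
Lemma c6_0 : c6 0 = 1. Proof. by rewrite /c6 conv0 c2_0 c4_0 /Dpow mul0r mulr0 addr0 mulr1. Qed.
Lemma c6_1 : c6 1 = - 504. Proof. by rewrite /c6 conv1 c2_0 c2_1 c4_0 c4_1 /Dpow c4_1; ring. Qed.

(** The quotient by Delta has weight 0 and is constant; the coefficient of q is 3 (240) + 2 (504) =
    1728. *)
Lemma E4_E6_Delta t : E4 t ^+ 3 - E6 t ^+ 2 = 1728 * Delta t.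
have h4 := QEc_ps0 tame_c4; have h6 := QEc_ps0 tame_c6.
have h46 := QEcM h4 (QEcM h4 h4); have h66 := QEcM h6 h6; rewrite !addr0 in h46 h66.
have h := QEcB h46 h66.
set c := (fun n => _) in h; have c0 : c 0%N = 0 by rewrite /c !conv0 c4_0 c6_0 !mulr1 subrr.
have c1 : c 1%N = 1728 by rewrite /c !conv1 !conv0 c4_0 c6_0 c4_1 c6_1; ring.
have hS (u : H) : ps c4 (e (uhpS u)) * (ps c4 (e (uhpS u)) * ps c4 (e (uhpS u))) -
 ps c6 (e (uhpS u)) * ps c6 (e (uhpS u)) = u° ^ (6 * 2) *
 (ps c4 (e u) * (ps c4 (e u) * ps c4 (e u)) - ps c6 (e u) * ps c6 (e u)).
 have := E4_S u; have := E6_S u; rewrite /E4 /E6 => -> ->.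
 by rewrite uhp_expr12; move: (ps c4 _) (ps c6 _) => x y; ring.
have h1 := MS_div_Delta h c0 hS; rewrite subrr in h1.
have [a ha] := MS_0_const h1.
have a1728 : a = 1728.
 have hs := QEc_shift h c0; rewrite add0r in hs.
 have h2 := QEcZ a Delta_QEc.
 have : (fun n => c n.+1) = (fun n => a * etac R 24%N n).
 apply: (QEc_inj hs); case: h2 => th h2; split=> // u; rewrite -h2.
 by rewrite -(ha u) divfK ?Delta_neq0.
 by move=> /(congr1 (fun f => f 0%N)); rewrite c1 etac0 mulr1.
by have := ha t; rewrite a1728 => <-; rewrite divfK ?Delta_neq0// /E4 /E6; move: (ps c4 _) (ps c6 _) => x y; ring.
Qed.

Lemma Delta_comb t : Delta t = (E4 t ^+ 3 - E6 t ^+ 2) / 1728.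
by rewrite E4_E6_Delta mulrAC divff ?mul1r// pnatr_eq0. Qed.
Lemma rho_X6 : (uhp_rho R)° ^+ 3 = -1.
have h := @uhp_rho_sqr R; rewrite exprS h mulrBr -expr2 h mulr1; ring.
Qed.
Lemma QE_fixed (f : H -> C) (t : H) : QE 0 f -> f (uhpT t) = f t.
by move=> h; rewrite (QE_uhpT t h) e0 mul1r. Qed.

(** As TS fixes rho, E4(rho) = rho^4 E4(rho) = -rho E4(rho), and rho is not -1. *)
Lemma E4_rho : E4 (uhp_rho R) = 0.
have [q _] := E4_MS; have := QE_fixed (uhpS (uhp_rho R)) q.
rewrite uhpTS_rho E4_S (exprS _ 3) rho_X6 mulrN1 mulNr => h.
have r0 : (uhp_rho R)° + 1 != 0.
 by apply/eqP => /(congr1 Re) /=; lra.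
by apply/eqP; rewrite -(mulrI_eq0 _ (mulfI r0)) mulrDl mul1r {2}h addrN.
Qed.

Lemma E6_rho_neq0 : E6 (uhp_rho R) != 0.
apply/eqP => h; have := E4_E6_Delta (uhp_rho R); rewrite E4_rho h !expr0n subrr => /esym/eqP.
by rewrite mulf_eq0 (negbTE (Delta_neq0 _)) orbF pnatr_eq0.
Qed.
Definition unitQ (f : H -> C) := exists d, QEc 0 d f /\ d 0%N = 1.
Lemma unitQ_M f g : unitQ f -> unitQ g -> unitQ (fun t => f t * g t).
move=> [d [hd d0]] [c [hc c0]]; exists (conv d c); split; last by rewrite conv0 d0 c0 mulr1.
by have := QEcM hd hc; rewrite addr0.
Qed.
Lemma unitQ_X f m : unitQ f -> unitQ (fun t => f t ^+ m).
move=> h; elim: m => [|m IH]; first by exists (@delta0 R); split=> //; exact: QEc1.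
by have := unitQ_M h IH; congr unitQ; apply/funext => t; rewrite exprS.
Qed.
Lemma unitQ_E a b : unitQ (fun t => E4 t ^+ a * E6 t ^+ b).
apply: unitQ_M; apply: unitQ_X; first by exists c4; split; [exact: QEc_ps0 tame_c4 | exact: c4_0].
by exists c6; split; [exact: QEc_ps0 tame_c6 | exact: c6_0].
Qed.
Lemma MS_E (a b : nat) : MS (2 * a%:Z + 3 * b%:Z) (fun t => E4 t ^+ a * E6 t ^+ b).
by apply: MS_ext (MS_M (MS_X a E4_MS) (MS_X b E6_MS)) => //; lia. Qed.

(** A monomial in E4 and E6 has constant term 1. Subtracting a multiple of it kills the constant
    term of r, and the rest is divisible by Delta. *)
Lemma MS_step (a b : nat) r : MS (2 * a%:Z + 3 * b%:Z) r -> exists c0 r',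
 MS (2 * a%:Z + 3 * b%:Z - 6) r' /\ forall t, r t = c0 * (E4 t ^+ a * E6 t ^+ b) + Delta t * r' t.
move=> hr; have [[c hc] _] := hr; have [d [hd d0]] := unitQ_E a b.
exists (c 0%N), (fun t => (r t - c 0%N * (E4 t ^+ a * E6 t ^+ b)) / Delta t); split; last first.
 by move=> t; have := Delta_neq0 t; move: (r t) (_ * _) (Delta t) => x y z z0; field.
have [_ hS] := MS_B hr (MS_Z (c 0%N) (MS_E a b)).
apply: (MS_div_Delta (QEcB hc (QEcZ (c 0%N) hd)) _ hS).
by rewrite d0 mulr1 subrr.
Qed.

Lemma MS_mul_eq0 j r : MS j r -> (forall t, r t * E4 t = 0) -> forall t, r t = 0.
move=> [rQ _] h; have [qE _] := E4_MS.
have [//|h4] := QEM_eq0 rQ qE h.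
have : QEc 0 c4 (fun=> 0).
 split=> [|t]; first exact: tame_c4.
 by rewrite mul0r e0 mul1r; exact: esym (h4 t).
by move=> /QEc_eq0/(_ 0%N)/eqP; rewrite c4_0 oner_eq0.
Qed.

(** The product g E4 has weight 6 and hence equals b E6. At rho, E4 vanishes and E6 does not, so b =
    0. *)
Lemma MS_1 g : MS 1 g -> forall t, g t = 0.
move=> hg; have [a [ra [hra ga]]] := @MS_step 1 0 _ (MS_M hg hg).
have {}hra t : ra t = 0 by apply: (MS_neg _ hra).
have [b [rb [hrb gb]]] := @MS_step 0 1 _ (MS_M hg E4_MS).
have {}hrb t : rb t = 0 by apply: (MS_neg _ hrb).
apply: (MS_mul_eq0 hg) => t; rewrite gb hrb.
have : b * E6 (uhp_rho R) = 0.
 by have := gb (uhp_rho R); rewrite E4_rho hrb !mulr0 expr0 expr1 mul1r addr0.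
by move=> /eqP; rewrite mulf_eq0 (negbTE E6_rho_neq0) orbF => /eqP ->; rewrite mul0r mulr0 addr0.
Qed.

Lemma weight_mono (j : nat) : j <> 1%N -> exists a b : nat, [/\ j%:Z = 2 * a%:Z + 3 * b%:Z & (a = 0%N) \/ (0 < a)%N].
move=> j1; have := ltn_pmod j (isT : (0 < 3)%N); have := divn_eq j 3.
case: (j %% 3)%N => [|[|[|//]]] h _.
- by exists 0%N, (j %/ 3)%N; split; [lia | left].
- by exists 2%N, (j %/ 3 - 1)%N; split; [lia | right].
- by exists 1%N, (j %/ 3)%N; split; [lia | right].
Qed.

(** Division by E4 in C[E4, E6] with remainder in C[E6], by iterating [MS_step] and replacing Delta
    by E4^3 and E6^2. The last clause says that the remainder is homogeneous of the right weight. *)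
Lemma MS_decomp j r : MS j r -> exists s c m, [/\ MS (j - 2) s,
 (forall t, r t = E4 t * s t + c * E6 t ^+ m) & c != 0 -> j = 3 * m%:Z].
have zero (k : int) f : (forall t, f t = 0) -> exists s c m, [/\ MS (k - 2) s,
 (forall t, f t = E4 t * s t + c * E6 t ^+ m) & c != 0 -> k = 3 * m%:Z].
 move=> f0; exists (fun=> 0), 0, 0%N; split=> [|t|/eqP//]; first exact: MS_0.
 by rewrite f0 mulr0 mul0r addr0.
case: j => [j|j]; last by move=> h; apply: zero; exact: MS_neg h.
have [n] := ubnP j; elim: n j r => // n IH j r jn hr.
have [j1|j1] := eqVneq j 1%N; first by apply: zero; apply: MS_1; rewrite j1 in hr.
have [a [b [jE ab]]] := weight_mono (elimN eqP j1).
rewrite jE in hr *; have [c0 [r' [hr' rE]]] := MS_step hr.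
have [s' [c' [m' [hs' r'E cm]]]] : exists s c m, [/\ MS (2 * a%:Z + 3 * b%:Z - 6 - 2) s,
 (forall t, r' t = E4 t * s t + c * E6 t ^+ m) & c != 0 -> 2 * a%:Z + 3 * b%:Z - 6 = 3 * m%:Z].
 have [j6|j6] := leqP 6 j; last by apply: zero; apply: MS_neg hr'; lia.
 have jj : 2 * a%:Z + 3 * b%:Z - 6 = (j - 6)%N%:Z by lia.
 by rewrite jj in hr' *; apply: IH hr'; lia.
have hc' : MS (2 * a%:Z + 3 * b%:Z - 2) (fun t => c' / 1728 * (E4 t ^+ 2 * E6 t ^+ m')).
 have [->|c0'] := eqVneq c' 0; first by apply: MS_ext (MS_0 _) => // t; rewrite !mul0r.
 by apply: MS_ext (MS_Z _ (MS_E 2 m')) => //; have := cm c0'; lia.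
have hD : MS (2 * a%:Z + 3 * b%:Z - 2) (fun t => Delta t * s' t).
 by apply: MS_ext (MS_M Delta_MS hs') => //; lia.
have n1728 : (1728 : C) != 0 by rewrite pnatr_eq0.
case: a ab rE hr hs' cm hc' hD {jE IH hr'} r'E => [|a] ab rE hr hs' cm hc' hD r'E.
 exists (fun t => Delta t * s' t + c' / 1728 * (E4 t ^+ 2 * E6 t ^+ m')), (c0 - c' / 1728), b.
 split=> [|t|_]; [exact: MS_D| |lia].
 have E : c' * E6 t ^+ m'.+2 = c' * E6 t ^+ b.
 by have [->|c0'] := eqVneq c' 0; rewrite ?mul0r//; congr (_ * _ ^+ _); have := cm c0'; lia.
 rewrite rE r'E Delta_comb expr0 mul1r.
 have -> : (c0 - c' / 1728) * E6 t ^+ b = c0 * E6 t ^+ b - (c' * E6 t ^+ b) / 1728.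
 by move: (E6 t ^+ b) => w; field.
 rewrite -E !exprS expr0.
 by move: (E4 t) (E6 t) (s' t) (_ ^+ m') (_ ^+ b) => x y z u v; field.
exists (fun t => c0 * (E4 t ^+ a * E6 t ^+ b) + (Delta t * s' t + c' / 1728 * (E4 t ^+ 2 * E6 t ^+ m'))),
 (- (c' / 1728)), m'.+2.
split=> [|t|]; first by apply: MS_D; [apply: MS_Z; apply: MS_ext (MS_E a b) => //; lia | exact: MS_D].
 rewrite rE r'E Delta_comb !exprS expr0.
 by move: (E4 t) (E6 t) (s' t) (_ ^+ m') (_ ^+ b) (_ ^+ a) => x y z u v w; field.
rewrite oppr_eq0 mulf_eq0 negb_or => /andP[/cm h _]; lia.
Qed.

End Forms.

(** * The graded module of vector-valued forms *)

Section ModuleOfForms.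
Variable R : realType.
Local Notation C := R[i].
Local Notation e := (@cexp2pi R).
Local Notation H := (uhp R).
Local Notation E4 := (@E4 R).
Local Notation E6 := (@E6 R).
Local Notation Delta := (@Delta R).
Local Notation MS := (@MS R).
Variables (n : nat) (S : 'M[C]_n) (L : 'I_n -> R).

Definition MF (j : int) (f : H -> 'cV[C]_n) := (forall i, QE (L i) (fun t => f t i 0)) /\
 forall t : H, f (uhpS t) = t° ^ (j * 2) *: (S *m f t).
Lemma MF_ext j k f g : j = k -> f =1 g -> MF j f -> MF k g.
by move=> <- /funext <-. Qed.
Lemma MF_D j f g : MF j f -> MF j g -> MF j (fun t => f t + g t).
move=> [fQ fS] [gQ gS]; split=> [i|t]; last by rewrite fS gS mulmxDr scalerDr.
by have := QED (fQ i) (gQ i); congr QE; apply/funext => t; rewrite mxE.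
Qed.
Lemma MF_M j k r f : MS j r -> MF k f -> MF (j + k) (fun t => r t *: f t).
move=> [rQ rS] [fQ fS]; split=> [i|t].
 by have := QEM rQ (fQ i); rewrite add0r; congr QE; apply/funext => t; rewrite mxE.
by rewrite rS fS uhp_exprD !scalerA -scalemxAr scalerA; congr (_ *: _); ring.
Qed.
Lemma MF_Z a j f : MF j f -> MF j (fun t => a *: f t).
by move=> h; apply: MF_ext (MF_M (MS_cst a) h); rewrite ?add0r. Qed.
Lemma MF_B j f g : MF j f -> MF j g -> MF j (fun t => f t - g t).
by move=> hf hg; apply: MF_ext (MF_D hf (MF_Z (-1) hg)) => // t; rewrite scaleN1r. Qed.
Lemma MF_0 j : MF j (fun=> 0).
split=> [i|t]; last by rewrite mulmx0 scaler0.
by have := @QE0 R (L i); congr QE; apply/funext => t; rewrite mxE.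
Qed.
Lemma MF_sum j (I : Type) (s : seq I) (F : I -> H -> 'cV[C]_n) :
 (forall i, MF j (F i)) -> MF j (fun t => \sum_(i <- s) F i t).
move=> h; elim: s => [|i s IH]; first by apply: MF_ext (MF_0 j) => // t; rewrite big_nil.
by apply: MF_ext (MF_D (h i) IH) => // t; rewrite big_cons.
Qed.

Hypotheses (isoS : isometric S) (L0 : forall i, 0 <= L i).

Lemma MF_neg j f : j < 0 -> MF j f -> forall t, f t = 0.
case: j => [//|m] _ [fQ fS]; apply: (@neg_weight_eq0 R n S L f m.+1 isoS L0) => // t.
rewrite fS; have -> : t° ^ (Negz m * 2) = t° ^- m.+1.*2 by rewrite NegzE mulNr exprnN -PoszM muln2.
by rewrite scalerA mulfV ?scale1r// expf_neq0// uhp_neq0.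
Qed.
Definition vanish (m : nat) (f : H -> 'cV[C]_n) :=
 forall i, exists c, QEc (L i) c (fun t => f t i 0) /\ forall k, (k < m)%N -> c k = 0.

Lemma MF_div_Delta j f m : MF j f -> vanish m.+1 f ->
 MF (j - 6) (fun t => (Delta t)^-1 *: f t) /\ vanish m (fun t => (Delta t)^-1 *: f t).
move=> [fQ fS] fv.
have key i : exists c, QEc (L i) c (fun t => ((Delta t)^-1 *: f t) i 0) /\ forall k, (k < m)%N -> c k = 0.
 have [c [hc c0]] := fv i; exists (conv (fun k => c k.+1) (etac R (- 24%:Z))); split.
 have := QEcM (QEc_shift hc (c0 0%N isT)) (@DeltaV_QEc R); rewrite addrK.
 by congr QEc; apply/funext => t; rewrite mxE mulrC.
 by move=> k km; rewrite /conv big1// => i0 _; rewrite c0 ?mul0r//; have := ltn_ord i0; lia.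
split=> //; split=> [i|t]; first by have [c [hc _]] := key i; exists c.
rewrite fS Delta_S; have t0 := uhp_neq0 t; have d0 := Delta_neq0 t.
have -> : t° ^ (j * 2) = t° ^+ 12 * t° ^ ((j - 6) * 2).
 by rewrite -uhp_expr12 -uhp_exprD; congr (_ ^ (_ * _)); lia.
rewrite -scalemxAr !scalerA; congr (_ *: _).
have := expf_neq0 12 t0; move: (_ ^+ 12) (_ ^ _) => x y x0; field.
by rewrite x0 d0.
Qed.

(** A substitute for the valence formula: m divisions by Delta lead to negative weight. *)
Lemma MF_vanish m j f : j < 6 * m%:Z -> MF j f -> vanish m f -> forall t, f t = 0.
elim: m j f => [|m IH] j f jm hf hv; first by apply: MF_neg hf; lia.
have [h1 h2] := MF_div_Delta hf hv => t.
have jm' : j - 6 < 6 * m%:Z by lia.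
by have /eqP := IH _ _ jm' h1 h2 t; rewrite scaler_eq0 invr_eq0 (negbTE (Delta_neq0 t)) => /eqP.
Qed.

Lemma QEc_0 lam : QEc lam (fun=> 0 : C) (fun=> 0).
split=> [|t]; last by rewrite ps_eq0 ?mulr0.
by apply: tame_le (@tame_delta0 R) => k; rewrite cn0 cn_ge0.
Qed.

Lemma QEc_sum lam (I : Type) (s : seq I) (c : I -> nat -> C) (f : I -> H -> C) :
 (forall i, QEc lam (c i) (f i)) ->
 QEc lam (fun k => \sum_(i <- s) c i k) (fun t => \sum_(i <- s) f i t).
move=> h; elim: s => [|i s IH].
 by have := QEc_0 lam; congr QEc; apply/funext => x; rewrite big_nil.
by have := QEcD (h i) IH; congr QEc; apply/funext => x; rewrite big_cons.
Qed.

(** By [MF_vanish] a form of this weight is determined by its first m coefficients in each of the n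
    components. A linear relation among these coefficient rows is therefore one among the forms. *)
Lemma MF_dependent (m : nat) (T : finType) j (f : T -> H -> 'cV[C]_n) : j < 6 * m%:Z -> (n * m < #|T|)%N ->
 (forall p, MF j (f p)) -> exists c : T -> C, (exists p, c p != 0) /\
 forall t, \sum_p c p *: f p t = 0.
move=> jm nmP hf.
have /choice[c hc] : forall p, exists c : 'I_n -> nat -> C, forall i, QEc (L i) (c i) (fun t => f p t i 0).
 by move=> p; have [q _] := hf p; have [c hc] := choice q; exists c.
pose A : 'M[C]_(#|T|, n * m) := \matrix_p mxvec (\matrix_(i < n, k < m) c (enum_val p) i k).
have : kermx A != 0 by rewrite -mxrank_eq0 mxrank_ker subn_eq0 -ltnNge (leq_ltn_trans (rank_leq_col A)).
case/rowV0Pn => v /sub_kermxP vA v0.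
exists (fun p => v 0 (enum_rank p)); split.
 by case/rV0Pn: v0 => p hp; exists (enum_val p); rewrite enum_valK.
apply: (@MF_vanish m j) => //; first by apply: MF_sum => p; exact: MF_Z.
move=> i; exists (fun k => \sum_p v 0 (enum_rank p) * c p i k); split.
 have := QEc_sum (index_enum T) (fun p => QEcZ (v 0 (enum_rank p)) (hc p i)).
 congr QEc; apply/funext => t; rewrite summxE; apply: eq_bigr => p _; by rewrite mxE.
move=> k km; have := congr1 (fun M : 'rV[C]_(n * m) => M 0 (mxvec_index i (Ordinal km))) vA.
rewrite !mxE => hz; rewrite -[RHS]hz (reindex (@enum_val T predT)) /=; last first.
 by exists enum_rank => p _; [exact: enum_valK | exact: enum_rankK].
by apply: eq_bigr => p _; rewrite enum_valK mxE mxvecE mxE.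
Qed.

Lemma MF_mul_eq0 j f : MF j f -> (forall t, E4 t *: f t = 0) -> forall t, f t = 0.
move=> [fQ _] h t; apply/colP => i; rewrite mxE.
have [qE _] := @E4_MS R; have [h4|//] : (forall t, E4 t = 0) \/ forall t, f t i 0 = 0.
 by apply: (QEM_eq0 qE (fQ i)) => u; have /colP/(_ i) := h u; rewrite !mxE.
by have := @E6_rho_neq0 R; have := E4_E6_Delta (uhp_i R); exfalso;
 have := @MS_mul_eq0 R 0 _ (@MS_cst R 1) (fun u => etrans (mul1r _) (h4 u)) (uhp_i R) => /eqP; rewrite oner_eq0.
Qed.

(* [h] is read off from 1728 Delta = E4^3 - E6^2. *)
Lemma MF_regular j U X : MF j U -> MF (j + 1) X -> (forall t, E6 t *: U t = E4 t *: X t) ->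
 exists2 h, MF (j - 2) h & forall t, U t = E4 t *: h t.
move=> hU hX E; pose g t := E4 t ^+ 2 *: U t - E6 t *: X t.
have hg : MF (j + 4) g.
 apply: MF_B; first by apply: MF_ext (MF_M (MS_X 2 (@E4_MS R)) hU) => //; lia.
 by apply: MF_ext (MF_M (@E6_MS R) hX) => //; lia.
have Eg t : E4 t *: g t = 1728 *: (Delta t *: U t).
 rewrite scalerBr !scalerA [E4 t * E6 t]mulrC -(scalerA (E6 t)) -E !scalerA -scalerBl.
 by rewrite -exprS -expr2 E4_E6_Delta.
have gv : vanish 1 g.
 move=> i; have [c hc] := hg.1 i; exists c; split=> // -[|//] _.
 have h1 := QEcM (QEc_ps0 (@tame_c4 R)) hc; rewrite add0r in h1.
 have [d hd] := hU.1 i; have h3 := QEcZ 1728 (QEc_unshift (QEcM hd (@Delta_QEc R))).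
 have E0 : (fun t : H => ps (@c4 R) (e t) * g t i 0) = (fun t : H => 1728 * (U t i 0 * Delta t)).
 by apply/funext => t; have /colP/(_ i) := Eg t; rewrite !mxE [Delta t * _]mulrC.
 rewrite E0 in h1; have := congr1 (fun F => F 0%N) (QEc_inj h1 h3).
 by rewrite conv0 c4_0 mul1r /= mulr0.
have [h1 _] := MF_div_Delta hg gv.
exists (fun t => 1728^-1 *: ((Delta t)^-1 *: g t)).
 by apply: MF_ext (MF_Z 1728^-1 h1) => //; lia.
move=> t; have d0 := Delta_neq0 t; rewrite !scalerA mulrC -scalerA Eg !scalerA.
by rewrite -[LHS]scale1r; congr (_ *: _); move: (Delta t) d0 => z z0; field.
Qed.

(** Membership in (E4, E6) M, the graded maximal ideal times the module; bases of complements in all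
    weights form a minimal system of generators. *)
Definition decomposable (j : int) (f : H -> 'cV[C]_n) := exists X Y,
 [/\ MF (j - 2) X, MF (j - 3) Y & forall t, f t = E4 t *: X t + E6 t *: Y t].
Lemma decomp_0 j : decomposable j (fun=> 0).
by exists (fun=> 0), (fun=> 0); split=> [||t]; rewrite ?scaler0 ?addr0//; exact: MF_0. Qed.
Lemma decomp_Z a j f : decomposable j f -> decomposable j (fun t => a *: f t).
move=> [X [Y [hX hY E]]]; exists (fun t => a *: X t), (fun t => a *: Y t).
split=> [||t]; [exact: MF_Z | exact: MF_Z |].
by rewrite E scalerDr !scalerA ![a * _]mulrC.
Qed.

(** Forms independent modulo decomposable ones are linearly independent, so [MF_dependent] bounds
    their number, and a family of maximal length must span the quotient. *)
Lemma complement (j : int) : exists p (b : nat -> H -> 'cV[C]_n), [/\ (forall a, MF j (b a)),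
 (forall c : nat -> C, decomposable j (fun t => \sum_(0 <= a < p) c a *: b a t) -> forall a, (a < p)%N -> c a = 0) &
 (forall f, MF j f -> exists c : nat -> C, decomposable j (fun t => f t - \sum_(0 <= a < p) c a *: b a t))].
pose P p := exists b : nat -> H -> 'cV[C]_n, (forall a, MF j (b a)) /\
 (forall c : nat -> C, decomposable j (fun t => \sum_(0 <= a < p) c a *: b a t) -> forall a, (a < p)%N -> c a = 0).
have P0 : exists p, `[< P p >].
 by exists 0%N; apply/asboolP; exists (fun _ _ => 0); split=> // a; exact: MF_0.
have Pb p : `[< P p >] -> (p <= n * `|j|.+1)%N.
 move=> /asboolP[b [hb ib]]; rewrite leqNgt; apply/negP => pn.
 have jm : j < 6 * (`|j|.+1)%:Z by lia.
 have cp : (n * `|j|.+1 < #|'I_p|)%N by rewrite card_ord.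
 have [c [[a ca] h]] := MF_dependent jm cp (fun a : 'I_p => hb a).
 have := ib (fun a => if insub a is Some a' then c a' else 0) _ a (ltn_ord a).
 rewrite valK => h1; move: ca; rewrite h1 ?eqxx//.
 have := decomp_0 j; congr decomposable; apply/funext => t; rewrite -[LHS](h t) big_mkord.
 by apply: eq_bigr => a' _; rewrite valK.
have [p /asboolP[b [hb ib]] pmax] := ex_maxnP P0 Pb.
exists p, b; split=> // f hf; apply: contrapT => nf.
suff : `[< P p.+1 >] by move/pmax; rewrite ltnn.
apply/asboolP; exists (fun a => if a == p then f else b a); split=> [a|c]; first by case: eqP.
move=> hc; have E t : \sum_(0 <= a < p.+1) c a *: (if a == p then f else b a) t =
 \sum_(0 <= a < p) c a *: b a t + c p *: f t.
 rewrite big_nat_recr//= eqxx; congr (_ + _); rewrite big_nat [RHS]big_nat.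
 by apply: eq_bigr => a /andP[_ ap]; rewrite (ltn_eqF ap).
have [cp|cp] := eqVneq (c p) 0.
 have ca := ib c _; move=> a; rewrite ltnS leq_eqVlt => /orP[/eqP->//|]; apply: ca.
 by move: hc; congr decomposable; apply/funext => t; rewrite E cp scale0r addr0.
case: nf; exists (fun a => - (c p)^-1 * c a).
have := decomp_Z (c p)^-1 hc; congr decomposable; apply/funext => t.
rewrite E scalerDr scalerA mulVf// scale1r addrC scaler_sumr -sumrN; congr (_ + _).
by apply: eq_bigr => a _; rewrite mulNr scaleNr opprK scalerA.
Qed.

Section Generators.
Variables (sz : nat -> nat) (b : nat -> nat -> H -> 'cV[C]_n).
Hypotheses (hb : forall k a, MF k%:Z (b k a))
 (ib : forall k (c : nat -> C), decomposable k%:Z (fun t => \sum_(0 <= a < sz k) c a *: b k a t) ->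
 forall a, (a < sz k)%N -> c a = 0)
 (gb : forall k f, MF k%:Z f ->
 exists c : nat -> C, decomposable k%:Z (fun t => f t - \sum_(0 <= a < sz k) c a *: b k a t)).

Definition gens (N : nat) : seq (nat * nat) := [seq (k, a) | k <- index_iota 0 N, a <- index_iota 0 (sz k)].
Lemma sum_gens (V : zmodType) (F : nat * nat -> V) N :
 \sum_(p <- gens N) F p = \sum_(0 <= k < N) \sum_(0 <= a < sz k) F (k, a).
by rewrite /gens big_allpairs_dep. Qed.
Lemma mem_gens N p : (p \in gens N) = (p.1 < N)%N && (p.2 < sz p.1)%N.
apply/allpairsPdep/andP => [[k [a [hk ha ->]]]|[h1 h2]].
 by move: hk ha; rewrite !mem_index_iota /=.
by exists p.1, p.2; rewrite !mem_index_iota; split=> //; case: (p).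
Qed.

Lemma sum_gens_pick (V : zmodType) (F : nat * nat -> V) N j : (j < N)%N ->
 \sum_(p <- gens N) (if p.1 == j then F p else 0) = \sum_(0 <= a < sz j) F (j, a).
move=> jN; rewrite sum_gens (bigD1_seq j) ?mem_index_iota ?iota_uniq//= [X in _ + X]big1 ?addr0.
 by apply: eq_bigr => a _; rewrite eqxx.
by move=> k /negbTE kj; apply: big1 => a _; rewrite kj.
Qed.

(** Graded Nakayama: modulo generators of weight j, a form is decomposable with factors of smaller
    weight, and the descent stops at negative weights. *)
Lemma gens_span N (j : int) f : j < N%:Z -> MF j f -> exists r : nat * nat -> H -> C,
 (forall p, MS (j - p.1%:Z) (r p)) /\ forall t, f t = \sum_(p <- gens N) r p t *: b p.1 p.2 t.
case: j => [j|j]; last first.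
 move=> _ h; exists (fun _ _ => 0); split=> [p|t]; first exact: MS_0.
 by rewrite (MF_neg _ h)// big1// => p _; rewrite scale0r.
have [m] := ubnP j; elim: m j f => // m IH j f jm jN hf.
have IH' (k : int) g : k < j%:Z -> MF k g -> exists r : nat * nat -> H -> C,
 (forall p, MS (k - p.1%:Z) (r p)) /\ forall t, g t = \sum_(p <- gens N) r p t *: b p.1 p.2 t.
 case: k => [k|k] kj hg; first by apply: IH; [lia|lia|].
 exists (fun _ _ => 0); split=> [p|t]; first exact: MS_0.
 by rewrite (MF_neg _ hg)// big1// => p _; rewrite scale0r.
have [c [X [Y [hX hY E]]]] := gb hf.
have j2 : j%:Z - 2 < j%:Z by lia.
have j3 : j%:Z - 3 < j%:Z by lia.
have [rX [hrX EX]] := IH' _ _ j2 hX.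
have [rY [hrY EY]] := IH' _ _ j3 hY.
exists (fun p t => E4 t * rX p t + E6 t * rY p t + if p.1 == j then c p.2 else 0); split=> [p|t].
 apply: MS_D; first apply: MS_D.
 - by apply: MS_ext (MS_M (@E4_MS R) (hrX p)) => //; lia.
 - by apply: MS_ext (MS_M (@E6_MS R) (hrY p)) => //; lia.
 case: eqP => [->|_]; last exact: MS_0.
 by apply: MS_ext (MS_cst (c p.2)) => //; lia.
rewrite -[LHS](subrK (\sum_(0 <= a < sz j) c a *: b j a t)) E EX EY !scaler_sumr -big_split /=.
rewrite -(@sum_gens_pick _ (fun p => c p.2 *: b p.1 p.2 t) N) -?big_split//=.
apply: eq_bigr => p _; rewrite !scalerA -!scalerDl; case: eqP => _; last by rewrite !addr0.
by rewrite -scalerDl.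
Qed.

(** Freeness from the regular sequence E4, E6. Modulo E4 the coefficients become c_p E6^q. In top
    weight the constants c_p vanish by [ib]; the others by [MF_regular], induction and evaluation at
    rho, where E4 = 0. The quotients by E4 then satisfy a relation of smaller weight. *)
Lemma gens_indep N (j : int) (r : nat * nat -> H -> C) : j < N%:Z -> (forall p, MS (j - p.1%:Z) (r p)) ->
 (forall t, \sum_(p <- gens N) r p t *: b p.1 p.2 t = 0) ->
 forall p, p \in gens N -> forall t, r p t = 0.
have negc (k : int) (r' : nat * nat -> H -> C) : k < 0 -> (forall p, MS (k - p.1%:Z) (r' p)) ->
 forall p t, r' p t = 0.
 by move=> k0 h p; apply: MS_neg (h p); lia.
case: j => [j|j]; last by move=> _ h _ p _; apply: negc h p.
have [m] := ubnP j; elim: m j r => // m IH j r jm jN hr E.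
have IH' (k : int) (r' : nat * nat -> H -> C) : k < j%:Z -> (forall p, MS (k - p.1%:Z) (r' p)) ->
 (forall t, \sum_(p <- gens N) r' p t *: b p.1 p.2 t = 0) -> forall p, p \in gens N -> forall t, r' p t = 0.
 case: k => [k|k] kj h; last by move=> _ p _; apply: negc h p.
 by move=> E'; apply: (IH k r' _ _ h E'); lia.
have /choice[s /choice[c /choice[q hq]]] : forall p, exists s c q, [/\ MS (j%:Z - p.1%:Z - 2) s,
 (forall t, r p t = E4 t * s t + c * E6 t ^+ q) & c != 0 -> j%:Z - p.1%:Z = 3 * q%:Z].
 by move=> p; exact: MS_decomp (hr p).
pose U t := \sum_(p <- gens N) (if p.1 == j then 0 else c p * E6 t ^+ (q p).-1) *: b p.1 p.2 t.
have hUp p : MS (j%:Z - 3 - p.1%:Z) (fun t => if p.1 == j then 0 else c p * E6 t ^+ (q p).-1).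
 case: eqP => [_|pj]; first exact: MS_0.
 have [_ _ cq] := hq p; have [->|c0] := eqVneq (c p) 0.
 by apply: MS_ext (MS_0 R _) => // t; rewrite mul0r.
 apply: MS_Z; apply: MS_ext (MS_X (q p).-1 (@E6_MS R)) => //; have := cq c0; lia.
have hU : MF (j%:Z - 3) U.
 by apply: MF_sum => p; apply: MF_ext (MF_M (hUp p) (hb p.1 p.2)) => //; lia.
pose X t := \sum_(p <- gens N) s p t *: b p.1 p.2 t.
have hX : MF (j%:Z - 2) X.
 by apply: MF_sum => p; have [h _ _] := hq p; apply: MF_ext (MF_M h (hb p.1 p.2)) => //; lia.
have Esum t : \sum_(0 <= a < sz j) c (j, a) *: b j a t + (E4 t *: X t + E6 t *: U t) = 0.
 have <- : \sum_(p <- gens N) (if p.1 == j then c p *: b p.1 p.2 t else 0) =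
 \sum_(0 <= a < sz j) c (j, a) *: b j a t.
 exact: (@sum_gens_pick _ (fun p => c p *: b p.1 p.2 t) N).
 rewrite -[RHS](E t).
 rewrite !scaler_sumr -!big_split /=; apply: eq_bigr => p _.
 rewrite !scalerA -!scalerDl; have [_ -> cq] := hq p; case: eqP => [pj|pj].
 rewrite mulr0 addr0 -scalerDl addrC; congr ((_ + _) *: _).
 have [->|c0] := eqVneq (c p) 0; first by rewrite mul0r.
 have -> : q p = 0%N by have := cq c0; rewrite pj; lia.
 by rewrite mulr1.
 rewrite add0r; congr ((_ + _) *: _); have [->|c0] := eqVneq (c p) 0; first by rewrite !mul0r mulr0.
 rewrite mulrCA -exprS prednK//; have := cq c0; case: (q p) => // q0; exfalso; apply: pj; lia.
have cj a : (a < sz j)%N -> c (j, a) = 0.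
 apply: (ib (c := fun a => c (j, a))); exists (fun t => (-1) *: X t), (fun t => (-1) *: U t).
 split=> [||t]; [exact: MF_Z | exact: MF_Z|].
 have /eqP := Esum t; rewrite addr_eq0 => /eqP ->.
 by rewrite !scalerA !mulrN1 !scaleNr opprD.
have E2 t : E6 t *: U t = E4 t *: ((-1) *: X t).
 have := Esum t; rewrite big_nat big1 ?add0r => [|a /andP[_ ha]]; last by rewrite cj// scale0r.
 by rewrite scalerA mulrN1 scaleNr => /eqP; rewrite addrC addr_eq0 => /eqP.
have j23 : j%:Z - 2 = j%:Z - 3 + 1 by lia.
have [h hh Uh] := MF_regular hU (MF_ext j23 (fun t => erefl) (MF_Z (-1) hX)) E2.
have j5 : j%:Z - 3 - 2 < N%:Z by lia.
have [u [hu Eu]] := gens_span j5 hh.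
have c0 p : p \in gens N -> p.1 != j -> c p = 0.
 move=> pN pj.
 have := IH' (j%:Z - 3) (fun p t => (if p.1 == j then 0 else c p * E6 t ^+ (q p).-1) - E4 t * u p t) _ _ _ p pN (uhp_rho R).
 rewrite (negbTE pj) E4_rho mul0r subr0 => h0; have /eqP : c p * E6 (uhp_rho R) ^+ (q p).-1 = 0.
 apply: h0 => [|p'|t]; first by lia.
 by apply: MS_B => //; apply: MS_ext (MS_M (@E4_MS R) (hu p')) => //; lia.
 under eq_bigr do rewrite scalerBl -scalerA.
 by rewrite sumrB -/(U t) -scaler_sumr -Eu -Uh subrr.
 by rewrite mulf_eq0 (negbTE (expf_neq0 _ (@E6_rho_neq0 R))) orbF => /eqP.
have U0 t : U t = 0.
 apply: big1_seq => p /andP[_ pN]; case: eqP => [_|/eqP pj]; first by rewrite scale0r.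
 by rewrite c0// mul0r scale0r.
have X0 t : X t = 0.
 apply: (MF_mul_eq0 hX) => u'; have := E2 u'; rewrite U0 scaler0 scalerA mulrN1 scaleNr => /esym/eqP.
 by rewrite oppr_eq0 => /eqP.
move=> p pN t; have [_ -> cq] := hq p.
have -> : s p t = 0.
 apply: (IH' (j%:Z - 2) s _ _ X0 p pN t); first by lia.
 by move=> p'; have [h' _ _] := hq p'; apply: MS_ext h' => //; lia.
rewrite mulr0 add0r; case: (eqVneq p.1 j) => [pj|pj]; last by rewrite c0// mul0r.
have := cj p.2; move: pN; rewrite mem_gens -pj => /andP[_ ->].
by rewrite -surjective_pairing => ->; rewrite ?mul0r.
Qed.


(** The i-th monomial has order exactly i at infinity; the induction splits off i = 0 and divides
    the rest by Delta. *)
Lemma mono_indep (m : nat) (c : 'I_m.+1 -> C) :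
 (forall t, \sum_(i < m.+1) c i * (Delta t ^+ i * E4 t ^+ (3 * (m - i))) = 0) -> forall i, c i = 0.
elim: m c => [|m IH] c h.
 move=> i; have := h (uhp_i R); rewrite big_ord1 subn0 muln0 !expr0 !mulr1.
 by move=> <-; congr c; apply: val_inj; rewrite (ord1 i).
pose r' t := \sum_(i < m.+1) c (lift ord0 i) * (Delta t ^+ i * E4 t ^+ (3 * (m - i))).
have E t : c ord0 * E4 t ^+ (3 * m.+1) + Delta t * r' t = 0.
 rewrite -[RHS](h t) big_ord_recl expr0 mul1r subn0; congr (_ + _).
 by rewrite mulr_sumr; apply: eq_bigr => i _; rewrite lift0 subSS exprS; ring.
have c0 : c ord0 = 0.
 have [d [hd d0]] := @unitQ_E R (3 * m.+1) 0.
 have hr : QE 0 r'.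
 apply: QE_sum => i _; apply: QEZ.
 have [q1 _] := MS_X i (@Delta_MS R); have [q2 _] := MS_X (3 * (m - i)) (@E4_MS R).
 by have := QEM q1 q2; rewrite addr0.
 have [c' hc'] := hr; have h1 := QEc_unshift (QEcM hc' (@Delta_QEc R)).
 have h2 := QEcD (QEcZ (c ord0) hd) h1.
 have E0 : (fun t : H => c ord0 * (E4 t ^+ (3 * m.+1) * E6 t ^+ 0) + r' t * Delta t) = (fun=> 0).
 by apply/funext => t; rewrite expr0 mulr1 [r' t * _]mulrC E.
 by rewrite E0 in h2; have := QEc_eq0 h2 0; rewrite d0 mulr1 /= addr0.
have r0 t : r' t = 0.
 have := E t; rewrite c0 mul0r add0r => /eqP.
 by rewrite mulf_eq0 (negbTE (Delta_neq0 t)) => /eqP.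
move=> i; have [j ->|->//] := unliftP ord0 i.
exact: (IH (fun j => c (lift ord0 j)) r0).
Qed.

(** Growth comparison. With n + 1 generators, the m + 1 monomials of [mono_indep] give (n+1)(m+1)
    independent forms at weight index 6m + N + 8, where [MF_dependent] allows at most n(m + N + 2);
    m = n(N + 2) is large enough. The 8 ensures that the missing weight N + 8 - k is never 1, so
    that a monomial fills it. *)
Lemma size_gens N : (size (gens N) <= n)%N.
rewrite leqNgt; apply/negP => sN.
pose m := (n * (N + 2))%N; pose J : int := (6 * m + N + 8)%N%:Z.
pose pk (k : 'I_n.+1) := nth (0, 0)%N (gens N) k.
have pN k : pk k \in gens N by apply: mem_nth; exact: leq_trans (ltn_ord k) sN.
have pk1 k : ((pk k).1 < N)%N by have := pN k; rewrite mem_gens => /andP[].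
have /choice[ab hab] : forall k, exists ab : nat * nat, (N + 8 - (pk k).1)%N%:Z = 2 * ab.1%:Z + 3 * ab.2%:Z.
 move=> k; have [|a [b' [h _]]] := @weight_mono (N + 8 - (pk k).1)%N; first by have := pk1 k; lia.
 by exists (a, b').
pose M k t := E4 t ^+ (ab k).1 * E6 t ^+ (ab k).2.
pose D (i : 'I_m.+1) t := Delta t ^+ i * E4 t ^+ (3 * (m - i)).
pose f (x : 'I_n.+1 * 'I_m.+1) t := (D x.2 t * M x.1 t) *: b (pk x.1).1 (pk x.1).2 t.
have hD i : MS (6 * m%:Z) (D i).
 by apply: MS_ext (MS_M (MS_X i (@Delta_MS R)) (MS_X (3 * (m - i)) (@E4_MS R))) => //; have := ltn_ord i; lia.
have hDM x : MS (J - (pk x.1).1%:Z) (fun t => D x.2 t * M x.1 t).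
 apply: MS_ext (MS_M (hD x.2) (MS_E R (ab x.1).1 (ab x.1).2)) => //.
 by have := hab x.1; have := pk1 x.1; rewrite /J; lia.
have hf x : MF J (f x) by apply: MF_ext (MF_M (hDM x) (hb _ _)) => //; lia.
have Jm : J < 6 * (m + N + 2)%N%:Z by rewrite /J; lia.
have cT : (n * (m + N + 2) < #|{: 'I_n.+1 * 'I_m.+1}|)%N.
 by rewrite card_prod !card_ord /m; nia.
have [c [[[k0 i0] c0] h]] := MF_dependent Jm cT hf.
pose r (p : nat * nat) t := \sum_(k < n.+1) (if pk k == p then (\sum_(i < m.+1) c (k, i) * D i t) * M k t else 0).
have pk_inj k k' : pk k = pk k' -> k = k'.
 move=> /eqP; rewrite nth_uniq ?(leq_trans (ltn_ord _) sN)//; first by move=> /eqP/val_inj.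
 rewrite /gens allpairs_uniq_dep ?iota_uniq// => [x _|[x1 x2] [y1 y2] _ _ [-> ->]//].
 exact: iota_uniq.
have Er k t : r (pk k) t = (\sum_(i < m.+1) c (k, i) * D i t) * M k t.
 by rewrite /r (bigD1 k)//= eqxx [X in _ + X]big1 ?addr0// => k' /eqP kk; case: eqP => // /pk_inj.
have hr p : MS (J - p.1%:Z) (r p).
 have S2 (I : Type) (s : seq I) (F : I -> H -> C) w : (forall i, MS w (F i)) -> MS w (fun t => \sum_(i <- s) F i t).
 move=> hF; elim: s => [|i s IH]; first by apply: MS_ext (MS_0 R w) => // t; rewrite big_nil.
 by apply: MS_ext (MS_D (hF i) IH) => // t; rewrite big_cons.
 apply: (S2) => k; case: eqP => [<-|_]; last exact: MS_0.
 apply: MS_ext (S2 _ (index_enum 'I_m.+1) (fun i t => c (k, i) * (D i t * M k t)) _ (fun i => MS_Z _ (hDM (k, i)))) => // t.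
 by rewrite mulr_suml; apply: eq_bigr => i _; rewrite mulrA.
pose N' := (6 * m + N + 9)%N.
have pN' k : pk k \in gens N'.
 by have := pN k; rewrite !mem_gens => /andP[h1 ->]; rewrite andbT; apply: leq_trans h1 _; rewrite /N'; lia.
have uN : uniq (gens N').
 rewrite /gens allpairs_uniq_dep ?iota_uniq// => [x _|[x1 x2] [y1 y2] _ _ [-> ->]//].
 exact: iota_uniq.
have Er0 t : \sum_(p <- gens N') r p t *: b p.1 p.2 t = 0.
 rewrite -[RHS](h t); under eq_bigr do rewrite /r scaler_suml.
 rewrite exchange_big /=; have -> : \sum_x c x *: f x t = \sum_k \sum_i c (k, i) *: f (k, i) t.
 by rewrite pair_bigA /=; apply: eq_bigr => -[].
 apply: eq_bigr => k _; rewrite (bigD1_seq (pk k))//= eqxx [X in _ + X]big1 ?addr0; last first.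
 by move=> p pk'; rewrite eq_sym (negbTE pk') scale0r.
 rewrite mulr_suml scaler_suml; apply: eq_bigr => i _.
 by rewrite /f scalerA mulrA.
have JN : J < N'%:Z by rewrite /J /N'; lia.
have {}h1 := gens_indep JN hr Er0 (pN' k0).
have hsum : QE 0 (fun t => \sum_(i < m.+1) c (k0, i) * D i t).
 by apply: QE_sum => i _; apply: QEZ; case: (hD i).
have [d [hd d0]] := @unitQ_E R (ab k0).1 (ab k0).2.
have [||hz|hz] := QEM_eq0 hsum (_ : QE 0 (M k0)).
- by exists d.
- by move=> t; rewrite -Er.
- by move: c0; rewrite (mono_indep hz) eqxx.
move: hd; have -> : (fun t : H => E4 t ^+ (ab k0).1 * E6 t ^+ (ab k0).2) = (fun=> 0).
 by apply/funext => t; exact: hz.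
by move=> /QEc_eq0/(_ 0%N)/eqP; rewrite d0 oner_eq0.
Qed.

Lemma gens_mono N N' : (N <= N')%N -> exists s, gens N' = gens N ++ s.
move=> NN; exists [seq (k, a) | k <- index_iota N N', a <- index_iota 0 (sz k)].
by rewrite /gens /index_iota !subn0 -[in LHS](subnKC NN) iotaD map_cat flatten_cat add0n.
Qed.

End Generators.

(** The matrix of F at [t0] factors through the generators of weight below N0, so there are at least
    n of these. By [size_gens] there are exactly n, and no further ones appear in higher weight. *)
Lemma free_basis (F : 'I_n -> H -> 'cV[C]_n) (w : 'I_n -> int) (t0 : H) :
 (forall l, MF (w l) (F l)) -> \det (\matrix_(i, l) F l t0 i 0) != 0 ->
 exists (k : 'I_n -> nat) (G : 'I_n -> H -> 'cV[C]_n), [/\ forall l, MF (k l)%:Z (G l),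
 (forall j f, MF j f -> exists r : 'I_n -> H -> C, (forall l, MS (j - (k l)%:Z) (r l)) /\
 forall t, f t = \sum_l r l t *: G l t) &
 \det (\matrix_(i, l) G l t0 i 0) != 0].
move=> hF dF.
have /choice[sz /choice[b hb]] := fun k : nat => complement k%:Z.
have hb1 k : forall a, MF k%:Z (b k a) by case: (hb k).
have hb2 k : forall c : nat -> C, decomposable k%:Z (fun t => \sum_(0 <= a < sz k) c a *: b k a t) ->
 forall a, (a < sz k)%N -> c a = 0 by case: (hb k).
have hb3 k : forall f, MF k%:Z f -> exists c : nat -> C,
 decomposable k%:Z (fun t => f t - \sum_(0 <= a < sz k) c a *: b k a t) by case: (hb k).
pose N0 := (\max_l `|w l|).+1%N.
have wN l : w l < N0%:Z.
 have : (`|w l| <= \max_l `|w l|)%N by exact: (@leq_bigmax _ (fun l => `|w l|%N) l).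
 by rewrite /N0; lia.
have span N (j : int) f : j < N%:Z -> MF j f -> exists r : nat * nat -> H -> C,
 (forall p, MS (j - p.1%:Z) (r p)) /\ forall t, f t = \sum_(p <- gens sz N) r p t *: b p.1 p.2 t.
 by move=> jN hf; apply: gens_span.
have sle N : (size (gens sz N) <= n)%N by exact: size_gens.
pose g (l : nat) := nth (0, 0)%N (gens sz N0) l.
have /choice[r hr] := fun l => span N0 _ _ (wN l) (hF l).
pose X : 'M[C]_(size (gens sz N0), n) := \matrix_(p, l) r l (g p) t0.
pose B : 'M[C]_(n, size (gens sz N0)) := \matrix_(i, p) b (g p).1 (g p).2 t0 i 0.
have FBX : \matrix_(i, l) F l t0 i 0 = B *m X.
 apply/matrixP => i l; rewrite !mxE; have [_ ->] := hr l.
 rewrite summxE (big_nth (0, 0)%N) big_mkord; apply: eq_bigr => p _.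
 by rewrite !mxE mulrC.
have s0 : size (gens sz N0) = n.
 apply/eqP; rewrite eqn_leq sle /=.
 have : \rank (\matrix_(i, l) F l t0 i 0) = n by apply: mxrank_unit; rewrite unitmxE unitfE.
 by rewrite FBX => h; rewrite -{1}h; exact: leq_trans (mxrankM_maxl _ _) (rank_leq_col _).
exists (fun l => (g l).1), (fun l => b (g l).1 (g l).2); split=> [l|j f hf|]; first exact: hb1.
 pose N := maxn N0 `|j|.+1.
 have jN : j < N%:Z by rewrite /N; lia.
 have [r' [hr' E]] := span N j f jN hf.
 have gE : gens sz N = gens sz N0.
 have [s hs] := gens_mono sz (leq_maxl N0 `|j|.+1); rewrite -/N in hs.
 have := sle N; rewrite hs size_cat s0 => h.
 by case: s h {hs} => [|x s] h; [rewrite cats0 | move: h => /=; lia].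
 exists (fun l => r' (g l)); split=> [l|t]; first exact: hr'.
 by rewrite E gE (big_nth (0, 0)%N) s0 big_mkord.
have : \matrix_(i, l) F l t0 i 0 = (\matrix_(i < n, l < n) b (g l).1 (g l).2 t0 i 0) *m (\matrix_(p < n, l < n) r l (g p) t0).
 apply/matrixP => i l; rewrite !mxE; have [_ ->] := hr l.
 rewrite summxE (big_nth (0, 0)%N) s0 big_mkord; apply: eq_bigr => p _.
 by rewrite !mxE mulrC.
by move=> h; move: dF; rewrite h det_mulmx mulf_eq0 negb_or => /andP[].
Qed.

End ModuleOfForms.

(** * The determinant of a basis as a power of eta *)

Section DetEta.
Variable R : realType.
Local Notation C := R[i].
Local Notation H := (uhp R).
Local Notation tpi := (@tpi R).
Local Notation E4 := (@E4 R).
Local Notation E6 := (@E6 R).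
Local Notation Delta := (@Delta R).
Local Notation MS := (@MS R).
Variables (n : nat) (S : 'M[C]_n) (L : 'I_n -> R).
Local Notation MF := (@MF R n S L).
Hypotheses (isoS : isometric S) (L0 : forall i, 0 <= L i).
Variables (k : 'I_n -> nat) (G : 'I_n -> H -> 'cV[C]_n) (t0 : H).
Hypotheses (hG : forall l, MF (k l)%:Z (G l))
 (spanG : forall j f, MF j f -> exists r : 'I_n -> H -> C, (forall l, MS (j - (k l)%:Z) (r l)) /\
 forall t, f t = \sum_l r l t *: G l t)
 (detG0 : \det (\matrix_(i, l) G l t0 i 0) != 0).

Definition Gm (t : H) : 'M[C]_n := \matrix_(i, l) G l t i 0.

Lemma serre_MF j f : MF j%:Z f -> exists g h : H -> 'cV[C]_n,
 [/\ MF (j%:Z + 1) g, forall i t, cder (fun u => f u i 0) t (tpi * h t i 0) &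
 forall t, h t = g t + (j%:R / 6 * E2 t) *: f t].
move=> [fQ fS].
have /choice[c hc] := fQ; have /choice[f' hf'] := fun i => QEc_cder (hc i).
pose h t := \col_i f' i t; pose g t := h t - (j%:R / 6 * E2 t) *: f t.
have hd i t : cder (fun u => f u i 0) t (tpi * h t i 0) by rewrite mxE; case: (hf' i).
exists g, h; split=> // [|t]; last by rewrite /g subrK.
have E2Q : QE 0 (@E2 R) by exists (@c2 R); split=> [|t]; [exact: tame_c2 | rewrite mul0r e0 mul1r E2_ps].
split=> [i|t].
 have q1 : QE (L i) (f' i) by case: (hf' i) => [q _]; eexists; exact: q.
 have q2 := QEM (QEZ (j%:R / 6) E2Q) (fQ i); rewrite add0r in q2; have := QEB q1 q2.
 by congr QE; apply/funext => t; rewrite !mxE.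
apply/colP => i.
have hS u : f (uhpS u) i 0 = u° ^+ j.*2 * (S *m f u) i 0 by rewrite fS -PoszM muln2 -exprnP mxE.
have dS u : cder (fun u => (S *m f u) i 0) u (tpi * (S *m h u) i 0).
 rewrite [in X in cder _ _ X]mxE mulr_sumr.
 have := cder_sum (index_enum 'I_n) (fun l => cderZ (S i l) (hd l u)).
 by apply: cder_eq => [v|]; [rewrite mxE | apply: eq_bigr => l _; rewrite mulrCA].
have := serre_S hS (hd i) dS t.
have -> : (j.*2)%:R / 12 = j%:R / 6 :> C by rewrite -muln2 natrM; field.
have -> : t° ^+ j.*2.+2 = t° ^ ((j%:Z + 1) * 2) by rewrite exprnP; congr (_ ^ _); lia.
have gE u : g u i 0 = h u i 0 - j%:R / 6 * E2 u * f u i 0 by rewrite /g !mxE.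
move=> hS'; rewrite [LHS]gE hS' [RHS]mxE; congr (_ * _); rewrite /g mulmxBr -scalemxAr.
by move: (S *m h t) (S *m f t) => a b; rewrite !mxE.
Qed.

(** The Serre derivative of G_l is a combination of the G_m in which the coefficient of G_l itself
    has weight 2 and vanishes by [MS_1]. The other terms repeat a column, so only the multiples of
    E2 contribute. *)
Lemma det_der t : cder (fun u => \det (Gm u)) t
 (tpi * ((\sum_l k l)%:R / 6) * E2 t * \det (Gm t)).
have /choice[g /choice[h hh]] := fun l => serre_MF (hG l).
have /choice[r hr] : forall l, exists r : 'I_n -> H -> C,
 (forall m, MS ((k l)%:Z + 1 - (k m)%:Z) (r m)) /\ forall t, g l t = \sum_m r m t *: G m t.
 by move=> l; have [hg _ _] := hh l; exact: spanG hg.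
have r0 l u : r l l u = 0.
 have [hr1 _] := hr l; apply: (@MS_1 R (r l l)).
 by apply: MS_ext (hr1 l) => //; lia.
pose Gr u (m : 'I_n) : 'M[C]_n := \matrix_(i, l) (if l == m then h l u i 0 else G l u i 0).
have step : cder (fun u => \det (Gm u)) t (tpi * \sum_m \det (Gr t m)).
 have d (s : {perm 'I_n}) : cder (fun u => (-1) ^+ s * \prod_i Gm u i (s i)) t
 ((-1) ^+ s * (tpi * \sum_i \prod_j (if j == i then h (s j) t j 0 else G (s j) t j 0))).
 apply: cderZ; have := @cder_prod R 'I_n (index_enum 'I_n) (fun i u => Gm u i (s i))
 (fun i => tpi * h (s i) t i 0) t (index_enum_uniq _) _.
 move=> /(_ (fun i => cder_eq (fun u => esym (mxE _ _ _ _)) erefl _)) dp.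
 apply: cder_eq (dp _) => // [|i]; last by have [_ hd _] := hh (s i); exact: hd.
 rewrite mulr_sumr; apply: eq_bigr => i _.
 rewrite (bigD1 i)//= eqxx [in RHS](bigD1 i)//= eqxx mulrA; congr (_ * _).
 by apply: eq_bigr => j /negbTE ->; rewrite mxE.
 have := cder_sum (index_enum _) d; apply: cder_eq => [u|]; first by [].
 rewrite mulr_sumr; under [RHS]eq_bigr do rewrite /determinant mulr_sumr.
 rewrite [RHS]exchange_big /=; apply: eq_bigr => s _.
 rewrite mulrCA mulr_sumr mulr_sumr; rewrite (reindex_inj (@perm_inj _ s^-1)) /=.
 apply: eq_bigr => i _; congr (_ * (_ * _)); apply: eq_bigr => j _.
 by rewrite mxE -[j == _](inj_eq (@perm_inj _ s)) permKV.
have E m : \det (Gr t m) = (k m)%:R / 6 * E2 t * \det (Gm t).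
 have -> : \det (Gr t m) = \sum_l (r m l t + if l == m then (k m)%:R / 6 * E2 t else 0) *
 \det (\matrix_(i, x) if x == m then G l t i 0 else G x t i 0).
 transitivity (\sum_i h m t i 0 * cofactor (Gm t) i m).
 rewrite (expand_det_col _ m); apply: eq_bigr => i _; rewrite mxE eqxx; congr (_ * (_ * \det _)).
 by apply/matrixP => a b; rewrite !mxE eq_sym (negbTE (neq_lift _ _)).
 transitivity (\sum_i \sum_l (r m l t + if l == m then (k m)%:R / 6 * E2 t else 0) * (G l t i 0 * cofactor (Gm t) i m)).
 apply: eq_bigr => i _; have [_ _ ->] := hh m; have [_ ->] := hr m.
 rewrite mxE summxE mxE -[X in _ + X]/(_ * G m t i 0) mulrDl mulr_suml.
 under [RHS]eq_bigr do rewrite mulrDl.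
 rewrite big_split /=; congr (_ + _).
 by apply: eq_bigr => l _; rewrite mxE mulrA.
 rewrite (bigD1 m)//= eqxx big1 ?addr0 ?mulrA// => l /negbTE ->; by rewrite mul0r.
 rewrite exchange_big /=; apply: eq_bigr => l _; rewrite -mulr_sumr; congr (_ * _).
 rewrite (expand_det_col _ m); apply: eq_bigr => i _; rewrite mxE eqxx; congr (_ * (_ * \det _)).
 by apply/matrixP => a b; rewrite !mxE eq_sym (negbTE (neq_lift _ _)).
 rewrite (bigD1 m)//= eqxx r0 add0r big1 ?addr0 => [|l lm].
 by congr (_ * \det _); apply/matrixP => i x; rewrite !mxE; case: eqP => [->|].
 rewrite (negbTE lm) addr0; apply/eqP; rewrite mulf_eq0; apply/orP; right; apply/eqP.
 rewrite -det_tr; apply: (determinant_alternate lm) => x.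
 by rewrite !mxE eqxx (negbTE lm).
have E' : \sum_m \det (Gr t m) = (\sum_l k l)%:R / 6 * E2 t * \det (Gm t).
 rewrite (eq_bigr _ (fun m _ => E m)) natr_sum !mulr_suml.
 by apply: eq_bigr => m _.
apply: cder_eq step => //; rewrite E'; move: (\det _) (E2 t) ((_)%:R) tpi => a b x p.
by field.
Qed.

Let W := (\sum_l k l)%N.

(** Both functions have the same logarithmic derivative, a multiple of (W/6) E2. Hence the
    determinant, nonzero at [t0], vanishes nowhere. *)
Lemma det_eta : exists2 c : C, c != 0 & forall t, \det (Gm t) = c * eta (4 * W)%N t.
pose F t := \det (Gm t) * eta (- (4 * W)%N%:Z) t.
have dF t : cder F t 0.
 apply: cder_eq (cderM (det_der t) (eta_der (- (4 * W)%N%:Z) t)) => //.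
 rewrite -/W mulrNz -pmulrn natrM; move: (\det _) (eta _ _) (E2 t) (W%:R) tpi => a b x w p.
 by field.
exists (F t0); first by rewrite mulf_neq0 ?eta_neq0.
by move=> t; rewrite (cder0_cst dF t0 t) /F -mulrA [eta _ t * _]mulrC eta_mulN mulr1.
Qed.

Lemma det_Gm_neq0 t : \det (Gm t) != 0.
by have [c c0 ->] := det_eta; rewrite mulf_neq0 ?eta_neq0. Qed.
Lemma Gm_S t : Gm (uhpS t) = S *m Gm t *m diag_mx (\row_l t° ^ ((k l)%:Z * 2)).
apply/matrixP => i l; have [_ hS] := hG l.
rewrite mxE hS mul_mx_diag !mxE mulrC; congr (_ * _).
by apply: eq_bigr => m _; rewrite mxE.
Qed.

Lemma span_unique t (r r' : 'I_n -> C) : \sum_l r l *: G l t = \sum_l r' l *: G l t -> r =1 r'.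
move=> h; have : Gm t *m \col_l r l = Gm t *m \col_l r' l.
 apply/colP => i; have /colP/(_ i) := h; rewrite !summxE !mxE => hh.
 transitivity (\sum_l (r l *: G l t) i 0); first by apply: eq_bigr => l _; rewrite !mxE mulrC.
 by rewrite hh; apply: eq_bigr => l _; rewrite !mxE mulrC.
move=> /(congr1 (mulmx (invmx (Gm t)))); rewrite !mulKmx ?unitmxE ?unitfE ?det_Gm_neq0// => hc l.
by have /colP/(_ l) := hc; rewrite !mxE.
Qed.

(* The leading coefficient matrix is invertible: a linear relation between its
 columns would give a form divisible by Delta with non-divisible coordinates. *)
Lemma sum_weights : (W%:R : R) = 6 * \sum_i L i.
have /choice[c hc] : forall l, exists c : 'I_n -> nat -> C, forall i, QEc (L i) (c i) (fun t => G l t i 0).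
 by move=> l; have [q _] := hG l; have [c hc] := choice q; exists c.
pose A : 'M[C]_n := \matrix_(i, l) c l i 0%N.
have dQ : exists d, QEc (\sum_i L i) d (fun t => \det (Gm t)) /\ d 0%N = \det A.
 have prodQ (s : seq 'I_n) (u : 'I_n -> 'I_n) : exists d, QEc (\sum_(i <- s) L i) d
 (fun t => \prod_(i <- s) Gm t i (u i)) /\ d 0%N = \prod_(i <- s) A i (u i).
 elim: s => [|i s [d [hd d0]]].
 exists (@delta0 R); rewrite !big_nil; split=> //.
 by have := @QEc1 R; congr QEc; apply/funext => t; rewrite big_nil.
 exists (conv (c (u i) i) d); rewrite !big_cons conv0 d0 mxE; split=> //.
 by have := QEcM (hc (u i) i) hd; congr QEc; apply/funext => t; rewrite big_cons mxE.
 have /choice[d hd] := fun s : {perm 'I_n} => prodQ (index_enum 'I_n) s.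
 exists (fun m => \sum_(s : {perm 'I_n}) (-1) ^+ s * d s m); split.
 exact: (QEc_sum (index_enum {perm 'I_n}) (fun s => QEcZ ((-1) ^+ s) (hd s).1)).
 by apply: eq_bigr => s _; have [_ ->] := hd s.
have [d [hd dA]] := dQ; have [a a0 aE] := det_eta.
have he := QEcZ a (@eta_QEc R (4 * W)%N).
have eE : (fun t => a * eta (4 * W)%N t) = (fun t => \det (Gm t)) by apply/funext => t; rewrite aE.
rewrite eE in he; suff A0 : \det A != 0.
 have := QEc_lead hd he; rewrite dA etac0 mulr1 => /(_ A0 a0) ->.
 by rewrite -pmulrn natrM; field.
rewrite -det_tr; apply/det0P => -[v v0 vA].
pose J := (W + 8)%N; have kJ l : (k l <= W)%N by rewrite /W (bigD1 l)//= leq_addr.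
have /choice[ab hab] : forall l, exists ab : nat * nat, (J - k l)%N%:Z = 2 * ab.1%:Z + 3 * ab.2%:Z.
 move=> l; have [|a' [b' [h _]]] := @weight_mono (J - k l)%N; first by have := kJ l; rewrite /J; lia.
 by exists (a', b').
pose M l t := E4 t ^+ (ab l).1 * E6 t ^+ (ab l).2.
have hM l : MS (J%:Z - (k l)%:Z) (M l).
 by apply: MS_ext (MS_E R (ab l).1 (ab l).2) => //; rewrite -hab; have := kJ l; rewrite /J; lia.
have /choice[d' hd'] : forall l, exists d, QEc 0 d (M l) /\ d 0%N = 1 by move=> l; exact: unitQ_E.
pose f t := \sum_l (v 0 l *: (M l t *: G l t)).
have hf : MF J%:Z f.
 by apply: MF_sum => l; apply: MF_Z; apply: MF_ext (MF_M (hM l) (hG l)) => //; lia.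
have fv : vanish L 1 f.
 move=> i; exists (fun m => \sum_l v 0 l * conv (d' l) (c l i) m); split.
 have := QEc_sum (index_enum 'I_n) (fun l => QEcZ (v 0 l) (QEcM (hd' l).1 (hc l i))).
 rewrite add0r; congr QEc; apply/funext => t; rewrite summxE; apply: eq_bigr => l _.
 by rewrite !mxE.
 move=> [|//] _; have := congr1 (fun B : 'rV[C]_n => B 0 i) vA; rewrite !mxE => h.
 rewrite -[RHS]h; apply: eq_bigr => l _.
 by rewrite conv0 (hd' l).2 mul1r !mxE.
have [hfD _] := MF_div_Delta hf fv; have [r [hr rE]] := spanG hfD.
case/rV0Pn: v0 => l /eqP; apply.
have [rQ _] := hr l; have [c' hc'] := rQ.
have h1 := QEc_unshift (QEcM hc' (@Delta_QEc R)).
have h2 := QEcZ (v 0 l) (hd' l).1.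
have E0 : (fun t => r l t * Delta t) = (fun t => v 0 l * M l t).
 apply/funext => t.
 have D0 := Delta_neq0 t.
 have := @span_unique t (fun l => (Delta t)^-1 * (v 0 l * M l t)) (fun l => r l t) _ l.
 move=> /= <-; first by rewrite mulrC mulVKf.
 rewrite -rE scaler_sumr; apply: eq_bigr => x _.
 by rewrite !scalerA mulrA.
rewrite E0 in h1; have := congr1 (fun F => F 0%N) (QEc_inj h2 h1).
by rewrite (hd' l).2 mulr1.
Qed.

End DetEta.

(** * Dimensions and duality *)

Section DimensionFormula.
Variable R : realType.
Local Notation C := R[i].
Local Notation e := (@cexp2pi R).
Local Notation H := (uhp R).
Local Notation E4 := (@E4 R).
Local Notation E6 := (@E6 R).
Local Notation Delta := (@Delta R).
Local Notation MS := (@MS R).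

Lemma has_dim_0 (V : lmodType C) (E : set V) : E = [set 0] -> has_dim E 0.
move=> ->; exists (fun=> 0); split=> [c _ []//|].
by apply/seteqP; split=> v /= => [->|[c ->]]; [exists (fun=> 0) |]; rewrite big_ord0.
Qed.

Lemma has_dim_S (V : lmodType C) (E : set V) (E' : set V) (n : nat) (x : V) (u : V -> V) :
 has_dim E' n -> (forall v w a, u (a *: v + w) = a *: u v + u w) ->
 (forall c v, E' v -> c *: x + u v = 0 -> c = 0 /\ v = 0) ->
 E = [set v | exists c w, E' w /\ v = c *: x + u w] -> has_dim E n.+1.
move=> [b [ib E'E]] ul inj ->.
have u0 : u 0 = 0.
 by have /eqP := ul 0 0 1; rewrite !scale1r addr0 -[X in X == _]addr0 (inj_eq (addrI _)) eq_sym => /eqP.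
have us k (c : 'I_k -> C) (f : 'I_k -> V) : u (\sum_i c i *: f i) = \sum_i c i *: u (f i).
 elim: k c f => [|k IH] c f; first by rewrite !big_ord0.
 by rewrite !big_ord_recl ul IH.
exists (fun i => if unlift ord0 i is Some j then u (b j) else x); split=> [c|].
 rewrite big_ord_recl unlift_none (eq_bigr (fun i => c (lift ord0 i) *: u (b i))); last first.
 by move=> i _; rewrite liftK.
 rewrite -us => /inj[|c0 /ib cb i]; first by rewrite E'E; eexists.
 by have [j ->|->//] := unliftP ord0 i.
apply/seteqP; split=> v /= [c].
 move=> [w [+ ->]]; rewrite E'E => -[d ->].
 exists (fun i => if unlift ord0 i is Some j then d j else c).
 rewrite big_ord_recl unlift_none us; congr (_ + _); apply: eq_bigr => i _.
 by rewrite liftK.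
move=> ->; exists (c ord0), (\sum_i c (lift ord0 i) *: b i); split.
 by rewrite E'E; exists (fun i => c (lift ord0 i)).
rewrite big_ord_recl unlift_none us; congr (_ + _); apply: eq_bigr => i _.
by rewrite liftK.
Qed.

Lemma has_dim_fin (V : lmodType C) (E : set V) (T : finType) (b : T -> V) :
 (forall c : T -> C, \sum_i c i *: b i = 0 -> forall i, c i = 0) ->
 E = [set v | exists c : T -> C, v = \sum_i c i *: b i] -> has_dim E #|T|.
move=> ib ->; exists (fun i => b (enum_val i)).
have re (c : 'I_#|T| -> C) : \sum_i c i *: b (enum_val i) = \sum_t c (enum_rank t) *: b t.
 rewrite (reindex (@enum_rank T)) /=; last first.
 by exists (@enum_val T predT) => i _; [exact: enum_rankK | exact: enum_valK].
 by apply: eq_bigr => i _; rewrite enum_rankK.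
split=> [c|].
 by rewrite re => /ib h i; rewrite -(enum_valK i).
apply/seteqP; split=> v /= [c ->].
 exists (fun i => c (enum_val i)); rewrite re.
 by apply: eq_bigr => i _; rewrite enum_rankK.
by exists (fun t => c (enum_rank t)); rewrite re.
Qed.

(** The number of monomials E4^a E6^b with 2a + 3b = m. *)
Definition dimM (m : int) : nat :=
 if m is Posz k then (if k %% 6 == 1 then k %/ 6 else (k %/ 6).+1)%N else 0%N.
Definition MSset (j : int) : set (H -> C^o) := [set g | MS j g].

Lemma dim_MS j : has_dim (MSset j) (dimM j).
have zero k : (forall f, MS k f -> forall t, f t = 0) -> has_dim (MSset k) 0.
 move=> h; apply: has_dim_0; apply/seteqP; split=> f /=; first by move=> /h f0; apply/funext.
 by move=> ->; exact: MS_0.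
case: j => [j|j]; last by apply: zero => f; exact: MS_neg.
have [n] := ubnP j; elim: n j => // n IH j jn.
have [->|j1] := eqVneq j 1%N; first by apply: zero; exact: MS_1.
have [a [b [jE _]]] := weight_mono (elimN eqP j1).
have dE : dimM j = (dimM (j%:Z - 6)).+1.
 have [j6|j6] := leqP 6 j.
 have -> : j%:Z - 6 = (j - 6)%N%:Z by lia.
 rewrite /dimM; have [q ->] : exists q, (j = q + 6)%N by exists (j - 6)%N; lia.
 by rewrite addnK modnDr divnDr// divnn /= addn1; case: eqP.
 by move: j1 j6; case: (j) => [|[|[|[|[|[|//]]]]]].
rewrite dE.
have hI : has_dim (MSset (j%:Z - 6)) (dimM (j%:Z - 6)).
 have [j6|j6] := leqP 6 j; last first.
 have neg : j%:Z - 6 < 0 by lia.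
 have -> : dimM (j%:Z - 6) = 0%N by move: neg; case: (_ - _).
 by apply: zero => f; exact: MS_neg.
 have -> : j%:Z - 6 = (j - 6)%N%:Z by lia.
 by apply: IH; lia.
apply: (@has_dim_S _ _ _ _ (fun t => E4 t ^+ a * E6 t ^+ b : C^o) (fun f t => Delta t * f t : C^o) hI).
- move=> v w c; apply/funext => t; rewrite !fctE /= -[c *: v t]/(c * v t) -[c *: _]/(c * _).
 by rewrite mulrDr mulrCA.
- move=> c v hv E0; have E1 t : c * (E4 t ^+ a * E6 t ^+ b) + v t * Delta t = 0.
 by rewrite [v t * _]mulrC; exact: (congr1 (fun F => F t) E0).
 have [d [hd d0]] := @unitQ_E R a b; have [[c' hc'] _] : MS _ v := hv.
 have h2 := QEcD (QEcZ c hd) (QEc_unshift (QEcM hc' (@Delta_QEc R))).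
 have z0 : (fun t => c * (E4 t ^+ a * E6 t ^+ b) + v t * Delta t) = (fun=> 0) by apply/funext => t; rewrite E1.
 rewrite z0 in h2.
 have c0 : c = 0 by have := QEc_eq0 h2 0; rewrite d0 mulr1 /= addr0.
 split=> //; apply/funext => t; have /eqP := E1 t.
 by rewrite c0 mul0r add0r mulf_eq0 (negbTE (Delta_neq0 t)) orbF => /eqP.
apply/seteqP; split=> f /=.
 rewrite /MSset /= jE => /MS_step[c0 [r' [hr' fE]]]; exists c0, r'; split=> //.
 by apply/funext => t; rewrite fE.
move=> [c [w [hw ->]]]; rewrite /MSset /= in hw *.
by apply: MS_ext (MS_D (MS_Z c (MS_ext (esym jE) (fun t => erefl) (MS_E R a b))) (MS_ext _ (fun t => erefl) (MS_M (@Delta_MS R) hw))) => //; lia.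
Qed.


(** Riemann-Roch for scalar forms: multiplication by Delta identifies weight -10 - 2m with the cusp
    forms of the dual weight 2 - 2m, which is why a single formula covers positive and negative
    m. *)
Lemma dimM_diff (q : int) (r : nat) : (r < 6)%N ->
 (dimM (6 * q + r%:Z))%:Z - (dimM (- 5 - (6 * q + r%:Z)))%:Z = q + (r != 1%N)%:Z.
move=> r6; have dN (m : int) : m < 0 -> dimM m = 0%N by case: m.
have dP (q' r' : nat) : (r' < 6)%N -> dimM (6 * q'%:Z + r'%:Z) = (q' + (r' != 1))%N.
 move=> r'6; have -> : 6 * q'%:Z + r'%:Z = (q' * 6 + r')%N%:Z by lia.
 by rewrite /dimM modnMDl divnMDl// modn_small// divn_small// addn0; case: eqP; rewrite /= ?addn0 ?addn1.
case: q => q.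
 by rewrite dP// [X in _ - X%:Z]dN ?subr0 ?PoszD//; lia.
rewrite [X in X%:Z - _]dN; last by rewrite NegzE; lia.
have [r1|r1] := leqP r 1.
 have -> : - 5 - (6 * Negz q + r%:Z) = 6 * q%:Z + (1 - r)%N%:Z by rewrite NegzE; lia.
 by rewrite dP ?NegzE; [case: r r1 {r6} => [|[|]]//= _; lia | lia].
case: q => [|q].
 rewrite dN; last by rewrite NegzE; lia.
 by rewrite NegzE; case: eqP; lia.
have -> : - 5 - (6 * Negz q.+1 + r%:Z) = 6 * q%:Z + (7 - r)%N%:Z by rewrite NegzE; lia.
by rewrite dP ?NegzE; [case: eqP; case: eqP; lia | lia].
Qed.

Definition rho2 : C := (uhp_rho R)° ^+ 2.
(** Chosen so that Re(chi3 rho2^m) is 1/3, -1/3, 0 for m = 0, 1, 2 mod 3. Its modulus 2/(3 sqrt 3)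
    is the constant in the final bound. *)
Definition chi3 : C := 1 / 3 +i* ((3 * Num.sqrt 3)^-1).
Lemma rho2_X3 : rho2 ^+ 3 = 1.
by rewrite /rho2 -exprM mulnC exprM rho_X6 sqrrN expr1n. Qed.
Lemma rho2E : rho2 = - (1 / 2) +i* (Num.sqrt 3 / 2).
by rewrite /rho2 uhp_rho_sqr; apply/eqP; rewrite eq_complex /=; apply/andP; split; apply/eqP; field. Qed.
Lemma rho2_sqr : rho2 ^+ 2 = - (1 / 2) +i* - (Num.sqrt 3 / 2).
have h3 : Num.sqrt 3 ^+ 2 = 3 :> R by rewrite sqr_sqrtr.
rewrite expr2 rho2E; apply/eqP; rewrite eq_complex /=; apply/andP; split; apply/eqP; last by field.
by move: h3; rewrite expr2; move: (Num.sqrt 3) => x h; lra.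
Qed.
Lemma cn_eq (z : C) (r : R) : 0 <= r -> complex.Re z ^+ 2 + complex.Im z ^+ 2 = r ^+ 2 -> cn z = r.
by move=> r0 h; apply/eqP; rewrite -(eqrXn2 (ltn0Sn 1)) ?cn_ge0// sqr_cn h. Qed.
Lemma cn_rho2 : cn rho2 = 1.
apply: cn_eq => //; rewrite rho2E /= sqrrN !exprMn sqr_sqrtr//.
by field.
Qed.

(** Writing the periodic part through characters of order 2 and 3 allows the sum over the weights of
    a basis to be expressed by traces. *)
Lemma dimM_chi (m : int) : (dimM m)%:R - (dimM (- 5 - m))%:R =
 m%:~R / 6 + 5 / 12 + complex.Re ((-1 : C) ^ m) / 4 + complex.Re (chi3 * rho2 ^ m) :> R.
have [q [r [r6 ->]]] : exists q : int, exists r : nat, (r < 6)%N /\ m = 6 * q + r%:Z.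
 exists (m %/ 6)%Z, (absz (m %% 6)%Z); have := divz_eq m 6.
 by have := modz_ge0 m (isT : 6 != 0 :> int); have := ltz_pmod m (isT : 0 < 6 :> int); split; lia.
have h := congr1 (fun z : int => z%:~R : R) (dimM_diff q r6).
rewrite rmorphB rmorphD /= in h; rewrite !pmulrn h.
have r0 : rho2 != 0 by rewrite /rho2 expf_neq0// uhp_neq0.
have N0 : (-1 : C) != 0 by rewrite oppr_eq0 oner_eq0.
have -> : (-1 : C) ^ (6 * q + r%:Z) = (-1) ^+ r.
 by rewrite expfzDr// -exprz_exp -[(-1) ^ 6]/((-1) ^+ 6) -signr_odd /= exp1rz mul1r -exprnP.
have -> : rho2 ^ (6 * q + r%:Z) = rho2 ^+ r.
 rewrite expfzDr// -exprz_exp -[rho2 ^ 6]/(rho2 ^+ 6) (exprM rho2 3 2) rho2_X3 expr1n exp1rz mul1r.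
 by rewrite -exprnP.
have s3 : 3 * Num.sqrt 3 != 0 :> R by rewrite mulf_neq0 ?sqrtr_eq0 -?ltNge ?pnatr_eq0.
have h3 : Num.sqrt 3 * (3 * Num.sqrt 3)^-1 = 1 / 3 :> R.
 by apply: (mulIf s3); rewrite mulfVK//; have := @sqr_sqrtr R 3 (ler0n _ _); rewrite expr2 => h'; lra.
have c0 : complex.Re chi3 = 1 / 3 by [].
have c1 : complex.Re (chi3 * rho2) = - (1 / 3).
 by rewrite rho2E /chi3 /=; move: h3; move: (Num.sqrt 3) (_^-1) => x y h'; nra.
have c2 : complex.Re (chi3 * rho2 ^+ 2) = 0.
 by rewrite rho2_sqr /chi3 /=; move: h3; move: (Num.sqrt 3) (_^-1) => x y h'; nra.
rewrite rmorphD rmorphM /= -pmulrn.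
case: r r6 {h} => [|[|[|[|[|[|//]]]]]] _; rewrite ?expr0 ?expr1 ?mulr1 ?c0 ?c1 ?c2.
- by rewrite /=; field.
- by rewrite /=; field.
- by rewrite sqrrN expr1n /=; field.
- by rewrite rho2_X3 mulr1 c0 -signr_odd expr1 /=; field.
- by rewrite (exprD rho2 3 1) rho2_X3 mul1r expr1 c1 -signr_odd /=; field.
- by rewrite (exprD rho2 3 2) rho2_X3 mul1r c2 -signr_odd /=; field.
Qed.

Section Span.
Variables (n : nat) (S : 'M[C]_n).
Local Notation MF := (@MF R n S).

Definition MFset L (j : int) : set (H -> 'cV[C]_n) := [set f | MF L j f].

Lemma has_dim_span (L : 'I_n -> R) (w : 'I_n -> int) (F : 'I_n -> H -> 'cV[C]_n) j :
 (forall l, MF L (w l) (F l)) ->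
 (forall r r' : 'I_n -> H -> C, (forall t, \sum_l r l t *: F l t = \sum_l r' l t *: F l t) -> forall l t, r l t = r' l t) ->
 (forall f, MF L j f -> exists r : 'I_n -> H -> C, (forall l, MS (j - w l) (r l)) /\
 forall t, f t = \sum_l r l t *: F l t) ->
 has_dim (MFset L j) (\sum_l dimM (j - w l))%N.
move=> hF uF sF; have hb l : has_dim (MSset (j - w l)) (dimM (j - w l)) := dim_MS _.
pose b l := sval (cid (hb l)).
have ib l c : \sum_i c i *: b l i = 0 -> forall i, c i = 0.
 by rewrite /b; case: cid => b' [h _] /=; exact: h.
have sb l : MSset (j - w l) = [set v | exists c : 'I_(dimM (j - w l)) -> C, v = \sum_i c i *: b l i].
 by rewrite /b; case: cid => b' [_ h] /=.
have mb l i : MS (j - w l) (b l i).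
 have : MSset (j - w l) (b l i); last by [].
 rewrite sb; exists (fun x => (x == i)%:R); rewrite (bigD1 i)//= eqxx scale1r big1 ?addr0//.
 by move=> x /negbTE ->; rewrite scale0r.
have fE l (c : 'I_(dimM (j - w l)) -> C) t : (\sum_i c i *: b l i) t = \sum_i c i * b l i t.
 by rewrite fct_sumE; apply: eq_bigr.
pose T_ l := 'I_(dimM (j - w l)); pose T : finType := {l : 'I_n & T_ l}.
pose tg l i : T := existT T_ l i.
pose B (p : T) : H -> 'cV[C]_n := fun t => b (tag p) (tagged p) t *: F (tag p) t.
have BE (c : T -> C) t : (\sum_p c p *: B p) t = \sum_l (\sum_i c (tg _ i) * b l i t) *: F l t.
 rewrite fct_sumE; under [RHS]eq_bigr do rewrite scaler_suml.
 rewrite (@sig_big_dep _ _ _ 'I_n T_ xpredT (fun _ _ => true)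
 (fun l i => (c (tg _ i) * b l i t) *: F l t)) /=.
 by apply: eq_big => [[]//|[l i] _]; rewrite -scalerA.
have -> : (\sum_l dimM (j - w l))%N = #|{: T}|.
 rewrite card_tagged sumnE big_map big_enum /=; apply: eq_bigr => l _; by rewrite card_ord.
apply: (@has_dim_fin _ _ _ B) => [c h [l i]|].
 have := uF (fun l t => \sum_i c (tg _ i) * b l i t) (fun _ _ => 0).
 move=> /(_ _ l) hh; apply: (@ib l (fun i => c (tg _ i))); apply/funext => t.
 rewrite fE; apply: hh => u; rewrite -BE h.
 by rewrite big1// => ? _; rewrite scale0r.
apply/seteqP; split=> f /=.
 move=> /sF[r [hr fr]].
 have ex : forall l, exists c : 'I_(dimM (j - w l)) -> C, r l = \sum_i c i *: b l i.
 by move=> l; have : MSset (j - w l) (r l) := hr l; rewrite sb.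
 pose c l := sval (cid (ex l)).
 have cE l : r l = \sum_i c l i *: b l i by rewrite /c; case: cid.
 exists (fun p => c (tag p) (tagged p)); apply/funext => t; rewrite fr BE.
 by apply: eq_bigr => l _; rewrite cE fE.
move=> [c ->]; rewrite /MFset /=.
have h := @MF_sum R n S L j T (index_enum T) (fun p t => c p *: B p t) _.
apply: MF_ext (h _) => // [t|[l i]]; first by rewrite fct_sumE; apply: eq_bigr.
by apply: MF_Z; apply: MF_ext (MF_M (mb l i) (hF l)) => //=; lia.
Qed.
End Span.

Lemma QE_det n (L : 'I_n -> R) (M : H -> 'M[C]_n) :
 (forall i l, QE (L i) (fun t => M t i l)) -> QE (\sum_i L i) (fun t => \det (M t)).
move=> h; have prodQ (s : seq 'I_n) (u : 'I_n -> 'I_n) :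
 QE (\sum_(i <- s) L i) (fun t => \prod_(i <- s) M t i (u i)).
 elim: s => [|i s IH].
 exists (@delta0 R); rewrite big_nil.
 by have := @QEc1 R; congr QEc; apply/funext => t; rewrite big_nil.
 by have := QEM (h i (u i)) IH; rewrite big_cons; congr QE; apply/funext => t; rewrite big_cons.
have /choice[d hd] := fun s : {perm 'I_n} => prodQ (index_enum 'I_n) s.
exists (fun m => \sum_(s : {perm 'I_n}) (-1) ^+ s * d s m).
exact: (QEc_sum (index_enum {perm 'I_n}) (fun s => QEcZ ((-1) ^+ s) (hd s))).
Qed.

Section Dual.
Variables (n : nat) (S : 'M[C]_n) (L : 'I_n -> R).
Local Notation MF := (@MF R n S).
Hypotheses (isoS : isometric S) (L0 : forall i, 0 <= L i) (SS : S^T *m S = 1%:M).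
Variables (k : 'I_n -> nat) (G : 'I_n -> H -> 'cV[C]_n) (t0 : H).
Hypotheses (hG : forall l, MF L (k l)%:Z (G l))
 (spanG : forall j f, MF L j f -> exists r : 'I_n -> H -> C, (forall l, MS (j - (k l)%:Z) (r l)) /\
 forall t, f t = \sum_l r l t *: G l t)
 (detG0 : \det (\matrix_(i, l) G l t0 i 0) != 0).
Local Notation Gm := (Gm G).

Let Gu t : Gm t \in unitmx.
by rewrite unitmxE unitfE (det_Gm_neq0 hG spanG detG0). Qed.

(** The dual basis, from the rows of the inverse of G; Delta^2 moves the exponents -L to 2 - L and
    the weight indices -k to 12 - k. *)
Definition dualG (l : 'I_n) (t : H) : 'cV[C]_n := \col_i (Delta t ^+ 2 * invmx (Gm t) l i).

Lemma dualG_MF l : MF (fun i => 2 - L i) (12 - (k l)%:Z) (dualG l).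
split=> [i|t].
 have [c c0 dE] := det_eta hG spanG detG0.
 (* With row i replaced by a unit row, the determinant is the cofactor in the formula for the
    inverse, and its exponent is the sum of L_a over a <> i. *)
 pose M t : 'M[C]_n := \matrix_(a, b) if a == i then (b == l)%:R else Gm t a b.
 have := @QE_det n (fun a => if a == i then 0 else L a) M.
 move=> /(_ _)/QEM dQ.
 have q1 : QE (\sum_(a < n) (if a == i then 0 else L a)) (fun t => \det (M t)).
 apply: QE_det => a b; have [ai|ai] := eqVneq a i.
 exists (fun m => (b == l)%:R * @delta0 R m); have := QEcZ (b == l)%:R (@QEc1 R).
 by congr QEc; apply/funext => t; rewrite mxE ai eqxx mulr1.
 have [q _] := hG b; have := q a; congr QE; apply/funext => t.
 by rewrite !mxE (negbTE ai).
 have q2 := QEZ c^-1 (QEM (QEM (eta_QE R 24%N) (eta_QE R 24%N)) (QEM (eta_QE R (- (4 * \sum_l k l)%N%:Z)) q1)).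
 have lE : 24%N%:~R / 24 + 24%N%:~R / 24 +
 ((- (4 * \sum_l k l)%N%:Z)%:~R / 24 + \sum_(a < n) (if a == i then 0 else L a)) = 2 - L i.
 have W := sum_weights hG spanG detG0.
 rewrite [X in _ = _ * X](bigD1 i)//= in W; rewrite mulrNz -!pmulrn natrM W [X in _ + (_ + X) = _](bigD1 i)//= eqxx.
 rewrite [X in _ + (_ + (_ + X)) = _](eq_bigr L) => [|a /negbTE -> //].
 by move: (L i) (\sum_(_ < _ | _) _) => x y; field.
 rewrite lE in q2; move: q2; congr QE; apply/funext => t.
 rewrite mxE /invmx Gu !mxE dE -/(Delta t) expr2.
 have -> : \det (M t) = cofactor (Gm t) i l.
 rewrite (expand_det_row _ i) (bigD1 l)//= mxE !eqxx mul1r big1 ?addr0 => [|b /negbTE bl].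
 congr (_ * \det _); apply/matrixP => a b; rewrite !mxE.
 by rewrite eq_sym (negbTE (neq_lift _ _)).
 by rewrite mxE eqxx bl mul0r.
 have -> : (c * eta (4 * (\sum_l k l))%N t)^-1 = c^-1 * eta (- (4 * \sum_l k l)%N%:Z) t.
 have := eta_mulN (4 * (\sum_l k l))%N%:Z t; have := eta_neq0 (4 * (\sum_l k l))%N%:Z t.
 by move: (eta _ t) (eta _ t) => a b a0 ab; rewrite invfM; congr (_ * _); apply: (mulfI a0); rewrite mulfV.
 by move: (Delta t) (c^-1) (eta _ t) (cofactor _ _ _) => a b x y; ring.
have St : S *m S^T = 1%:M by apply: mulmx1C.
apply/colP => i; rewrite [RHS]mxE [in LHS]mxE Delta_S (Gm_S hG).
pose D := diag_mx (\row_l t° ^ ((k l)%:Z * 2)).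
pose D' := diag_mx (\row_l t° ^ (- ((k l)%:Z * 2))).
have DD : D *m D' = 1%:M.
 rewrite mulmx_diag; apply/matrixP => a b; rewrite !mxE; case: eqP => [->|]; last by rewrite !mulr0n.
 by rewrite -expfzDr ?uhp_neq0// subrr expr0z.
have -> : invmx (S *m Gm t *m D) = D' *m invmx (Gm t) *m S^T.
 have h : (S *m Gm t *m D) *m (D' *m invmx (Gm t) *m S^T) = 1%:M.
 by rewrite !mulmxA -(mulmxA _ D D') DD mulmx1 -(mulmxA _ (Gm t)) mulmxV// mulmx1.
 have hu := mulmx1_unit h; rewrite -[RHS](mulKmx hu.1) h mulmx1 //.
rewrite mxE [X in _ = _ * X]mxE !mulr_sumr; apply: eq_bigr => a _.
rewrite mul_diag_mx !mxE.
have -> : t° ^ ((12 - (k l)%:Z) * 2) = t° ^+ (12 * 2) * t° ^ (- ((k l)%:Z * 2)).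
 by rewrite exprnP -expfzDr ?uhp_neq0//; congr (_ ^ _); lia.
rewrite exprMn -exprM; move: (Delta t ^+ 2) (_ ^+ (12 * 2)) (_ ^ _) (invmx _ _ _) (S _ _) => x y z u v.
by ring.
Qed.

(** The coefficients are the pairings of f with the G_l divided by Delta^2; orthogonality of S makes
    them scalar forms. *)
Lemma dual_span j f : MF (fun i => 2 - L i) j f -> exists r : 'I_n -> H -> C,
 (forall l, MS (j - (12 - (k l)%:Z)) (r l)) /\ forall t, f t = \sum_l r l t *: dualG l t.
move=> [fQ fS]; exists (fun l t => (Delta t)^-1 ^+ 2 * \sum_i G l t i 0 * f t i 0); split=> [l|t].
 have [gQ gS] := hG l; split=> [|t].
 have hs : QE 2 (fun t => \sum_i G l t i 0 * f t i 0).
 have /choice[c hc] : forall i, exists c, QEc 2 c (fun t => G l t i 0 * f t i 0).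
 by move=> i; have := QEM (gQ i) (fQ i); rewrite subrKC.
 exists (fun m => \sum_i c i m); exact: (QEc_sum (index_enum 'I_n) hc).
 have DV : QE (-1) (fun t => (Delta t)^-1) by eexists; exact: DeltaV_QEc.
 have := QEM (QEM DV DV) hs; rewrite (_ : -1 + -1 + 2 = 0) ?addNKr; last by ring.
 by congr QE; apply/funext => t; rewrite expr2.
 have -> : \sum_i G l (uhpS t) i 0 * f (uhpS t) i 0 =
 t° ^ ((k l)%:Z * 2) * t° ^ (j * 2) * \sum_i G l t i 0 * f t i 0.
 rewrite gS fS.
 transitivity ((t° ^ ((k l)%:Z * 2) * t° ^ (j * 2)) * ((S *m G l t)^T *m (S *m f t)) 0 0).
 rewrite [X in _ = _ * X]mxE mulr_sumr; apply: eq_bigr => i _.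
 rewrite mxE [X in _ * X = _]mxE [X in _ = _ * (X * _)]mxE.
 by move: (_ ^ _) (_ ^ _) ((S *m G l t) i 0) ((S *m f t) i 0) => a b x y; ring.
 rewrite trmx_mul -mulmxA (mulmxA S^T) SS mul1mx mxE; congr (_ * _).
 by apply: eq_bigr => i _; rewrite mxE.
 rewrite Delta_S invfM exprMn.
 have -> : t° ^ ((j - (12 - (k l)%:Z)) * 2) = (t° ^- 12) ^+ 2 * (t° ^ ((k l)%:Z * 2) * t° ^ (j * 2)).
 rewrite -exprVn -exprM exprVn exprnN -!expfzDr ?uhp_neq0//; congr (_ ^ _); lia.
 by move: (_ ^+ 2) (_ ^+ 2) (_ ^ _) (_ ^ _) (\sum_i _) => a b x y z; ring.
have E : f t = (invmx (Gm t))^T *m ((Gm t)^T *m f t) by rewrite mulmxA -trmx_mul mulmxV// trmx1 mul1mx.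
rewrite [LHS]E; apply/colP => i; rewrite summxE mxE; apply: eq_bigr => l _.
rewrite mxE [X in _ * X]mxE [RHS]mxE [X in _ = _ * X]mxE.
have -> : \sum_i0 (Gm t)^T l i0 * f t i0 0 = \sum_i G l t i 0 * f t i 0 by apply: eq_bigr => a _; rewrite !mxE.
have D0 := Delta_neq0 t; move: (\sum_i _) (invmx _ _ _) (Delta t) D0 => a b d d0.
by field.
Qed.

Lemma dual_unique (r r' : 'I_n -> H -> C) :
 (forall t, \sum_l r l t *: dualG l t = \sum_l r' l t *: dualG l t) -> forall l t, r l t = r' l t.
move=> h l t.
have E (x : 'I_n -> C) : (Gm t)^T *m (\sum_l x l *: dualG l t) = Delta t ^+ 2 *: \col_l x l.
 have -> : \sum_l x l *: dualG l t = Delta t ^+ 2 *: ((invmx (Gm t))^T *m \col_l x l).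
 apply/colP => i; rewrite summxE [RHS]mxE mxE mulr_sumr; apply: eq_bigr => m _.
 by rewrite !mxE; move: (invmx _ _ _) (Delta t ^+ 2) => a b; ring.
 by rewrite -scalemxAr mulmxA -trmx_mul mulVmx// trmx1 mul1mx.
have := congr1 (mulmx (Gm t)^T) (h t); rewrite (E (fun l => r l t)) (E (fun l => r' l t)).
move=> /(scalerI _) hh; have /colP/(_ l) := hh (expf_neq0 2 (Delta_neq0 t)).
by rewrite !mxE.
Qed.

Lemma trace_conj (A B : 'M[C]_n) (d : 'I_n -> C) : A \in unitmx -> (forall l, d l != 0) ->
 A = B *m A *m diag_mx (\row_l d l) -> \tr B = \sum_l (d l)^-1.
move=> Au d0 h.
have DD : diag_mx (\row_l d l) *m diag_mx (\row_l (d l)^-1) = 1%:M.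
 rewrite mulmx_diag; apply/matrixP => a b; rewrite !mxE; case: eqP => [->|]; last by rewrite !mulr0n.
 by rewrite mulfV.
have -> : B = A *m diag_mx (\row_l (d l)^-1) *m invmx A.
 by rewrite [X in X *m _ *m _]h -!mulmxA (mulmxA (diag_mx _)) DD mul1mx mulmxV// mulmx1.
rewrite mxtrace_mulC mulmxA mulVmx// mul1mx mxtrace_diag.
by apply: eq_bigr => l _; rewrite mxE.
Qed.

(** At the fixed point i of S, the transformation law of the invertible matrix G conjugates S to the
    diagonal matrix of the signs (-1)^(k_l). *)
Lemma trS : \tr S = \sum_l (-1) ^+ k l.
rewrite (trace_conj (A := Gm (uhp_i R)) (d := fun l => (-1) ^+ k l)) ?Gu//.
- by apply: eq_bigr => l _; rewrite -exprVn invrN1.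
- by move=> l; rewrite expf_neq0// oppr_eq0 oner_eq0.
rewrite -[in LHS]uhpS_i (Gm_S hG); congr (_ *m diag_mx _); apply/rowP => l; rewrite !mxE.
by rewrite -PoszM -exprnP mulnC exprM sqr_i.
Qed.

(** The same at rho, fixed by TS; T contributes the diagonal matrix e(L). *)
Lemma trTS : \sum_i e (L i)%:C * S i i = \sum_l rho2 ^ (- (k l)%:Z).
pose D := diag_mx (\row_i e (L i)%:C).
have TG t : Gm (uhpT t) = D *m Gm t.
 apply/matrixP => i l; rewrite mul_diag_mx !mxE; have [q _] := hG l.
 by rewrite (QE_uhpT t (q i)).
transitivity (\tr (D *m S)).
 by apply: eq_bigr => i _; rewrite mul_diag_mx !mxE.
have r0 : rho2 != 0 by rewrite /rho2 expf_neq0// uhp_neq0.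
rewrite (trace_conj (A := Gm (uhp_rho R)) (d := fun l => rho2 ^+ k l)) ?Gu//.
- by apply: eq_bigr => l _; rewrite exprnN.
- by move=> l; rewrite expf_neq0.
rewrite -[in LHS]uhpTS_rho TG (Gm_S hG) !mulmxA; congr (_ *m diag_mx _); apply/rowP => l; rewrite !mxE.
by rewrite -PoszM -exprnP mulnC exprM.
Qed.

Lemma dim_formula (j : int) : exists s m : nat,
 [/\ has_dim (MFset S L j) s, has_dim (MFset S (fun i => 2 - L i) (7 - j)) m
 & `|s%:R - m%:R - (n%:R * (j%:~R / 6 + 5 / 12) - \sum_i L i)| <=
 cn (\tr S) / 4 + cn (\sum_i e (L i)%:C * S i i) * (2 / (3 * Num.sqrt 3)) :> R].
(* The dual weight index 7 - j satisfies (7 - j) - (12 - k_l) = -5 - (j - k_l), so [dimM_chi]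
   applies term by term. *)
exists (\sum_l dimM (j - (k l)%:Z))%N, (\sum_l dimM (- 5 - (j - (k l)%:Z)))%N; split.
- apply: (has_dim_span hG) => [r r' h l t|f]; last exact: spanG.
 exact: (span_unique hG spanG detG0 (h t)).
- have -> : (\sum_l dimM (- 5 - (j - (k l)%:Z)) = \sum_l dimM (7 - j - (12 - (k l)%:Z)))%N.
 by apply: eq_bigr => l _; congr dimM; lia.
 by apply: (has_dim_span dualG_MF) => [|f]; [exact: dual_unique | exact: dual_span].
rewrite !natr_sum -sumrB (eq_bigr _ (fun l _ => dimM_chi _)) !big_split /=.
have W := sum_weights hG spanG detG0.
rewrite sumr_const card_ord -mulr_suml.
have -> : \sum_(i < n) (j - (k i)%:Z)%:~R = n%:R * j%:~R - 6 * \sum_i L i :> R.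
 rewrite -W natr_sum; transitivity (\sum_(i < n) (j%:~R - (k i)%:R) : R).
 by apply: eq_bigr => i _; rewrite mulrzBr -pmulrn.
 by rewrite sumrB sumr_const card_ord [in RHS]mulr_natl.
have -> : \sum_(i < n) complex.Re ((-1 : C) ^ (j - (k i)%:Z)) / 4 = complex.Re ((-1) ^ j * \tr S) / 4.
 rewrite -mulr_suml trS mulr_sumr raddf_sum; congr (_ / _); apply: eq_bigr => l _.
 rewrite expfzDr ?oppr_eq0 ?oner_eq0//; congr (complex.Re (_ * _)).
 by rewrite -exprnN -exprVn invrN1.
have -> : \sum_(i < n) complex.Re (chi3 * rho2 ^ (j - (k i)%:Z)) =
 complex.Re (chi3 * rho2 ^ j * \sum_i e (L i)%:C * S i i).
 rewrite trTS mulr_sumr raddf_sum; apply: eq_bigr => l _.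
 by rewrite expfzDr ?mulrA// /rho2 expf_neq0// uhp_neq0.
set a := complex.Re _; set b := complex.Re _; set x := \sum_i L i.
have ha : `|a| <= cn (\tr S).
 apply: le_trans (cn_ge_Re _) _; rewrite cnM.
 by rewrite cnXz cnN cn1 exp1rz mul1r.
have hb : `|b| <= cn (\sum_i e (L i)%:C * S i i) * (2 / (3 * Num.sqrt 3)).
 apply: le_trans (cn_ge_Re _) _; rewrite cnM mulrC; apply: ler_wpM2l; first exact: cn_ge0.
 rewrite cnM cnXz cn_rho2 exp1rz mulr1 (@cn_eq _ (2 / (3 * Num.sqrt 3)))//=.
 by rewrite divr_ge0// mulr_ge0// sqrtr_ge0.
 rewrite !exprMn !exprVn !exprMn sqr_sqrtr//.
 by field.
have -> : (n%:R * j%:~R - 6 * x) / 6 + (5 / 12) *+ n + a / 4 + b - (n%:R * (j%:~R / 6 + 5 / 12) - x) = a / 4 + b.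
 by rewrite -[(5 / 12) *+ n]mulr_natl; field.
apply: le_trans (ler_normD _ _) _; apply: lerD => //.
by rewrite normrM (ger0_norm (_ : 0 <= 4^-1)) ?invr_ge0// ler_wpM2r ?invr_ge0.
Qed.

End Dual.
End DimensionFormula.

(** * Words in the generators and their normal form *)

Section Words.

Section Val.
Variables (M : Type) (op : M -> M -> M) (one s t : M).

Fixpoint wval (w : seq bool) : M :=
 if w is b :: w' then op (if b then s else t) (wval w') else one.

(** Centrality of s^2, the braid relation and s^8 = 1 present Mp_2(Z), by [mpval_weq] and
    [mp_generated]. A monoid suffices because inverses are words ([winv_exists]). *)
Record mp_relations : Prop := MpRelations {
 mpr_assoc : associative op;
 mpr_1x : left_id one op;
 mpr_x1 : right_id one op;
 mpr_center : op t (op s s) = op s (op s t);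
 mpr_braid : op t (op s (op t (op s t))) = s;
 mpr_order : wval (nseq 8 true) = one }.

Hypothesis rel : mp_relations.

Lemma wval_cat u v : wval (u ++ v) = op (wval u) (wval v).
case: rel => opA op1 _ _ _ _.
by elim: u => [|b u IH] /=; rewrite ?op1// IH opA.
Qed.
Lemma wval_s8 k : wval (nseq (8 * k) true) = one.
case: rel => _ op1 _ _ _ o8; elim: k => [|k IH]; first by rewrite muln0.
by rewrite mulnS nseqD wval_cat o8 IH op1.
Qed.
End Val.
(** Equality in every monoid with these relations stands for equality in the presented group. *)
Definition weq (u v : seq bool) := forall (M : Type) (op : M -> M -> M) (one s t : M),
 mp_relations op one s t -> wval op one s t u = wval op one s t v.
Lemma weq_trans u v w : weq u v -> weq v w -> weq u w.
by move=> h k M op one s t r; rewrite (h _ _ _ _ _ r) (k _ _ _ _ _ r). Qed.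
Lemma weq_cat u v u' v' : weq u u' -> weq v v' -> weq (u ++ v) (u' ++ v').
by move=> h k M op one s t r; rewrite !(wval_cat r) (h _ _ _ _ _ r) (k _ _ _ _ _ r). Qed.
Lemma weq_refl u : weq u u. Proof. by []. Qed.
Lemma weq_cons b u v : weq u v -> weq (b :: u) (b :: v).
by move=> h; exact: (weq_cat (@weq_refl [:: b]) h). Qed.

Lemma weq_center k w : weq (false :: nseq (2 * k) true ++ w) (nseq (2 * k) true ++ false :: w).
elim: k => [|k IH] //; rewrite mulnS -[nseq _ _]/[:: true, true & nseq (2 * k) true] /=.
have h := weq_cat (@weq_refl [:: true; true]) IH; apply: weq_trans h.
move=> M op one s t r /=; have [opA _ _ c _ _] := r.
by rewrite 3!opA -[op (op t s) s]opA c !opA.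
Qed.

Lemma weq_braid w : weq [:: false, true, false, true, false & w] (true :: w).
move=> M op one s t r /=; have [opA _ _ _ b _] := r; set x := wval _ _ _ _ _.
have -> : op t (op s (op t (op s (op t x)))) = op (op t (op s (op t (op s t)))) x by rewrite !opA.
by rewrite b.
Qed.
(** The letters are t and tst, which in SL_2(Z) are the upper and the lower unipotent matrix with
    entry 1. *)
Definition flat (u : seq bool) : seq bool :=
 flatten [seq if b then [:: false; true; false] else [:: false] | b <- u].
Definition nfw k (e1 : bool) u (e2 : bool) :=
 nseq (2 * k) true ++ nseq e1 true ++ flat u ++ nseq e2 true.

(** When a letter is prepended, s^2 moves to the front, an s between two t is absorbed into tst, and
    tstst collapses to s. *)
Lemma nf_exists w : exists k e1 u e2, weq w (nfw k e1 u e2).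
elim: w => [|b w [k [e1 [u [e2 h]]]]]; first by exists 0%N, false, [::], false.
have {}h : weq (b :: w) (b :: nfw k e1 u e2) by exact: weq_cons.
suff [k' [e1' [u' [e2' h']]]] : exists k' e1' u' e2', weq (b :: nfw k e1 u e2) (nfw k' e1' u' e2').
 by exists k', e1', u', e2'; exact: weq_trans h h'.
have nS m x : nseq m true ++ true :: x = true :: nseq m true ++ x :> seq bool by elim: m => //= m ->.
case: b {h}.
 case: e1.
 exists k.+1, false, u, e2; by rewrite /nfw mulnS nseqD -catA /= nS.
 by exists k, true, u, e2; rewrite /nfw /= nS.
have {}c := @weq_center k (nseq e1 true ++ flat u ++ nseq e2 true).
suff [k' [e1' [u' [e2' h']]]] : exists k' e1' u' e2',
 weq (nseq (2 * k) true ++ false :: (nseq e1 true ++ flat u ++ nseq e2 true)) (nfw k' e1' u' e2').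
 by exists k', e1', u', e2'; exact: weq_trans c h'.
case: e1 {c} => /=; last by exists k, false, (false :: u), e2.
case: u => [|[] u] /=.
- case: e2; last by exists k, false, [:: false], true.
 exists k.+1, false, [:: false], false.
 have -> : nfw k.+1 false [:: false] false = nseq (2 * k) true ++ [:: true; true; false].
 by rewrite /nfw mulnS addnC (nseqD (2 * k) 2) -catA.
 exact: (weq_cat (@weq_refl (nseq (2 * k) true)) (@weq_center 1 [::])).
- exists k, true, u, e2; apply: weq_cat => //=; exact: weq_braid.
- by exists k, false, (true :: u), e2.
Qed.

End Words.

(** * Generators and relations of SL_2(Z) *)

Section SL2.

Definition mx2 (a b c d : int) : 'M[int]_2 :=
 \matrix_(i, j) (if i == 0 then if j == 0 then a else b else if j == 0 then c else d).
Lemma mx2P (A B : 'M[int]_2) : A 0 0 = B 0 0 -> A 0 1 = B 0 1 -> A 1 0 = B 1 0 -> A 1 1 = B 1 1 -> A = B.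
move=> h1 h2 h3 h4; apply/matrixP => i j.
have o (x : 'I_2) : x = 0 \/ x = 1 by case: x => -[|[|//]] p; [left|right]; exact/val_inj.
by case: (o i) => ->; case: (o j) => ->.
Qed.
Lemma mul2E (A B : 'M[int]_2) i j : (A *m B) i j = A i 0 * B 0 j + A i 1 * B 1 j.
rewrite mxE !big_ord_recl big_ord0 addr0.
by have -> : lift (0 : 'I_2) 0 = 1 by exact/val_inj.
Qed.
Lemma mxSE : mxS = mx2 0 (-1) 1 0. Proof. by apply: mx2P; rewrite !mxE. Qed.
Lemma mxTE : mxT = mx2 1 1 0 1. Proof. by apply: mx2P; rewrite !mxE. Qed.
Lemma mx1E : 1%:M = mx2 1 0 0 1. Proof. by apply: mx2P; rewrite !mxE. Qed.
Lemma mx2_eta (A : 'M[int]_2) : A = mx2 (A 0 0) (A 0 1) (A 1 0) (A 1 1).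
by apply: mx2P; rewrite !mxE. Qed.
Lemma mul2 a b c d a' b' c' d' : mx2 a b c d *m mx2 a' b' c' d' =
 mx2 (a * a' + b * c') (a * b' + b * d') (c * a' + d * c') (c * b' + d * d').
by apply: mx2P; rewrite mul2E !mxE. Qed.
Lemma mx2_inj a b c d a' b' c' d' : mx2 a b c d = mx2 a' b' c' d' -> [/\ a = a', b = b', c = c' & d = d'].
move=> h; have e i j := congr1 (fun M : 'M[int]_2 => M i j) h.
by split; [have := e 0 0|have := e 0 1|have := e 1 0|have := e 1 1]; rewrite !mxE.
Qed.
Definition sl_op := (@mulmx int 2 2 2).
Definition slval := wval sl_op 1%:M mxS mxT.
Lemma mx2_eq a b c d a' b' c' d' : a = a' -> b = b' -> c = c' -> d = d' -> mx2 a b c d = mx2 a' b' c' d'.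
by move=> -> -> -> ->. Qed.

Lemma sl_relations : mp_relations sl_op 1%:M mxS mxT.
rewrite /sl_op; split=> [A B D|A|A||| ].
- exact: mulmxA.
- exact: mul1mx.
- exact: mulmx1.
- by rewrite mxSE mxTE !mul2; apply: mx2_eq.
- by rewrite mxSE mxTE !mul2; apply: mx2_eq.
- by rewrite /= mxSE mx1E !mul2; apply: mx2_eq.
Qed.

(** There is no cancellation between nonnegative matrices: each letter strictly increases an
    off-diagonal entry. *)
Lemma flat_nonneg u : exists a b c d : nat, slval (flat u) = mx2 a.+1%:Z b%:Z c%:Z d.+1%:Z /\
 ((b + c = 0)%N -> u = [::]).
elim: u => [|l u [a [b [c [d [h hu]]]]]].
 by exists 0%N, 0%N, 0%N, 0%N; split; rewrite // /slval /= mx1E.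
rewrite /flat /= -/(flat u) /slval (wval_cat sl_relations) -/(slval (flat u)) h /sl_op.
case: l => /=; rewrite mxTE ?mxSE mx1E !mul2.
 exists a, b, (a.+1 + c)%N, (b + d)%N; split; last by lia.
 by apply: mx2_eq; lia.
exists (a + c)%N, (b + d.+1)%N, c, d; split; last by lia.
by apply: mx2_eq; lia.
Qed.

Lemma slval_s2 k : slval (nseq (2 * k) true) = 1%:M \/ slval (nseq (2 * k) true) = mx2 (-1) 0 0 (-1).
elim: k => [|k IH]; first by left; rewrite muln0.
rewrite mulnS nseqD /slval (wval_cat sl_relations) -/slval /= mxSE mx1E /sl_op !mul2.
by case: IH => ->; rewrite ?mx1E mul2; [right|left]; apply: mx2_eq.
Qed.

(** In the normal form the middle factor has positive diagonal and nonnegative entries. Comparing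
    signs forces it to be empty and the outer powers of s to agree. *)
Lemma slval_eq1 w : slval w = 1%:M -> exists k, weq w (nseq (2 * k) true).
have [k [e1 [u [e2 h]]]] := nf_exists w; rewrite /slval (h _ _ _ _ _ sl_relations).
have [a [b [c [d [uE u0]]]]] := flat_nonneg u.
have nS m m' x : nseq m true ++ nseq m' true ++ x = nseq (m + m') true ++ x :> seq bool by rewrite catA -nseqD.
rewrite /nfw !(wval_cat sl_relations) -/slval uE => E.
suff [u0' e12] : u = [::] /\ e1 = e2.
 exists (k + e2)%N; rewrite u0' e12 in h; apply: weq_trans h _.
 by rewrite /nfw /flat /= -!nseqD (_ : 2 * (k + e2) = 2 * k + (e2 + e2))%N; last lia.
move: E; case: (slval_s2 k) => ->; case: e1 {h}; case: e2; rewrite /slval /= /sl_op ?mxSE mx1E !mul2 => /mx2_inj[*]; 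
 by [split=> //; apply: u0; lia | exfalso; lia].
Qed.

Definition mxTz (n : int) := mx2 1 n 0 1.
Lemma slval_cat u v : slval (u ++ v) = slval u *m slval v.
exact: (wval_cat sl_relations). Qed.

Lemma gen_Tz n : exists w, slval w = mxTz n.
have P (a b : int) : mxTz a *m mxTz b = mxTz (a + b).
 by rewrite mul2; apply: mx2_eq; lia.
have [N hN] : exists w, slval w = mxTz (-1).
 exists [:: true; false; true; false; true; true; true].
 by rewrite /slval /= mxSE mxTE mx1E /sl_op !mul2; apply: mx2_eq.
have [T hT] : exists w, slval w = mxTz 1.
 by exists [:: false]; rewrite /slval /= mxTE mx1E /sl_op mul2; apply: mx2_eq.
elim: n => [|n [w hw]|n [w hw]].
- by exists [::]; rewrite /slval /= mx1E.
- by exists (T ++ w); rewrite slval_cat hT hw P; congr mxTz; lia.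
- by exists (N ++ w); rewrite slval_cat hN hw P; congr mxTz; lia.
Qed.

(** Euclid's algorithm on the first column: T^q reduces a modulo c, and S exchanges the rows. *)
Lemma sl_generated (M : 'M[int]_2) : \det M = 1 -> exists w, slval w = M.
rewrite det2 [in X in _ -> X](mx2_eta M).
move: (M 0 0) (M 0 1) (M 1 0) (M 1 1) => a b c d.
have [n] := ubnP `|c|%N; elim: n a b c d => // n IH a b c d cn dM.
have [c0|c0] := eqVneq c 0.
 have [w hw] := gen_Tz (b * d).
 have [ad|ad] : a = 1 /\ d = 1 \/ a = -1 /\ d = -1.
 move: dM; rewrite c0 mulr0 subr0 => ad.
 have : (`|a| * `|d|)%N == 1%N by rewrite -abszM ad.
 rewrite muln_eq1 => /andP[/eqP a1 /eqP d1].
 have [aE|aE] : a = 1 \/ a = -1 by lia.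
 by left; split=> //; rewrite aE in ad; lia.
 by right; split=> //; rewrite aE in ad; lia.
 - by exists w; rewrite hw; apply: mx2_eq; nia.
 - exists ([:: true; true] ++ w); rewrite slval_cat hw /slval /= mxSE mx1E /sl_op !mul2.
 by apply: mx2_eq; nia.
pose q := (a %/ c)%Z; pose a' := a - q * c; pose b' := b - q * d.
have a'c : (`|a'| < `|c|)%N.
 have := modz_ge0 a c0; have := ltz_mod a c0; have := divz_eq a c; rewrite /a' /q.
 by move: (a %/ c)%Z (a %% c)%Z => x y; lia.
have [] := IH (- c) (- d) a' b'; first by lia.
 by rewrite /a' /b'; nia.
move=> w hw; have [v hv] := gen_Tz q.
exists (v ++ [:: true; true; true] ++ w); rewrite !slval_cat hv hw /slval /= mxSE mx1E /sl_op !mul2.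
by apply: mx2_eq; rewrite /a' /b'; lia.
Qed.

End SL2.

(** * The metaplectic group and its presentation *)

Section Metaplectic.
Variable R : realType.
Local Notation C := R[i].
Local Notation H := (uhp R).

Lemma mp2_ext (g h : mp2 R) : mp_mx g = mp_mx h -> mp_phi g =1 mp_phi h -> g = h.
case: g h => [M p d hp s] [M' p' d' hp' s'] /= E /funext F; subst M' p'.
by congr Mp2; exact: Prop_irrelevance.
Qed.

Lemma mp_act_mul (g h : mp2 R) t : mp_act (mp_mul g h) t = mp_act g (mp_act h t).
apply/val_inj => /=; have := cocycle_neq0 t (mp_det h).
have := cocycle_neq0 (mp_act h t) (mp_det g).
rewrite {1}/mp_act /= /moebius.
have := cocycleM (mp_mx g) t (mp_det h); rewrite /moebius => ->.
rewrite /cocycle !mul2E !rmorphD !rmorphM /=.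
move: (mp_mx g 0 0)%:~R (mp_mx g 0 1)%:~R (mp_mx g 1 0)%:~R (mp_mx g 1 1)%:~R => a b c d.
move: (mp_mx h 0 0)%:~R (mp_mx h 0 1)%:~R (mp_mx h 1 0)%:~R (mp_mx h 1 1)%:~R => a' b' c' d'.
move: (uhp_val t) => z n1 n2; field.
rewrite n2 /=; have -> : c * (a' * z + b') + d * (c' * z + d') = (c * ((a' * z + b') / (c' * z + d')) + d) * (c' * z + d').
 by field.
by rewrite mulf_neq0.
Qed.

Lemma mp_mulA : associative (@mp_mul R).
move=> f g h; apply: mp2_ext => [|t]; first exact: mulmxA.
by rewrite /= mp_act_mul mulrA.
Qed.
Lemma mp_act1 t : mp_act (mp_one R) t = t.
by apply/val_inj; rewrite /= /moebius /cocycle !mxE /= !(mul1r, mul0r, add0r, addr0, divr1). Qed.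
Lemma mp_mul1g : left_id (mp_one R) (@mp_mul R).
by move=> g; apply: mp2_ext => [|t]; [exact: mul1mx | rewrite /= mul1r]. Qed.
Lemma mp_mulg1 : right_id (mp_one R) (@mp_mul R).
by move=> g; apply: mp2_ext => [|t]; [exact: mulmx1 | rewrite /= mp_act1 mulr1]. Qed.
Lemma mp_actT t : mp_act (mpT R) t = uhpT t. Proof. exact/val_inj. Qed.
Lemma mp_actS t : mp_act (mpS R) t = uhpS t. Proof. exact/val_inj. Qed.
Lemma Im_sqrtC_ge0 (z : C) : 0 <= complex.Im (sqrtC z).
by have := @Im_rootC_ge0 _ 2 z isT; rewrite -complexIm ler0c. Qed.

(** Squaring leaves a sign. All roots have Re > 0 and Im >= 0, so a minus sign would force Im(sqrt
    z) = 0, contrary to Im z > 0. *)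
Lemma sqrtC_mul (x y z : H) : (x : C) * (y : C) = z -> sqrtC (x : C) * sqrtC (y : C) = sqrtC (z : C).
move=> xyz; have x0 := Re_sqrtC_gt0 x; have y0 := Re_sqrtC_gt0 y; have z0 := Re_sqrtC_gt0 z.
have x1 := Im_sqrtC_ge0 x; have y1 := Im_sqrtC_ge0 y; have z1 := Im_sqrtC_ge0 z.
have : (sqrtC (x : C) * sqrtC (y : C)) ^+ 2 = sqrtC (z : C) ^+ 2 by rewrite exprMn !sqrtCK.
move=> /eqP; rewrite eqf_sqr => /orP[/eqP //|/eqP h]; exfalso.
have zz := uhp_gt0 z; rewrite -[uhp_val z]sqrtCK expr2 in zz.
have := congr1 (@complex.Im R) h; move: zz; clear h xyz.
case: (sqrtC (x : C)) x0 x1 => a b /=; case: (sqrtC (y : C)) y0 y1 => a' b' /=.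
case: (sqrtC (z : C)) z0 z1 => a'' b'' /= z0 z1 a0' b0' a0 b0 zz E.
have p1 := mulr_ge0 (ltW a0) b0'; have p2 := mulr_ge0 b0 (ltW a0').
have b''0 : b'' = 0 by lra.
by move: zz; rewrite b''0 mulr0 mul0r addr0 ltxx.
Qed.

Lemma sqrtC_mulS (t : H) : sqrtC (uhpS t)° * sqrtC t° = 'i%C.
have x0 := Re_sqrtC_gt0 (uhpS t); have y0 := Re_sqrtC_gt0 t.
have x1 := Im_sqrtC_ge0 (uhpS t); have y1 := Im_sqrtC_ge0 t.
have : (sqrtC (uhpS t)° * sqrtC t°) ^+ 2 = 'i%C ^+ 2 by rewrite exprMn !sqrtCK uhpSE mulNr mulVf ?uhp_neq0// sqr_i.
move=> /eqP; rewrite eqf_sqr => /orP[/eqP //|/eqP h]; exfalso.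
have := congr1 (@complex.Im R) h; clear h.
case: (sqrtC (uhpS t)°) x0 x1 => a b /=; case: (sqrtC t°) y0 y1 => a' b' /= *; nra.
Qed.

Local Notation S := (mpS R).
Local Notation T := (mpT R).
Local Notation mpval := (wval (@mp_mul R) (mp_one R) S T).

Lemma mp_SS_phi t : mp_phi (mp_mul S S) t = 'i%C.
by rewrite -[LHS]/(sqrtC (mp_act S t : C) * sqrtC t°) mp_actS sqrtC_mulS. Qed.
Lemma mp_S4_phi t : mp_phi (mp_mul (mp_mul S S) (mp_mul S S)) t = -1.
by rewrite [LHS]/(mp_phi (mp_mul S S) _ * mp_phi (mp_mul S S) _) !mp_SS_phi -[LHS]/('i%C ^+ 2 : C) sqr_i. Qed.

Lemma mp_relations_mp2 : mp_relations (@mp_mul R) (mp_one R) S T.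
split.
- exact: mp_mulA.
- exact: mp_mul1g.
- exact: mp_mulg1.
- apply: mp2_ext => [|t]; first exact: (mpr_center sl_relations).
 rewrite (mp_mulA S S T) -[LHS]/(1 * mp_phi (mp_mul S S) t) -[RHS]/(mp_phi (mp_mul S S) (mp_act T t) * 1).
 by rewrite !mp_SS_phi mul1r mulr1.
- apply: mp2_ext => [|t]; first exact: (mpr_braid sl_relations).
 rewrite /= !mul1r !mulr1 -/(mp_act T t).
 pose u := mp_act (mp_mul T (mp_mul S T)) t; apply: (@sqrtC_mul u (mp_act T t) t).
 rewrite /u !mp_act_mul !mp_actT mp_actS !uhpTE uhpSE uhpTE.
 have := uhp_neq0 (uhpT t); rewrite uhpTE => n0.
 by field.
- have E : mpval (nseq 8 true) = mp_mul (mp_mul (mp_mul S S) (mp_mul S S)) (mp_mul (mp_mul S S) (mp_mul S S)).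
 by rewrite /= mp_mulg1 !mp_mulA.
 rewrite E; apply: mp2_ext => [|t].
 by rewrite /= mxSE mx1E !mul2; apply: mx2_eq.
 by rewrite [LHS]/(mp_phi (mp_mul (mp_mul S S) (mp_mul S S)) _ * mp_phi (mp_mul (mp_mul S S) (mp_mul S S)) _) !mp_S4_phi -[LHS]/((-1) * (-1) : C) mulrNN mulr1.
Qed.

Lemma mpval_mx w : mp_mx (mpval w) = slval w.
by elim: w => [//|b w IH]; rewrite /= IH; case: b. Qed.

(** By [slval_eq1] the word is s^(2k). Since S^2 acts trivially with phi = i, one gets i^k = 1, so 4
    divides k and s^8 = 1 concludes. *)
Lemma mpval_eq1 w : mpval w = mp_one R -> weq w [::].
move=> h; have [k hk] : exists k, weq w (nseq (2 * k) true).
 by apply: slval_eq1; rewrite -mpval_mx h.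
have E := hk _ _ _ _ _ mp_relations_mp2; rewrite h in E; apply: weq_trans hk _.
have P m : mp_act (mpval (nseq (2 * m) true)) (uhp_i R) = uhp_i R /\ mp_phi (mpval (nseq (2 * m) true)) (uhp_i R) = 'i%C ^+ m.
 elim: m => [|m [IH1 IH2]]; first by rewrite muln0 /= mp_act1 expr0.
 rewrite mulnS nseqD (wval_cat mp_relations_mp2).
 have -> : mpval (nseq 2 true) = mp_mul S S by rewrite /= mp_mulg1.
 split.
 by rewrite !mp_act_mul IH1 !mp_actS !uhpS_i.
 by rewrite [LHS]/(mp_phi (mp_mul S S) _ * mp_phi (mpval (nseq (2 * m) true)) _) mp_SS_phi IH2 exprS.
have [_] := P k; rewrite -E /= => ik.
have k4 : (4 %| k)%N.
 rewrite /dvdn; have := ltn_mod k 4; move: ik; rewrite {1}(divn_eq k 4) exprD mulnC exprM (exprM _ 2 2) sqr_i sqrrN expr1n expr1n mul1r.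
 case: (k %% 4)%N => [//|[|[|[|//]]]]; rewrite ?expr1 ?sqr_i ?exprS ?expr0 => /eqP; rewrite eq_complex /= => /andP[/eqP + /eqP +] _; lra.
have -> : (2 * k = 8 * (k %/ 4))%N by rewrite -[in LHS](divnK k4); lia.
by move=> M op one s t r; rewrite (wval_s8 r).
Qed.

Lemma winv_exists w : exists v, weq (w ++ v) [::] /\ weq (v ++ w) [::].
elim: w => [|b w [v [h1 h2]]]; first by exists [::].
have [x [x1 x2]] : exists x, weq (b :: x) [::] /\ weq (x ++ [:: b]) [::].
 case: b.
 by exists (nseq 7 true); split=> M op one s t r; exact: (mpr_order r).
 exists [:: true, false, true, false & nseq 7 true].
 have e M op (one s t : M) (r : mp_relations op one s t) :
 op t (wval op one s t [:: true, false, true, false & nseq 7 true]) = one.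
 by rewrite -[LHS]/(wval op one s t [:: false, true, false, true, false & nseq 7 true]) (weq_braid _ r) (mpr_order r).
 split=> M op one s t r; first exact: e.
 rewrite (wval_cat r) [wval _ _ _ _ [:: false]]/= (mpr_x1 r).
 have := e _ _ _ _ _ r; move: (wval _ _ _ _ _) => x tx.
 pose y := op (wval op one s t (nseq 7 true)) (op t (op s (op t s))).
 have [opA op1 opx _ br o8] := r.
 have yt : op y t = one.
 rewrite /y -!opA br; have := o8; rewrite -[nseq 8 true]/(nseq 7 true ++ [:: true]) (wval_cat r).
 by move=> _; move: o8; rewrite op1 /= opx.
 by rewrite -[op x t]op1 -yt -opA [op t (op x t)]opA tx op1.
exists (v ++ x); split.
 rewrite catA -[(b :: w) ++ v]/(b :: (w ++ v)).
 apply: weq_trans (weq_cat (weq_cons b h1) (@weq_refl x)) x1.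
rewrite -catA -[x ++ b :: w]/(x ++ [:: b] ++ w) [x ++ _]catA.
exact: weq_trans (weq_cat (@weq_refl v) (weq_cat x2 (@weq_refl w))) h2.
Qed.

(** Hence operators satisfying the relations define a representation through arbitrarily chosen
    words. *)
Lemma mpval_weq u v : mpval u = mpval v -> weq u v.
move=> uv; have [v' [h1 h2]] := winv_exists v; have r := mp_relations_mp2.
have E : weq (u ++ v') [::].
 by apply: mpval_eq1; rewrite (wval_cat r) uv -(wval_cat r) (h1 _ _ _ _ _ r).
have E2 : weq u (u ++ (v' ++ v)).
 by have := weq_cat (@weq_refl u) h2; rewrite cats0 => h M op one s t r'; rewrite (h _ _ _ _ _ r').
apply: weq_trans E2 _; rewrite catA; exact: (weq_cat E (@weq_refl v)).
Qed.

Lemma hol_cont (f : H -> C) (t : H) : holomorphic f -> forall eps : R, 0 < eps ->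
 exists2 d : R, 0 < d & forall u : H, cn (u° - t°) < d -> cn (f u - f t) < eps.
move=> /(uhp_ext_differentiable t)/differentiable_continuous.
move=> /(@cvgrPdist_lt _ C^o C^o _ (nbhs_filter (t : C^o))) h eps e0.
have e0' : 0 < (eps%:C : C) by rewrite ltcR.
case: (h _ e0') => -[a b]; rewrite /= ltcE /= => /andP[/eqP -> a0] hd.
exists a => // u ua; have := hd u°; rewrite /ball_ /= uhp_extE uhp_extE.
rewrite -[a +i* 0]/(a%:C) !cnE !ltcR cnBC [cn (f t - _)]cnBC; exact.
Qed.

(** Two elements over one matrix differ by a sign, which is locally constant by continuity of phi
    and hence constant; S^4 realizes the sign -1. *)
Lemma mp_generated (g : mp2 R) : exists w, mpval w = g.
have [w hw] := sl_generated (mp_det g); pose h := mpval w.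
have hm : mp_mx h = mp_mx g by rewrite mpval_mx.
have sq t : mp_phi g t ^+ 2 = mp_phi h t ^+ 2 by rewrite !mp_sqr hm.
have nz t : mp_phi h t != 0.
 by apply/negP => /eqP z; have := mp_sqr h t; rewrite z expr0n /= => /esym/eqP; rewrite (negbTE (cocycle_neq0 t (mp_det h))).
pose eps t := mp_phi g t / mp_phi h t.
have eq1 t : eps t = 1 \/ eps t = -1.
 by have /eqP := sq t; rewrite eqf_sqr => /orP[]/eqP E; [left|right]; rewrite /eps E ?mulNr mulfV.
have gE t : mp_phi g t = eps t * mp_phi h t by rewrite /eps mulfVK.
have loc t : cder eps t 0.
 have c0 : 0 < cn (mp_phi h t) by rewrite cn_gt0.
 have [d d0 hd] := hol_cont t (@mp_hol _ g) c0; have [d' d'0 hd'] := hol_cont t (@mp_hol _ h) c0.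
 exists 0, (Num.min d d'); split=> // [|u]; first by rewrite lt_min d0.
 rewrite lt_min => /andP[ud ud']; rewrite mul0r mul0r subr0.
 suff -> : eps u = eps t by rewrite subrr cn0.
 have := hd _ ud; have := hd' _ ud'; rewrite !gE => h1 h2.
 have ne : eps u <> - eps t.
 move=> E; rewrite E in h2.
 have E2 : - eps t * mp_phi h u - eps t * mp_phi h t = - eps t * (2 * mp_phi h t + (mp_phi h u - mp_phi h t)) by ring.
 rewrite E2 cnM cnN in h2.
 have ce : cn (eps t) = 1 by case: (eq1 t) => ->; rewrite ?cnN cn1.
 rewrite ce mul1r in h2.
 have := cnB (2 * mp_phi h t + (mp_phi h u - mp_phi h t)) (mp_phi h u - mp_phi h t).
 by rewrite addrK cnM cn_nat; move: h1 h2; clear; lra.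
 by case: (eq1 u) (eq1 t) ne => [->|->] [->|->]; rewrite ?opprK.
have ct := cder0_cst loc (uhp_i R).
case: (eq1 (uhp_i R)) => e1.
 exists w; apply: mp2_ext => // t; rewrite gE -ct e1 mul1r.
 by [].
exists (nseq 4 true ++ w); rewrite (wval_cat mp_relations_mp2).
have -> : mpval (nseq 4 true) = mp_mul (mp_mul S S) (mp_mul S S) by rewrite /= mp_mulg1 !mp_mulA.
apply: mp2_ext => [|t].
 rewrite -hm /= -/h; have -> : mxS *m mxS *m (mxS *m mxS) = 1%:M by rewrite mxSE mx1E !mul2; apply: mx2_eq.
 by rewrite mul1mx.
by rewrite [LHS]/(mp_phi (mp_mul (mp_mul S S) (mp_mul S S)) _ * mp_phi (mpval w) t) mp_S4_phi gE -ct e1.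
Qed.

End Metaplectic.

(** * Poincare series and existence of enough forms *)

Section Poincare.
Variable R : realType.
Local Notation C := R[i].
Local Notation e := (@cexp2pi R).
Local Notation H := (uhp R).

Fact uhpD_gt0 (t z : H) : 0 < complex.Im (t° + (z : C)).
by rewrite raddfD /= addr_gt0// uhp_gt0. Qed.
Definition uhpD (t z : H) : H := Uhp (uhpD_gt0 t z).

Transparent ps.
Lemma ps_scale (c : nat -> C) x w : ps c (w * x) = ps (fun m => c m * x ^+ m) w.
by rewrite /ps; apply: eq_usum => m; rewrite exprMn; ring. Qed.
Opaque ps.

Lemma QE_shift lam (f : H -> C) (z : H) : QE lam f -> QE lam (fun t => f (uhpD t z)).
move=> [c [tc fE]]; exists (fun m => e (lam%:C * (z : C)) * (c m * e (z : C) ^+ m)); split.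
 apply: tameZ; apply: (tame_le _ tc) => m; rewrite cnM cnX ler_piMr ?cn_ge0//.
 by rewrite exprn_ile1 ?cn_ge0// ltW// cn_e_uhp.
move=> t; rewrite fE /= mulrDr (eD (lam%:C * _)) -mulrA; congr (_ * _).
have tz : cn (e t°) < 1 := cn_e_uhp t.
rewrite psZ; last by [].
 by rewrite (eD t° (z : C)) ps_scale.
by apply: (tame_le _ tc) => m; rewrite cnM cnX ler_piMr ?cn_ge0// exprn_ile1 ?cn_ge0// ltW// cn_e_uhp.
Qed.

Definition uhp_2i : H := @Uhp R (0 +i* 2) (ltr0n _ 2).
Definition pcol (g : int * int) : C := g.2%:~R * uhp_2i° + g.1%:~R.
Definition mcol (M : 'M[int]_2) : int * int := (M 0 0, M 1 0).
Definition mcol2 (M : 'M[int]_2) : int * int := (M 0 1, M 1 1).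
(** For M = (a b; c d) this is (c t + d)(M t + 2i), the denominator of the reproducing kernel at the
    point 2i, whose conjugate is -2i. *)
Definition Xfac (M : 'M[int]_2) (t : C) : C := pcol (mcol M) * t + pcol (mcol2 M).
Lemma pcolE (g : int * int) : pcol g = g.1%:~R +i* (2 * g.2%:~R).
rewrite /pcol !intr_complex /=; apply/eqP; rewrite eq_complex /=; apply/andP; split; apply/eqP; ring.
Qed.
Lemma pcol_neq0 g : g != (0, 0) -> pcol g != 0.
case: g => a c h; rewrite pcolE eq_complex /= mulf_eq0 pnatr_eq0 /= !intr_eq0.
by apply: contra h => /andP[/eqP -> /eqP ->].
Qed.
Lemma mcol_neq0 M : \det M = 1 -> mcol M != (0, 0).
by rewrite det2 => dM; apply/negP => /eqP[a c]; move: dM; rewrite a c; lia. Qed.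

Fact zM_gt0 (M : 'M[int]_2) (dM : \det M = 1) : 0 < complex.Im (pcol (mcol2 M) / pcol (mcol M)).
have := mcol_neq0 dM; move: dM; rewrite det2 => /(congr1 (fun n : int => n%:~R : R)).
rewrite rmorphB !rmorphM /= !pcolE /mcol /mcol2 /= => dM h.
have n0 : 0 < (M 0 0)%:~R ^+ 2 + (2 * (M 1 0)%:~R) ^+ 2 :> R.
 rewrite lt_def addr_ge0 ?sqr_ge0// andbT paddr_eq0 ?sqr_ge0// !sqrf_eq0 mulf_eq0 pnatr_eq0 /= !intr_eq0.
 by apply: contra h => /andP[/eqP -> /eqP ->].
move: n0 dM; set a := (M 0 0)%:~R; set b := (M 0 1)%:~R; set c := (M 1 0)%:~R; set d := (M 1 1)%:~R => n0 dM.
set N := _ + _ in n0 *.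
have -> : b * - (2 * c / N) + 2 * d * (a / N) = 2 / N * (a * d - b * c) by field; exact: lt0r_neq0.
by rewrite dM mulr1 divr_gt0.
Qed.
Definition zM M dM : H := Uhp (@zM_gt0 M dM).

Lemma mcol_Tz M j : mcol (M *m mxTz j) = mcol M.
by rewrite /mcol !mul2E !mxE /= !mulr1 !mulr0 !addr0. Qed.
Lemma det_Tz j : \det (mxTz j) = 1.
by rewrite det2 !mxE /= mulr0 subr0. Qed.

Lemma Xfac_Tz M (dM : \det M = 1) j (t : H) :
 Xfac (M *m mxTz j) t = pcol (mcol M) * ((uhpD t (zM dM) : C) + j%:~R).
rewrite /Xfac mcol_Tz /=; have p0 := pcol_neq0 (mcol_neq0 dM).
have -> : pcol (mcol2 (M *m mxTz j)) = pcol (mcol M) * j%:~R + pcol (mcol2 M).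
 rewrite /pcol /mcol /mcol2 !mul2E !mxE /= !mulr1 !rmorphD !rmorphM /=.
 by move: uhp_2i° => x; ring.
move: (pcol _) (pcol _) p0 => x y y0; field.
by [].
Qed.

(** Matrices with a common first column form a coset of the translations; summing over such a coset
    will produce a Lipschitz sum. *)
Lemma fibreP M M' : \det M = 1 -> \det M' = 1 -> mcol M' = mcol M -> exists j, M *m mxTz j = M'.
move=> d d' [a c]; exists (M 1 1 * M' 0 1 - M 0 1 * M' 1 1); move: d d'; rewrite !det2 a c => d d'.
have h0 : M 0 0 * M 1 1 = 1 + M 0 1 * M 1 0 by rewrite -d subrK.
have h1 : M 0 0 * M' 1 1 = 1 + M' 0 1 * M 1 0 by rewrite -d' subrK.
apply: mx2P; rewrite mul2E !mxE /= ?mulr1 ?mulr0 ?addr0 ?a ?c//.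
 rewrite mulrBr mulrA h0 [M 0 0 * (_ * _)]mulrCA h1; ring.
have h2 : M 1 0 * M' 0 1 = M 0 0 * M' 1 1 - 1 by rewrite h1 addrC addKr mulrC.
have h3 : M 1 0 * M 0 1 = M 0 0 * M 1 1 - 1 by rewrite h0 addrC addKr mulrC.
rewrite mulrBr [M 1 0 * (M 1 1 * _)]mulrCA h2 mulrA h3; ring.
Qed.

Lemma Tz_inj M : \det M = 1 -> injective (fun j => M *m mxTz j).
move=> dM j j' E; have := congr1 (fun A : 'M[int]_2 => A 0 1) E; have := congr1 (fun A : 'M[int]_2 => A 1 1) E.
rewrite !mul2E !mxE /= => /addIr h1 /addIr h2; move: dM; rewrite det2.
have [a0|a0] := eqVneq (M 0 0) 0.
 have [c0|c0 _] := eqVneq (M 1 0) 0; first by rewrite a0 c0; lia.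
 exact: (mulfI c0).
by move=> _; exact: (mulfI a0).
Qed.

Lemma strip_bound (y : R) K : 0 < y -> exists2 B : R, 0 <= B & forall t : H, y <= complex.Im t° ->
 bsum (fun j : int => cn (t° + j%:~R) ^- K.+2) B.
move=> y0; have [d d0 hd] := @shift_lower R y 1 y0 (lexx _).
exists (d ^- K.+2 * 6); first by rewrite mulr_ge0// invr_ge0 exprn_ge0// ltW.
have base (t : H) : y <= complex.Im t° -> `|complex.Re t°| <= 1 ->
 bsum (fun j : int => cn (t° + j%:~R) ^- K.+2) (d ^- K.+2 * 6).
 move=> h1 h2 s us; apply: le_trans (_ : \sum_(j <- s) d ^- K.+2 * (`|j|.+1%:R : R) ^- 2 <= _).
 apply: ler_sum => j _; have := hd t h1 h2 j => hj.
 have p0 : 0 < d * `|j|.+1%:R by rewrite mulr_gt0.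
 apply: le_trans (_ : (d * `|j|.+1%:R) ^- K.+2 <= _).
 by rewrite lef_pV2 ?posrE ?exprn_gt0//; [rewrite lerXn2r// ?nnegrE ?cn_ge0// ltW | exact: lt_le_trans p0 hj].
 rewrite exprMn invfM; apply: ler_wpM2l; first by rewrite invr_ge0 exprn_ge0// ltW.
 by rewrite lef_pV2 ?posrE ?exprn_gt0// ler_weXn2l ?ler1n.
 rewrite -mulr_sumr ler_wpM2l//; first by rewrite invr_ge0 exprn_ge0// ltW.
 exact: bsum_intsq.
move=> t ty; pose N := Num.floor (complex.Re t°); pose t' := uhp_add t (- N).
have h1 : y <= complex.Im (t' : C) by rewrite /t' /= Im_add_int.
have h2 : `|complex.Re (t' : C)| <= 1.
 have -> : complex.Re (t' : C) = complex.Re t° - N%:~R by rewrite /t' /= intr_complex raddfD /= rmorphN.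
 have := floor_le (complex.Re t°); have := floorD1_gt (complex.Re t°).
 by rewrite -/N rmorphD /= ler_norml; lra.
apply: (@bsum_inj R int int (fun j => j - N)).
- by move=> j j'; exact: addIr.
- by move=> i hi; exfalso; apply: hi; exists (i + N); rewrite addrK.
by apply: bsumW (base t' h1 h2) => j; rewrite /t' /= rmorphB rmorphN /= -addrA [_ - N%:~R]addrC.
Qed.

Definition gX K (M : 'M[int]_2) (t : H) : R := if \det M == 1 then cn (Xfac M t) ^- K else 0.
Lemma gX_ge0 K M t : 0 <= gX K M t.
by rewrite /gX; case: eqP => // _; rewrite invr_ge0 exprn_ge0 ?cn_ge0. Qed.
Definition gcol (B : R) K (g : int * int) : R := if g == (0, 0) then 0 else B * cn (pcol g) ^- K.

(** One constant serves all columns and the whole half-plane Im t >= y, which is the uniformity that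
    [QE_usum] asks for. *)
Lemma fibre_bound (y : R) K : 0 < y -> exists2 B : R, 0 <= B & forall t : H, y <= complex.Im t° ->
 forall g, bsum (fun M => if mcol M == g then gX K.+2 M t else 0) (gcol B K.+2 g).
move=> y0; have [B B0 hB] := strip_bound K y0; exists B => // t ty g.
have g0 : 0 <= gcol B K.+2 g.
 by rewrite /gcol; case: eqP => // _; rewrite mulr_ge0// invr_ge0 exprn_ge0 ?cn_ge0.
have [[M0 [dM cM]]|no] := pselect (exists M, \det M = 1 /\ mcol M = g); last first.
 move=> s _; rewrite big1// => M _; case: eqP => // Mg; rewrite /gX; case: eqP => // dM.
 by exfalso; apply: no; exists M.
apply: (bsum_inj (Tz_inj dM)) => [M hM|].
 case: eqP => // Mg; rewrite /gX; case: eqP => // dM'.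
 by exfalso; apply: hM; apply: fibreP; rewrite // Mg.
rewrite /gcol -cM (negbTE (mcol_neq0 dM)) => s us.
have le1 : y <= complex.Im (uhpD t (zM dM) : C) by rewrite [complex.Im _]raddfD /= (le_trans ty)// lerDl; exact: ltW (uhp_gt0 (zM dM)).
rewrite mulrC; apply: le_trans (_ : \sum_(j <- s) cn (pcol (mcol M0)) ^- K.+2 * cn ((uhpD t (zM dM) : C) + j%:~R) ^- K.+2 <= _).
 apply: ler_sum => j _; rewrite mcol_Tz eqxx /gX det_mulmx dM det_Tz mulr1 eqxx.
 by rewrite (Xfac_Tz dM) cnM exprMn invfM.
rewrite -mulr_sumr ler_wpM2l ?invr_ge0 ?exprn_ge0 ?cn_ge0//.
exact: hB le1 _ us.
Qed.

Lemma bsum_gcol (B : R) K : 0 <= B -> (3 <= K)%N -> exists Bt, bsum (gcol B K) Bt.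
move=> B0 K3; have [d d0 hd] := @lattice_lower R uhp_2i.
exists (B * d ^- K * ((2 * 3) * (2 * 3))) => s us.
have sq (n : nat) : 1 <= Num.sqrt n.+1%:R :> R by rewrite -[leLHS]sqrtr1 ler_sqrt// ler1n.
apply: le_trans (_ : \sum_(g <- s) B * d ^- K * (alpha R `|g.1|%N * alpha R `|g.2|%N) <= _).
 apply: ler_sum => -[a c] _ /=; rewrite /gcol.
 have al n : 0 <= alpha R n by rewrite ltW// alpha_gt0.
 have dK : 0 <= d ^- K by rewrite invr_ge0 exprn_ge0// ltW.
 case: eqP => [_|/eqP ac]; first by rewrite !mulr_ge0.
 rewrite -mulrA; apply: ler_wpM2l => //.
 have ac' : (c, a) != (0, 0) by apply: contra ac => /eqP[-> ->].
 have h := hd _ _ ac'; have p0 : 0 < d * (Num.sqrt `|c|.+1%:R * Num.sqrt `|a|.+1%:R).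
 by rewrite mulr_gt0// mulr_gt0// (lt_le_trans ltr01).
 apply: le_trans (_ : (d * (Num.sqrt `|c|.+1%:R * Num.sqrt `|a|.+1%:R)) ^- K <= _).
 rewrite lef_pV2 ?posrE ?exprn_gt0//; first by rewrite lerXn2r// ?nnegrE ?cn_ge0// ltW.
 exact: lt_le_trans p0 h.
 rewrite exprMn invfM; apply: ler_wpM2l => //; rewrite exprMn invfM mulrC /alpha.
 have x n : Num.sqrt n.+1%:R ^- K <= Num.sqrt n.+1%:R ^- 3 :> R.
 by rewrite lef_pV2 ?posrE ?exprn_gt0 ?(lt_le_trans ltr01 (sq n))// ler_weXn2l.
 by apply: ler_pM; rewrite ?invr_ge0 ?exprn_ge0 ?sqrtr_ge0.
rewrite -mulr_sumr; apply: ler_wpM2l; first by rewrite mulr_ge0// invr_ge0 exprn_ge0// ltW.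
have bi : bsum (fun j : int => alpha R `|j|%N) (2 * 3).
 by apply: bsum_int (@bsum_alpha R) => n; rewrite ltW// alpha_gt0.
by apply: (bsum_prod _ _ bi bi us) => j; rewrite ltW// alpha_gt0.
Qed.

Lemma bsum_gX K (t : H) : (3 <= K)%N -> exists Bt, bsum (fun M => gX K M t) Bt.
case: K => [|[|K]]// K3; have [B B0 hB] := @fibre_bound (complex.Im t°) K (uhp_gt0 t).
have [Bt hBt] := bsum_gcol B0 K3; exists Bt.
by apply: (@bsum_group R _ _ mcol _ _ _ _ (hB t (lexx _)) hBt) => M; exact: gX_ge0.
Qed.

Section Rep.
Variables (n : nat) (S : 'M[C]_n) (L : 'I_n -> R).
Local Notation D := (diag_mx (\row_i e (L i)%:C)).
Hypotheses (isoS : isometric S) (SS : S *m S = 1%:M)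
 (braid : D *m (S *m (D *m (S *m D))) = S).

Definition repval := wval (@mulmx C n n n) 1%:M S D.

Lemma rep_relations : mp_relations (@mulmx C n n n) 1%:M S D.
split=> //.
- exact: mulmxA.
- exact: mul1mx.
- exact: mulmx1.
- by rewrite SS mulmx1 mulmxA SS mul1mx.
- by rewrite /= mulmx1 SS mulmx1 SS mulmx1 SS mulmx1 SS.
Qed.

(** Any word for M may be taken: a word with trivial matrix is an even power of s, and S^2 = 1
    ([repval_eq]). *)
Definition rho (M : 'M[int]_2) : 'M[C]_n :=
 if pselect (exists w, slval w = M) is left h then repval (sval (cid h)) else 1%:M.

Lemma repval_eq u v : slval u = slval v -> repval u = repval v.
move=> uv; have [v' [h1 h2]] := winv_exists v; have r := rep_relations.
have E : repval (u ++ v') = 1%:M.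
 have : slval (u ++ v') = 1%:M by rewrite slval_cat uv -slval_cat /slval (h1 _ _ _ _ _ sl_relations).
 move=> /slval_eq1[k hk]; rewrite /repval (hk _ _ _ _ _ r).
 by elim: k {hk} => [|k IH]; rewrite ?muln0// mulnS nseqD (wval_cat r) IH /= !mulmx1.
have E2 : repval (v' ++ v) = 1%:M by rewrite /repval (h2 _ _ _ _ _ r).
rewrite -[LHS]mulmx1 -E2 /repval (wval_cat r) mulmxA -(wval_cat r) -/(repval _) E.
exact: mul1mx.
Qed.

Lemma rhoE w : rho (slval w) = repval w.
rewrite /rho; case: pselect => [h|[]]; last by exists w.
by case: cid => u hu /=; exact: repval_eq.
Qed.
Lemma rhoM A B : \det A = 1 -> \det B = 1 -> rho (A *m B) = rho A *m rho B.
move=> /sl_generated[u <-] /sl_generated[v <-]; rewrite -slval_cat !rhoE.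
exact: (wval_cat rep_relations).
Qed.
Lemma rho1 : rho 1%:M = 1%:M. Proof. by rewrite -[X in rho X]/(slval [::]) rhoE. Qed.
Lemma rhoS : rho mxS = S.
by have := rhoE [:: true]; rewrite /slval /repval /= /sl_op !mulmx1. Qed.
Lemma rhoT : rho mxT = D.
by have := rhoE [:: false]; rewrite /slval /repval /= /sl_op !mulmx1. Qed.
Lemma rho_N1 : rho (mx2 (-1) 0 0 (-1)) = 1%:M.
have <- : slval [:: true; true] = mx2 (-1) 0 0 (-1).
 by rewrite /slval /= mxSE mx1E /sl_op !mul2; apply: mx2_eq.
by rewrite rhoE /repval /= mulmx1 SS.
Qed.

Lemma rho_iso A : isometric (rho A).
rewrite /rho; case: pselect => [h|_]; last exact: isometric1.
elim: (sval _) => [|b w IH]; first exact: isometric1.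
move=> x; rewrite /repval /= -/(repval w) -mulmxA -[RHS]IH; case: b; first exact: isoS.
apply: eq_bigr => i _; rewrite mul_diag_mx mxE [X in cn (X * _)]mxE cnM cn_e_real mul1r.
by [].
Qed.

Definition adj2 (A : 'M[int]_2) := mx2 (A 1 1) (- A 0 1) (- A 1 0) (A 0 0).
Lemma adj2M A B : adj2 (A *m B) = adj2 B *m adj2 A.
by rewrite mul2 /adj2 !mul2E; apply: mx2_eq; ring. Qed.
Lemma det_adj2 A : \det (adj2 A) = \det A.
by rewrite !det2 !mxE /=; ring. Qed.

Lemma adj2_S : rho (adj2 mxS) = S.
have d1 : \det (adj2 mxS) = 1 by rewrite det_adj2 mxS_det.
have h : rho (adj2 mxS) *m S = 1%:M.
 rewrite -rhoS -rhoM ?mxS_det// -rho1; congr rho.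
 by rewrite /adj2 !mxE /= mxSE mul2 mx1E; apply: mx2_eq.
by rewrite -[LHS]mulmx1 -SS mulmxA h mul1mx.
Qed.

Lemma rho_Tz j (x : 'cV[C]_n) i : (rho (mxTz j) *m x) i 0 = e (L i * j%:~R)%:C * x i 0.
have step a (y : 'cV[C]_n) : (rho (mxTz (a + 1)) *m y) i 0 = e (L i)%:C * (rho (mxTz a) *m y) i 0.
 have -> : mxTz (a + 1) = mxT *m mxTz a by rewrite mxTE mul2; apply: mx2_eq; lia.
 by rewrite rhoM ?mxT_det ?det_Tz// rhoT -mulmxA mul_diag_mx mxE [X in X * _]mxE.
have e1 a : e (L i * (a + 1)%:~R)%:C = e (L i)%:C * e (L i * a%:~R)%:C by rewrite -eD -rmorphD /= rmorphD /= mulrDr mulr1 addrC.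
have e00 : (rho (mxTz 0) *m x) i 0 = e (L i * 0%:~R)%:C * x i 0.
 have z0 : mxTz 0 = 1%:M by rewrite mx1E.
 by rewrite z0 rho1 mul1mx mulr0 e0 mul1r.
elim: j => [//|m IH|m IH].
 have mm : m.+1%:Z = m%:Z + 1 by lia.
 by rewrite mm step e1 IH mulrA.
have E := step (- m.+1%:Z) x; have E1 := e1 (- m.+1%:Z).
have mm : - m.+1%:Z + 1 = - m%:Z by lia.
rewrite mm IH in E; rewrite mm in E1; rewrite E1 -mulrA in E.
by apply/esym; apply: (mulfI (e_neq0 (L i)%:C)).
Qed.

Variables (v : 'cV[C]_n).
Definition nv : R := Num.sqrt (\sum_i cn (v i 0) ^+ 2).
Definition uvec A := rho (adj2 A) *m v.

Lemma uvec_le A i : cn (uvec A i 0) <= nv.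
rewrite -[leLHS]ger0_norm ?cn_ge0// -sqrtr_sqr /nv ler_wsqrtr// -(rho_iso (adj2 A) v).
by rewrite (bigD1 i)//= lerDl sumr_ge0// => j _; rewrite sqr_ge0.
Qed.
Lemma nv_ge0 : 0 <= nv. Proof. exact: sqrtr_ge0. Qed.
Definition pterm K i (t : H) (A : 'M[int]_2) : C :=
 if \det A == 1 then (Xfac A t) ^- K * uvec A i 0 else 0.
Lemma cn_pterm K i t A : cn (pterm K i t A) <= nv * gX K A t.
rewrite /pterm /gX; case: eqP => dA; last by rewrite cn0 mulr0.
by rewrite cnM cnV cnX mulrC ler_wpM2r ?uvec_le// invr_ge0 exprn_ge0 ?cn_ge0.
Qed.
Lemma bsumZ (I : choiceType) (g : I -> R) B a : 0 <= a -> bsum g B -> bsum (fun i => a * g i) (a * B).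
by move=> a0 h s us; rewrite -mulr_sumr ler_wpM2l// h. Qed.
Lemma summ_pterm K i t : (3 <= K)%N -> summ (pterm K i t).
move=> K3; have [B hB] := bsum_gX t K3.
exact: summW (cn_pterm K i t) (bsumZ nv_ge0 hB).
Qed.
Definition poinc K (t : H) : 'cV[C]_n := \col_i usum (pterm K i t).

Lemma poinc_S K (t : H) : (3 <= K)%N -> poinc K (uhpS t) = t° ^+ K *: (S *m poinc K t).
move=> K3; apply/colP => i; rewrite [RHS]mxE !mxE.
pose G A := \sum_l S i l * pterm K l t A.
have sG : summ G by apply: summ_sum => l; exact/summZ/summ_pterm.
have -> : \sum_j S i j * poinc K t j 0 = usum G.
 rewrite /G usum_sum => [|l]; last exact/summZ/summ_pterm.
 by apply: eq_bigr => l _; rewrite mxE usumZ//; exact: summ_pterm.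
have bS : bijective (fun A : 'M[int]_2 => A *m mxS).
 exists (fun A : 'M[int]_2 => A *m (mx2 0 1 (-1) 0)) => A; rewrite -mulmxA mxSE mul2 -[RHS]mulmx1 mx1E;
 by congr (_ *m _); apply: mx2_eq.
rewrite (usum_bij bS sG) -usumZ; last exact: (@summ_comp R _ _ _ (bij_inj bS) _ sG).
apply: eq_usum => A; rewrite /G /pterm det_mulmx mxS_det mulr1.
case: eqP => dA; last by rewrite big1 ?mulr0// => l _; rewrite mulr0.
have XE : Xfac A (uhpS t) = t°^-1 * Xfac (A *m mxS) t.
 rewrite /Xfac uhpSE /mcol /mcol2 !mul2E mxSE !mxE /= !mulr0 !mulr1 !mulrN1 !add0r !addr0.
 have -> : pcol (- A 0 0, - A 1 0) = - pcol (A 0 0, A 1 0) by rewrite /pcol /= !rmorphN /= mulNr opprD.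
 have := uhp_neq0 t; move: (pcol _) (pcol _) => x y t0; field.
 by [].
have uE : uvec A = S *m uvec (A *m mxS).
 rewrite /uvec adj2M rhoM ?det_adj2 ?mxS_det// adj2_S -mulmxA mulmxA SS mul1mx.
 by [].
rewrite XE exprMn invfM exprVn invrK uE mxE -mulrA; congr (_ * _).
rewrite mulr_sumr; apply: eq_bigr => l _; rewrite mulrCA.
by [].
Qed.

(** Translation by j multiplies component i by e(-L_i j) = e(-lam j), the integer q being invisible.
    The Lipschitz formula then gives the expansion at infinity. *)
Lemma usum_fibre K i t (M0 : 'M[int]_2) (dM : \det M0 = 1) (lam : R) (q : nat) : (3 <= K.+1)%N ->
 L i = lam + q%:R ->
 usum (fun A => if mcol A == mcol M0 then pterm K.+1 i t A else 0) =
 (pcol (mcol M0) ^- K.+1 * uvec M0 i 0) * lip lam K (uhpD t (zM dM)).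
move=> K3 Lq; rewrite (usum_inj (Tz_inj dM)); last 2 first.
- move=> A hA; case: eqP => // Ag; rewrite /pterm; case: eqP => // dA.
 by exfalso; apply: hA; exact: fibreP.
- exact/summ_if/summ_pterm.
rewrite /lip -usumZ; last by apply: summ_lip; lia.
apply: eq_usum => j; rewrite mcol_Tz eqxx /pterm det_mulmx dM det_Tz mulr1 eqxx (Xfac_Tz dM).
have -> : uvec (M0 *m mxTz j) i 0 = e (- (lam%:C * j%:~R)) * uvec M0 i 0.
 rewrite /uvec adj2M rhoM ?det_adj2 ?det_Tz// -mulmxA.
 have -> : adj2 (mxTz j) = mxTz (- j) by rewrite /adj2 /mxTz !mxE /= oppr0.
 rewrite rho_Tz; congr (_ * _).
 have -> : (L i * (- j)%:~R)%:C = - (lam%:C * j%:~R) + (- (q%:Z * j))%:~R.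
 rewrite real_mul_int intr_complex -rmorphN -rmorphD /= Lq; congr (_%:C).
 by rewrite !rmorphN rmorphM /= -pmulrn; ring.
 by rewrite eD e_int mulr1.
rewrite exprMn invfM; move: (_ ^- _) (_ ^- _) (e _) (uvec _ _ _) => a b c d; ring.
Qed.

Lemma poinc_QE K i N k q : (2 <= K)%N -> (k < N)%N -> L i = k%:R / N%:R + q%:R ->
 QE (k%:R / N%:R) (fun t => poinc K.+1 t i 0).
move=> K2 kN Lq; have K3 : (3 <= K.+1)%N by [].
pose f g t := usum (fun A => if mcol A == g then pterm K.+1 i t A else 0).
have -> : (fun t => poinc K.+1 t i 0) = (fun t => usum (fun g => f g t)).
 by apply/funext => t; rewrite mxE; have [_ ->] := usum_group mcol (summ_pterm i t K3).
apply: QE_usum => [g|y y0].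
 have [[M0 [dM cM]]|no] := pselect (exists M, \det M = 1 /\ mcol M = g).
 have ql : QE (k%:R / N%:R) (lip (k%:R / N%:R : R) K).
 by eexists; apply: lip_QE; [exact: leq_trans K2 | exact: kN |].
 have := QEZ (pcol (mcol M0) ^- K.+1 * uvec M0 i 0) (QE_shift (zM dM) ql).
 by congr QE; apply/funext => t; rewrite /f -cM (usum_fibre t dM K3 Lq).
 have -> : f g = (fun=> 0); last exact: QE0.
 apply/funext => t; transitivity (usum (fun _ : 'M[int]_2 => 0 : C)); last exact: usum0.
 apply: eq_usum => A.
 case: eqP => // Ag; rewrite /pterm; case: eqP => // dA.
 by exfalso; apply: no; exists A.
case: K K2 K3 @f Lq => [//|K] _ K3 f Lq; have [B B0 hB] := fibre_bound K y0; have [Bt hBt] := bsum_gcol B0 K3.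
exists (fun g => nv * gcol B K.+2 g), (nv * Bt); split; first exact: bsumZ nv_ge0 hBt.
move=> g t ty; apply: usum_le; first exact/summ_if/summ_pterm.
apply: bsumW (bsumZ nv_ge0 (hB t ty g)) => A.
by case: eqP => _; rewrite ?cn0 ?mulr0// cn_pterm.
Qed.

(** The expansion starts at the fractional part of L_i, possibly L_i - 1. The factor Delta raises
    the exponent by 1 and the weight index by 6. *)
Lemma poinc_MF K j : (forall i, exists N k q : nat, [/\ (k < N)%N, (q <= 1)%N & L i = k%:R / N%:R + q%:R]) ->
 (2 <= K)%N -> K.+1 = (2 * j)%N -> MF S L (j%:Z + 6) (fun t => Delta t *: poinc K.+1 t).
move=> hL K2 Kj; split=> [i|t].
 have [N [k [q [kN q1 Lq]]]] := hL i.
 have D1 : QE 1 (@Delta R) by eexists; exact: Delta_QEc.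
 have h := QEM (poinc_QE K2 kN Lq) D1.
 have hE : (fun t => poinc K.+1 t i 0 * Delta t) = (fun t => (Delta t *: poinc K.+1 t) i 0).
 by apply/funext => t; rewrite [RHS]mxE mulrC.
 rewrite hE in h; rewrite Lq; case: q q1 {Lq} => [|[|//]] _; last exact: h.
 by rewrite addr0; exact: (@QE_unshift R _ 1 _ h).
rewrite Delta_S poinc_S// -scalemxAr !scalerA; congr (_ *: _).
rewrite uhp_exprD uhp_expr12 (_ : t° ^ (j%:Z * 2) = t° ^+ K.+1).
 by move: (_ ^+ _) (_ ^+ _) (Delta t) => a b d; ring.
by rewrite exprnP Kj; congr (_ ^ _); lia.
Qed.

Lemma Xfac_2i A : \det A = 1 -> cn (Xfac A uhp_2i°) ^+ 2 =
 ((A 0 1) ^+ 2 + 16 * (A 1 0) ^+ 2 + 4 * (A 0 0) ^+ 2 + 4 * (A 1 1) ^+ 2 + 8)%:~R.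
rewrite det2 => /(congr1 (fun n : int => n%:~R : R)); rewrite rmorphB !rmorphM /= => dA.
rewrite /Xfac !pcolE sqr_cn /= !rmorphD /= !rmorphM /=.
move: ((A 0 0)%:~R) ((A 0 1)%:~R) ((A 1 0)%:~R) ((A 1 1)%:~R) dA => a b c d dA.
rewrite -[16%:~R]/(16 : R) -[4%:~R]/(4 : R) -dA.
ring.
Qed.

(** The integer in [Xfac_2i] is 16 at plus and minus the identity; this gap makes those two terms
    dominate. *)
Lemma Xfac_2i_ge A : \det A = 1 -> A != 1%:M -> A != mx2 (-1) 0 0 (-1) ->
 17 <= cn (Xfac A uhp_2i°) ^+ 2.
move=> dA h1 h2; rewrite Xfac_2i// (_ : 17 = (17 : int)%:~R)// ler_int.
have {}h1 : ~ [/\ A 0 0 = 1, A 0 1 = 0, A 1 0 = 0 & A 1 1 = 1].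
 by move=> [x y z w]; case/eqP: h1; rewrite (mx2_eta A) x y z w mx1E.
have {}h2 : ~ [/\ A 0 0 = -1, A 0 1 = 0, A 1 0 = 0 & A 1 1 = -1].
 by move=> [x y z w]; case/eqP: h2; rewrite (mx2_eta A) x y z w.
move: dA h1 h2; rewrite det2; move: (A 0 0) (A 0 1) (A 1 0) (A 1 1) => a b c d dA h1 h2.
have sq (x : int) : x != 0 -> 1 <= x ^+ 2 by move=> x0; rewrite expr2; nia.
have sq0 (x : int) : 0 <= x ^+ 2 := sqr_ge0 x.
have [c0|c0] := eqVneq c 0; last first.
 have [b0|b0] := eqVneq b 0; last first.
 by have := sq _ b0; have := sq _ c0; have := sq0 a; have := sq0 d; lia.
 have ad : a != 0 /\ d != 0 by split; apply/eqP => z; move: dA; rewrite b0 z; lia.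
 by have := sq _ c0; have := sq _ ad.1; have := sq _ ad.2; have := sq0 b; lia.
have ad : a != 0 /\ d != 0 by split; apply/eqP => z; move: dA; rewrite c0 z; lia.
have [b0|b0] := eqVneq b 0; last first.
 by have := sq _ b0; have := sq _ ad.1; have := sq _ ad.2; have := sq0 c; lia.
exfalso; move: dA; rewrite b0 c0 mulr0 subr0 => ad1.
have : (`|a| * `|d|)%N == 1%N by rewrite -abszM ad1.
rewrite muln_eq1 => /andP[/eqP a1 /eqP d1].
have [aE|aE] : a = 1 \/ a = -1 by lia.
 by apply: h1; split=> //; rewrite aE in ad1; lia.
by apply: h2; split=> //; rewrite aE in ad1; lia.
Qed.

(** At plus and minus the identity X^4 = 256, and each contributes v. For all other matrices |X|^4
    >= 17^2 > 256, so their terms tend to 0, dominated by the series of exponent 8. *)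
Lemma poinc_lim i : clim (fun m => 256 ^+ m.+2 * poinc (4 * m.+2) uhp_2i i 0) (2 * v i 0).
have K3 m : (3 <= 4 * m.+2)%N by lia.
pose N1 := mx2 (-1) 0 0 (-1).
pose G (A : 'M[int]_2) : C := if (A == 1%:M) || (A == N1) then v i 0 else 0.
have -> : 2 * v i 0 = usum G.
 have ne : 1%:M != N1 by rewrite mx1E; apply/eqP => /mx2_inj[].
 rewrite (@usum_fin R _ G [:: 1%:M; N1]).
 - by rewrite !big_cons big_nil /G !eqxx orbT /=; ring.
 - by rewrite /= inE ne.
 - by move=> A; rewrite !inE /G => /negbTE ->.
apply: (eq_clim (u := fun m => usum (fun A => 256 ^+ m.+2 * pterm (4 * m.+2) i uhp_2i A))).
 by move=> m; rewrite mxE usumZ//; exact: summ_pterm.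
have [B hB] := @bsum_gX 8 uhp_2i isT.
have u0 A : 0 <= cn (Xfac A uhp_2i°) by exact: cn_ge0.
pose r A : R := 256 / cn (Xfac A uhp_2i°) ^+ 4.
have r_le A m : \det A = 1 -> cn (256 ^+ m * pterm (4 * m) i uhp_2i A) <= r A ^+ m * nv.
 move=> dA; rewrite /pterm dA eqxx mulrA cnM; apply: ler_pM; rewrite ?cn_ge0//; last exact: uvec_le.
 by rewrite cnM cnV !cnX cn_nat /r exprMn exprVn -exprM.
have x4 A : cn (Xfac A uhp_2i°) ^+ 4 = (cn (Xfac A uhp_2i°) ^+ 2) ^+ 2 by rewrite -exprM.
have one A : A = 1%:M \/ A = N1 -> \det A = 1 /\ Xfac A uhp_2i° ^+ 4 = 256.
 move=> hA; have [dA tA] : \det A = 1 /\ ((A 0 1 = 0 /\ A 1 0 = 0) /\ ((A 0 0 = 1 /\ A 1 1 = 1) \/ (A 0 0 = -1 /\ A 1 1 = -1))).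
 by case: hA => ->; rewrite ?mx1E det2 !mxE /=; split=> //; split=> //; [left|right].
 split=> //; have [[z1 z2] [[o1 o2]|[o1 o2]]] := tA; rewrite /Xfac !pcolE /= z1 z2 o1 o2;
 rewrite -[4%N]/(2 * 2)%N exprM !expr2; apply/eqP; rewrite eq_complex /=; apply/andP; split; apply/eqP; rewrite /= ?rmorphN /=; ring.
have r1 A : A = 1%:M \/ A = N1 -> r A = 1.
 by move=> /one[_ h]; rewrite /r -cnX h cn_nat divff// pnatr_eq0.
have rlt A : \det A = 1 -> ~ (A = 1%:M \/ A = N1) -> 0 <= r A < 1.
 move=> dA no; have n1 : A != 1%:M by apply/eqP => h; apply: no; left.
 have n2 : A != N1 by apply/eqP => h; apply: no; right.
 have h := Xfac_2i_ge dA n1 n2; rewrite /r x4.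
 have p : 256 < (cn (Xfac A uhp_2i°) ^+ 2) ^+ 2 by rewrite expr2; nra.
 have p0 : 0 < (cn (Xfac A uhp_2i°) ^+ 2) ^+ 2 by rewrite (lt_trans _ p).
 by rewrite divr_ge0 ?(ltW p0)//= ltr_pdivrMr// mul1r.
have r01 A : \det A = 1 -> 0 <= r A <= 1.
 move=> dA; have [/r1 ->|/(rlt _ dA)/andP[-> /ltW ->]//] := pselect (A = 1%:M \/ A = N1).
 by rewrite ler01 lexx.
apply: (@clim_usum R _ _ _ (fun A => (256 ^+ 2 * nv) * gX 8 A uhp_2i) _ _ _ _); last 2 first.
- exact: (bsumZ (mulr_ge0 (exprn_ge0 2 (ler0n _ 256)) nv_ge0) hB).
- move=> A; have [hA|hA] := pselect (A = 1%:M \/ A = N1).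
 have [dA xA] := one _ hA; have GE : G A = v i 0.
 by rewrite /G; case: hA => ->; rewrite eqxx ?orbT.
 apply: (eq_clim (u := fun _ => G A)); last exact: clim_cst.
 move=> m; rewrite GE /pterm dA eqxx (exprM _ 4) xA mulVKf ?expf_neq0 ?pnatr_eq0//.
 rewrite /uvec; have -> : rho (adj2 A) = 1%:M; last by rewrite mul1mx.
 case: hA => ->; rewrite /adj2 ?mx1E !mxE /= ?oppr0 -?mx1E ?rho1//.
 exact: rho_N1.
 have GE : G A = 0 by rewrite /G; case: eqP => [E|_]; [case: hA; left | case: eqP => // E; case: hA; right].
 rewrite GE; have [dA|dA] := eqVneq (\det A) 1; last first.
 by apply: (eq_clim (u := fun _ => 0)); [move=> m; rewrite /pterm (negbTE dA) mulr0 | exact: clim_cst].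
 have ra := rlt _ dA hA; have /andP[ra0 ra1] := ra.
 apply: (@clim_dominated R _ ((1 - r A)^-1 * nv)) => m; apply: le_trans (r_le _ _ dA) _.
 rewrite [leRHS]mulrAC ler_wpM2r ?nv_ge0//.
 rewrite ler_pdivlMr// mulrC.
 apply: le_trans (natX_bound m.+1 ra); apply: ler_wpM2l => //.
 by apply: ler_wiXn2l => //; exact: ltW.
move=> m A; have [dA|dA] := eqVneq (\det A) 1; last first.
 by rewrite /pterm /gX (negbTE dA) !mulr0 cn0.
 have /andP[ra0 ra1] := r01 _ dA; apply: le_trans (r_le _ _ dA) _.
 have E : 256 ^+ 2 * nv * gX 8 A uhp_2i = r A ^+ 2 * nv by rewrite /gX dA eqxx mulrAC /r expr_div_n -exprM.
 rewrite E; apply: ler_wpM2r; first exact: nv_ge0.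
 by apply: ler_wiXn2l.
Qed.

End Rep.

Lemma clim_sum (I : Type) (l : seq I) (u : I -> nat -> C) (a : I -> C) :
 (forall i, clim (u i) (a i)) -> clim (fun m => \sum_(i <- l) u i m) (\sum_(i <- l) a i).
move=> h; elim: l => [|i l IH].
 by rewrite big_nil; apply: (eq_clim (u := fun _ => 0)); [move=> m; rewrite big_nil | exact: clim_cst].
rewrite big_cons; apply: (eq_clim (u := fun m => u i m + \sum_(i <- l) u i m)); last exact: climD.
by move=> m; rewrite big_cons.
Qed.

Lemma clim_neq0 (u : nat -> C) a : clim u a -> a != 0 -> exists m, u m != 0.
move=> h a0; have [|N hN] := h (cn a); first by rewrite cn_gt0.
exists N; apply/eqP => z; have := hN N (leqnn _); rewrite z sub0r cnN ltxx.
by [].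
Qed.

Section Existence.
Variables (n : nat) (S : 'M[C]_n) (L : 'I_n -> R).
Local Notation D := (diag_mx (\row_i e (L i)%:C)).
Hypotheses (isoS : isometric S) (SS : S *m S = 1%:M)
 (braid : D *m (S *m (D *m (S *m D))) = S)
 (hL : forall i, exists N k q : nat, [/\ (k < N)%N, (q <= 1)%N & L i = k%:R / N%:R + q%:R]).

(** With v running over the unit vectors, the normalized determinant at 2i tends to 2^n, so it is
    nonzero for some weight. *)
Lemma full_rank_forms : exists (F : 'I_n -> H -> 'cV[C]_n) (w : 'I_n -> int),
 (forall l, MF S L (w l) (F l)) /\ \det (\matrix_(i, l) F l uhp_2i i 0) != 0.
pose P l K t := poinc S L (delta_mx l 0 : 'cV[C]_n) K t.
have lim : clim (fun m => \det (\matrix_(i, l) (256 ^+ m.+2 * P l (4 * m.+2)%N uhp_2i i 0))) (2 ^+ n).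
 have -> : 2 ^+ n = \det (\matrix_(i < n, l < n) (2 * (delta_mx l 0 : 'cV[C]_n) i 0)).
 rewrite -[LHS]det_scalar; congr (\det _); apply/matrixP => i l; rewrite !mxE eqxx andbT.
 by case: eqP => _; rewrite ?mulr1n ?mulr0n ?mulr1 ?mulr0.
 rewrite /determinant; apply: clim_sum => s; apply: climZ; apply: clim_prod => i.
 rewrite [X in clim _ X]mxE; have := poinc_lim isoS SS braid (delta_mx (s i) 0) i.
 move=> pl; refine (@eq_clim R (fun m => 256 ^+ m.+2 * poinc S L (delta_mx (s i) 0) (4 * m.+2) uhp_2i i 0) _ _ _ pl) => m.
 by rewrite [RHS]mxE.
have [|m hm] := clim_neq0 lim; first by rewrite expf_neq0// pnatr_eq0.
exists (fun l t => Delta t *: P l (4 * m.+2)%N t), (fun=> (2 * m.+2)%N%:Z + 6); split=> [l|].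
 have := @poinc_MF n S L isoS SS braid (delta_mx l 0) (4 * m + 7)%N (2 * m.+2)%N hL.
 rewrite (_ : (4 * m + 7).+1 = 4 * m.+2)%N; last lia.
 by apply; lia.
have -> : \matrix_(i, l) (Delta uhp_2i *: P l (4 * m.+2)%N uhp_2i) i 0 = Delta uhp_2i *: \matrix_(i, l) P l (4 * m.+2)%N uhp_2i i 0.
 by apply/matrixP => i l; rewrite [LHS]mxE [LHS]mxE [RHS]mxE [X in _ = _ * X]mxE.
rewrite detZ mulf_neq0 ?expf_neq0 ?Delta_neq0//.
apply: contra hm => /eqP h0.
have -> : \matrix_(i, l) (256 ^+ m.+2 * P l (4 * m.+2)%N uhp_2i i 0) = 256 ^+ m.+2 *: \matrix_(i, l) P l (4 * m.+2)%N uhp_2i i 0.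
 by apply/matrixP => i l; rewrite [LHS]mxE [RHS]mxE [X in _ = _ * X]mxE.
by rewrite detZ h0 mulr0.
Qed.

Lemma vv_dim_formula (j : int) : S^T = S -> exists s m : nat,
 [/\ has_dim (MFset S L j) s, has_dim (MFset S (fun i => 2 - L i) (7 - j)) m
 & `|s%:R - m%:R - (n%:R * (j%:~R / 6 + 5 / 12) - \sum_i L i)| <=
 cn (\tr S) / 4 + cn (\sum_i e (L i)%:C * S i i) * (2 / (3 * Num.sqrt 3)) :> R].
move=> ST; have [F [w [hF dF]]] := full_rank_forms.
have L0 i : 0 <= L i.
 by have [N [k [q [_ _ ->]]]] := hL i; rewrite addr_ge0 ?divr_ge0.
have [k [G [hG sG dG]]] := free_basis isoS L0 hF dF.
have SS' : S^T *m S = 1%:M by rewrite ST.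
by apply: (dim_formula SS' hG sG dG).
Qed.

End Existence.
End Poincare.

(** * Four squares with sum -1 modulo m *)

Section FourSquares.
Local Open Scope nat_scope.

(** A quaternion of norm -1 modulo m; for m the level it will carry Q to -Q on A^4. *)
Definition four_sq (m : nat) := exists a b c d : int, (m%:Z %| (a ^+ 2 + b ^+ 2 + c ^+ 2 + d ^+ 2 + 1)%R)%Z.

Lemma four_sq_coprime m n : coprime m n -> 0 < m -> 0 < n -> four_sq m -> four_sq n -> four_sq (m * n).
move=> co m0 n0 [a [b [c [d h]]]] [a' [b' [c' [d' h']]]].
have cz : coprimez m%:Z n%:Z by [].
have ch (x y : int) : exists z u v : int, (z = x + u * m%:Z)%R /\ (z = y + v * n%:Z)%R.
 pose z := zchinese m n x y.
 have /eqP := zchinese_modl cz x y; rewrite eqz_mod_dvd => /dvdzP[u hu].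
 have /eqP := zchinese_modr cz x y; rewrite eqz_mod_dvd => /dvdzP[v hv].
 by exists z, u, v; rewrite -hu -hv !subrKC.
have [A [a1 [a2 [A1 A2]]]] := ch a a'; have [B [b1 [b2 [B1 B2]]]] := ch b b'.
have [X [c1 [c2 [X1 X2]]]] := ch c c'; have [D [d1 [d2 [D1 D2]]]] := ch d d'.
exists A, B, X, D; rewrite PoszM Gauss_dvdz//; apply/andP; split.
- have -> : (A ^+ 2 + B ^+ 2 + X ^+ 2 + D ^+ 2 + 1 = (a ^+ 2 + b ^+ 2 + c ^+ 2 + d ^+ 2 + 1) +
 (a1 * (a + A) + b1 * (b + B) + c1 * (c + X) + d1 * (d + D)) * m%:Z)%R by rewrite A1 B1 X1 D1; ring.
 by rewrite rpredD// dvdz_mull.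
- have -> : (A ^+ 2 + B ^+ 2 + X ^+ 2 + D ^+ 2 + 1 = (a' ^+ 2 + b' ^+ 2 + c' ^+ 2 + d' ^+ 2 + 1) +
 (a2 * (a' + A) + b2 * (b' + B) + c2 * (c' + X) + d2 * (d' + D)) * n%:Z)%R by rewrite A2 B2 X2 D2; ring.
 by rewrite rpredD// dvdz_mull.
Qed.

(** Modulo every power of 2, -7 is the square of an odd number, and 7 = 1 + 1 + 4 + 1. Lifting
    replaces x by x + 2^(k+1) when the quotient q is odd. *)
Lemma four_sq_pow2 k : four_sq (2 ^ k).
suff [x [q h]] : exists (x : int) (q : int), ((2 * x + 1) ^+ 2 + 7 = q * (8 * (2 ^ k)%N%:Z))%R.
 exists (2 * x + 1)%R, 1%R, 1%R, 2%R; have -> : ((2 * x + 1) ^+ 2 + 1 ^+ 2 + 1 ^+ 2 + 2 ^+ 2 + 1 = (2 * x + 1) ^+ 2 + 7 :> int)%R by ring.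
 by rewrite h mulrA dvdz_mull.
elim: k => [|k [x [q h]]]; first by exists 0%R, 1%R.
have [[r rq]|[r rq]] : (exists r, q = 2 * r)%R \/ (exists r, q = 2 * r + 1)%R.
 have := divz_eq q 2; have := modz_ge0 q (isT : 2%Z != 0); have := ltz_pmod q (isT : (0 < 2 :> int)%R).
 move: (q %% 2)%Z (q %/ 2)%Z => a b l0 l1 E.
 have [a0|a1] : (a = 0 \/ a = 1)%R by lia.
 by left; exists b; lia.
 by right; exists b; lia.
 by exists x, r; rewrite h rq expnS PoszM; ring.
exists (x + 2 * (2 ^ k)%N%:Z)%R, (r + 1 + x + (2 ^ k)%N%:Z)%R.
rewrite expnS PoszM; move: (2 ^ k)%N%:Z h => p h.
have -> : ((2 * (x + 2 * p) + 1) ^+ 2 + 7 = ((2 * x + 1) ^+ 2 + 7) + 8 * p * (2 * x + 1 + 2 * p))%R by ring.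
by rewrite h rq; ring.
Qed.

Lemma sq_inj_half p (x y : nat) : prime p -> odd p -> x <= p./2 -> y <= p./2 ->
 (x%:R ^+ 2 = y%:R ^+ 2 :> 'F_p)%R -> x = y.
move=> pp op; wlog xy : x y / x <= y.
 move=> h hx hy E; have [/h|/ltnW/h] := leqP x y; first exact.
 by move=> h'; apply/esym/h'.
move=> hx hy E; have : p %| y ^ 2 - x ^ 2 by rewrite (dvdn_pcharf (pchar_Fp pp)) natrB ?leq_exp2r// !natrX E subrr.
have p2 := odd_double_half p; rewrite op in p2.
rewrite subn_sqr Euclid_dvdM// => /orP[] /dvdnP[[|q] h]; try lia.
Qed.

(** Pigeonhole: the (p+1)/2 values x^2 and the (p+1)/2 values -1 - y^2 cannot be disjoint in F_p. *)
Lemma two_sq_prime p : prime p -> odd p -> exists x y : nat, p %| x ^ 2 + y ^ 2 + 1.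
move=> pp op; pose h := p./2.
have p2 := odd_double_half p; rewrite op in p2.
pose f (x : 'I_h.+1) : 'F_p := ((x : nat)%:R ^+ 2)%R.
pose g (y : 'I_h.+1) : 'F_p := (- 1 - (y : nat)%:R ^+ 2)%R.
have fi : injective f.
 by move=> x y E; apply/val_inj; apply: (sq_inj_half pp op _ _ E); rewrite -ltnS ltn_ord.
have gi : injective g.
 move=> x y /addrI/oppr_inj E; apply/val_inj.
 by apply: (sq_inj_half pp op _ _ E); rewrite -ltnS ltn_ord.
have [x [y xy]] : exists x y, f x = g y.
 apply/not_existsP => no.
 pose F : {set 'F_p} := [set f x | x : 'I_h.+1]%SET; pose G : {set 'F_p} := [set g x | x : 'I_h.+1]%SET.
 have FG : (F :&: G)%SET = finset.set0.
 apply/setP => z; rewrite !inE; apply/negP => /andP[/imsetP[x _ zx] /imsetP[y _ zy]].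
 by apply: (no x); exists y; rewrite -zx -zy.
 have cp : #|'F_p| = p := card_Fp pp.
 have := max_card (mem (F :|: G)%SET); rewrite cp.
 have := cardsUI F G; rewrite FG cards0 addn0 => ->; rewrite /F /G.
 by rewrite !card_imset// !card_ord /h; lia.
exists x, y; rewrite (dvdn_pcharf (pchar_Fp pp)) !natrD !natrX.
by apply/eqP; rewrite -[(_%:R ^+ 2)%R]/(f x) xy /g; ring.
Qed.

(** Hensel lifting in x, which needs p not to divide x; since p cannot divide both x and y, they are
    exchanged if necessary. *)
Lemma four_sq_prime p k : prime p -> odd p -> four_sq (p ^ k).
move=> pp op; suff [x [y [h xp]]] : exists x y : int, ((p ^ k.+1)%N%:Z %| (x ^+ 2 + y ^+ 2 + 1)%R)%Z /\ ~~ (p%:Z %| x)%Z.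
 exists x, y, 0%R, 0%R; rewrite expr0n /= !addr0.
 by apply: dvdz_trans h; rewrite expnS PoszM dvdz_mull.
elim: k => [|k [x [y [/dvdzP[t ht] xp]]]].
 have [x [y h]] := two_sq_prime pp op; rewrite expn1.
 have hz : (p%:Z %| (x%:Z ^+ 2 + y%:Z ^+ 2 + 1)%R)%Z.
 have -> : (x%:Z ^+ 2 + y%:Z ^+ 2 + 1)%R = (x ^ 2 + y ^ 2 + 1)%N%:Z by rewrite !PoszD !expr2 -!PoszM !mulnn.
 exact: h.
 have [px|px] := boolP (p%:Z %| x%:Z)%Z; last by exists x%:Z, y%:Z.
 exists y%:Z, x%:Z; rewrite [(y%:Z ^+ 2 + _)%R]addrC; split=> //; apply/negP => py.
 have : (p%:Z %| 1)%Z.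
 rewrite [X in (_ %| X)%Z](_ : _ = (x%:Z ^+ 2 + y%:Z ^+ 2 + 1) - (x%:Z ^+ 2 + y%:Z ^+ 2))%R; last by rewrite addrC addKr.
 by rewrite rpredB// rpredD// expr2 dvdz_mull.
 by rewrite dvdz1 /= => /eqP p1; rewrite p1 in pp.
have co : coprimez (2 * x)%R p%:Z.
 rewrite coprimezE /= coprime_sym prime_coprime// abszM Euclid_dvdM// negb_or; apply/andP; split=> //.
 by rewrite dvdn_prime2// -[2]/(absz 2%Z) /=; apply/negP => /eqP p2; rewrite p2 in op.
have /coprimezP[[u v] /= uv] := co.
exists (x + (p ^ k.+1)%N%:Z * (- (t * u)))%R, y; split.
 have -> : ((x + (p ^ k.+1)%N%:Z * - (t * u)) ^+ 2 + y ^+ 2 + 1 =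
 (x ^+ 2 + y ^+ 2 + 1) - (p ^ k.+1)%N%:Z * (t * (u * (2 * x))) + (p ^ k.+1)%N%:Z * (p ^ k.+1)%N%:Z * (t * u) ^+ 2)%R by ring.
 have uE : (u * (2 * x) = 1 - v * p%:Z)%R by apply/esym/eqP; rewrite subr_eq uv.
 rewrite ht uE; have -> : ((p ^ k.+2)%N%:Z = (p ^ k.+1)%N%:Z * p%:Z)%R by rewrite expnSr PoszM.
 have -> : (p ^ k.+1)%N%:Z = ((p ^ k)%N%:Z * p%:Z)%R by rewrite expnSr PoszM.
 move: (p ^ k)%N%:Z p%:Z => P q.
 apply/dvdzP; exists (t * v + P * (t * u) ^+ 2)%R; ring.
by rewrite rpredDr// expnS PoszM -mulrA dvdz_mulr.
Qed.

Lemma four_sq_all m : 0 < m -> four_sq m.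
elim/ltn_ind: m => m IH m0; have [m1|m1] := leqP m 1.
 have -> : m = 1%N by lia.
 by exists 0%R, 0%R, 0%R, 0%R; exact: dvd1n.
pose p := pdiv m; have pp := pdiv_prime m1.
have [q [co E]] : exists q, coprime p q /\ m = (p ^ logn p m * q)%N.
 by have [q co E] := pfactor_coprime pp m0; exists q; rewrite mulnC.
have k0 : 0 < logn p m by rewrite logn_gt0 mem_primes pp m0 pdiv_dvd.
have q0 : 0 < q by move: m0; rewrite E muln_gt0 => /andP[].
have pk : 1 < p ^ logn p m by rewrite -(exp1n (logn p m)) ltn_exp2r// prime_gt1.
rewrite E; apply: four_sq_coprime => //; first by rewrite coprimeXl.
- have fs r k : prime r -> four_sq (r ^ k).
 move=> pr; have [->|op] := even_prime pr; [exact: four_sq_pow2 | exact: four_sq_prime].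
 exact: fs.
- apply: IH => //; move: pk E; move: (p ^ logn p m)%N => P pk E; nia.
Qed.

End FourSquares.

(** * The character e on Q/Z *)

Section ExpQZ.
Variable R : realType.
Local Notation C := R[i].
Local Notation e := (@cexp2pi R).
Local Notation ex := (@expQZ R).
Local Open Scope quotient_scope.

Lemma piQZ_eq0 (q : rat) : \pi_QZ q = 0 <-> exists n : int, q = n%:~R.
have h : (q \in (Num.int_num_subdef : {pred rat})) = (\pi_QZ q == \pi_QZ 0) by rewrite -[in LHS](subr0 q) Quotient.idealrBE eqmodE.
split.
 move=> q0; have : q \in (Num.int_num_subdef : {pred rat}) by rewrite h; apply/eqP; rewrite q0 raddf0.
 by move=> /intrP.
by move=> [n qE]; apply/eqP; rewrite -[X in _ == X](raddf0 (\pi_QZ)) -h qE; exact: intr_int.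
Qed.

Lemma expQZ_pi (q : rat) : ex (\pi q) = e (ratr q).
have [n hn] : exists n : int, repr (\pi_QZ q) - q = n%:~R.
 by apply/piQZ_eq0; rewrite raddfB /= reprK subrr.
rewrite /expQZ -[repr _](subrK q) hn rmorphD /= ratr_int eD e_int mul1r.
by [].
Qed.

Lemma expQZD x y : ex (x + y) = ex x * ex y.
by rewrite -[x]reprK -[y]reprK -raddfD !expQZ_pi rmorphD eD. Qed.
Lemma expQZ0 : ex 0 = 1.
by rewrite -(raddf0 (\pi_QZ)) expQZ_pi rmorph0 e0. Qed.
Lemma expQZ_neq0 x : ex x != 0.
exact: e_neq0. Qed.
Lemma expQZN x : ex (- x) = (ex x)^-1.
by apply: (mulfI (expQZ_neq0 x)); rewrite -expQZD subrr expQZ0 mulfV// expQZ_neq0. Qed.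
Lemma expQZMn x n : ex (x *+ n) = ex x ^+ n.
by elim: n => [|n IH]; rewrite ?mulr0n ?expQZ0// mulrS exprS expQZD IH. Qed.
Lemma ratr_real (q : rat) : (ratr q : C) = (ratr q : R)%:C.
by rewrite fmorph_rat. Qed.

Lemma expQZ_eq1 x : ex x = 1 -> x = 0.
rewrite -[x]reprK expQZ_pi; move: (repr x) => q h; apply/piQZ_eq0.
exists (Num.floor q); apply/eqP; rewrite -subr_eq0; apply/eqP.
have E : e (ratr (q - (Num.floor q)%:~R) : R)%:C = 1 by rewrite -ratr_real rmorphB /= ratr_int eB h e_int divr1.
have := floor_le q; have := floorD1_gt q; rewrite rmorphD /= => h1 h2.
have b : -1 < (ratr (q - (Num.floor q)%:~R) : R) < 1.
 by rewrite -[-1](ratr_int R (-1)) -[X in _ < _ < X](ratr_int R 1) !ltr_rat; lra.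
by have /eqP := e_eq1 b E; rewrite fmorph_eq0 => /eqP.
Qed.

Lemma expQZ_conj x : (ex x)^* = ex (- x).
by rewrite -[x]reprK -raddfN !expQZ_pi ratr_real e_conj rmorphN /= -ratr_real.
Qed.
Lemma cn_expQZ x : cn (ex x) = 1.
by rewrite -[x]reprK expQZ_pi ratr_real cn_e_real. Qed.
End ExpQZ.

(** * Quaternions acting on a quadratic module *)

Section Quaternions.
Variables (V W : zmodType).

Lemma addr8 (a b c d a' b' c' d' : V) :
 a + a' + (b + b') + (c + c' + (d + d')) = a + b + (c + d) + (a' + b' + (c' + d')).
by rewrite (addrACA a a') (addrACA c c') (addrACA (a + b)). Qed.

Lemma addr12 (a1 b1 c1 a2 b2 c2 a3 b3 c3 a4 b4 c4 : V) :
 a1 + b1 + c1 + (a2 + b2 + c2) + (a3 + b3 + c3 + (a4 + b4 + c4)) =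
 a1 + a2 + (a3 + a4) + (b1 + b2 + (b3 + b4)) + (c1 + c2 + (c3 + c4)).
by rewrite (addrACA (a1 + b1) c1) (addrACA a1 b1) (addrACA (a3 + b3) c3) (addrACA a3 b3)
 (addrACA (a1 + a2 + (b1 + b2)) (c1 + c2)) (addrACA (a1 + a2) (b1 + b2)).
Qed.

Variables (Q : V -> W) (B : V -> V -> W) (I J K : V -> V) (a b c d : int).
Hypotheses (QD : forall u v, Q (u + v) = Q u + Q v + B u v) (BC : forall u v, B u v = B v u)
 (BD : forall u v w, B (u + v) w = B u w + B v w) (BM : forall u w n, B (u *~ n) w = B u w *~ n)
 (QM : forall u n, Q (u *~ n) = Q u *~ (n ^+ 2))
 (QI : forall v, Q (I v) = Q v) (QJ : forall v, Q (J v) = Q v) (QK : forall v, Q (K v) = Q v)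
 (ID : {morph I : x y / x + y}) (JD : {morph J : x y / x + y}) (KD : {morph K : x y / x + y})
 (cross : forall v, [/\ B v (I v) = 0, B v (J v) = 0 & B v (K v) = 0] /\
 [/\ B (I v) (J v) = 0, B (I v) (K v) = 0 & B (J v) (K v) = 0])
 (nondeg : forall x, (forall y, B x y = 0) -> x = 0).

(* Left multiplication by the quaternion a + b i + c j + d k. *)
Definition quat (v : V) := v *~ a + I v *~ b + (J v *~ c + K v *~ d).

Lemma Q_quat v : Q (quat v) = Q v *~ (a ^+ 2 + b ^+ 2 + c ^+ 2 + d ^+ 2).
have [[h1 h2 h3] [h4 h5 h6]] := cross v.
have BM0 u w m n : B u w = 0 -> B (u *~ m) (w *~ n) = 0.
 by move=> h; rewrite BM BC BM BC h !mul0rz.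
have e1 : Q (v *~ a + I v *~ b) = Q v *~ (a ^+ 2) + Q v *~ (b ^+ 2) by rewrite QD BM0// addr0 !QM QI.
have e2 : Q (J v *~ c + K v *~ d) = Q v *~ (c ^+ 2) + Q v *~ (d ^+ 2) by rewrite QD BM0// addr0 !QM QJ QK.
have e3 : B (v *~ a + I v *~ b) (J v *~ c + K v *~ d) = 0 by rewrite BC BD !(BC _ (_ + _)) !BD !BM0// !addr0.
by rewrite /quat QD e1 e2 e3 addr0 -!mulrzDr addrA.
Qed.

Lemma quatD u v : quat (u + v) = quat u + quat v.
by rewrite /quat ID JD KD !mulrzDl; exact: addr8. Qed.

Hypothesis quatN : forall v, Q v *~ (a ^+ 2 + b ^+ 2 + c ^+ 2 + d ^+ 2) = - Q v.

(** If w is in the kernel, then Q(w + x) = Q(x) for all x, because [quat] changes Q only by a sign;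
    with Q(w) = 0 this says that w is orthogonal to everything. *)
Lemma quat_inj : injective quat.
move=> u v h; apply/eqP; rewrite -subr_eq0; apply/eqP; set w := u - v.
have qw : quat w = 0 by apply: (addIr (quat v)); rewrite -quatD /w subrK h add0r.
have Q0 : Q 0 = 0 by rewrite -(mulr0z (0 : V)) QM mulr0z.
have Qw : Q w = 0 by apply: oppr_inj; rewrite -quatN -Q_quat qw Q0 oppr0.
apply: nondeg => x; have := QD w x; rewrite Qw add0r.
have -> : Q (w + x) = Q x by apply: oppr_inj; rewrite -!quatN -!Q_quat quatD qw add0r.
by rewrite -[LHS]addr0 => /addrI/esym.
Qed.
End Quaternions.

(** * Gauss sums of a finite quadratic module *)

Section GaussSums.
Variable R : realType.
Local Notation C := R[i].
Local Notation ex := (@expQZ R).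

Lemma cn_mul_conj (z : C) : (cn z ^+ 2)%:C = z * z^*%C.
rewrite sqr_cn; case: z => a b /=; apply/eqP; rewrite eq_complex /=; apply/andP; split; apply/eqP; ring.
Qed.

Variable A : finQuadMod.
Local Notation q := (@fqm_form A).
Local Notation B := (@fqm_bil A).

Lemma fqm_formD x y : q (x + y) = q x + q y + B x y.
by rewrite (_ : B x y = q (x + y) - (q x + q y)) ?subrKC// opprD addrA. Qed.
Lemma fqm_bilC x y : B x y = B y x.
by rewrite /fqm_bil /polar_form (addrC y x) addrAC. Qed.
Lemma fqm_bilDl x y z : B (x + y) z = B x z + B y z.
exact: fqm_bilin. Qed.
Lemma fqm_bilDr x y z : B x (y + z) = B x y + B x z.
by rewrite fqm_bilC fqm_bilDl !(fqm_bilC x). Qed.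
Lemma fqm_bil0l x : B 0 x = 0.
by apply: (addrI (B 0 x)); rewrite -fqm_bilDl !addr0. Qed.
Lemma fqm_bilNl x y : B (- x) y = - B x y.
by apply: (addrI (B x y)); rewrite -fqm_bilDl !subrr fqm_bil0l. Qed.
Lemma fqm_bilNr x y : B x (- y) = - B x y.
by rewrite fqm_bilC fqm_bilNl fqm_bilC. Qed.
Lemma fqm_bilMnl x y n : B (x *+ n) y = B x y *+ n.
by elim: n => [|n IH]; rewrite ?mulr0n ?fqm_bil0l// !mulrS fqm_bilDl IH. Qed.
Lemma fqm_bilMzl x y (n : int) : B (x *~ n) y = B x y *~ n.
by case: n => n; rewrite ?NegzE ?mulrNz ?fqm_bilNl -!pmulrn fqm_bilMnl. Qed.
Lemma fqm_form0 : q 0 = 0.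
by rewrite -(mulr0z (0 : A)) fqm_formM mulr0z. Qed.
Lemma fqm_formN x : q (- x) = q x.
by rewrite -mulrN1z fqm_formM sqrrN expr1n mulr1z. Qed.
Lemma fqm_formMn x n : q (x *+ n) = q x *+ n ^ 2.
have h := fqm_formM n%:Z x; rewrite -pmulrn in h; rewrite h.
by rewrite -[n%:Z ^+ 2]/(n%:Z * n%:Z) -PoszM -pmulrn mulnn. Qed.
Lemma fqm_bilxx x : B x x = q x *+ 2.
have E : q (x + x) = q x *+ 2 + q x + q x by rewrite -mulr2n fqm_formMn -!mulrSr.
by rewrite /fqm_bil /polar_form E !addrK. Qed.
Lemma fqm_bil_nondeg x : (forall y, B x y = 0) -> x = 0.
exact: fqm_nondeg. Qed.

Opaque fqm_bil.

Lemma char_sum x : \sum_(y : A) ex (B x y) = if x == 0 then #|A|%:R else 0.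
case: eqP => [->|x0].
 by under eq_bigr do rewrite fqm_bil0l expQZ0; rewrite sumr_const.
have [y0 hy] : exists y, B x y <> 0.
 by apply/not_existsP => h; apply: x0; apply: fqm_bil_nondeg => y; apply: contrapT => /(h y).
apply/eqP; have : (ex (B x y0) - 1) * \sum_y ex (B x y) = 0.
 rewrite mulrBl mul1r mulr_sumr; apply/eqP; rewrite subr_eq0; apply/eqP.
 rewrite [RHS](reindex_inj (addrI y0)); apply: eq_bigr => y _.
 by rewrite fqm_bilDr expQZD.
move/eqP; rewrite mulf_eq0 subr_eq0 => /orP[/eqP/expQZ_eq1|//].
by [].
Qed.

Definition gauss n : C := \sum_(x : A) ex (q x *+ n).
Lemma gauss_conj n : (gauss n)^*%C = \sum_(x : A) ex (- (q x *+ n)).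
by rewrite /gauss rmorph_sum; apply: eq_bigr => x _; exact: expQZ_conj. Qed.

(** Writing one variable as y + c leaves the character sum of e((n c, y)) over y, which vanishes
    unless n c = 0. *)
Lemma gauss_sqr n : gauss n * (gauss n)^*%C = #|A|%:R * \sum_(c in torsion A n) ex (q c *+ n).
rewrite gauss_conj /gauss mulr_sumr mulr_sumr.
under eq_bigr do rewrite mulr_suml.
transitivity (\sum_(y : A) \sum_(c : A) ex (q c *+ n) * ex (B (c *+ n) y)).
 apply: eq_bigr => y _; rewrite (reindex_inj (addrI y)) /=; apply: eq_bigr => c _.
 rewrite -!expQZD fqm_formD fqm_bilMnl (fqm_bilC c); congr ex.
 move: (q y) (q c) (B y c) => u v w; rewrite !mulrnDl -[_ *+ n + _ + _]addrA [LHS]addrC addKr.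
 by [].
rewrite exchange_big /= [RHS]big_mkcond /=; apply: eq_bigr => c _.
by rewrite -mulr_sumr char_sum inE; case: eqP => _; rewrite ?mulr0// mulrC.
Qed.

Lemma gauss_bound n : cn (gauss n) ^+ 2 <= #|A|%:R * #|torsion A n|%:R.
have h : cn (gauss n) ^+ 2 = cn (#|A|%:R * \sum_(c in torsion A n) ex (q c *+ n)).
 by rewrite -gauss_sqr -cn_mul_conj cn_real ger0_norm// sqr_ge0.
rewrite h cnM cn_nat; apply: ler_wpM2l => //.
apply: le_trans (_ : \sum_(c in torsion A n) 1 <= _); last by rewrite sumr_const.
rewrite big_mkcond [leRHS]big_mkcond /=; apply: le_trans (cn_sum _ _) _.
by apply: ler_sum => c _; case: ifP => _; rewrite ?cn0// cn_expQZ.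
Qed.

Lemma torsion1 : torsion A 1 = [set 0]%SET.
by apply/setP => x; rewrite !inE. Qed.
Lemma gauss1_sqr : gauss 1 * (gauss 1)^*%C = #|A|%:R.
by rewrite gauss_sqr torsion1 big_set1 fqm_form0 mul0rn expQZ0 mulr1. Qed.
Lemma cardA_gt0 : (0 < #|A|)%N.
by apply/card_gt0P; exists 0. Qed.

(** Completing the square: translate y by x and use (x, x) = 2 Q(x). *)
Lemma gauss_shift x : \sum_(y : A) ex (- (q y) + B x y) = ex (q x) * (gauss 1)^*%C.
rewrite gauss_conj mulr_sumr (reindex_inj (addrI x)) /=; apply: eq_bigr => y _.
rewrite -expQZD fqm_formD fqm_bilDr fqm_bilxx mulr1n; congr ex.
move: (q x) (q y) (B x y) => a b c; apply: (addrI (a + b + c)).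
by rewrite addrA subrr add0r mulr2n [a + b + c]addrAC -[RHS]addrA [b + _]addrCA subrr addr0 addrAC.
Qed.

Definition Q4 (v : (A * A) * (A * A)) := q v.1.1 + q v.1.2 + (q v.2.1 + q v.2.2).
Definition B4 (u v : (A * A) * (A * A)) := B u.1.1 v.1.1 + B u.1.2 v.1.2 + (B u.2.1 v.2.1 + B u.2.2 v.2.2).
Lemma Q4D u v : Q4 (u + v) = Q4 u + Q4 v + B4 u v.
rewrite /Q4 /B4 /= !fqm_formD.
exact: addr12.
Qed.
Lemma B4C u v : B4 u v = B4 v u.
by rewrite /B4 !(fqm_bilC u.1.1) !(fqm_bilC u.1.2) !(fqm_bilC u.2.1) !(fqm_bilC u.2.2). Qed.
Lemma B4Dl u v w : B4 (u + v) w = B4 u w + B4 v w.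
by rewrite /B4 /= !fqm_bilDl addr8. Qed.
Lemma pair_mulrz (U W : zmodType) (u : U) (w : W) (n : int) : (u, w) *~ n = (u *~ n, w *~ n).
have P (m : nat) : (u, w) *+ m = (u *+ m, w *+ m) by elim: m => // m IH; rewrite !mulrS IH.
by case: n => n; rewrite ?NegzE ?mulrNz -!pmulrn P.
Qed.
Lemma B4Ml u w n : B4 (u *~ n) w = B4 u w *~ n.
by case: u => -[a b] [c d]; rewrite /B4 !pair_mulrz /= !fqm_bilMzl !mulrzDl. Qed.
Lemma Q4M u n : Q4 (u *~ n) = Q4 u *~ (n ^+ 2).
by case: u => -[a b] [c d]; rewrite /Q4 !pair_mulrz /= !fqm_formM !mulrzDl. Qed.
Definition I4 (v : (A * A) * (A * A)) : (A * A) * (A * A) := ((- v.1.2, v.1.1), (- v.2.2, v.2.1)).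
Definition J4 (v : (A * A) * (A * A)) : (A * A) * (A * A) := ((- v.2.1, v.2.2), (v.1.1, - v.1.2)).
Definition K4 (v : (A * A) * (A * A)) : (A * A) * (A * A) := ((- v.2.2, - v.2.1), (v.1.2, v.1.1)).

Lemma Q4I v : Q4 (I4 v) = Q4 v.
by rewrite /Q4 /= !fqm_formN [q v.1.2 + _]addrC [q v.2.2 + _]addrC. Qed.
Lemma Q4J v : Q4 (J4 v) = Q4 v.
by rewrite /Q4 /= !fqm_formN [LHS]addrC. Qed.
Lemma Q4K v : Q4 (K4 v) = Q4 v.
by rewrite /Q4 /= !fqm_formN [LHS]addrC [q v.1.2 + _]addrC [q v.2.2 + _]addrC. Qed.

Lemma cross4 v : [/\ B4 v (I4 v) = 0, B4 v (J4 v) = 0 & B4 v (K4 v) = 0] /\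
 [/\ B4 (I4 v) (J4 v) = 0, B4 (I4 v) (K4 v) = 0 & B4 (J4 v) (K4 v) = 0].
case: v => -[a b] [c d]; rewrite /B4 /= !(fqm_bilNl, fqm_bilNr) !opprK.
rewrite (fqm_bilC b a) (fqm_bilC c a) (fqm_bilC c b) (fqm_bilC d a) (fqm_bilC d b) (fqm_bilC d c).
have h1 (x y : QZ) : - x + x + (- y + y) = 0 by rewrite !addNr addr0.
have h2 (x y : QZ) : - x + y + (x - y) = 0 by rewrite addrACA addNr subrr addr0.
have h3 (x y : QZ) : - x - y + (y + x) = 0 by rewrite addrC [y + x]addrC -opprD subrr.
have h4 (x y : QZ) : x + y + (- y - x) = 0 by rewrite [- y - x]addrC -opprD subrr.
have h5 (x y : QZ) : x - y + (y - x) = 0 by rewrite addrA subrK subrr.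
have h6 (x y : QZ) : x - y + (- x + y) = 0 by rewrite addrACA subrr addNr addr0.
have h7 (x y : QZ) : x - x + (y - y) = 0 by rewrite !subrr addr0.
by split; split; [exact: h1|exact: h2|exact: h3|exact: h4|exact: h6|exact: h7].
Qed.


Lemma I4D : {morph I4 : x y / x + y}. Proof. by move=> x y; rewrite /I4 /= !opprD. Qed.
Lemma J4D : {morph J4 : x y / x + y}. Proof. by move=> x y; rewrite /J4 /= !opprD. Qed.
Lemma K4D : {morph K4 : x y / x + y}. Proof. by move=> x y; rewrite /K4 /= !opprD. Qed.

Lemma B4_nondeg w : (forall v, B4 w v = 0) -> w = 0.
case: w => -[x y] [x' y'] z.
have f1 : x = 0 by apply: fqm_bil_nondeg => t; have := z ((t, 0), (0, 0)); rewrite /B4 /= !(fqm_bilC _ 0) !fqm_bil0l !addr0.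
have f2 : y = 0 by apply: fqm_bil_nondeg => t; have := z ((0, t), (0, 0)); rewrite /B4 /= !(fqm_bilC _ 0) !fqm_bil0l !addr0 add0r.
have f3 : x' = 0 by apply: fqm_bil_nondeg => t; have := z ((0, 0), (t, 0)); rewrite /B4 /= !(fqm_bilC _ 0) !fqm_bil0l !addr0 add0r.
have f4 : y' = 0 by apply: fqm_bil_nondeg => t; have := z ((0, 0), (0, t)); rewrite /B4 /= !(fqm_bilC _ 0) !fqm_bil0l !add0r.
by rewrite f1 f2 f3 f4.
Qed.

End GaussSums.

(** * The normalized Gauss sum is an eighth root of unity *)

Section Milgram.
Variable R : realType.
Local Notation C := R[i].
Local Notation e := (@cexp2pi R).
Local Notation ex := (@expQZ R).
Variable A : finQuadMod.
Local Notation q := (@fqm_form A).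

Lemma levelP : (0 < level A)%N /\ forall x, q x *+ level A = 0.
rewrite /level; case: ex_minnP => n /andP[n0 /forallP h] _; split=> // x.
by apply/eqP.
Qed.

Lemma gauss4 (F : A -> C) : (\sum_x F x) ^+ 4 = \sum_(v : (A * A) * (A * A)) F v.1.1 * F v.1.2 * (F v.2.1 * F v.2.2).
have two (T : finType) (G : T -> C) : (\sum_x G x) ^+ 2 = \sum_(v : T * T) G v.1 * G v.2.
 rewrite expr2 mulr_suml; under eq_bigr do rewrite mulr_sumr.
 by rewrite pair_big.
by rewrite (exprM _ 2 2) (two A) (two (A * A)%type).
Qed.

(** The fourth power is the Gauss sum of A^4, and the quaternion of norm -1 modulo the level
    permutes A^4 and turns Q into -Q. *)
Lemma gauss4_conj : gauss R A 1 ^+ 4 = ((gauss R A 1)^*%C) ^+ 4.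
have [l0 hl] := levelP; have [a [b [c [d /dvdzP[k hk]]]]] := four_sq_all l0.
have qN (v : (A * A) * (A * A)) : Q4 v *~ (a ^+ 2 + b ^+ 2 + c ^+ 2 + d ^+ 2) = - Q4 v.
 have -> : a ^+ 2 + b ^+ 2 + c ^+ 2 + d ^+ 2 = (level A)%:Z * k - 1 by rewrite mulrC -hk addrK.
 rewrite mulrzBr mulr1z mulrzA; have -> : Q4 v *~ (level A)%:Z = 0; last by rewrite mul0rz sub0r.
 by rewrite -pmulrn /Q4 !mulrnDl !hl !addr0.
have QQ v : Q4 (quat (@I4 A) (@J4 A) (@K4 A) a b c d v) = Q4 v *~ (a ^+ 2 + b ^+ 2 + c ^+ 2 + d ^+ 2).
 apply: Q_quat; [exact: Q4D|exact: B4C|exact: B4Dl|exact: B4Ml|exact: Q4M|exact: Q4I|exact: Q4J|exact: Q4K|exact: cross4].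
have QI : injective (quat (@I4 A) (@J4 A) (@K4 A) a b c d).
 apply: (@quat_inj _ _ (@Q4 A) (@B4 A)); [exact: Q4D|exact: B4C|exact: B4Dl|exact: B4Ml|exact: Q4M|exact: Q4I|
 exact: Q4J|exact: Q4K|exact: I4D|exact: J4D|exact: K4D|exact: cross4|exact: B4_nondeg|exact: qN].
rewrite gauss_conj /gauss !gauss4 [LHS](reindex_inj QI); apply: eq_bigr => v _.
transitivity (ex (Q4 (quat (@I4 A) (@J4 A) (@K4 A) a b c d v))).
 by rewrite /Q4 !expQZD !mulr1n.
by rewrite QQ qN /Q4 !opprD !expQZD !mulr1n.
Qed.

Definition gsign : C := (sqrt_card R #|A|)%:C^-1 * gauss R A 1.
Lemma sqrt_card_gt0 : 0 < sqrt_card R #|A|.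
by rewrite /sqrt_card sqrtr_gt0 ltr0n cardA_gt0. Qed.
Lemma sqrt_card_sqr : (sqrt_card R #|A|)%:C ^+ 2 = #|A|%:R :> C.
by rewrite -rmorphXn /= /sqrt_card sqr_sqrtr// rmorph_nat. Qed.
Lemma sqrt_card_neq0 : (sqrt_card R #|A|)%:C != 0 :> C.
by rewrite fmorph_eq0 gt_eqF// sqrt_card_gt0. Qed.
Lemma gsign_conj : gsign * ((sqrt_card R #|A|)%:C^-1 * (gauss R A 1)^*%C) = 1.
rewrite /gsign mulrACA gauss1_sqr -expr2 exprVn sqrt_card_sqr mulVf// pnatr_eq0 -lt0n.
exact: cardA_gt0.
Qed.
Lemma gsign8 : gsign ^+ 8 = 1.
have h : gsign ^+ 4 = ((sqrt_card R #|A|)%:C^-1 * (gauss R A 1)^*%C) ^+ 4 by rewrite /gsign !exprMn gauss4_conj.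
by rewrite (exprD _ 4 4) {2}h -exprMn gsign_conj expr1n.
Qed.

Lemma prim8 : 8.-primitive_root (e (8%:R^-1 : C)).
have r8 : (8%:R^-1 : C) = (8%:R^-1 : R)%:C by rewrite fmorphV rmorph_nat.
rewrite /primitive_root_of_unity /=; apply/forallP => i; apply/eqP.
rewrite unity_rootE eX; have [->|i8] := eqVneq i.+1 8%N.
 by rewrite divff ?e_1 ?eqxx// pnatr_eq0.
apply/negbTE; rewrite r8 -(rmorph_nat (real_complex R)) -rmorphM; apply: e_neq1.
have i7 : (i.+1 < 8)%N by rewrite ltn_neqAle i8 ltn_ord.
by rewrite divr_gt0//= ltr_pdivrMr// mul1r ltr_nat.
Qed.

(** By [gsign8] the normalized Gauss sum is a power of e(1/8), so the search in [signature]
    succeeds. *)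
Lemma signatureP : gsign = e ((signature R A : nat)%:R / 8%:R).
have [i hi] := prim_rootP prim8 gsign8.
have hG : (sqrt_card R #|A|)%:C^-1 * \sum_(a : A) ex (q a) = gsign by [].
rewrite /signature; case: pickP => [s /eqP <-|/(_ i)]; first by rewrite hG.
by rewrite hG hi eX eqxx.
Qed.
End Milgram.

(** * Existence of the Weil representation *)

Section WeilRepresentation.
Variable R : realType.
Local Notation C := R[i].
Local Notation ex := (@expQZ R).
Local Notation H := (uhp R).
Variable A : finQuadMod.
Local Notation q := (@fqm_form A).
Local Notation B := (@fqm_bil A).
Local Notation GA := (group_alg R A).

Definition weilc : C := gsign R A / (sqrt_card R #|A|)%:C.
Definition weilT_fun (f : GA) : GA := [ffun y => ex (- q y) * f y].
Definition weilS_fun (f : GA) : GA := [ffun y => weilc * \sum_(x : A) ex (B x y) * f x].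
Lemma weilT_linear : linear weilT_fun.
move=> a u v; apply/ffunP => y; rewrite !ffunE /= -[a *: u y]/(a * u y) -[a *: (_ * _)]/(a * (ex (- q y) * u y)).
by rewrite mulrDr mulrCA.
Qed.

Lemma weilS_linear : linear weilS_fun.
move=> a u v; apply/ffunP => y; rewrite !ffunE /= -[a *: (_ * _)]/(a * (weilc * \sum_x ex (B x y) * u x)).
transitivity (weilc * (a * (\sum_x ex (B x y) * u x) + \sum_x ex (B x y) * v x)); last by rewrite mulrDr mulrCA.
congr (_ * _); rewrite mulr_sumr -big_split /=; apply: eq_bigr => x _.
by rewrite !ffunE /= -[a *: u x]/(a * u x) mulrDr mulrCA.
Qed.

HB.instance Definition _ := GRing.isLinear.Build C GA GA *:%R weilT_fun weilT_linear.
HB.instance Definition _ := GRing.isLinear.Build C GA GA *:%R weilS_fun weilS_linear.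

Definition weilT : 'End(GA) := linfun weilT_fun.
Definition weilS : 'End(GA) := linfun weilS_fun.
Lemma weilTE f y : weilT f y = ex (- q y) * f y.
by rewrite lfunE /= ffunE. Qed.
Lemma weilSE f y : weilS f y = weilc * \sum_(x : A) ex (B x y) * f x.
by rewrite lfunE /= ffunE. Qed.
Lemma weilc_sqr : weilc ^+ 2 * #|A|%:R = gsign R A ^+ 2.
by rewrite /weilc expr_div_n sqrt_card_sqr mulfVK// pnatr_eq0 -lt0n cardA_gt0. Qed.

Lemma weilSS f y : weilS (weilS f) y = gsign R A ^+ 2 * f (- y).
rewrite weilSE; under eq_bigr do rewrite weilSE mulrCA mulr_sumr.
rewrite -mulr_sumr mulrA -expr2 exchange_big /= (bigD1 (- y))//= [X in _ + X]big1 ?addr0 => [|z zy].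
 have -> : \sum_i ex (B i y) * (ex (B (- y) i) * f (- y)) = #|A|%:R * f (- y).
 rewrite (eq_bigr (fun=> f (- y))) ?sumr_const ?mulr_natl// => x _.
 by rewrite mulrA -expQZD (fqm_bilC x) fqm_bilNl subrr expQZ0 mul1r.
 by rewrite mulrA weilc_sqr.
under eq_bigr do rewrite mulrA -expQZD fqm_bilC -fqm_bilDl.
by rewrite -mulr_suml char_sum addrC addr_eq0 (negbTE zy) mul0r.
Qed.

(** The inner sum is a shifted Gauss sum; its phases cancel those of T, and its constant cancels one
    factor [weilc] by [gsign_conj]. *)
Lemma weil_braid f y : weilT (weilS (weilT (weilS (weilT f)))) y = weilS f y.
rewrite weilTE weilSE; under eq_bigr do rewrite weilTE weilSE.
have E x z : ex (B x y) * (ex (- q x) * (weilc * (ex (B z x) * (ex (- q z) * f z)))) =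
 weilc * (ex (- q z) * f z) * ex (- (q x) + B (y + z) x).
 rewrite fqm_bilDl (fqm_bilC y) (expQZD R (- q x)) (expQZD R (B x y)).
 by move: (ex (B x y)) (ex (- q x)) (ex (B z x)) (ex _) => a b c d; ring.
transitivity (ex (- q y) * (weilc * \sum_z \sum_x weilc * (ex (- q z) * f z) * ex (- (q x) + B (y + z) x))).
 congr (_ * (_ * _)); rewrite exchange_big; apply: eq_bigr => x _ /=.
 rewrite !mulr_sumr; apply: eq_bigr => z _; rewrite weilTE -E.
 by [].
have inner z : \sum_x weilc * (ex (- q z) * f z) * ex (- (q x) + B (y + z) x) =
 weilc * (ex (- q z) * f z) * (ex (q y) * ex (q z) * ex (B z y) * (gauss R A 1)^*%C).
 rewrite -mulr_sumr gauss_shift (fqm_formD y z) (fqm_bilC y z) (expQZD R (q y + q z)) (expQZD R (q y)).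
 by [].
rewrite (eq_bigr _ (fun z _ => inner z)).
rewrite weilSE /= mulrCA !mulr_sumr; apply: eq_bigr => z _.
have h1 := gsign_conj R A; have n1 := expQZ_neq0 R (q y); have n2 := expQZ_neq0 R (q z).
rewrite !expQZN.
have E2 : weilc * weilc * (gauss R A 1)^*%C = weilc.
 by rewrite -mulrA; rewrite {2}/weilc -mulrA h1 mulr1.
rewrite -[in RHS]E2; move: (ex _) (ex _) (ex _) weilc ((gauss R A 1)^*%C) (f z) n1 n2 => a b c d g x n1 n2.
by field; rewrite n1 n2.
Qed.

Lemma weil_relations : mp_relations (fun g h : 'End(GA) => (g \o h)%VF) \1%VF weilS weilT.
split.
- by move=> f g h; rewrite comp_lfunA.
- by move=> f; rewrite comp_lfun1l.
- by move=> f; rewrite comp_lfun1r.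
- apply/lfunP => f; rewrite !comp_lfunE; apply/ffunP => y.
 by rewrite weilTE !weilSS weilTE fqm_formN mulrCA.
- apply/lfunP => f; rewrite !comp_lfunE; apply/ffunP => y; exact: weil_braid.
apply/lfunP => f; rewrite /= !comp_lfunE !id_lfunE; apply/ffunP => y.
rewrite !weilSS !opprK; have := gsign8 R A; move: (gsign R A) (f y : C) => g c g8.
by rewrite -[RHS]mul1r -g8; ring.
Qed.

Definition mpword (g : mp2 R) : seq bool := sval (cid (mp_generated g)).
Definition weilval := wval (fun g h : 'End(GA) => (g \o h)%VF) \1%VF weilS weilT.
Lemma weil_basis (f : GA) : f = \sum_x f x *: basis_elt R x.
apply/ffunP => y; rewrite sum_ffunE (bigD1 y)//= big1 => [|x xy].
 by rewrite !ffunE eqxx addr0 -[RHS]/(f y * 1) mulr1.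
by rewrite !ffunE eq_sym (negbTE xy) -[LHS]/(f x * 0) mulr0.
Qed.

(** Each group element is sent to the value of a chosen word; [mpval_weq] makes the choice
    irrelevant. *)
Lemma weil_exists : exists rho : mp2 R -> 'End(GA), is_weil_rep rho.
exists (fun g => weilval (mpword g)).
have V w g : wval (@mp_mul R) (mp_one R) (mpS R) (mpT R) w = g -> weilval (mpword g) = weilval w.
 move=> wg; apply: (mpval_weq (R := R) (u := mpword g) (v := w)); last exact: weil_relations.
 by rewrite wg /mpword; case: cid.
split.
- by rewrite (V [::]).
- move=> g h; rewrite (V (mpword g ++ mpword h)).
 exact: (wval_cat weil_relations).
 by rewrite (wval_cat (mp_relations_mp2 R)) /mpword; case: cid => ? /= ->; case: cid => ? /= ->.
- move=> x; rewrite (V [:: false]) /= ?mp_mulg1// /weilval /= comp_lfun1r.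
 apply/ffunP => y; rewrite weilTE !ffunE -[RHS]/(ex (- q x) * (y == x)%:R).
 by case: eqP => [->//|_]; rewrite !mulr0.
- move=> x; rewrite (V [:: true]) /= ?mp_mulg1// /weilval /= comp_lfun1r -signatureP.
 apply/ffunP => y; rewrite weilSE ffunE sum_ffunE -[RHS]/(weilc * _); congr (_ * _).
 rewrite (bigD1 x)//= [RHS](bigD1 y)//= !big1 ?addr0 => [|z zy|z zx].
 + by rewrite !ffunE !eqxx.
 + by rewrite !ffunE eq_sym (negbTE zy) -[LHS]/(_ * (0 : C)) mulr0.
 + by rewrite !ffunE (negbTE zx) mulr0.
Qed.

Lemma weil_repP : is_weil_rep (weil_rep R A).
by rewrite /weil_rep; have [rho h] := weil_exists; exact: xgetPex (ex_intro _ rho h). Qed.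

Lemma weil_repT f y : weil_rep R A (mpT R) f y = ex (- q y) * f y.
have [_ _ hT _] := weil_repP; rewrite -weilTE; congr (fun_of_fin _ y).
rewrite [f in LHS]weil_basis [f in RHS]weil_basis !linear_sum; apply: eq_bigr => x _.
rewrite !linearZ /= hT; congr (_ *: _); apply/ffunP => z; rewrite weilTE !ffunE -[LHS]/(ex (- q x) * (z == x)%:R).
by case: eqP => [->//|_]; rewrite !mulr0.
Qed.

Lemma weil_repS f y : weil_rep R A (mpS R) f y = weilc * \sum_(x : A) ex (B x y) * f x.
have [_ _ _ hS] := weil_repP; rewrite -weilSE; congr (fun_of_fin _ y).
rewrite [f in LHS]weil_basis [f in RHS]weil_basis !linear_sum; apply: eq_bigr => x _.
rewrite !linearZ /= hS -signatureP; congr (_ *: _); apply/ffunP => z.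
rewrite weilSE ffunE sum_ffunE -[LHS]/(weilc * _); congr (_ * _).
rewrite (bigD1 z)//= [RHS](bigD1 x)//= !big1 ?addr0 => [|t tx|t tz].
+ by rewrite !ffunE !eqxx.
+ by rewrite !ffunE (negbTE tx) mulr0.
+ by rewrite !ffunE eq_sym (negbTE tz) -[LHS]/(_ * (0 : C)) mulr0.
Qed.

Lemma modular_iff (w : int) (f : H -> GA) : modular_of_weight2 (A := A) w f <->
 [/\ forall x, holomorphic (fun t => f t x), forall t x, f (uhpT t) x = ex (- q x) * f t x &
 forall t y, f (uhpS t) y = sqrtC t° ^ w * (weilc * \sum_x ex (B x y) * f t x)].
split=> [[hh hm]|[hh hT hS]].
 split=> // [t x|t y].
 by have := hm (mpT R) t; rewrite mp_actT /= exp1rz scale1r => ->; rewrite weil_repT.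
 have := hm (mpS R) t; rewrite mp_actS => ->.
 by rewrite ffunE weil_repS.
split=> // g t; have [r1 rM _ _] := weil_repP.
have [v <-] := mp_generated g; elim: v t => [|b v IH] t.
 by rewrite /= mp_act1 exp1rz scale1r r1 id_lfunE.
rewrite [wval _ _ _ _ _]/= mp_act_mul rM comp_lfunE.
set h := wval _ _ _ _ v in IH *; have IH' := IH t.
case: b => /=; rewrite expfzMl.
 apply/ffunP => y; rewrite mp_actS hS IH' ffunE weil_repS.
 rewrite -[RHS]/((sqrtC (mp_act h t : C) ^ w * mp_phi h t ^ w) * (weilc * \sum_x ex (B x y) * weil_rep R A h (f t) x)).
 rewrite -[RHS]mulrA; congr (_ * _); rewrite [RHS]mulrCA; congr (_ * _); rewrite mulr_sumr.
 by apply: eq_bigr => x _; rewrite ffunE -[_ *: _]/(mp_phi h t ^ w * _) mulrCA.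
apply/ffunP => y; rewrite mp_actT hT IH' !ffunE weil_repT exp1rz mul1r.
by rewrite -[RHS]/(_ * _) -[_ *: _]/(mp_phi h t ^ w * _) mulrCA.
Qed.

End WeilRepresentation.

(** * Expansions in e(t/N) and fractional exponents *)

Section Fourier2.
Variable R : realType.
Local Notation C := R[i].
Local Notation e := (@cexp2pi R).
Local Notation H := (uhp R).

Transparent ps.
Lemma ps_hsum (c : nat -> C) z : tame c -> cn z < 1 -> hsum (fun n => c n * z ^+ n) (ps c z).
by move=> tc z1; exact: usumP (summ_ps tc z1). Qed.
Opaque ps.

Lemma cvg_climP (u : nat -> C) (l : C) : ((u : nat -> C^o) @ \oo --> (l : C^o)) <-> clim u l.
split=> [/(@cvgrPdist_lt _ C^o nat \oo) h eps eps0|h].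
 have e0' : 0 < (eps%:C : C) by rewrite ltcR.
 have [N _ hN] := h _ e0'; exists N => n Nn; have := hN n Nn.
 by rewrite cnE ltcR cnBC.
apply/(@cvgrPdist_lt _ C^o nat \oo) => -[a b]; rewrite ltcE /= => /andP[/eqP -> a0].
have [N hN] := h a a0; exists N => // n /= Nn.
by rewrite cnE -[_ +i* _]/(a%:C) ltcR cnBC; exact: hN.
Qed.

Lemma seriesE (u : nat -> C) : series (u : nat -> C^o) = (fun n => \sum_(i < n) u i) :> (nat -> C).
by apply/funext => n; rewrite /series /= big_mkord. Qed.
Fact uhp_div_gt0 (N : nat) (t : H) : 0 < complex.Im ((N.+1%:R^-1 : R)%:C * t°).
by case: t => -[x y] y0 /=; rewrite mul0r addr0 mulr_gt0// invr_gt0. Qed.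
Definition uhp_div N t : H := Uhp (uhp_div_gt0 N t).
Fact uhp_addr_gt0 (a : R) (t : H) : 0 < complex.Im (t° + a%:C).
by case: t => -[x y] y0 /=; rewrite addr0. Qed.
Definition uhp_addr a t : H := Uhp (uhp_addr_gt0 a t).
Lemma QE_holomorphic lam (f : H -> C) : QE lam f -> holomorphic f.
by move=> [c hc]; apply: cder_derivable => t; have [f' [_ h]] := QEc_cder hc; eexists; exact: h.
Qed.

Lemma QEc_add lam c (f : H -> C) (a : R) : QEc lam c f ->
 QEc lam (fun n => e (lam * a)%:C * (c n * e a%:C ^+ n)) (fun t => f (uhp_addr a t)).
move=> [tc fE]; have tc' : tame (fun n => c n * e a%:C ^+ n).
 by apply: (tame_le _ tc) => m; rewrite cnM cnX cn_e_real expr1n mulr1.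
split; first exact: tameZ.
move=> t; rewrite fE psZ//; last exact: cn_e_uhp.
rewrite -[(uhp_addr a t)°]/(t° + a%:C) mulrDr -rmorphM (eD (lam%:C * t°)) (eD t°) ps_scale mulrA.
by [].
Qed.

Lemma real_div_nat (a b : nat) : (a%:R / b%:R : C) = (a%:R / b%:R : R)%:C.
by rewrite rmorphM fmorphV !rmorph_nat. Qed.

Lemma clim_bounded_terms (u : nat -> C) l : clim (fun n => \sum_(i < n) u i) l -> exists B, forall n, cn (u n) <= B.
move=> h; have [N hN] := h 1 ltr01.
exists (2 + \sum_(i < N) cn (u i)) => n; have s0 : 0 <= \sum_(i < N) cn (u i) by apply: sumr_ge0 => i _; exact: cn_ge0.
have [nN|Nn] := ltnP n N.
 rewrite (bigD1 (Ordinal nN))//= addrCA lerDl addr_ge0// sumr_ge0// => i _; exact: cn_ge0.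
have h1 := hN _ Nn; have h2 := hN _ (leqW Nn); rewrite big_ord_recr /= in h2.
have := cnB (\sum_(i < n) u i + u n - l) (\sum_(i < n) u i - l).
have -> : \sum_(i < n) u i + u n - l - (\sum_(i < n) u i - l) = u n by move: (\sum_(_ < _) _) (u n) => a b; ring.
by move: h1 h2; lra.
Qed.

Lemma e_uhp_div N (t : H) : e (uhp_div N t)° ^+ N.+1 = e t°.
rewrite eX; congr e; rewrite /= mulrA fmorphV rmorph_nat mulfV ?mul1r//.
by rewrite pnatr_eq0.
Qed.
Lemma e_uhp_div_r N r (t : H) : e (uhp_div N t)° ^+ r = e ((r%:R / N.+1%:R : R)%:C * t°).
by rewrite eX; congr e; rewrite /= mulrA rmorphM rmorph_nat. Qed.

Lemma hsum_progression N r (c : nat -> C) (t : H) l : injective (fun m => r + m * N.+1)%N ->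
 (forall n, c n != 0 -> exists m, n = (r + m * N.+1)%N) ->
 hsum (fun m => c (r + m * N.+1)%N * e t° ^+ m) l ->
 hsum (fun n => c n * e (uhp_div N t)° ^+ n) (e ((r%:R / N.+1%:R : R)%:C * t°) * l).
move=> inj cz h; apply: (@hsum_inj R _ _ _ inj) => [n no|].
 have [->|/cz[m nm]] := eqVneq (c n) 0; first by rewrite mul0r.
 by exfalso; apply: no; exists m.
rewrite -e_uhp_div_r; have := hsumZ (e (uhp_div N t)° ^+ r) h.
apply: eq_hsum => m; rewrite exprD (mulnC m) (exprM _ N.+1) e_uhp_div.
by rewrite mulrCA.
Qed.

(** After rescaling by N+1 the expansion is a power series in q. Translating by 1/(N+1) multiplies
    the n-th coefficient by e(n/(N+1)), so the law under T keeps only n congruent to r. If r = N+1,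
    the index 0 would also qualify, and c_0 = 0 excludes it. *)
Lemma qexp_QE (N r : nat) (g : H -> C) (c : nat -> C) : (r <= N.+1)%N ->
 (forall t : H, clim (fun n => \sum_(i < n) (c i * e (i%:R / N.+1%:R * t°))) (g t)) ->
 (forall t : H, g (uhpT t) = e (r%:R / N.+1%:R : R)%:C * g t) -> (r = N.+1 -> c 0%N = 0) ->
 QE (r%:R / N.+1%:R) g.
move=> rN hc hT c00; have N0 : N.+1%:R != 0 :> C by rewrite pnatr_eq0.
pose F t := g (uhp_scale N t).
have hF (t : H) : clim (fun n => \sum_(i < n) c i * e t° ^+ i) (F t).
 apply: eq_clim (hc _) => n; apply: eq_bigr => i _; rewrite eX uhp_scaleE; congr (_ * e _).
 by rewrite mulrA mulfVK.
have tc : tame c.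
 apply/tameP => r0 /andP[r00 r01]; pose s := (r0 + 1) / 2.
 have [s0 s1 rs _] : [/\ 0 < s, s < 1, r0 < s & true] by rewrite /s; split=> //; lra.
 have [t [et _]] := uhp_pt 0 (introT andP (conj s0 s1)).
 have [B hB] := @clim_bounded_terms (fun i => c i * e t° ^+ i) _ (hF t); exists B => n.
 apply: le_trans (hB n); rewrite cnM cnX et cnM cn_real (ger0_norm (ltW s0)) cn_e_real mulr1.
 by apply: ler_wpM2l; [exact: cn_ge0 | rewrite lerXn2r// ?nnegrE ltW].
have FE (t : H) : F t = ps c (e t°).
 have hh := hsum_clim (ps_hsum tc (cn_e_uhp t)).
 exact: (clim_unique (hF t) hh).
have FQ : QEc 0 c F by split=> // t; rewrite mul0r e0 mul1r.
have gE t : g t = F (uhp_div N t).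
 congr g; apply/val_inj; rewrite [RHS]uhp_scaleE /= mulrA (_ : N.+1%:R * _ = 1) ?mul1r//.
 by rewrite fmorphV rmorph_nat mulfV.
have cz n : c n != 0 -> exists m, n = (r + m * N.+1)%N.
 move=> cn0; have h1 := QEc_add (N.+1%:R^-1) FQ.
 have h2 := QEcZ (e (r%:R / N.+1%:R : R)%:C) FQ.
 have E0 : (fun t => F (uhp_addr N.+1%:R^-1 t)) = (fun t => e (r%:R / N.+1%:R : R)%:C * F t).
 apply/funext => t; rewrite /F -hT; congr g; apply/val_inj; rewrite [LHS]uhp_scaleE [RHS]uhpTE uhp_scaleE /=.
 by rewrite mulrDr fmorphV rmorph_nat mulfV.
 rewrite E0 in h1; have := congr1 (fun d => d n) (QEc_inj h1 h2) => /=.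
 rewrite mul0r e0 mul1r [RHS]mulrC => /(mulfI cn0); rewrite eX -(rmorph_nat (real_complex R)) -rmorphM => E1.
 pose x : R := n%:R / N.+1%:R - r%:R / N.+1%:R.
 have ex1 : e x%:C = 1 by rewrite /x rmorphB eB E1 divff// e_neq0.
 pose k := Num.floor x; have k1 := floor_le x; have k2 := floorD1_gt x; rewrite -/k rmorphD /= in k1 k2.
 have xk : x - k%:~R = 0.
 apply: e_eq1; first by lra.
 have -> : (x - k%:~R)%:C = x%:C - k%:~R :> C by rewrite rmorphB rmorph_int.
 by rewrite eB ex1 e_int divr1.
 have nE : n%:Z = r%:Z + k * N.+1%:Z.
 apply/eqP; rewrite -(eqr_int R) rmorphD rmorphM /=; apply/eqP.
 move/eqP: xk; rewrite subr_eq0 /x -mulrBl => /eqP xk.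
 have N0' : N.+1%:R != 0 :> R by rewrite pnatr_eq0.
 have := congr1 (fun z => z * N.+1%:R) xk; rewrite /= mulfVK// => h3.
 by move: h3; rewrite -!pmulrn; lra.
 have k0 : 0 <= k.
 have [rN'|rN'] := eqVneq r N.+1.
 have n0 : n <> 0%N by move=> z; move: cn0; rewrite z c00 ?eqxx.
 by rewrite rN' in nE; nia.
 by nia.
 by exists `|k|%N; lia.
have tc' : tame (fun m => c (r + m * N.+1)%N).
 apply/tameP => rh /andP[rh0 rh1]; have [->|rhn] := eqVneq rh 0.
 exists (cn (c (r + 0 * N.+1)%N)) => -[|n]; first by rewrite expr0 mulr1.
 by rewrite expr0n /= mulr0 cn_ge0.
 have rh0' : 0 < rh by rewrite lt_def rhn.
 have [t [et _]] := uhp_pt 0 (introT andP (conj rh0' rh1)).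
 have ce : cn (e t°) = rh by rewrite et cnM cn_real cn_e_real mulr1 ger0_norm.
 pose s := cn (e (uhp_div N t)°); have s0 : 0 < s by rewrite cn_gt0 e_neq0.
 have sN : s ^+ N.+1 = rh.
 rewrite /s -cnX eX -ce; congr (cn (e _)); rewrite /= mulrA fmorphV rmorph_nat mulfV// mul1r.
 by [].
 have [B hB] := @clim_bounded_terms (fun i => c i * e (uhp_div N t)° ^+ i) _ (hF (uhp_div N t)); exists (B / s ^+ r) => m.
 rewrite ler_pdivlMr ?exprn_gt0//; apply: le_trans (hB (r + m * N.+1)%N).
 by rewrite cnM cnX -/s exprD (mulnC m) exprM sN -!mulrA [rh ^+ m * _]mulrC.
exists (fun m => c (r + m * N.+1)%N); split=> // t; rewrite gE FE.
have inj : injective (fun m => r + m * N.+1)%N by move=> a b /addnI/eqP; rewrite eqn_mul2r => /eqP.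
exact: (hsum_unique (ps_hsum tc (cn_e_uhp (uhp_div N t))) (hsum_progression inj cz (ps_hsum tc' (cn_e_uhp t)))).
Qed.

Lemma QE_qexp (N r : nat) (g : H -> C) : QE (r%:R / N.+1%:R) g -> exists c : nat -> C,
 (forall t : H, clim (fun n => \sum_(i < n) (c i * e (i%:R / N.+1%:R * t°))) (g t)) /\
 ((0 < r)%N -> c 0%N = 0).
move=> [c' [tc' gE]].
have inj : injective (fun m => r + m * N.+1)%N by move=> a b /addnI/eqP; rewrite eqn_mul2r => /eqP.
pose c n : C := if (r <= n)%N && (N.+1 %| n - r)%N then c' ((n - r) %/ N.+1)%N else 0.
have cE m : c (r + m * N.+1)%N = c' m by rewrite /c leq_addr addKn dvdn_mull// mulnK.
exists c; split=> [t|r0]; last by rewrite /c leqNgt r0.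
have h : hsum (fun n => c n * e (uhp_div N t)° ^+ n) (g t).
 rewrite gE; apply: (hsum_progression inj) => [n|].
 rewrite /c; case: ifP => [/andP[rn /dvdnP[m hm]] _|_]; last by rewrite eqxx.
 by exists m; rewrite -hm subnKC.
 by apply: eq_hsum (ps_hsum tc' (cn_e_uhp t)) => m; rewrite cE.
have h' := hsum_clim h; refine (@eq_clim R _ _ _ _ h') => n; apply: eq_bigr => i _.
by rewrite e_uhp_div_r -real_div_nat.
Qed.

End Fourier2.

(** * Cusp forms and modular forms by their exponents *)

Section FourierIff.
Variable R : realType.
Local Notation C := R[i].
Local Notation e := (@cexp2pi R).
Local Notation ex := (@expQZ R).
Local Notation H := (uhp R).
Variable A : finQuadMod.
Local Notation q := (@fqm_form A).
Local Notation B := (@fqm_bil A).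
Local Notation GA := (group_alg R A).
Variable (r : A -> nat).
Hypothesis hr : forall x, e ((r x)%:R / (level A)%:R : R)%:C = ex (- q x).

Definition vvforms (w : int) : set (H -> GA) := [set f |
 (forall x, QE ((r x)%:R / (level A)%:R) (fun t => f t x)) /\
 forall t y, f (uhpS t) y = sqrtC t° ^ w * (weilc R A * \sum_x ex (B x y) * f t x)].
Lemma level_S : level A = (level A).-1.+1.
by rewrite prednK// (levelP A).1. Qed.
Lemma vvforms_modular w f : vvforms w f -> modular_of_weight2 w f.
move=> [fQ fS]; apply/modular_iff; split=> // [x|t x]; first exact: QE_holomorphic (fQ x).
by rewrite (QE_uhpT t (fQ x)) hr.
Qed.
Lemma fourierP (f : H -> GA) c : fourier_expansion f c <-> forall x (t : H),
 clim (fun n => \sum_(i < n) (c x i * e (i%:R / (level A).-1.+1%:R * t°))) (f t x).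
by rewrite /fourier_expansion {1}level_S; split=> h x t; have := h x t; rewrite seriesE => /cvg_climP. Qed.

Lemma modular_formsE w : (forall x, (r x < level A)%N) -> modular_forms R A w = vvforms w.
move=> rN; apply/seteqP; split=> f /=.
 move=> [/modular_iff[_ fT fS] [c /fourierP hc]]; split=> // x; rewrite level_S.
 apply: (qexp_QE (c := c x)) => [|t|t|rE]; rewrite -?level_S ?(ltnW (rN x)) ?fT ?hr//.
 by have := hc x t; rewrite -level_S.
 by have := rN x; rewrite rE -level_S ltnn.
move=> h; split; first exact: vvforms_modular.
have [fQ _] := h; have /choice[c hc] : forall x, exists c : nat -> C, (forall t : H, clim (fun n => \sum_(i < n) (c i * e (i%:R / (level A).-1.+1%:R * t°))) (f t x)).
 by move=> x; have := fQ x; rewrite level_S => /QE_qexp[c [hc _]]; exists c.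
by exists c; apply/fourierP.
Qed.

(** Where e(-Q(x)) = 1, choosing the exponent 1 instead of 0 encodes the vanishing of the constant
    term. *)
Lemma cusp_formsE w : (forall x, (0 < r x <= level A)%N) -> cusp_forms R A w = vvforms w.
move=> rN; apply/seteqP; split=> f /=.
 move=> [/modular_iff[_ fT fS] [c /fourierP hc c0]]; split=> // x; rewrite level_S.
 apply: (qexp_QE (c := c x)) => [|t|t|rE]; rewrite -?level_S ?fT ?hr//.
 - by have /andP[] := rN x.
 - by have := hc x t; rewrite -level_S.
move=> h; split; first exact: vvforms_modular.
have [fQ _] := h; have /choice[c hc] : forall x, exists c : nat -> C, (forall t : H, clim (fun n => \sum_(i < n) (c i * e (i%:R / (level A).-1.+1%:R * t°))) (f t x)) /\ c 0%N = 0.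
 move=> x; have := fQ x; rewrite level_S => /QE_qexp[c [hc c0]]; exists c; split=> //.
 by apply: c0; have /andP[] := rN x.
by exists c => [|x]; [apply/fourierP => x; exact: (hc x).1 | exact: (hc x).2].
Qed.
End FourierIff.

(** * Orbits of negation *)

Section Orbits.
Variable G : finZmodType.

Definition orbs : {set {set G}} := [set [set x; - x]%SET | x : G]%SET.
Lemma mem_orbs x : [set x; - x]%SET \in orbs.
exact: imset_f. Qed.
Definition idx (x : G) : 'I_#|orbs| := enum_rank_in (mem_orbs 0) [set x; - x]%SET.
Lemma idxE x : enum_val (idx x) = [set x; - x]%SET.
by rewrite /idx enum_rankK_in// mem_orbs. Qed.
Lemma rep_ex (i : 'I_#|orbs|) : exists x, enum_val i = [set x; - x]%SET.
by have /imsetP[x _ ->] := enum_valP i; exists x. Qed.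
Definition rep i := sval (cid (rep_ex i)).
Lemma repE i : enum_val i = [set rep i; - rep i]%SET.
by rewrite /rep; case: cid. Qed.
Lemma idx_rep i : idx (rep i) = i.
by apply: enum_val_inj; rewrite idxE repE. Qed.
Lemma idxN x : idx (- x) = idx x.
by apply: enum_val_inj; rewrite !idxE opprK finset.setUC. Qed.

Lemma idx_eq x i : (idx x == i) = (x == rep i) || (x == - rep i).
apply/eqP/orP => [<-|[]/eqP->]; last 2 first.
- exact: idx_rep.
- by rewrite idxN idx_rep.
have : x \in enum_val (idx x) by rewrite idxE !inE eqxx.
by rewrite repE !inE => /orP[] ->; [left|right].
Qed.

Lemma rep_idx x : rep (idx x) = x \/ rep (idx x) = - x.
have : (x == rep (idx x)) || (x == - rep (idx x)) by rewrite -idx_eq.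
by case/orP => /eqP h; [left; exact: esym h | right; apply: oppr_inj; rewrite opprK; exact: esym h].
Qed.
Definition mult i : nat := if rep i == - rep i then 1 else 2.

Lemma sum_orbits (K : pzRingType) (phi : G -> K) : (forall x, phi (- x) = phi x) ->
 \sum_x phi x = \sum_i (mult i)%:R * phi (rep i).
move=> ev; rewrite (partition_big idx xpredT)//=; apply: eq_bigr => i _.
rewrite (eq_bigl (fun x => (x == rep i) || (x == - rep i))) => [|x]; last exact: idx_eq.
rewrite /mult; case: eqP => [e|/eqP e].
 by rewrite -e (eq_bigl (pred1 (rep i))) ?big_pred1_eq ?mul1r// => x; rewrite orbb.
rewrite (bigD1 (rep i)) ?eqxx//= (big_pred1 (- rep i)) ?ev => [|x].
 by rewrite mulrDl mul1r.
by case: (x =P rep i) => [->|]; rewrite /= ?andbF ?andbT//; apply/esym/negbTE.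
Qed.

(** An orbit of size two occurs twice in the first sum; a fixed point occurs once in each. *)
Lemma sum_orbits2 (K : pzRingType) (phi : G -> K) : (forall x, phi (- x) = phi x) ->
 2 * \sum_i phi (rep i) = \sum_x phi x + \sum_(x | x == - x) phi x.
move=> ev; rewrite [X in _ = _ + X]big_mkcond /= !sum_orbits// => [|x].
 rewrite -big_split mulr_sumr; apply: eq_bigr => i _ /=; rewrite /mult.
 by case: eqP => _; rewrite ?mulr0 ?addr0// mul1r mulrDl mul1r.
by rewrite opprK eq_sym ev.
Qed.

End Orbits.

(** * The Weil representation on even functions *)

Section ScatteringMatrix.
Variable R : realType.
Local Notation C := R[i].
Local Notation e := (@cexp2pi R).
Local Notation ex := (@expQZ R).
Local Notation H := (uhp R).
Variable A : finQuadMod.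
Local Notation q := (@fqm_form A).
Local Notation B := (@fqm_bil A).
Local Notation GA := (group_alg R A).
Local Notation d := #|orbs A|.

(** The even part of the character; it is real, and it alone acts on even functions. *)
Definition chi (x y : A) : C := (ex (B x y) + ex (- B x y)) / 2.
Lemma chiC x y : chi x y = chi y x.
by rewrite /chi fqm_bilC. Qed.
Lemma chiNl x y : chi (- x) y = chi x y.
by rewrite /chi fqm_bilNl opprK addrC. Qed.
Lemma chiNr x y : chi x (- y) = chi x y.
by rewrite chiC chiNl chiC. Qed.
Lemma chi_conj x y : (chi x y)^*%C = chi x y.
by rewrite /chi rmorphM fmorphV rmorph_nat rmorphD /= !expQZ_conj opprK addrC.
Qed.

Lemma chi_mul a b x : chi a x * chi x b =
 (ex (B (a + b) x) + ex (B (a - b) x) + ex (B (- a + b) x) + ex (B (- a - b) x)) / 4.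
rewrite /chi (fqm_bilC x b) !fqm_bilDl !fqm_bilNl.
rewrite (expQZD R (B a x) (B b x)) (expQZD R (B a x) (- B b x)) (expQZD R (- B a x) (B b x)) (expQZD R (- B a x) (- B b x)).
by move: (ex (B a x)) (ex (- B a x)) (ex (B b x)) (ex (- B b x)) => y y' z z'; field.
Qed.

Lemma chi_orth a b : \sum_x chi a x * chi x b =
 #|A|%:R / 2 * ((a == b)%:R + (a == - b)%:R).
under eq_bigr do rewrite chi_mul; rewrite -mulr_suml !big_split /= !char_sum.
have -> : (- a - b == 0) = (a == - b) by rewrite -opprD oppr_eq0 addr_eq0.
have -> : (- a + b == 0) = (a == b) by rewrite addrC subr_eq0 eq_sym.
rewrite (addr_eq0 a b) (subr_eq0 a b); move: (#|A|%:R) => c.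
by case: (a == b); case: (a == - b); rewrite /= ?mulr1n ?mulr0n; field.
Qed.

Lemma chi_braid a b : \sum_x ex (- q x) * (chi a x * chi x b) =
 (gauss R A 1)^*%C * (ex (q a) * ex (q b)) * chi a b.
have E x : ex (- q x) * (chi a x * chi x b) = (ex (- q x + B (a + b) x) + ex (- q x + B (a - b) x) +
 ex (- q x + B (- a + b) x) + ex (- q x + B (- a - b) x)) / 4.
 rewrite chi_mul (expQZD R (- q x) (B (a + b) x)) (expQZD R (- q x) (B (a - b) x))
 (expQZD R (- q x) (B (- a + b) x)) (expQZD R (- q x) (B (- a - b) x)).
 by move: (ex (- q x)) (ex _) (ex _) (ex _) (ex _) => *; field.
under eq_bigr do rewrite E; rewrite -mulr_suml !big_split /= !gauss_shift.
have -> : q (- a - b) = q (a + b) by rewrite -opprD fqm_formN.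
have -> : q (- a + b) = q (a - b) by rewrite -[- a + b]opprK fqm_formN opprD opprK.
rewrite !fqm_formD fqm_formN fqm_bilNr (expQZD R (q a + q b) (B a b)) (expQZD R (q a + q b) (- B a b)) (expQZD R (q a) (q b)) /chi.
by move: (ex (q a)) (ex (q b)) (ex (B a b)) (ex (- B a b)) (_^*%C) => x y u v w; field.
Qed.

(** Square roots of the orbit sizes normalize the coordinates on even functions so that the matrix
    of S becomes symmetric. *)
Definition sq (i : 'I_d) : R := Num.sqrt (mult i)%:R.
Lemma sq_gt0 i : 0 < sq i.
by rewrite sqrtr_gt0 /mult; case: eqP. Qed.
Lemma sq_neq0 i : (sq i)%:C != 0 :> C.
by rewrite fmorph_eq0 gt_eqF// sq_gt0. Qed.
Lemma sq_sqr i : (sq i)%:C ^+ 2 = (mult i)%:R :> C.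
by rewrite -rmorphXn /= sqr_sqrtr// rmorph_nat. Qed.

Lemma sum_chi (F : A -> C) y : (forall x, F (- x) = F x) ->
 \sum_x ex (B x y) * F x = \sum_i (mult i)%:R * (chi (rep i) y * F (rep i)).
move=> ev; rewrite -(sum_orbits (phi := fun x => chi x y * F x)) => [|x]; last by rewrite chiNl ev.
have E : \sum_x ex (B x y) * F x = \sum_x ex (- B x y) * F x.
 by rewrite (reindex_inj oppr_inj) /=; apply: eq_bigr => x _; rewrite fqm_bilNl ev.
apply: (mulfI (_ : 2 != 0)); first by rewrite pnatr_eq0.
rewrite [LHS]mulrDl mul1r {2}E -big_split mulr_sumr; apply: eq_bigr => x _ /=.
by rewrite /chi -mulrDl; move: (ex _ + ex _) (F x) => u v; field.
Qed.

Variable (eps : C).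

Definition Smat : 'M[C]_d := \matrix_(i, j)
 (eps / (sqrt_card R #|A|)%:C * ((sq i)%:C * (sq j)%:C) * chi (rep i) (rep j)).
Lemma Smat_sym : Smat^T = Smat.
by apply/matrixP => i j; rewrite !mxE chiC [(sq j)%:C * _]mulrC. Qed.

Lemma Smat_conv (phi : A -> C) i k : (forall x, phi (- x) = phi x) ->
 \sum_j Smat i j * phi (rep j) * Smat j k =
 eps ^+ 2 / #|A|%:R * ((sq i)%:C * (sq k)%:C) * \sum_x phi x * (chi (rep i) x * chi x (rep k)).
move=> ev; rewrite (sum_orbits (phi := fun x => phi x * (chi (rep i) x * chi x (rep k)))) => [|x]; last by rewrite chiNl chiNr ev.
rewrite mulr_sumr; apply: eq_bigr => j _; rewrite !mxE -sq_sqr -sqrt_card_sqr.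
have := sqrt_card_neq0 R A; move: (sqrt_card R #|A|)%:C => s s0.
by field.
Qed.

Hypothesis eps2 : eps ^+ 2 = 1.

Lemma Smat_sqr : Smat *m Smat = 1%:M.
apply/matrixP => i k; rewrite !mxE.
transitivity (\sum_j Smat i j * 1 * Smat j k); first by apply: eq_bigr => j _; rewrite mulr1.
rewrite (Smat_conv (phi := fun _ => 1))//; under eq_bigr do rewrite mul1r.
rewrite chi_orth eps2; have A0 : #|A|%:R != 0 :> C by rewrite pnatr_eq0 -lt0n cardA_gt0.
have [->|ik] := eqVneq i k.
 rewrite -expr2 sq_sqr eqxx /mult; move: (#|A|%:R) A0 => c c0.
 by case: eqP => _; rewrite /= ?mulr1n ?mulr0n; field.
have -> : (rep i == rep k) = false.
 by apply/negbTE; apply: contra ik => /eqP E; rewrite -(idx_rep i) E idx_rep.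
have -> : (rep i == - rep k) = false.
 by apply/negbTE; apply: contra ik => /eqP E; rewrite -(idx_rep i) E idxN idx_rep.
by rewrite addr0 !mulr0 mulr0n.
Qed.

Hypothesis epsR : eps^*%C = eps.

Lemma Smat_iso : isometric Smat.
move=> x; apply: (@complexI R); rewrite !rmorph_sum /=.
have cM (a b : C) : (a * b)^*%C = a^*%C * b^*%C by exact: rmorphM.
have Sc i j : (Smat i j)^*%C = Smat i j.
 rewrite mxE; move: (chi _ _) (chi_conj (rep i) (rep j)) => c cc.
 by rewrite !cM conjc_inv !conjc_real epsR cc.
transitivity (\sum_i ((Smat *m x) i 0) * ((Smat *m x) i 0)^*%C).
 by apply: eq_bigr => i _; rewrite cn_mul_conj.
transitivity (((Smat *m x)^T *m (Smat *m (\col_j (x j 0)^*%C))) 0 0).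
 rewrite mxE; apply: eq_bigr => i _; rewrite [X in _ = X * _]mxE; congr (_ * _).
 rewrite [RHS]mxE mxE rmorph_sum; apply: eq_bigr => j _; rewrite /= cM Sc [X in _ = _ * X]mxE.
 by [].
rewrite trmx_mul Smat_sym -mulmxA (mulmxA Smat) Smat_sqr mul1mx mxE.
by apply: eq_bigr => i _; rewrite !mxE cn_mul_conj.
Qed.

(** After [chi_braid] only a scalar remains. Here z is the contribution e(n/24) of eta^n to T, and
    the second hypothesis says that z^3 eps cancels the conjugate Gauss sum. *)
Lemma Smat_braid (L : 'I_d -> R) (z : C) : (forall i, e (L i)%:C = ex (- q (rep i)) * z) ->
 z ^+ 3 * eps * ((sqrt_card R #|A|)%:C^-1 * (gauss R A 1)^*%C) = 1 ->
 let D := diag_mx (\row_i e (L i)%:C) in D *m (Smat *m (D *m (Smat *m D))) = Smat.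
move=> hL hz D; apply/matrixP => i k.
rewrite mul_diag_mx mxE [X in X * _]mxE mxE.
transitivity (e (L i)%:C * (e (L k)%:C * (z * \sum_j Smat i j * ex (- q (rep j)) * Smat j k))).
 congr (_ * _); rewrite !mulr_sumr; apply: eq_bigr => j _.
 rewrite mul_diag_mx mxE [X in _ * (X * _)]mxE mul_mx_diag mxE [X in _ * (_ * (_ * X))]mxE hL.
 by move: (Smat i j) (Smat j k) (e _) (ex _) => a b x y; ring.
rewrite (Smat_conv (phi := fun x => ex (- q x))) => [|x]; last by rewrite fqm_formN.
rewrite chi_braid !hL mxE eps2 -sqrt_card_sqr !expQZN.
have n1 := expQZ_neq0 R (q (rep i)); have n2 := expQZ_neq0 R (q (rep k)).
move: hz (sqrt_card_neq0 R A) n1 n2; move: ((sqrt_card R #|A|)%:C) (_^*%C) (ex _) (ex _) (sq i)%:C (sq k)%:C (chi _ _).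
move=> s g a b x y c hz s0 a0 b0.
rewrite -[RHS]mul1r -[X in _ = X * _]hz.
have e4 : eps * eps = 1 by rewrite -expr2.
transitivity (z ^+ 3 * (eps * eps) * g / s ^+ 2 * (x * y) * c); last by field.
by rewrite e4; field; rewrite s0 a0 b0.
Qed.

(** * Passage to even integral weight by a power of eta *)

Section Transfer.
Variables (w p : int) (n : nat) (lam : A -> R).
Hypotheses (wp : w + n%:Z = p * 4) (epsE : eps = sqrtC (uhp_i R)° ^- n * gsign R A)
 (lamN : forall x, lam (- x) = lam x).

Definition vvf : set (H -> GA) := [set f |
 (forall x, QE (lam x) (fun t => f t x)) /\
 forall t y, f (uhpS t) y = sqrtC t° ^ w * (weilc R A * \sum_x ex (B x y) * f t x)].
Lemma sqrtC_uhp_neq0 (t : H) : sqrtC t° != 0.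
by rewrite sqrtC_eq0 uhp_neq0. Qed.

(** Applying S twice gives f(x) = g^2 i^w f(-x) for the normalized Gauss sum g. From eps^2 = 1 one
    gets g^2 = i^n, and 4 divides w + n. *)
Lemma vvf_even f : vvf f -> forall t x, f t (- x) = f t x.
move=> [_ fS] t x.
have h : weilc R A * \sum_y ex (B y x) * (weilc R A * \sum_z ex (B z y) * f t z) = gsign R A ^+ 2 * f t (- x).
 rewrite -(@weilSS R A (f t) x) weilSE; congr (_ * _); apply: eq_bigr => y _.
 by rewrite weilSE.
have E : (f t : A -> C) x = gsign R A ^+ 2 * (sqrtC (uhpS t)° ^ w * sqrtC t° ^ w) * f t (- x).
 rewrite [RHS]mulrAC -h -[t in LHS]uhpSS fS.
 have -> : \sum_y ex (B y x) * f (uhpS t) y = sqrtC t° ^ w * \sum_y ex (B y x) * (weilc R A * \sum_z ex (B z y) * f t z).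
 by rewrite mulr_sumr; apply: eq_bigr => y _; rewrite fS mulrCA.
 have gen (a b c x' : C) : a * (b * (c * x')) = b * x' * (a * c) by ring.
 exact: gen.
rewrite E -expfzMl sqrtC_mulS.
suff -> : gsign R A ^+ 2 * 'i%C ^ w = 1 by rewrite mul1r.
have s0 := sqrtC_uhp_neq0 (uhp_i R).
have gE : gsign R A = sqrtC (uhp_i R)° ^+ n * eps by rewrite epsE mulVKf// expf_neq0.
rewrite gE exprMn eps2 mulr1 -exprM mulnC exprM sqrtC_i_sqr exprnP.
rewrite -expfzDr; last by rewrite -sqrtC_i_sqr expf_neq0.
by rewrite addrC wp mulrC -exprz_exp -[_ ^ 4]/('i%C ^+ (2 * 2)) exprM sqr_i sqrrN expr1n exp1rz.
Qed.

Definition of_coords (h : H -> 'cV[C]_d) (t : H) : GA :=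
 [ffun x => eta (- n%:Z) t * ((sq (idx x))%:C^-1 * h t (idx x) 0)].
Definition to_coords (f : H -> GA) (t : H) : 'cV[C]_d := \col_i (eta n t * ((sq i)%:C * f t (rep i))).

Lemma of_to_coords f : vvf f -> of_coords (to_coords f) = f.
move=> hf; apply/funext => t; apply/ffunP => x; rewrite ffunE mxE.
have -> : f t (rep (idx x)) = f t x by have [->|->] := rep_idx x; rewrite ?(vvf_even hf).
have := eta_mulN n t; have := sq_neq0 (idx x); move: (sq _)%:C (eta n t) (eta (- n%:Z) t) (f t x : C) => s a b y s0 ab.
have -> : b * (s^-1 * (a * (s * y))) = (a * b) * y by field.
by rewrite ab mul1r.
Qed.

Let Lam (i : 'I_d) := lam (rep i) + n%:R / 24.

Lemma uhp_weight (t : H) : sqrtC t° ^ w * sqrtC t° ^+ n = t° ^ (p * 2).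
have s0 := sqrtC_uhp_neq0 t.
rewrite exprnP -expfzDr// wp -{2}(sqrtCK t°) -[sqrtC _ ^+ 2]/(sqrtC t° ^ (2 : int)) exprz_exp; congr (_ ^ _).
by lia.
Qed.

Lemma to_coords_MF f : vvf f -> MF Smat Lam p (to_coords f).
move=> hf; have [fQ fS] := hf; split=> [i|t].
 have := QEM (eta_QE R n) (QEZ (sq i)%:C (fQ (rep i))).
 rewrite addrC -pmulrn /Lam; congr QE; apply/funext => t.
 by rewrite mxE.
apply/colP => i; rewrite !mxE eta_S_nat fS -(uhp_weight t) (sum_chi _ (vvf_even hf t)).
rewrite !mulr_sumr; apply: eq_bigr => j _.
have s0 := sqrtC_uhp_neq0 (uhp_i R).
have gE : gsign R A = sqrtC (uhp_i R)° ^+ n * eps by rewrite epsE mulVKf// expf_neq0.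
rewrite !mxE -sq_sqr /weilc gE chiC.
have := sqrt_card_neq0 R A; have := expf_neq0 n s0.
move: (sqrtC (uhp_i R)° ^+ n) (sqrtC t° ^+ n) (sqrtC t° ^ w) (sqrt_card R #|A|)%:C (eta n t) (sq i)%:C (sq j)%:C (chi _ _) (f t (rep j) : C).
move=> a b c s x y z u v a0 s1; field.
by rewrite s1 a0.
Qed.

Lemma of_coords_vvf h : MF Smat Lam p h -> vvf (of_coords h).
move=> [hQ hS]; split=> [x|t y].
 have := QEM (eta_QE R (- n%:Z)) (QEZ (sq (idx x))%:C^-1 (hQ (idx x))).
 have -> : (- n%:Z)%:~R / 24 + Lam (idx x) = lam x.
 rewrite /Lam mulrNz -pmulrn; have [->|->] := rep_idx x; rewrite ?lamN; by field.
 by congr QE; apply/funext => t; rewrite ffunE.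
have ev x : of_coords h t (- x) = of_coords h t x by rewrite !ffunE idxN.
rewrite (sum_chi _ ev) ffunE hS mxE -(uhp_weight t) mxE !mulr_sumr.
have s0 := sqrtC_uhp_neq0 (uhp_i R); have t0 := sqrtC_uhp_neq0 t.
have gE : gsign R A = sqrtC (uhp_i R)° ^+ n * eps by rewrite epsE mulVKf// expf_neq0.
have eS : eta (- n%:Z) (uhpS t) = sqrtC (uhp_i R)° ^+ n * sqrtC t° ^- n * eta (- n%:Z) t.
 have h1 := eta_mulN n (uhpS t); have h2 := eta_mulN n t; rewrite eta_S_nat in h1.
 have x0 := eta_neq0 n t; have a0 := expf_neq0 n s0; have b0 := expf_neq0 n t0.
 apply: (mulfI (mulf_neq0 (mulf_neq0 (invr_neq0 a0) b0) x0)); rewrite h1 -h2.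
 move: (eta n t) (eta (- n%:Z) t) (sqrtC (uhp_i R)° ^+ n) (sqrtC t° ^+ n) a0 b0 => x1 y1 a1 b1 a0 b0; field.
 by rewrite a0 b0.
apply: eq_bigr => j _; rewrite ffunE idx_rep eS !mxE -sq_sqr /weilc gE.
have -> : chi (rep (idx y)) (rep j) = chi (rep j) y.
 by rewrite chiC; have [->|->] := rep_idx y; rewrite ?chiNr.
have := sqrt_card_neq0 R A; have := expf_neq0 n s0; have := expf_neq0 n t0; have := sq_neq0 j; have := sq_neq0 (idx y).
move: (sqrtC (uhp_i R)° ^+ n) (sqrtC t° ^+ n) (sqrtC t° ^ w) (sqrt_card R #|A|)%:C (eta _ t) (sq _)%:C (sq j)%:C (chi _ _) (h t j 0).
move=> a b c s x y' z u v y0 z0 b0 a0 s1; field.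
by rewrite ?y0 ?z0 ?b0 ?a0 ?s1.
Qed.

Lemma vvf_has_dim m : has_dim (MFset Smat Lam p) m -> has_dim vvf m.
move=> [b [ib bE]]; have mb i : MF Smat Lam p (b i).
 have : MFset Smat Lam p (b i); last by [].
 rewrite bE; exists (fun x => (x == i)%:R); rewrite (bigD1 i)//= eqxx scale1r big1 ?addr0//.
 by move=> x /negbTE ->; rewrite scale0r.
have lin k (c : 'I_k -> C) (F : 'I_k -> H -> 'cV[C]_d) : of_coords (\sum_i c i *: F i) = \sum_i c i *: of_coords (F i).
 apply/funext => t; apply/ffunP => x; rewrite ffunE !fct_sumE summxE sum_ffunE !mulr_sumr.
 apply: eq_bigr => i _; rewrite !ffunE /= mxE -[RHS]/(c i * _).
 by move: (c i) (eta _ t) (_^-1) (F i t _ _) => u v x' y; ring.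
have inj h : of_coords h = 0 -> h = 0.
 move=> h0; apply/funext => t; apply/colP => i.
 have E : eta (- n%:Z) t * ((sq i)%:C^-1 * h t i 0) = 0.
 transitivity (of_coords h t (rep i) : C); first by rewrite ffunE idx_rep.
 by rewrite h0 -[LHS]/((0 : GA) (rep i)) ffunE.
 move: E (eta_neq0 (- n%:Z) t) (sq_neq0 i); move: (eta _ t) (sq i)%:C => a s E a0 s0; move/eqP: E.
 rewrite !mulf_eq0 invr_eq0 (negbTE a0) (negbTE s0) /= => /eqP ->.
 by rewrite mxE.
exists (fun i => of_coords (b i)); split=> [c|].
 by rewrite -lin => /inj/ib.
apply/seteqP; split=> f /=.
 move=> hf; have : MFset Smat Lam p (to_coords f) := to_coords_MF hf.
 by rewrite bE => -[c E]; exists c; rewrite -lin -E of_to_coords.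
move=> [c ->]; rewrite -lin; apply: of_coords_vvf.
have : MFset Smat Lam p (\sum_i c i *: b i); last by [].
by rewrite bE; exists c.
Qed.

End Transfer.
End ScatteringMatrix.

(** * Finite Fourier expansion of the sawtooth *)

Section Sawtooth.
Variable R : realType.
Local Notation C := R[i].
Local Notation e := (@cexp2pi R).

Lemma cn_one_sub_e (x : R) : cn (1 - e x%:C) ^+ 2 = (2 * sin (pi * x)) ^+ 2.
by rewrite (sqr_cn_one_sub_e x 0) mulr0 oppr0 expR0 subrr; ring. Qed.

Variable N : nat.
Hypothesis N0 : (0 < N)%N.

Lemma natN0 : N%:R != 0 :> R.
by rewrite pnatr_eq0 -lt0n. Qed.
(** The finite Fourier coefficient of r -> 1/2 + 1/(2N) - r/N on 1, ..., N, with the argument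
    shifted to r - 1. *)
Definition saw_coef (n : nat) : C := (N%:R * (1 - e (- (n%:R / N%:R : R)%:C)))^-1.
Lemma e_frac_neq1 n : (0 < n < N)%N -> e (- (n%:R / N%:R : R)%:C) != 1.
move=> /andP[n0 nN]; rewrite eN invr_eq1; apply: e_neq1.
by rewrite divr_gt0 ?ltr0n//= ltr_pdivrMr ?ltr0n// mul1r ltr_nat.
Qed.

Lemma saw_coef_bound n : (0 < n < N)%N ->
 cn (saw_coef n) <= (2 * N%:R)^-1 * (1 + N%:R / pi * (n%:R^-1 + (N - n)%N%:R^-1)).
move=> nN; have /andP[n0 nN'] := nN; have pi0 := pi_gt0 R.
have NR : 0 < N%:R :> R by rewrite ltr0n.
have n0R : 0 < n%:R :> R by rewrite ltr0n.
have x01 : 0 < (n%:R / N%:R : R) < 1 by rewrite divr_gt0//= ltr_pdivrMr// mul1r ltr_nat.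
have xpi : 0 < (pi * (n%:R / N%:R) : R) < pi.
 by have /andP[a b] := x01; rewrite mulr_gt0//= -[ltRHS]mulr1 ltr_pM2l.
have s0 : 0 < sin (pi * (n%:R / N%:R)) :> R by exact: sin_gt0_pi.
have ce : cn (1 - e (- (n%:R / N%:R : R)%:C)) = 2 * sin (pi * (n%:R / N%:R)).
 apply/eqP; rewrite -(eqrXn2 (ltn0Sn 1)) ?cn_ge0 ?mulr_ge0 ?(ltW s0)// -rmorphN cn_one_sub_e.
 by rewrite mulrN sinN mulrN sqrrN.
rewrite /saw_coef cnV cnM cn_nat ce mulrCA invfM [(2 * N%:R)^-1]invfM -!mulrA ler_pM2l ?invr_gt0//.
rewrite invfM ler_pM2l ?invr_gt0//; apply: le_trans (inv_sin_le xpi) _.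
rewrite -addrA lerD2l !mulrDr; apply: lerD; first by rewrite invfM invf_div mulrCA.
have -> : pi - pi * (n%:R / N%:R) = pi * ((N - n)%N%:R / N%:R) :> R.
 by rewrite natrB ?(ltnW nN')// mulrBl divff ?natN0// mulrBr mulr1.
by rewrite invfM invf_div mulrCA.
Qed.

Lemma sum_e_frac r : (0 < r < N)%N -> \sum_(1 <= n < N) e ((n%:R / N%:R : R)%:C * r%:R) = -1.
move=> rN; have h : \sum_(j < N) e (j%:R * (r%:~R / N%:R)) = 0 :> C.
 apply: (@sum_roots R N r%:Z N0) => x; apply/eqP => rx; move: rN; have : (N %| r)%N.
 by rewrite -(dvdzE N r) rx; apply/dvdzP; exists x.
 by move=> /dvdn_leq + /andP[r0 rN]; move=> /(_ r0); rewrite leqNgt rN.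
rewrite -(big_mkord xpredT (fun j => e (j%:R * (r%:~R / N%:R)))) big_ltn// mul0r e0 in h.
have gen (F G : nat -> C) : F =1 G -> 1 + \sum_(1 <= n < N) G n = 0 -> \sum_(1 <= n < N) F n = -1.
 move=> FG E; have -> : \sum_(1 <= n < N) F n = \sum_(1 <= n < N) G n by apply: eq_bigr => i _; exact: FG.
 by move/eqP: E; rewrite addrC addr_eq0 => /eqP.
apply: gen h => n; congr e.
by rewrite rmorphM fmorphV !rmorph_nat -pmulrn mulrAC mulrA.
Qed.

Definition sawD (r : nat) : C := \sum_(1 <= n < N) saw_coef n * e ((n%:R / N%:R : R)%:C * r.-1%:R).

(** Pair n with N - n: 1/(1 - z) + 1/(1 - 1/z) = 1. *)
Lemma sawD1 : sawD 1 = ((N%:R - 1) / (2 * N%:R) : R)%:C.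
have N0C : N%:R != 0 :> C by rewrite pnatr_eq0 -lt0n.
have E : \sum_(1 <= n < N) saw_coef n = sawD 1.
 by apply: eq_bigr => n _; rewrite /= mulr0 e0 mulr1.
have refl : \sum_(1 <= n < N) saw_coef n = \sum_(1 <= n < N) saw_coef (N - n).
 rewrite big_nat_rev /=; apply: eq_big_nat => n nN; congr saw_coef.
have pair : \sum_(1 <= n < N) (saw_coef n + saw_coef (N - n)) = \sum_(1 <= n < N) (N%:R^-1 : C).
 apply: eq_big_nat => n nN; have /andP[n0 nN'] := nN; rewrite /saw_coef.
 have -> : e (- ((N - n)%N%:R / N%:R : R)%:C) = (e (- (n%:R / N%:R : R)%:C))^-1.
 rewrite -eN opprK natrB ?(ltnW nN')// mulrBl divff ?natN0// rmorphB opprB eB e_1 divr1.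
 by [].
 have := e_frac_neq1 nN; have := e_neq0 (- (n%:R / N%:R : R)%:C); move: (e _) => z z0 z1.
 have z1' : 1 - z != 0 by rewrite subr_eq0 eq_sym.
 have z1'' : z - 1 != 0 by rewrite subr_eq0.
 by field; rewrite N0C z0 z1' z1''.
rewrite big_split -refl /= E sumr_const_nat -[sawD 1 + _]mulr2n -[X in X = _]mulr_natl -[X in _ = X]mulr_natl in pair.
have h2 : 2 != 0 :> C by rewrite pnatr_eq0.
apply: (mulfI h2); rewrite pair rmorphM fmorphV rmorphM rmorphB !rmorph_nat /= natrB//.
by field.
Qed.

(** Consecutive values differ by 1/N times a sum over the nontrivial N-th roots of unity, that is,
    by -1/N. *)
Lemma sawDE r : (0 < r <= N)%N -> sawD r = (1 / 2 + (2 * N%:R)^-1 - r%:R / N%:R : R)%:C.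
case: r => // r; elim: r => [|r IH] rN.
 rewrite sawD1; congr (_%:C); have := natN0; move: (N%:R : R) => x x0; by field.
have step : sawD r.+2 - sawD r.+1 = - (N%:R^-1 : R)%:C.
 rewrite /sawD -sumrB; transitivity (N%:R^-1 * \sum_(1 <= n < N) e ((n%:R / N%:R : R)%:C * r.+1%:R)).
 rewrite mulr_sumr; apply: eq_big_nat => n nN; rewrite /= -mulrBr.
 have -> : e ((n%:R / N%:R : R)%:C * r%:R) = e ((n%:R / N%:R : R)%:C * r.+1%:R) * e (- (n%:R / N%:R : R)%:C).
 by rewrite -eD; congr e; rewrite -addn1 natrD mulrDr mulr1 addrK.
 have := e_frac_neq1 nN; rewrite /saw_coef; move: (e (- (n%:R / N%:R : R)%:C)) (e ((n%:R / N%:R : R)%:C * r.+1%:R)) => z y z1.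
 have z1' : 1 - z != 0 by rewrite subr_eq0 eq_sym.
 by field; rewrite z1' pnatr_eq0 -lt0n N0.
 rewrite sum_e_frac; last by move: rN; lia.
 by rewrite mulrN1 fmorphV rmorph_nat.
have := IH _; move: step => /eqP; rewrite subr_eq => /eqP -> ->; last by move: rN; lia.
rewrite -rmorphN -rmorphD; congr (_%:C); rewrite -[r.+2]addn1 natrD; have := natN0.
by move: (N%:R : R) (r.+1%:R) => x y x0; field.
Qed.

Lemma harmonic_le M : (0 < M)%N -> \sum_(1 <= n < M.+1) (n%:R^-1 : R) <= 1 + ln M%:R.
case: M => // M _; elim: M => [|M IH]; first by rewrite big_nat1 ln1 addr0 invr1.
rewrite big_nat_recr//=; apply: le_trans (lerD IH (lexx _)) _.
rewrite -addrA lerD2l; have x0 : 0 < M.+2%:R :> R by rewrite ltr0n.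
have h : -1 < - (M.+2%:R)^-1 :> R by rewrite ltrN2 invf_lt1// ltr1n.
have := le_ln1Dx h; have -> : 1 + - (M.+2%:R)^-1 = M.+1%:R / M.+2%:R :> R.
 have -> : M.+1%:R = M.+2%:R - 1 :> R by rewrite -[M.+2]addn1 natrD addrK.
 by move: (M.+2%:R : R) x0 => x x0; field; rewrite gt_eqF.
by rewrite ln_div ?posrE ?ltr0n//; move: (ln _) (ln _) (_^-1) => a b c; lra.
Qed.

End Sawtooth.

(** * Sawtooth coefficients along multiples of a divisor *)

Section SumSplitting.
Variable R : realType.

Lemma sum_multiples (b M : nat) (F : nat -> R) : (0 < b)%N ->
 \sum_(1 <= n < b * M | (b %| n)%N) F n = \sum_(1 <= m < M) F (b * m)%N.
move=> b0; rewrite -big_filter -(big_map (muln b) xpredT F); apply: perm_big; apply: uniq_perm.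
- by rewrite filter_uniq// iota_uniq.
- rewrite map_inj_uniq ?iota_uniq// => x y /eqP; rewrite eqn_pmul2l// => /eqP.
 by [].
move=> n; rewrite mem_filter mem_index_iota; apply/idP/mapP => [/and3P[/dvdnP[m ->] m0 mM]|[m]].
 exists m; last by rewrite mulnC.
 by rewrite mem_index_iota; move: m0 mM; rewrite muln_gt0 (mulnC m) ltn_pmul2l// => /andP[-> _].
by rewrite mem_index_iota => /andP[m0 mM] ->; rewrite dvdn_mulr// muln_gt0 b0 m0 ltn_pmul2l.
Qed.

(** Restriction to multiples of b gains a factor 1/b in the count and in both harmonic sums; it
    becomes the weight 1/b in sigma(-1, A). *)
Lemma sum_saw_le (N b : nat) : (0 < b)%N -> (b %| N)%N -> (b < N)%N ->
 \sum_(1 <= n < N | (b %| n)%N) ((2 * N%:R)^-1 * (1 + N%:R / pi * (n%:R^-1 + (N - n)%N%:R^-1))) <=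
 b%:R^-1 * (1 / 2 + (1 + ln N%:R) / pi) :> R.
move=> b0 /dvdnP[M NE] bN; have N0 : (0 < N)%N by apply: leq_trans bN.
have M1 : (1 < M)%N by move: bN; rewrite NE -{1}[b]mul1n ltn_pmul2r.
have pi0 := pi_gt0 R; have b0R : 0 < b%:R :> R by rewrite ltr0n.
have N0R : 0 < N%:R :> R by rewrite ltr0n.
rewrite {1}NE mulnC (sum_multiples (b := b) M (fun n => (2 * N%:R)^-1 * (1 + N%:R / pi * (n%:R^-1 + (N - n)%N%:R^-1))))//.
pose h : R := \sum_(1 <= m < M) m%:R^-1.
have hM : h <= 1 + ln N%:R.
 rewrite /h; have M0 : (0 < M.-1)%N by move: M1; case: M {NE h} => [|[]].
 have -> : M = M.-1.+1 by rewrite prednK// ltnW.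
 apply: le_trans (harmonic_le R M0) _; rewrite lerD2l ler_ln ?posrE ?ltr0n// ler_nat NE.
 by apply: leq_trans (leq_pred _) _; rewrite leq_pmulr.
have h1 : \sum_(1 <= m < M) ((b * m)%N%:R^-1 : R) = b%:R^-1 * h.
 by rewrite mulr_sumr; apply: eq_bigr => m _; rewrite natrM invfM.
have h2 : \sum_(1 <= m < M) ((N - b * m)%N%:R^-1 : R) = b%:R^-1 * h.
 rewrite mulr_sumr [RHS]big_nat_rev /=; apply: eq_big_nat => m /andP[m0 mM].
 by rewrite NE mulnC -mulnBr natrM invfM add1n subSS.
rewrite -mulr_sumr big_split /= -mulr_sumr big_split /= h1 h2 sumr_const_nat.
have Mle : (M - 1)%N%:R <= N%:R / b%:R :> R by rewrite ler_pdivlMr// -natrM ler_nat NE leq_mul2r leq_subr orbT.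
apply: le_trans (_ : (2 * N%:R)^-1 * (N%:R / b%:R + N%:R / pi * (2 * (b%:R^-1 * (1 + ln N%:R)))) <= _).
 apply: ler_wpM2l; first by rewrite invr_ge0 mulr_ge0// ltW.
 apply: lerD => //; apply: ler_wpM2l; first by rewrite divr_ge0// ltW.
 rewrite mulrDl mul1r; have h3 : b%:R^-1 * h <= b%:R^-1 * (1 + ln N%:R) by rewrite ler_pM2l ?invr_gt0.
 exact: lerD.
rewrite le_eqVlt; apply/orP; left; apply/eqP; move: (N%:R : R) (b%:R : R) (pi : R) (ln _) N0R b0R pi0 => x y z l x0 y0 z0.
by field; rewrite !gt_eqF.
Qed.

End SumSplitting.

(** * Exponents and traces as Gauss sums *)

Section Exponents.
Local Open Scope quotient_scope.
Variable R : realType.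
Local Notation C := R[i].
Local Notation e := (@cexp2pi R).
Local Notation ex := (@expQZ R).
Variable A : finQuadMod.
Local Notation q := (@fqm_form A).
Local Notation N := (level A).
Local Notation rA := (sqrt_card R #|A|).
Local Notation rT n := (sqrt_card R #|torsion A n|).

(** By definition of the level, N Q(x) = 0, so a residue modulo N describes Q(x); the residue 0 is
    replaced by N, since cusp forms require exponents in (0, 1]. *)
Lemma lamr_ex (x : A) : exists r : nat, (0 < r <= N)%N /\ e (r%:R / N%:R : R)%:C = ex (- q x).
have [N0 hN] := levelP A; have N0' : N%:R != 0 :> rat by rewrite pnatr_eq0 -lt0n.
pose a := repr (- q x).
have : \pi_QZ (a *+ N) = 0 by rewrite raddfMn /= /a reprK mulNrn hN oppr0.
move=> /piQZ_eq0[n nE]; have aE : a = n%:~R / N%:R by rewrite -nE -[a *+ N]mulr_natr mulfK.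
pose r0 := `|(n %% N%:Z)%Z|%N.
have r0E : (r0 : int) = (n %% N%:Z)%Z by rewrite /r0 gez0_abs// modz_ge0// -lt0n.
have r0N : (r0 < N)%N by rewrite -ltz_nat r0E ltz_pmod.
have key (r : nat) (k : int) : n = r%:Z + k * N%:Z -> e (r%:R / N%:R : R)%:C = ex (- q x).
 move=> E; rewrite -[- q x]reprK -/a expQZ_pi ratr_real.
 have -> : ratr a = n%:~R / N%:R :> R by rewrite aE rmorphM fmorphV /= ratr_int ratr_nat.
 rewrite E.
 have N0R : N%:R != 0 :> R by rewrite pnatr_eq0 -lt0n.
 rewrite rmorphD rmorphM /= -!pmulrn mulrDl mulfK// rmorphD eD rmorph_int e_int mulr1.
 by [].
have nE' := divz_eq n N%:Z; rewrite -r0E addrC in nE'.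
have [r00|r00] := posnP r0.
 exists N; rewrite leqnn N0; split=> //; apply: (key N ((n %/ N%:Z)%Z - 1)).
 by move: nE'; rewrite r00 [_ + _ * _]add0r; move: (_ %/ _)%Z => c ->; ring.
by exists r0; rewrite r00 ltnW//; split=> //; exact: key nE'.
Qed.

Definition lamr x := sval (cid (lamr_ex x)).
Lemma lamr_bounds x : (0 < lamr x <= N)%N.
by rewrite /lamr; case: cid => r []. Qed.
Lemma lamrE x : e ((lamr x)%:R / N%:R : R)%:C = ex (- q x).
by rewrite /lamr; case: cid => r []. Qed.

Lemma lamrN x : lamr (- x) = lamr x.
have [N0 _] := levelP A; have N0R : 0 < N%:R :> R by rewrite ltr0n.
have /andP[a0 a1] := lamr_bounds x; have /andP[b0 b1] := lamr_bounds (- x).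
have : ((lamr (- x))%:R / N%:R - (lamr x)%:R / N%:R : R) = 0.
 apply: e_eq1; last by rewrite rmorphB eB !lamrE fqm_formN divff// expQZ_neq0.
 have {}a0 : 0 < (lamr x)%:R :> R by rewrite ltr0n.
 have {}b0 : 0 < (lamr (- x))%:R :> R by rewrite ltr0n.
 have {}a1 : (lamr x)%:R <= N%:R :> R by rewrite ler_nat.
 have {}b1 : (lamr (- x))%:R <= N%:R :> R by rewrite ler_nat.
 rewrite -mulrBl ltr_pdivlMr// ltr_pdivrMr// mulN1r mul1r; move: N0R a0 a1 b0 b1.
 move: (N%:R : R) ((lamr x)%:R : R) ((lamr (- x))%:R : R) => a b c a0 b0 ba c0 ca.
 by apply/andP; split; lra.
rewrite -mulrBl => /eqP; rewrite mulf_eq0 invr_eq0 (gt_eqF N0R) orbF subr_eq0 eqr_nat => /eqP.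
by [].
Qed.

Definition lam x : R := (lamr x)%:R / N%:R.
Lemma lam_bounds x : 0 < lam x <= 1.
have [N0 _] := levelP A; have N0R : 0 < N%:R :> R by rewrite ltr0n.
have /andP[a0 a1] := lamr_bounds x.
by rewrite /lam divr_gt0 ?ltr0n//= ler_pdivrMr// mul1r ler_nat.
Qed.
Lemma lamN x : lam (- x) = lam x.
by rewrite /lam lamrN. Qed.
Lemma level_ann (x : A) : x *+ N = 0.
apply: fqm_bil_nondeg => y; rewrite fqm_bilMnl.
have [_ hN] := levelP A; have := hN (x + y).
by rewrite fqm_formD !mulrnDl !hN !add0r.
Qed.
Lemma torsion_level : #|torsion A N| = #|A|.
by rewrite -cardsT; apply: eq_card => x; rewrite !inE level_ann eqxx. Qed.

Lemma torsion_gcd n : torsion A n \subset torsion A (gcdn n N).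
apply/fintype.subsetP => x; rewrite !inE => /eqP xn; have [N0 _] := levelP A.
have [a _ /dvdnP[b E]] := Bezoutr n N0.
have := congr1 (fun m => x *+ m) E; rewrite /= mulrnDr [(a * n)%N]mulnC [(b * N)%N]mulnC !mulrnA.
by rewrite xn level_ann !mul0rn addr0 => ->.
Qed.

(** The divisor b = N, with term sqrt|A|/N, is left out because the sawtooth expansion runs over 1
    <= n < N, which contains no multiple of N. *)
Definition sigma' : R := \sum_(b <- divisors N | (b < N)%N) b%:R^-1 * rT b.
Lemma sigma'_ge0 : 0 <= sigma'.
by apply: sumr_ge0 => b _; rewrite mulr_ge0 ?invr_ge0// sqrtr_ge0. Qed.

Lemma sigmaE : sigma_m1 R A = sigma' + rA / N%:R.
have [N0 _] := levelP A; rewrite /sigma_m1 (bigID (fun b => b < N)%N) /=; congr (_ + _).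
rewrite -big_filter; have -> : [seq b <- divisors N | ~~ (b < N)%N] = [:: N].
 apply: perm_small_eq => //; apply: uniq_perm => //; first by rewrite filter_uniq// divisors_uniq.
 move=> b; rewrite mem_filter inE -dvdn_divisors// -leqNgt; apply/andP/eqP => [[Nb bN]|->]; last by rewrite leqnn dvdnn.
 by apply/eqP; rewrite eqn_leq Nb dvdn_leq.
by rewrite big_seq1 torsion_level mulrC.
Qed.

(** A[n] lies in A[gcd(n, N)], one term of the sum. Enlarging it to all divisors b of n allows the
    sum over n to be carried out over the multiples of each b. *)
Lemma sqrt_torsion_le n : (0 < n < N)%N ->
 rT n <= \sum_(b <- divisors N | (b < N)%N) if (b %| n)%N then rT b else 0.
move=> /andP[n0 nN]; have [N0 _] := levelP A; pose g := gcdn n N.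
have gN : (g < N)%N by apply: leq_ltn_trans nN; exact: dvdn_leq (dvdn_gcdl _ _).
have gd : g \in divisors N by rewrite -dvdn_divisors// dvdn_gcdr.
apply: le_trans (_ : rT g <= _).
 by rewrite /sqrt_card ler_sqrt ?ler0n// ler_nat subset_leq_card// torsion_gcd.
rewrite -big_filter (bigD1_seq g) ?mem_filter ?gN//= ?filter_uniq ?divisors_uniq//.
rewrite dvdn_gcdl lerDl; apply: sumr_ge0 => b _; case: ifP => // _; exact: sqrtr_ge0.
Qed.

Lemma cn_gauss_le n : cn (gauss R A n) <= rA * rT n.
have := gauss_bound R A n; rewrite /sqrt_card -sqrtrM ?ler0n// => h.
by rewrite -[leLHS]ger0_norm ?cn_ge0// -sqrtr_sqr ler_sqrt ?mulr_ge0.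
Qed.

(** In the n-th Fourier mode e(lam x) enters to the power n, so summing over x gives the conjugate
    Gauss sum of n. *)
Lemma sum_sawE : (\sum_x (1 / 2 + (2 * N%:R)^-1 - lam x) : R)%:C =
 \sum_(1 <= n < N) saw_coef R N n * (e (- (n%:R / N%:R : R)%:C) * (gauss R A n)^*%C).
have [N0 _] := levelP A; rewrite rmorph_sum /=.
transitivity (\sum_x \sum_(1 <= n < N) saw_coef R N n * (e (- (n%:R / N%:R : R)%:C) * ex (- (q x *+ n)))).
 apply: eq_bigr => x _; rewrite -(sawDE R N0 (lamr_bounds x)); apply: eq_bigr => n _.
 congr (_ * _); rewrite -mulNrn expQZMn -lamrE eX -eD; congr e.
 have /andP[l0 _] := lamr_bounds x; rewrite -{2}(prednK l0) -[(lamr x).-1.+1]addn1 natrD.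
 rewrite !rmorphM rmorphD !fmorphV !rmorph_nat /=.
 by move: (n%:R) (N%:R^-1) (_.-1%:R) => a b c; ring.
by rewrite exchange_big /=; apply: eq_bigr => n _; rewrite gauss_conj !mulr_sumr.
Qed.

Lemma cn_conj (x : C) : cn x^*%C = cn x.
by case: x => a b; rewrite /cn /Normc.normc /= sqrrN. Qed.

Lemma sum_half_sub_lam : `|\sum_x (1 / 2 - lam x)| <=
 #|A|%:R / (2 * N%:R) + rA * sigma' * (1 / 2 + (1 + ln N%:R) / pi).
have [N0 _] := levelP A.
pose f n : R := (2 * N%:R)^-1 * (1 + N%:R / pi * (n%:R^-1 + (N - n)%N%:R^-1)).
have pi0 := pi_gt0 R; have N0R : 0 < N%:R :> R by rewrite ltr0n.
have f0 n : 0 <= f n.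
 rewrite mulr_ge0 ?invr_ge0 ?mulr_ge0 ?(ltW N0R)// addr_ge0// mulr_ge0 ?divr_ge0 ?(ltW pi0)//.
 by rewrite addr_ge0// invr_ge0.
have s0 : 0 <= rA by exact: sqrtr_ge0.
have E : \sum_x (1 / 2 - lam x) = \sum_x (1 / 2 + (2 * N%:R)^-1 - lam x) - #|A|%:R / (2 * N%:R) :> R.
 have -> : #|A|%:R / (2 * N%:R) = \sum_(x : A) (2 * N%:R)^-1 :> R by rewrite sumr_const mulr_natl.
 by rewrite -sumrB; apply: eq_bigr => x _; ring.
rewrite E; apply: le_trans (ler_normB _ _) _; rewrite addrC; apply: lerD.
 by rewrite ger0_norm// divr_ge0// mulr_ge0// ltW.
rewrite -cn_real sum_sawE; apply: le_trans (cn_sum _ _) _.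
apply: le_trans (_ : \sum_(1 <= n < N) f n * (rA * \sum_(b <- divisors N | (b < N)%N) (if (b %| n)%N then rT b else 0)) <= _).
 apply: ler_sum_nat => n nN; rewrite (cnM (saw_coef R N n)) (cnM (e (- (n%:R / N%:R : R)%:C))).
 have -> : cn (e (- (n%:R / N%:R : R)%:C)) = 1 by rewrite -rmorphN cn_e_real.
 rewrite mul1r; apply: ler_pM; rewrite ?cn_ge0//; first exact: saw_coef_bound.
 by rewrite cn_conj; apply: le_trans (cn_gauss_le n) _; apply: ler_wpM2l => //; exact: sqrt_torsion_le.
have -> : \sum_(1 <= n < N) f n * (rA * \sum_(b <- divisors N | (b < N)%N) (if (b %| n)%N then rT b else 0)) =
 rA * \sum_(b <- divisors N | (b < N)%N) (rT b * \sum_(1 <= n < N | (b %| n)%N) f n).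
 transitivity (\sum_(1 <= n < N) \sum_(b <- divisors N | (b < N)%N) rA * (rT b * (if (b %| n)%N then f n else 0))).
 apply: eq_bigr => n _; rewrite !mulr_sumr; apply: eq_bigr => b _.
 by case: ifP => _; move: (f n) (sqrt_card R _) (sqrt_card R _) => u v w; ring.
 rewrite exchange_big /= mulr_sumr; apply: eq_bigr => b _.
 by rewrite [in RHS]big_mkcond /= !mulr_sumr.
rewrite -mulrA; apply: ler_wpM2l => //; rewrite /sigma' mulr_suml big_seq_cond [leRHS]big_seq_cond.
apply: ler_sum => b /andP[]; rewrite -dvdn_divisors// => bN bltN.
have b0 : (0 < b)%N by apply: dvdn_gt0 bN.
rewrite [b%:R^-1 * _]mulrC -mulrA; apply: ler_wpM2l; first exact: sqrtr_ge0.
exact: sum_saw_le.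
Qed.

Lemma sum_fixed_half_sub_lam : `|\sum_(x : A | x == - x) (1 / 2 - lam x)| <= #|torsion A 2|%:R / 2.
apply: le_trans (ler_norm_sum _ _ _) _.
apply: le_trans (_ : \sum_(x : A | x == - x) (2^-1 : R) <= _).
 apply: ler_sum => x _; have /andP[a b] := lam_bounds x; rewrite ler_norml; apply/andP; split; lra.
rewrite sumr_const mulr_natl; have -> : #|[pred x : A | x == - x]| = #|torsion A 2|; last by [].
by apply: eq_card => x; rewrite !inE mulr2n addr_eq0.
Qed.

Lemma sum_orbits_half_sub_lam : `|\sum_i (1 / 2 - lam (rep i))| <=
 #|torsion A 2|%:R / 4 + rA / 4 * sigma_m1 R A +
 rA / (2 * pi) * (1 + ln N%:R) * sigma'.
have h := sum_orbits2 (phi := fun x : A => 1 / 2 - lam x) (fun x => congr1 (fun y => 1 / 2 - y) (lamN x)).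
have h1 := sum_half_sub_lam; have h2 := sum_fixed_half_sub_lam.
have h3 := ler_normD (\sum_x (1 / 2 - lam x)) (\sum_(x : A | x == - x) (1 / 2 - lam x)).
rewrite -h normrM (ger0_norm (ler0n _ 2)) in h3.
have [N0 _] := levelP A; have N0R : 0 < N%:R :> R by rewrite ltr0n.
have pi0 := pi_gt0 R.
have sA : #|A|%:R = rA ^+ 2 :> R by rewrite sqr_sqrtr.
have E : rA / 4 * sigma_m1 R A + rA / (2 * pi) * (1 + ln N%:R) * sigma' =
 (#|A|%:R / (2 * N%:R) + rA * sigma' * (1 / 2 + (1 + ln N%:R) / pi)) / 2.
 rewrite sA sigmaE; move: (N%:R : R) (sqrt_card R _) sigma' (pi : R) (ln _) N0R pi0 => a b c p l a0 p0.
 by field; rewrite !gt_eqF.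
rewrite -addrA E; move: h1 h2 h3.
move: `|_| `|_| `|_| (#|torsion A 2|%:R) (#|A|%:R / _ + _) => a b c d g; lra.
Qed.

Section Traces.
Variables (eps z : C).
Hypotheses (eps2 : eps ^+ 2 = 1) (z1 : cn z = 1).

Lemma cn_eps : cn eps = 1.
by apply/eqP; rewrite -(eqrXn2 (ltn0Sn 1)) ?cn_ge0// -cnX eps2 cn1 expr1n.
Qed.

Lemma sum_diag_Smat (phi : A -> C) : (forall x, phi (- x) = phi x) ->
 \sum_i phi (rep i) * Smat A eps i i = eps / (rA)%:C * \sum_x phi x * chi R x x.
move=> ev; rewrite (sum_orbits (phi := fun x => phi x * chi R x x)) => [|x]; last by rewrite ev chiNl chiNr.
rewrite mulr_sumr; apply: eq_bigr => i _; rewrite mxE -expr2 sq_sqr.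
by move: (phi _) (chi _ _ _) (_%:R) (eps / _) => a b c d; ring.
Qed.

Lemma chi_diag x : chi R x x = (ex (q x *+ 2) + ex (- (q x *+ 2))) / 2.
by rewrite /chi fqm_bilxx. Qed.

Lemma cn_avg_le (x y : C) (a b : R) : cn x <= rA * a -> cn y <= rA * b ->
 cn (eps / (rA)%:C * ((x + y) / 2)) <= (a + b) / 2.
have s0 := sqrt_card_gt0 R A; move=> hx hy.
rewrite !cnM !cnV cn_eps cn_real cn_nat (ger0_norm (ltW s0)) mul1r mulrA ler_pM2r ?invr_gt0//.
rewrite ler_pdivrMl//; apply: le_trans (cnD _ _) _; rewrite mulrDr.
exact: lerD.
Qed.

Lemma cn_trace_Smat : cn (\tr (Smat A eps)) <= rT 2.
have -> : \tr (Smat A eps) = eps / (rA)%:C * ((gauss R A 2 + (gauss R A 2)^*%C) / 2).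
 have := sum_diag_Smat (phi := fun _ => 1) (fun=> erefl).
 under eq_bigr do rewrite mul1r; rewrite -/(mxtrace _) => ->; congr (_ * _).
 rewrite gauss_conj -big_split mulr_suml; apply: eq_bigr => x _.
 by rewrite mul1r chi_diag.
apply: le_trans (cn_avg_le (cn_gauss_le 2) _) _; first by rewrite cn_conj; exact: cn_gauss_le.
by rewrite -mulr2n -[_ *+ 2]mulr_natr mulfK// pnatr_eq0.
Qed.

(** As (x, x) = 2 Q(x) and e(-Q)(e(2Q) + e(-2Q)) = e(Q) + e(-3Q), the Gauss sums of 1 and 3 enter;
    A[1] is trivial and yields the summand 1. *)
Lemma cn_trace_DSmat (L : 'I_#|orbs A| -> R) : (forall i, e (L i)%:C = ex (- q (rep i)) * z) ->
 cn (\sum_i e (L i)%:C * Smat A eps i i) <= (1 + rT 3) / 2.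
move=> hL; have -> : \sum_i e (L i)%:C * Smat A eps i i =
 z * (eps / (rA)%:C * ((gauss R A 1 + (gauss R A 3)^*%C) / 2)).
 transitivity (z * \sum_i ex (- q (rep i)) * Smat A eps i i).
 by rewrite mulr_sumr; apply: eq_bigr => i _; rewrite hL; move: (ex _) (Smat _ _ _ _) => a b; ring.
 rewrite (sum_diag_Smat (phi := fun x => ex (- q x))) => [|x]; last by rewrite fqm_formN.
 do 2 congr (_ * _); rewrite gauss_conj -big_split mulr_suml; apply: eq_bigr => x _.
 rewrite chi_diag mulrA mulrDr; congr ((_ + _) / 2); rewrite -expQZD; congr (ex _).
 by rewrite mulr2n addrA addNr add0r mulr1n.
 by rewrite -opprD -mulrS.
rewrite cnM z1 mul1r; apply: cn_avg_le; last by rewrite cn_conj; exact: cn_gauss_le.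
by have := cn_gauss_le 1; rewrite torsion1 cards1 /sqrt_card sqrtr1.
Qed.

End Traces.
End Exponents.

(** * Comparison of A with A(-1) and the final estimate *)

Section MainTheorem.
Variable R : realType.
Local Notation C := R[i].
Local Notation e := (@cexp2pi R).

Transparent cexp2pi.
Lemma sqrtC_uhp_i : sqrtC (uhp_i R)° = e (8^-1 : R)%:C.
have pi0 := pi_gt0 R.
have q1 : e (8^-1 : R)%:C ^+ 2 = 'i%C.
 rewrite eX mulrC mulr_natr -rmorphMn /=.
 have -> : 8^-1 *+ 2 = 4^-1 :> R by rewrite -mulr_natr; field.
 rewrite /cexp2pi /= mulr0 oppr0 expR0 mul1r.
 have -> : 2 * pi * 4^-1 = pi / 2 :> R by field.
 by rewrite cos_pihalf sin_pihalf.
have r1 : 0 < complex.Re (e (8^-1 : R)%:C).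
 rewrite /cexp2pi /= mulr0 oppr0 expR0 mul1r mul0r subr0; apply: cos_gt0_pihalf.
 by apply/andP; split; lra.
have r2 := Re_sqrtC_gt0 (uhp_i R).
have := sqrtC_i_sqr R; rewrite -q1 => /eqP; rewrite eqf_sqr => /orP[/eqP //|/eqP E].
by move: r2; rewrite E raddfN /= oppr_gt0 => /(lt_trans r1); rewrite ltxx.
Qed.
Opaque cexp2pi.

Lemma level_opp (A : finQuadMod) : level (fqm_opp A) = level A.
have [n0 hn] := levelP (fqm_opp A); have [m0 hm] := levelP A.
apply/eqP; rewrite eqn_leq; apply/andP; split.
 rewrite {1}/level; case: ex_minnP => k _; apply; rewrite m0; apply/forallP => x.
 by rewrite -[fqm_form x]/(- @fqm_form A x) mulNrn hm oppr0.
rewrite {1}/level; case: ex_minnP => k _; apply; rewrite n0; apply/forallP => x.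
have E : - (@fqm_form A x *+ level (fqm_opp A)) = 0 by rewrite -mulNrn; exact: hn x.
by rewrite -oppr_eq0 E.
Qed.

Lemma gauss_opp (A : finQuadMod) : gauss R (fqm_opp A) 1 = (gauss R A 1)^*%C.
by rewrite gauss_conj; apply: eq_bigr => x _; rewrite !mulr1n. Qed.

Lemma gsign_opp (A : finQuadMod) : gsign R (fqm_opp A) = (gsign R A)^-1.
have h := gsign_conj R A.
have g0 : gsign R A != 0 by apply/negP => /eqP g; move/eqP: h; rewrite g mul0r eq_sym oner_eq0.
apply: (mulfI g0); rewrite mulfV// -h /gsign gauss_opp.
by [].
Qed.

Lemma chi_opp (A : finQuadMod) (x y : A) : chi R (A := fqm_opp A) x y = chi R (A := A) x y.
have E : @fqm_bil (fqm_opp A) x y = - @fqm_bil A x y by exact: polar_form_opp.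
by rewrite /chi E opprK addrC.
Qed.
Lemma Smat_opp (A : finQuadMod) eps : Smat (fqm_opp A) eps = Smat A eps :> 'M[C]_#|orbs A|.
by apply/matrixP => i j; rewrite !mxE chi_opp. Qed.

End MainTheorem.

Theorem theorem4p5 (R : realType) (A : finQuadMod) (k : R) (w : int)
  (hw : w%:~R = 2 * k) (hk : 3 / 2 <= k)
  (hsig : (w = - (signature R A : nat)%:Z %[mod 4])%Z) :
  exists s m : nat,
    [/\ has_dim (cusp_forms R A w) s,
        has_dim (modular_forms R (fqm_opp A) (4 - w)) m
      & `|s%:R - m%:R - (num_pm_orbits A)%:R * (k - 1) / 12| <= dim_error R A].
Proof.
pose N := level A; have [N0 _] := levelP A; have N0R : 0 < N%:R :> R by rewrite ltr0n.
(* Multiplication by eta^n raises the weight w/2 to 2p. *)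
pose n := `|((- w) %% 4)%Z|%N; pose p := - ((- w) %/ 4)%Z.
have nE : n%:Z = ((- w) %% 4)%Z by rewrite /n gez0_abs// modz_ge0.
have n4 : (n < 4)%N by rewrite -ltz_nat nE ltz_pmod.
have wp : w + n%:Z = p * 4 by have := divz_eq (- w) 4; rewrite -nE /p; lia.
pose u : R[i] := sqrtC (uhp_i R : R[i]).
have u0 : u != 0 by exact: sqrtC_uhp_neq0.
have uE : u = cexp2pi (8^-1 : R)%:C by exact: sqrtC_uhp_i.
pose eps := u ^- n * gsign R A.
pose sg := (signature R A : nat).
have gE : gsign R A = u ^+ sg.
 by rewrite signatureP uE eX; congr cexp2pi; rewrite fmorphV rmorph_nat.
have u8 : u ^+ 8 = 1 by rewrite uE eX fmorphV rmorph_nat mulfV ?e_1// pnatr_eq0.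
(* With u = e(1/8), eps is u^(sg - n). The congruence [hsig] and n = -w mod 4 make sg - n divisible
   by 4. *)
have eps2 : eps ^+ 2 = 1.
 have [c cE] : exists c : int, sg%:Z - n%:Z = c * 4.
 have /eqP := hsig; rewrite eqz_mod_dvd opprK => /dvdzP[c cE].
 by exists (c - p); move: cE wp; rewrite -/sg; lia.
 have -> : eps = u ^ (c * 4).
 by rewrite -cE expfzDr// /eps gE mulrC exprnN.
 rewrite -[_ ^+ 2]/((u ^ (c * 4)) ^ (2 : int)) exprz_exp -mulrA mulrC -exprz_exp.
 by rewrite -[u ^ (4 * 2)]/(u ^+ 8) u8 exp1rz.
have epsR : eps^*%C = eps.
 move/eqP: eps2; rewrite sqrf_eq1 => /orP[] /eqP ->; apply/eqP; rewrite eq_complex /= ?oppr0 ?eqxx//.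
pose L (i : 'I_#|orbs A|) : R := lam R (rep i) + n%:R / 24.
pose z := cexp2pi (n%:R / 24 : R)%:C; have zE : z = cexp2pi (n%:R / 24 : R)%:C by [].

have Lz i : cexp2pi (L i)%:C = expQZ R (- fqm_form (rep i)) * z.
 by rewrite zE /L rmorphD eD lamrE.
have z3 : z ^+ 3 = u ^+ n.
 rewrite zE uE !eX; congr cexp2pi; rewrite rmorphM !fmorphV !rmorph_nat; move: (n%:R : R[i]) => c.
 by field.
have g0 : gsign R A != 0 by rewrite gE expf_neq0.
have zb : z ^+ 3 * eps * ((sqrt_card R #|A|)%:C^-1 * (gauss R A 1)^*%C) = 1.
 rewrite z3 /eps; have := gsign_conj R A; move: (gsign R A) (_^-1 * _) g0 => g h _ E.
 by rewrite mulVKf ?expf_neq0.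
(* L_i is at most 1 + 3/24 < 2, and 24 N is a common denominator. *)
have hL i : exists N k q : nat, [/\ (k < N)%N, (q <= 1)%N & L i = k%:R / N%:R + q%:R :> R].
 pose K := (24 * lamr R (rep i) + n * N)%N; pose D := (24 * N)%N.
 have D0 : (0 < D)%N by rewrite muln_gt0.
 have /andP[_ lN] := lamr_bounds R (rep i : A).
 have KD : (K < 2 * D)%N by rewrite /K /D -/N in lN *; nia.
 exists D, (K %% D)%N, (K %/ D)%N; split.
 - by rewrite ltn_mod.
 - by rewrite -ltnS ltn_divLR.
 have D0R : D%:R != 0 :> R by rewrite pnatr_eq0 -lt0n.
 apply: (mulIf D0R); rewrite [RHS]mulrDl [X in _ = X + _](divfK D0R) -natrM -natrD [X in _ = X%:R]addnC -divn_eq.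
 rewrite /K /D /L /lam -/N !natrM natrD !natrM; move: (N%:R : R) N0R (n%:R : R) ((lamr R (rep i : A))%:R : R) => a a0 b c.
 by field; rewrite gt_eqF.
have [s [m [hs hm hsm]]] := vv_dim_formula (Smat_iso eps2 epsR) (Smat_sqr A eps2) (Smat_braid eps2 Lz zb) hL p (Smat_sym A eps).
exists s, m; split.
- rewrite (cusp_formsE (lamrE R (A := A)) _ (lamr_bounds R (A := A))).
 exact: (vvf_has_dim eps2 wp (erefl eps) (lamN R (A := A)) hs).
(* The complement 1 - lam lies in [0, 1), the range of exponents for holomorphic forms of A(-1). *)
- pose r' (x : fqm_opp A) := (N - lamr R (x : A))%N.
 have r'E (x : fqm_opp A) : cexp2pi ((r' x)%:R / (level (fqm_opp A))%:R : R)%:C = expQZ R (- fqm_form x).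
 have /andP[_ lN] := lamr_bounds R (x : A).
 rewrite level_opp natrB// mulrBl divff ?gt_eqF// rmorphB eB e_1 lamrE -[@fqm_form (fqm_opp A) x]/(- @fqm_form A x).
 by rewrite opprK expQZN invrK mul1r.
 rewrite (modular_formsE r'E) => [|x]; last first.
 by have /andP[l0 _] := lamr_bounds R (x : A); rewrite level_opp ltn_subrL l0.
 (* The complementary power eta^(24 - n) gives the weight index 7 - p and the exponents (1 - lam) +
    (24 - n)/24 = 2 - L of the dual space. *)
 have wp' : 4 - w + (24 - n)%N%:Z = (7 - p) * 4.
 by move: wp n4; lia.
 have u24 : u ^+ 24 = 1 by rewrite -[24%N]/(8 * 3)%N exprM u8 expr1n.
 have epsE' : eps = u ^- (24 - n) * gsign R (fqm_opp A).
 have e0 : eps != 0 by apply/negP => /eqP g; move/eqP: eps2; rewrite g expr0n eq_sym oner_eq0.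
 apply: (mulfI e0); rewrite -expr2 eps2 gsign_opp /eps; have := expf_neq0 n u0; have := expf_neq0 (24 - n) u0.
 have : u ^+ (24 - n) * u ^+ n = 1 by rewrite -exprD subnK ?u24//; move: n4; lia.
 move: (u ^+ (24 - n)) (u ^+ n) (gsign R A) g0 => a b c c0 ab a0 b0.
 have -> : b^-1 * c * (a^-1 * c^-1) = (a * b)^-1 by field; rewrite a0 b0 c0.
 by rewrite ab invr1.
 have lamN' (x : fqm_opp A) : (r' (- x))%:R / (level (fqm_opp A))%:R = (r' x)%:R / (level (fqm_opp A))%:R :> R.
 by rewrite /r' -[- x]/(- (x : A)) lamrN.
 apply: (vvf_has_dim eps2 wp' epsE' lamN'); rewrite Smat_opp; move: hm; congr (has_dim (MFset _ _ _) _).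
 apply/funext => i; rewrite /L /r' level_opp natrB; last by have /andP[] := lamr_bounds R (rep i : A).
 rewrite natrB; last by move: n4; lia.
 rewrite /lam -/N; move: (N%:R : R) N0R (n%:R : R) ((lamr R (rep i : A))%:R : R) => a a0 b c.
 by field; rewrite gt_eqF.
have z1 : cn z = 1 by rewrite zE cn_e_real.
have t1 := cn_trace_Smat A eps2; have t2 := cn_trace_DSmat eps2 z1 Lz.
have t3 := sum_orbits_half_sub_lam R A.
have wR : w%:~R + n%:R = p%:~R * 4 :> R.
 by have := congr1 (fun x : int => x%:~R : R) wp; rewrite /= rmorphD rmorphM /=.
have dE : (num_pm_orbits A)%:R = #|orbs A|%:R :> R by [].
(* Since p = (2k + n)/4, the n/24 in L_i cancels: p/6 + 5/12 - n/24 = (k - 1)/12 + 1/2, and the 1/2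
   joins -lam in the sawtooth sum. *)
have E : s%:R - m%:R - (num_pm_orbits A)%:R * (k - 1) / 12 =
 (s%:R - m%:R - (#|orbs A|%:R * (p%:~R / 6 + 5 / 12) - \sum_i L i)) + \sum_i (1 / 2 - lam R (rep i : A)).
 have -> : \sum_i L i = \sum_i lam R (rep i : A) + #|orbs A|%:R * (n%:R / 24).
 by rewrite big_split sumr_const card_ord (mulr_natl (n%:R / 24) #|orbs A|).
 have -> : \sum_i (1 / 2 - lam R (rep i : A)) = #|orbs A|%:R / 2 - \sum_i lam R (rep i : A).
 by rewrite sumrB sumr_const card_ord -(mulr_natl (1 / 2) #|orbs A|) mul1r.
 have pE : p%:~R = (2 * k + n%:R) / 4 :> R by rewrite -hw wR mulfK// pnatr_eq0.
 rewrite dE pE; move: (s%:R) (m%:R) (#|_|%:R) (n%:R) (\sum_i _) => x1 x2 x3 x4 x5.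
 by field.
rewrite E; apply: le_trans (ler_normD _ _) _; apply: le_trans (lerD hsm t3) _.
rewrite /dim_error -/N; have pi0 := pi_gt0 R; have s30 : 0 < Num.sqrt 3 :> R by rewrite sqrtr_gt0.
have -> : sigma_m1 R A - sqrt_card R #|A| / N%:R = sigma' R A by rewrite sigmaE addrK.
have sg0 := sigma'_ge0 R A; have sq0 : 0 <= sqrt_card R #|A| by exact: sqrtr_ge0.
have h1 : cn (\sum_i cexp2pi (L i)%:C * Smat A eps i i) * (2 / (3 * Num.sqrt 3)) <=
 (1 + sqrt_card R #|torsion A 3|) / (3 * Num.sqrt 3).
 apply: le_trans (ler_wpM2r _ t2) _; first by rewrite divr_ge0// mulr_ge0// ltW.
 by rewrite mulrA mulfVK// pnatr_eq0.
(* The estimate holds with 1 + ln N here and with |A[2]|/4; both are weakened to the constants of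
   [dim_error]. *)
have h2 : sqrt_card R #|A| / (2 * pi) * (1 + ln N%:R) * sigma' R A <=
 sqrt_card R #|A| / (2 * pi) * (3 / 2 + ln N%:R) * sigma' R A.
 apply: ler_wpM2r => //; apply: ler_wpM2l; first by rewrite divr_ge0// mulr_ge0// ltW.
 by rewrite lerD2r; lra.
have h3 : 0 <= #|torsion A 2|%:R :> R by rewrite ler0n.
have h4 : cn (\tr (Smat A eps)) / 4 <= sqrt_card R #|torsion A 2| / 4 by rewrite ler_pM2r ?invr_gt0.
move: h1 h2 h3 h4.
move: (cn _ * _) (cn _ / 4) (_ * sigma' R A) (_ / 4 * sigma_m1 R A) => a b c d.
lra.
Qed.
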